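(* Let $\alpha \in [0,d)$ and let $f$ be an SGF on $\mathbb{R}^d$ or $\mathbb{Z}^d$ with spectral measure $\mu$. Suppose that (1) (spectral singularity of order $\alpha$) $\displaystyle\lim_{\delta\to 0}\frac{\log \mu[B(\delta)]}{\log \delta}=\alpha$; (2) (non-singularity) $\mu_{a.c.}\neq 0$ and $\mu_{s.c.}=0$; (3) (regular capacity growth) for every $\epsilon>0$, $\mathrm{Cap}_f(B(T+T^{1-\epsilon}))\sim \mathrm{Cap}_f(B(T))$ as $T\to\infty$. Then, as $T\to\infty$, $$\theta_\mu(T)\sim m\,(d-\alpha)\,\mathrm{Cap}_f(B(T))\,\log T,$$ where $m=\|\mu_{a.c.}\|>0$.
   Context: An SGF on $\mathbb{R}^d$ or $\mathbb{Z}^d$ is a continuous (in the case of $\mathbb{R}^d$), centred, non-degenerate, stationary Gaussian field $f$. Its covariance kernel is $K(x)=\mathbb{E}[f(0)f(x)]$; its spectral measure $\mu$ is the unique non-negative, finite, symmetric measure with $K=\mathcal{F}[\mu]$, where $\mathcal{F}[\mu](x)=\int e^{-2\pi i\langle\lambda,x\rangle}d\mu(\lambda)$. It lives on $\mathbb{R}^d$ for fields on $\mathbb{R}^d$, and on the torus $\mathbb{R}^d/\mathbb{Z}^d$ for fields on $\mathbb{Z}^d$. Write $\mu=\mu_{a.c.}+\mu_d+\mu_{s.c.}$ for the decomposition into absolutely continuous, discrete, and singular continuous parts, and $\|\cdot\|$ for total mass. $B(r)$ is the closed Euclidean ball of radius $r$ about the origin; for fields on $\mathbb{Z}^d$, a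 spatial domain $B(T)$ is understood as $B(T)\cap\mathbb{Z}^d$. Persistence: $\theta_\mu(T)=-\log\mathbb{P}[f(x)\ge 0 \text{ for all } x\in B(T)]$. Capacity: for a compact domain $D$, $$\mathrm{Cap}_f(D)=\min\{\|h\|_H^2: h\in H,\ h\ge 1\text{ on }D\}=\Big(\min_{\nu\in\mathcal{P}(D)}\int_D\int_D K(x-y)\,d\nu(x)\,d\nu(y)\Big)^{-1}\in(0,\infty]$$ (the two expressions coincide), where $\mathcal{P}(D)$ is the set of Borel probability measures on $D$ and $H=\{\mathcal{F}[g\,d\mu]: g\in L^2_\mu\}$ (with $g$ Hermitian so that elements of $H$ are real-valued) is the reproducing kernel Hilbert space, with norm $\|\mathcal{F}[g\,d\mu]\|_H=\|g\|_{L^2_\mu}$. $a(T)\sim b(T)$ means $a(T)/b(T)\to1$. *)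

(* Defs.v *)
From HB Require Import structures.
From mathcomp Require Export all_boot all_order all_algebra.
From mathcomp Require Export complex.
From mathcomp Require Export all_classical all_reals all_analysis.

Set Implicit Arguments.
Unset Strict Implicit.
Unset Printing Implicit Defensive.

Export Order.TTheory GRing.Theory Num.Theory.
Export numFieldNormedType.Exports.

Local Open Scope classical_set_scope.
Local Open Scope ring_scope.

Section EuclideanSpace.
Context {R : realType} {d : nat}.

Definition dot (x y : 'rV[R]_d) : R := \sum_i x 0 i * y 0 i.

(* The norm that the library puts on ['rV[R]_d] is the sup norm. *)
Definition enorm (x : 'rV[R]_d) : R := Num.sqrt (dot x x).

Definition cball (r : R) : set 'rV[R]_d := [set x | enorm x <= r].

End EuclideanSpace.

Definition borel (R : realType) (d : nat) :=
  g_sigma_algebraType (@open 'rV[R]_d).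

(* Lebesgue measure on R^d, as an iterated integral over the coordinates. It is
   a bare set function, meaningful on Borel sets; only its null sets matter. *)
Fixpoint lebesgue_rV (R : realType) (n : nat) : set (borel R n) -> \bar R :=
  match n with
  | 0 => fun A => (\1_A (0 : 'rV[R]_0))%:E
  | n'.+1 => fun A => (\int[@lebesgue_measure R]_t
      lebesgue_rV [set v : borel R n' | A (row_mx (const_mx t : 'rV[R]_1) v)])%E
  end.

Record lebesgue_decomposition (R : realType) (d : nat)
    (mu mu_ac mu_d mu_sc : {finite_measure set (borel R d) -> \bar R}) : Prop := {
  decomp_sum : forall A, measurable A -> mu A = (mu_ac A + mu_d A + mu_sc A)%E ;
  decomp_ac : mu_ac `<< @lebesgue_rV R d ;
  decomp_d : exists2 S : set (borel R d), countable S & mu_d (~` S) = 0%E ;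
  decomp_singular : exists N : set (borel R d),
    [/\ measurable N, lebesgue_rV N = 0%E & mu_sc (~` N) = 0%E] ;
  decomp_continuous : forall x : borel R d, mu_sc [set x] = 0%E
}.

Inductive domain := Euclidean | Lattice.

Definition site (R : realType) (d : nat) (D : domain) : zmodType :=
  match D with
  | Euclidean => 'rV[R]_d
  | Lattice => 'rV[int]_d
  end.

Definition pos {R : realType} {d : nat} {D : domain} : site R d D -> 'rV[R]_d :=
  match D with
  | Euclidean => id
  | Lattice => map_mx intr
  end.

(* The dual group of the sites: R^d, or the torus R^d/Z^d, which is identified
   with its fundamental cell [-1/2, 1/2[^d. On the cell, the distance to the
   origin of the torus is the Euclidean norm and the Haar measure is the
   Lebesgue measure. *)
Definition spectral_cell (R : realType) (d : nat) (D : domain) : set (borel R d) :=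
  match D with
  | Euclidean => setT
  | Lattice => [set l : 'rV[R]_d | forall i, - 2^-1 <= l 0 i < 2^-1]
  end.

(* Negation in the dual group; on the torus, -1/2 is its own opposite. *)
Definition spectral_opp (R : realType) (d : nat) (D : domain) :
    'rV[R]_d -> 'rV[R]_d :=
  match D with
  | Euclidean => fun l => - l
  | Lattice => fun l =>
      map_mx (fun t => t - (Num.floor (t + 2^-1))%:~R) (- l)
  end.

Section Fourier.
Context {R : realType} {d : nat}.
Implicit Types (mu : {finite_measure set (borel R d) -> \bar R}).

Definition cis (t : R) : R[i] := (cos t +i* sin t)%C.

Definition cintegral mu (F : 'rV[R]_d -> R[i]) : R[i] :=
  ((\int[mu]_l complex.Re (F l)) +i* (\int[mu]_l complex.Im (F l)))%C.

(* The Fourier transform of the complex measure [g dmu]. *)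
Definition fourier mu (g : 'rV[R]_d -> R[i]) (x : 'rV[R]_d) : R[i] :=
  cintegral mu (fun l => g l * cis (- (2 * pi * dot l x))).

Definition sqr_modulus (z : R[i]) : R := complex.Re z ^+ 2 + complex.Im z ^+ 2.

Definition sqr_L2norm mu (g : 'rV[R]_d -> R[i]) : \bar R :=
  (\int[mu]_l (sqr_modulus (g l))%:E)%E.

Definition in_L2 mu (g : 'rV[R]_d -> R[i]) : Prop :=
  [/\ measurable_fun [set: borel R d] (fun l => complex.Re (g l)),
      measurable_fun [set: borel R d] (fun l => complex.Im (g l)) &
      (sqr_L2norm mu g < +oo)%E].

End Fourier.

Section Capacity.
Context {R : realType} {d : nat} (D : domain).
Variable mu : {finite_measure set (borel R d) -> \bar R}.

(* [h] is the element F[g dmu] of the reproducing kernel Hilbert space, whose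
   squared norm is [sqr_L2norm mu g]. *)
Definition rkhs_repr (h : site R d D -> R) (g : 'rV[R]_d -> R[i]) : Prop :=
  [/\ in_L2 mu g,
      {ae mu, forall l, g (spectral_opp D l) = conjc (g l)} &
      forall x, ((h x)%:C)%C = fourier mu g (pos x)].

(* The infimum is [+oo] when no [h] is admissible. *)
Definition capacity (A : set 'rV[R]_d) : \bar R :=
  ereal_inf [set s | exists h g, [/\ rkhs_repr h g,
    forall x, A (pos x) -> 1 <= h x & s = sqr_L2norm mu g]].

End Capacity.

(* The library's [normal_prob m 0] is not the degenerate normal law. *)
Definition gaussian_law (R : realType) (m s : R) (A : set R) : \bar R :=
  if s == 0 then \d_m A else normal_prob m s A.

Section GaussianFields.
Context {R : realType} {d : nat} {D : domain}.
Context {disp : measure_display} {Omega : measurableType disp}.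
Variable P : probability Omega R.
Variable f : site R d D -> {RV P >-> R}.

Definition gaussian_field : Prop :=
  forall (n : nat) (x : 'I_n -> site R d D) (a : 'I_n -> R),
  exists m s : R, forall A : set R, measurable A ->
    P [set w | A (\sum_i a i * f (x i) w)] = gaussian_law m s A.

Definition stationary_field : Prop :=
  forall (n : nat) (x : 'I_n -> site R d D) (t : site R d D) (A : 'I_n -> set R),
  (forall i, measurable (A i)) ->
  P [set w | forall i, A i (f (x i + t) w)] = P [set w | forall i, A i (f (x i) w)].

Definition covariance_kernel (x : site R d D) : R :=
  fine ('E_P[fun w => f 0%R w * f x w]%R)%E.

Definition persistence_exponent (T : R) : \bar R :=
  (- lne (P [set w | forall x, cball T (pos x) -> 0 <= f x w]%R))%E.

End GaussianFields.

(* Continuity is required of every sample path, which makes the event in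
   [persistence_exponent] measurable. *)
Definition continuous_field (R : realType) (d : nat) (D : domain)
    (disp : measure_display) (Omega : measurableType disp)
    (P : probability Omega R) : (site R d D -> {RV P >-> R}) -> Prop :=
  match D with
  | Euclidean => fun f => forall w, continuous (fun x : 'rV[R]_d => f x w)
  | Lattice => fun=> True
  end.

Record SGF (R : realType) (d : nat) (D : domain)
    (disp : measure_display) (Omega : measurableType disp)
    (P : probability Omega R) (f : site R d D -> {RV P >-> R}) : Prop := {
  SGF_gaussian : gaussian_field f ;
  SGF_continuous : continuous_field f ;
  SGF_centred : forall x, ('E_P[f x] = 0)%E ;
  SGF_nondegenerate : 0 < covariance_kernel f 0 ;
  SGF_stationary : stationary_field f
}.

Record spectral_measure (R : realType) (d : nat) (D : domain)
    (disp : measure_display) (Omega : measurableType disp)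
    (P : probability Omega R) (f : site R d D -> {RV P >-> R})
    (mu : {finite_measure set (borel R d) -> \bar R}) : Prop := {
  spectral_carrier : mu (~` spectral_cell D) = 0%E ;
  spectral_symmetric : forall A : set (borel R d), measurable A ->
    mu (spectral_opp D @^-1` A) = mu A ;
  spectral_fourier : forall x,
    ((covariance_kernel f x)%:C)%C = fourier mu (fun=> 1) (pos x)
}.

(* The ratio is taken in the extended reals, where capacities and -log P live;
   r / +oo = 0 for every r in [0, +oo], so a limit 1 forces [b] to be eventually
   finite. *)
Definition asymp_equiv (R : realType) (a b : R -> \bar R) : Prop :=
  (a T / b T)%E @[T --> +oo%R] --> 1%E.

(* Main.v *)
(* The persistence probability is compared with that of finite families of sites, on which f is a
   Gaussian vector; write b = m (d - alpha) Cap(B(T)) log T.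

   Lower bound. Let l^2 = 2 m (d - alpha) (1 + eps) log T. The equilibrium measure of B(T) provides
   an element h of the reproducing kernel Hilbert space with h >= 1 on B(T) and norm^2 close to the
   capacity; shifting f by l h costs exp(- l^2 Cap / 2), about exp(- b), and turns the event |f| <= l
   into f >= 0. The event |f| <= l has probability at least exp(- o(b)): removing finitely many
   atoms of mu leaves a field of variance close to m, whose oscillations on unit cells are
   negligible (Fernique), so that the Sidak inequality reduces the event to T^d cells, on each of
   which it fails with probability T^(alpha - d - eps'). The resulting exponent
   T^(alpha - eps'') is negligible because the capacity is at least T^(alpha - o(1)).

   Upper bound. Write f = g + h with independent g and h, where h has spectral density w mu_ac such
   that w mu_ac has mass close to m and, pushed to a torus, density at most m + eps. On each
   translate of a sufficiently sparse grid, h is then dominated by independent variables of variance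
   close to m. Let nu be the equilibrium measure of a slightly smaller ball; if the nu-average of g
   over the translates of the grid is less than the level l (now with (1 - eps)), then g is less
   than l on average over one of these translates, where h would have to exceed - g everywhere:
   this has probability at most exp(- T^(alpha + eps')). The nu-average of g has variance at most
   1 / Cap, hence exceeds l with probability at most exp(- l^2 Cap / 2). The regular growth of the
   capacity allows one to pass from the smaller ball to B(T). *)

(* The level l is critical: at that height the tail of a Gaussian of variance m is about T^(alpha -
   d), so that T^d cells produce about T^alpha exceedances, and T^alpha is also the order of the
   capacity up to factors T^(o(1)). A margin eps in the level therefore makes the cost of the cells
   polynomially smaller, or polynomially larger, than the capacity. This is why error terms are
   compared as powers of T and why crude polynomial bounds on the capacity suffice. Gaussian vectors
   are given by their characteristic functions, degenerate covariances included, since atoms have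
   finite rank and sites may be repeated. A covariance that is a sum of positive semidefinite
   matrices is realised on a product space, and events are carried from one space to another because
   trigonometric moments determine a law. In place of an equilibrium measure stands a finitely
   supported near-minimiser of the energy; its potential is bounded below by moving a small mass to
   an arbitrary point of the ball. *)
Require Import Defs.
From HB Require Import structures.
From mathcomp Require Import measurable_realfun lebesgue_integral_under.
From mathcomp Require Import ring lra zify.

Set Implicit Arguments.
Unset Strict Implicit.
Unset Printing Implicit Defensive.

Local Open Scope classical_set_scope.
Local Open Scope ring_scope.

(** * Integrals against densities and moments of the normal law *)

Section Density.
Context d (T : measurableType d) (R : realType).
Variables (mu nu : {measure set T -> \bar R}) (p : T -> R).
Hypothesis p_ge0 : forall x, 0 <= p x.
Hypothesis p_meas : measurable_fun setT p.
Hypothesis nuE : forall A, measurable A -> nu A = (\int[mu]_(x in A) (p x)%:E)%E.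

Import HBNNSimple.

Let indic_density E : measurable E ->
  (\int[nu]_x (\1_E x)%:E = \int[mu]_x ((\1_E x)%:E * (p x)%:E))%E.
Proof.
move=> mE; rewrite integral_indic// setIT nuE// integral_mkcond/=.
apply: eq_integral => x _; rewrite patchE indicE.
by case: ifPn => xE; rewrite ?mul1e ?mul0e.
Qed.

Let nnsfun_density (f : {nnsfun T >-> R}) :
  (\int[nu]_x (f x)%:E = \int[mu]_x ((f x)%:E * (p x)%:E))%E.
Proof.
under [LHS]eq_integral do rewrite fimfunE -fsumEFin//.
rewrite [LHS]ge0_integral_fsum//; last 2 first.
  - by move=> r; exact/measurable_EFinP/measurableT_comp.
  - by move=> n x _; rewrite EFinM nnfun_muleindic_ge0.
under [RHS]eq_integral.
  move=> x xD; rewrite fimfunE -fsumEFin// ge0_mule_fsuml; last first.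
    by move=> r; rewrite EFinM nnfun_muleindic_ge0.
  over.
rewrite [RHS]ge0_integral_fsum//; last 2 first.
  - move=> r; apply: emeasurable_funM; last exact/measurable_EFinP.
    by apply/measurable_EFinP/measurableT_comp.
  - by move=> n x _; rewrite mule_ge0 ?(lee_fin 0 (p x))// EFinM nnfun_muleindic_ge0.
apply: eq_fsbigr => r _.
have mE : measurable (f @^-1` [set r]) by exact: measurable_sfunP.
rewrite integralZl_indic_nnsfun// indic_density//.
have [r0|r0] := ltP r 0.
  have -> : f @^-1` [set r] = set0.
    by apply/seteqP; split=> // x /= fx; move: r0; rewrite -fx ltNge fun_ge0.
  rewrite integral0_eq; last by move=> x _; rewrite indic0 mul0e.
  by rewrite mule0 integral0_eq// => x _; rewrite indic0 mulr0 mul0e.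
rewrite -ge0_integralZl//.
- by apply: eq_integral => x _; rewrite EFinM muleA.
- apply: emeasurable_funM; last exact/measurable_EFinP.
  by apply/measurable_EFinP/measurable_indic.
- by move=> x _; rewrite mule_ge0 ?lee_fin ?p_ge0.
Qed.

(** Indicators, then simple functions, then monotone convergence. It serves the normal density here
    and the Radon-Nikodym density in [periodized_density]. *)
Lemma ge0_integral_density (f : T -> \bar R) :
  measurable_fun setT f -> (forall x, 0 <= f x)%E ->
  (\int[nu]_x f x = \int[mu]_x (f x * (p x)%:E))%E.
Proof.
move=> mf f0.
pose f_ := nnsfun_approx measurableT mf.
transitivity (lim (\int[nu]_x (f_ n x)%:E @[n --> \oo])%E).
  rewrite -monotone_convergence//=.
  - apply: eq_integral => ? /[!inE] xD; apply/esym/cvg_lim => //=.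
    exact: cvg_nnsfun_approx.
  - by move=> n; exact/measurable_EFinP/measurable_funTS.
  - by move=> n ? _; rewrite lee_fin.
  - by move=> ? _ ? ? mn; rewrite lee_fin; exact/lefP/nd_nnsfun_approx.
under eq_fun do rewrite nnsfun_density.
rewrite -monotone_convergence//=.
- apply: eq_integral => x /[!inE] xD; apply/cvg_lim => //.
  apply: cvgeZr => //; exact: cvg_nnsfun_approx.
- by move=> n; apply: emeasurable_funM; exact/measurable_EFinP/measurable_funTS.
- by move=> n ? _; rewrite mule_ge0// lee_fin.
- move=> x _ a b ab; rewrite lee_wpmul2r ?lee_fin//.
  exact/lefP/nd_nnsfun_approx.
Qed.

End Density.

Section BoundedIntegrals.
Context d (T : measurableType d) (R : realType).
Variable mu : {finite_measure set T -> \bar R}.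

Lemma bounded_integrable (f : T -> R) (C : R) : measurable_fun setT f ->
  (forall x, `|f x| <= C) -> mu.-integrable setT (EFin \o f).
Proof.
move=> mf fC; apply: measurable_bounded_integrable => //.
  by rewrite -ge0_fin_numE// fin_num_measure.
exists C; split; first by rewrite num_real.
by move=> M CM x _ /=; rewrite (le_trans (fC x))// ltW.
Qed.

Lemma Rint_cos (f : T -> R) : measurable_fun setT f ->
  mu.-integrable setT (fun x => (cos (f x))%:E).
Proof.
move=> mf; apply: (@bounded_integrable (cos \o f) 1).
  by apply: measurableT_comp => //; apply: continuous_measurable_fun; exact: continuous_cos.
by move=> x /=; rewrite ler_norml cos_geN1 cos_le1.
Qed.

Lemma Rint_sin (f : T -> R) : measurable_fun setT f ->
  mu.-integrable setT (fun x => (sin (f x))%:E).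
Proof.
move=> mf; apply: (@bounded_integrable (sin \o f) 1).
  by apply: measurableT_comp => //; apply: continuous_measurable_fun; exact: continuous_sin.
by move=> x /=; rewrite ler_norml sin_geN1 sin_le1.
Qed.

Lemma Rintegral_cvg_bounded (f_ : nat -> T -> R) (f : T -> R) (C : R) :
  (forall n, measurable_fun setT (f_ n)) ->
  (forall n x, `|f_ n x| <= C) ->
  (forall x, f_ n x @[n --> \oo] --> f x) ->
  \int[mu]_x f_ n x @[n --> \oo] --> \int[mu]_x f x.
Proof.
move=> mf fC cf.
have mlim : measurable_fun setT f.
  apply: (measurable_fun_cvg mf) => x _; exact: cf.
have intC : mu.-integrable setT (EFin \o cst C).
  apply: (@bounded_integrable _ `|C|) => //; exact: measurable_cst.
have h1 n : measurable_fun setT (fun x => (f_ n x)%:E) by exact/measurable_EFinP.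
have h2 : measurable_fun setT (fun x => (f x)%:E) by exact/measurable_EFinP.
have h3 : {ae mu, forall x, setT x -> (f_ n x)%:E @[n --> \oo] --> (f x)%:E}.
  by apply: aeW => x _; apply: cvg_EFin; [exact: nearW|exact: cf].
have h4 : {ae mu, forall x n, setT x -> (`|(f_ n x)%:E| <= (EFin \o cst C) x)%E}.
  by apply: aeW => x n _; rewrite /= lee_fin.
have [_ _ h] := dominated_convergence measurableT h1 h2 h3 intC h4.
apply/fine_cvg; rewrite fineK//; apply: integrable_fin_num => //.
apply: (@bounded_integrable _ C) => // x.
apply: (ler_cvg_to (cvg_norm (cf x)) (cvg_cst C)).
by apply: nearW => n; exact: fC.
Qed.

End BoundedIntegrals.

Section NormalLaw.
Context {R : realType}.
Variables (m s : R).
Hypothesis s0 : s != 0.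
Local Notation leb := (@lebesgue_measure R).
Local Notation p := (normal_pdf m s).
Local Notation N := (normal_prob m s).

Let s2gt0 : 0 < s ^+ 2. Proof. by rewrite exprn_even_gt0. Qed.

Lemma ge0_integral_normal (f : R -> \bar R) :
  measurable_fun setT f -> (forall x, 0 <= f x)%E ->
  (\int[N]_x f x = \int[leb]_x (f x * (p x)%:E))%E.
Proof.
move=> mf f0.
apply: (@ge0_integral_density _ (measurableTypeR R) R leb N p _ _ _ f mf f0) => //.
- by move=> x; exact: normal_pdf_ge0.
- exact: measurable_normal_pdf.
Qed.

(** A quadratic factor is absorbed by doubling the standard deviation: u e^(-u) <= 4 e^(-u/4),
    because e^(3u/4) >= 1 + 3u/4. Integrability and decay at infinity then come from a normal
    density. *)
Lemma normal_pdf_second_moment (x : R) :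
  (x - m) ^+ 2 * p x <= 16 * s ^+ 2 * normal_pdf m (2 * s) x.
Proof.
rewrite !normal_pdfE ?mulf_neq0//.
rewrite /normal_fun /normal_peak.
set y := (x - m) ^+ 2.
have y0 : 0 <= y by exact: sqr_ge0.
have pi0 : 0 < pi :> R by exact: pi_gt0.
have -> : Num.sqrt ((2 * s) ^+ 2 * pi *+ 2) = 2 * Num.sqrt (s ^+ 2 * pi *+ 2).
  rewrite (_ : (2 * s) ^+ 2 * pi *+ 2 = 2 ^+ 2 * (s ^+ 2 * pi *+ 2)); last by ring.
  by rewrite sqrtrM ?sqr_ge0// sqrtr_sqr ger0_norm.
set q := Num.sqrt _.
have q0 : 0 < q by rewrite sqrtr_gt0 pmulrn_lgt0// mulr_gt0.
set u := y / (s ^+ 2 *+ 2).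
have u0 : 0 <= u by rewrite divr_ge0// mulrn_wge0// ltW.
have -> : - y / (s ^+ 2 *+ 2) = - u by rewrite mulNr.
have -> : - y / ((2 * s) ^+ 2 *+ 2) = - (u / 4).
  rewrite mulNr /u; congr (- _); field; exact: s0.
have -> : y = u * (2 * s ^+ 2) by rewrite /u; field; exact: s0.
rewrite invfM.
have -> : 16 * s ^+ 2 * (2^-1 * q^-1 * expR (- (u / 4))) =
   (8 * s ^+ 2 * q^-1) * expR (- (u / 4)) by field; rewrite gt_eqF.
have -> : u * (2 * s ^+ 2) * (q^-1 * expR (- u)) = (2 * s ^+ 2 * q^-1) * (u * expR (-u)) by ring.
have -> : 8 * s ^+ 2 / q * expR (- (u / 4)) = 2 * s ^+ 2 / q * (4 * expR (- (u / 4))) by ring.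
rewrite ler_wpM2l//; first by rewrite divr_ge0 ?ltW// mulr_gt0.
have -> : - (u / 4) = - u + 3 / 4 * u by field.
rewrite expRD mulrCA mulrC ler_wpM2l ?expR_ge0//.
have := expR_ge1Dx (3 / 4 * u); lra.
Qed.

Lemma normal_integrable (f : R -> R) (A B : R) : measurable_fun setT f ->
  (forall x, `|f x| <= A + B * (x - m) ^+ 2) ->
  leb.-integrable setT (fun x => (f x * p x)%:E).
Proof.
move=> mf fAB.
have mp := measurable_normal_pdf m s.
pose g x := (`|A| * p x + `|B| * (16 * s ^+ 2 * normal_pdf m (2 * s) x))%:E.
have ig : leb.-integrable setT g.
  rewrite /g; under eq_fun do rewrite EFinD !EFinM.
  apply: integrableD => //; first by apply: integrableZl => //; exact: integrable_normal_pdf.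
  apply: integrableZl => //; rewrite -EFinM; apply: integrableZl => //.
  exact: integrable_normal_pdf.
apply: le_integrable ig => //.
  by apply/measurable_EFinP/measurable_funM.
move=> x _; rewrite /= lee_fin normrM (ger0_norm (normal_pdf_ge0 _ _ _)).
rewrite [leRHS]ger0_norm; last first.
  by rewrite addr_ge0// mulr_ge0// ?normal_pdf_ge0// mulr_ge0 ?normal_pdf_ge0// mulr_ge0// sqr_ge0.
apply: (@le_trans _ _ ((`|A| + `|B| * (x - m) ^+ 2) * p x)).
  rewrite ler_wpM2r ?normal_pdf_ge0// (le_trans (fAB x))// lerD ?ler_norm//.
  by rewrite ler_wpM2r ?sqr_ge0// ler_norm.
rewrite mulrDl lerD2l -mulrA ler_wpM2l//.
exact: normal_pdf_second_moment.
Qed.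

Lemma is_derive_normal_pdf (x : R) :
  is_derive x 1 p (- ((x - m) / s ^+ 2) * p x).
Proof.
rewrite normal_pdfE// /normal_fun.
apply: is_derive_eq.
rewrite /GRing.scale /=; field.
exact: s0.
Qed.

Lemma normal_pdf_decay (x : R) :
  (x - m) ^+ 2 * p x <= 16 * s ^+ 2 * normal_peak (2 * s).
Proof.
apply: (le_trans (normal_pdf_second_moment x)).
rewrite ler_wpM2l ?normal_pdf_ub ?mulf_neq0//.
by rewrite mulr_ge0// ltW.
Qed.
End NormalLaw.

Section SteinIdentity.
Context {R : realType}.
Variables (m s : R).
Hypothesis s0 : s != 0.
Local Notation leb := (@lebesgue_measure R).
Local Notation p := (normal_pdf m s).
Local Notation N := (normal_prob m s).

Let s2gt0 : 0 < s ^+ 2. Proof. by rewrite exprn_even_gt0. Qed.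

(** Integration by parts: the derivative of [G * p] is [g * p] minus s^-2 (x - m) G p, and [G * p]
    vanishes at infinity. The mean, the variance and the characteristic function of the normal law
    are all instances. *)
Lemma stein_identity (G g : R -> R) (A B C : R) : 0 <= A -> 0 <= B ->
  (forall x : R, is_derive x 1 G (g x)) -> continuous g ->
  (forall x, `|(x - m) * G x| <= A + B * (x - m) ^+ 2) ->
  (forall x, `|g x| <= C) ->
  \int[leb]_x ((x - m) * G x * p x) = s ^+ 2 * \int[leb]_x (g x * p x).
Proof.
move=> A0 B0 dG cg yG gC.
have cG : continuous G.
  move=> x; apply/differentiable_continuous/derivable1_diffP.
  by have [] := dG x.
have mG : measurable_fun [set: measurableTypeR R] G by exact: continuous_measurable_fun.
have mg : measurable_fun [set: measurableTypeR R] g by exact: continuous_measurable_fun.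
have cp : continuous p by exact: continuous_normal_pdf.
pose F x := G x * p x.
pose f x := g x * p x - s ^- 2 * ((x - m) * G x * p x).
have dF (x : R) : is_derive x 1 F (f x).
  have := dG x; have := @is_derive_normal_pdf _ m s s0 x => dp dGx.
  apply: is_derive_eq; rewrite /f /GRing.scale /=; field.
  exact: s0.
have cf : continuous f.
  move=> x; apply: (@cvgB _ R^o); apply: cvgM => //.
  - exact: cg.
  - exact: cp.
  - exact: cvg_cst.
  - apply: cvgM; last exact: cp.
    apply: cvgM; last exact: cG.
    by apply: (@cvgB _ R^o) => //; exact: cvg_cst.
have i1 : leb.-integrable setT (fun x => (g x * p x)%:E).
  by apply: (@normal_integrable _ m s s0 g C 0) => // x; rewrite mul0r addr0.
have i2 : leb.-integrable setT (fun x => ((x - m) * G x * p x)%:E).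
  apply: (@normal_integrable _ m s s0 (fun x => (x - m) * G x) A B) => //.
  apply: measurable_funM => //; exact: measurable_funB.
have i3 : leb.-integrable setT (fun x => (f x)%:E).
  rewrite /f; under eq_fun do rewrite EFinB.
  apply: integrableB => //; under eq_fun do rewrite EFinM.
  exact: integrableZl.
suff f0 : \int[leb]_x f x = 0.
  move: f0; rewrite /f RintegralB//; last first.
    exact: (integrableZl measurableT _ i2).
  rewrite RintegralZl// => /eqP; rewrite subr_eq0 => /eqP ->.
  by rewrite mulVKf// expf_eq0.
(* K / n bounds [F] at distance n >= 1 from the mean. The second term controls a fourth moment:
   [normal_pdf_second_moment] is followed by [normal_pdf_decay] for the density of standard
   deviation 2 s. *)
pose K := A * (16 * s ^+ 2 * normal_peak (2 * s)) +
  B * (16 * s ^+ 2) * (16 * (2 * s) ^+ 2 * normal_peak (2 * (2 * s))).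
have FK (n : nat) (x : R) : (x - m) ^+ 2 = n.+1%:R ^+ 2 -> `|F x| <= K * n.+1%:R^-1.
  move=> xn.
  have y1 : 1 <= `|x - m|.
    rewrite -(@ler_pXn2r _ 2)// ?nnegrE//.
    by rewrite expr1n -normrX xn ger0_norm ?sqr_ge0// -natrX ler1n expn_gt0.
  rewrite ler_pdivlMr// mulrC.
  apply: (@le_trans _ _ (n.+1%:R ^+ 2 * ((A + B * (x - m) ^+ 2) * p x))).
    rewrite /F normrM (ger0_norm (normal_pdf_ge0 _ _ _)) -xn.
    apply: ler_pM; rewrite ?mulr_ge0 ?normal_pdf_ge0//.
      by rewrite xn expr2 ler_peMr// ler1n.
    rewrite ler_wpM2r ?normal_pdf_ge0//.
    apply: le_trans (yG x); rewrite normrM ler_peMl//.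
  rewrite -xn /K mulrDl mulrDr; apply: lerD.
    by rewrite mulrCA ler_wpM2l//; exact: normal_pdf_decay.
  rewrite -(mulrA B) mulrCA -(mulrA B) ler_wpM2l//.
  apply: (@le_trans _ _ ((x - m) ^+ 2 * (16 * s ^+ 2 * normal_pdf m (2 * s) x))).
    by rewrite ler_wpM2l ?sqr_ge0//; exact: normal_pdf_second_moment.
  rewrite mulrCA ler_wpM2l//; first by rewrite mulr_ge0// ltW.
  by apply: normal_pdf_decay; rewrite mulf_neq0.
pose I (n : nat) : set R := `[m - n.+1%:R, m + n.+1%:R]%classic.
have IF n : (\int[leb]_(x in I n) (f x)%:E)%E = (F (m + n.+1%:R) - F (m - n.+1%:R))%:E.
  rewrite EFinB; apply: continuous_FTC2 => //.
  - by rewrite ltrBlDr -addrA ltrDl ltr_wpDr.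
  - exact: continuous_subspaceT.
  - have cF : continuous F by move=> x; apply: cvgM; [exact: cG|exact: cp].
    split.
    + by move=> x _; have [] := dF x.
    + by apply: cvg_at_right_filter; exact: cF.
    + by apply: cvg_at_left_filter; exact: cF.
  - by move=> x _; rewrite derive1E; have [_ ->] := dF x.
have cI : (\int[leb]_(x in I n) (f x)%:E)%E @[n --> \oo] --> (\int[leb]_x (f x)%:E)%E.
  under eq_fun do rewrite integral_mkcond.
  have mf : measurable_fun [set: measurableTypeR R] f by exact: continuous_measurable_fun.
  have mI n : measurable (I n : set (measurableTypeR R)) by exact: measurable_itv.
  have h1 n : measurable_fun [set: measurableTypeR R] ((fun x => (f x)%:E) \_ (I n)).
    apply/(measurable_restrictT _ _).1 => //.
    by apply/measurable_EFinP; exact: measurable_funTS.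
  have h2 : measurable_fun [set: measurableTypeR R] (fun x => (f x)%:E) by exact/measurable_EFinP.
  have h3 : {ae leb, forall x, setT x ->
      ((fun x => (f x)%:E) \_ (I n)) x @[n --> \oo] --> (f x)%:E}.
    apply: aeW => x _; apply: cvg_near_cst; near=> n.
    rewrite patchE mem_set// /I /= in_itv/= -ler_distl.
    rewrite (@le_trans _ _ n%:R) ?ler_nat//.
    near: n; exact: nbhs_infty_ger.
  have h4 : {ae leb, forall x n, setT x ->
     (`|((fun x => (f x)%:E) \_ (I n)) x| <= (fun x => `|(f x)%:E|) x)%E}.
    apply: aeW => x n _; rewrite patchE; case: ifPn => // _.
    by rewrite abse0.
  have i4 : leb.-integrable setT (fun x => `|(f x)%:E|%E) by exact: integrable_abse.
  by have [_ _] := dominated_convergence measurableT h1 h2 h3 i4 h4.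
have cI0 : (\int[leb]_(x in I n) (f x)%:E)%E @[n --> \oo] --> 0%E.
  under eq_fun do rewrite IF.
  apply: cvg_EFin; first exact: nearW.
  apply: norm_cvg0.
  apply: (@squeeze_cvgr _ _ _ _ (cst 0) (fun n => 2 * K * n.+1%:R^-1)).
  - apply: nearW => n; rewrite normr_ge0/= (le_trans (ler_normB _ _))//.
    rewrite -mulrA mulr_natl mulr2n lerD//; apply: FK.
      by rewrite addrAC subrr add0r.
    by rewrite addrAC subrr add0r sqrrN.
  - exact: cvg_cst.
  - rewrite -[X in _ --> X](mulr0 (2 * K)); apply: cvgM; first exact: cvg_cst.
    exact: cvg_harmonic.
by rewrite /Rintegral -(cvg_lim _ cI)// (cvg_lim _ cI0).
Unshelve. all: end_near. Qed.

Lemma Rintegral_normal (f : R -> R) (A B : R) :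
  measurable_fun [set: measurableTypeR R] f ->
  (forall x, `|f x| <= A + B * (x - m) ^+ 2) ->
  N.-integrable setT (fun x => (f x)%:E) /\
  \int[N]_x f x = \int[leb]_x (f x * p x).
Proof.
move=> mf fAB.
have ifp := normal_integrable s0 mf fAB.
have mF : measurable_fun [set: measurableTypeR R] (fun x => (f x)%:E).
  exact/measurable_EFinP.
have pE x : `|p x| = p x by rewrite ger0_norm// normal_pdf_ge0.
split.
  apply/integrableP; split => //.
  rewrite ge0_integral_normal//; last exact: measurableT_comp.
  move/integrableP : ifp => [_]; congr (_ < _)%E.
  by apply: eq_integral => x _; rewrite /= normrM pE EFinM.
rewrite /Rintegral integralE [in RHS]integralE.
rewrite ge0_integral_normal//; last exact: measurable_funepos.
rewrite ge0_integral_normal//; last exact: measurable_funeneg.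
congr fine; congr (_ - _)%E; apply: eq_integral => x _.
  rewrite !funeposE -!EFin_max -EFinM; congr EFin.
  by rewrite maxr_pMl ?normal_pdf_ge0// mul0r.
rewrite !funenegE -!EFinN -!EFin_max -EFinM; congr EFin.
by rewrite maxr_pMl ?normal_pdf_ge0// mul0r mulNr.
Qed.

End SteinIdentity.

Section ZeroDerivative.
Context {R : realType}.

Lemma is_derive_0_cst (f : R -> R) : (forall x : R, is_derive x 1 f 0) ->
  forall x y, f x = f y.
Proof.
move=> df; have aux x y : x < y -> f x = f y.
  move=> xy.
  have cf : {within `[x, y], continuous f}.
    apply: derivable_within_continuous => z _; by have [] := df z.
  have [c _] := MVT xy (fun z _ => df z) cf.
  by rewrite mul0r => /eqP; rewrite subr_eq0 => /eqP.
by move=> x y; case: (ltgtP x y) => [/aux|/aux|->].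
Qed.

(* Applied to the Fourier transform of a Gaussian law, through [stein_identity]. *)
Lemma gaussian_ode (v : R) (F : R -> R) :
  (forall t : R, is_derive t 1 F (- (v * t) * F t)) ->
  forall t, F t = F 0 * expR (- (v * t ^+ 2) / 2).
Proof.
move=> dF t.
pose H (u : R) := F u * expR (v * u ^+ 2 / 2).
have dH (u : R) : is_derive u 1 H 0.
  rewrite /H; have := dF u => dFu.
  by apply: is_derive_eq; rewrite /GRing.scale /=; field.
have := is_derive_0_cst dH t 0.
rewrite /H expr0n/= mulr0 mul0r expR0 mulr1 => <-.
by rewrite -mulrA -expRD mulNr subrr expR0 mulr1.
Qed.

End ZeroDerivative.

Section NormalMoments.
Context {R : realType}.
Variables (m s : R).
Hypothesis s0 : s != 0.
Local Notation leb := (@lebesgue_measure R).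
Local Notation p := (normal_pdf m s).
Local Notation N := (normal_prob m s).

Lemma normal_integral_stein (G g : R -> R) (A B C : R) : 0 <= A -> 0 <= B ->
  (forall x : R, is_derive x 1 G (g x)) -> continuous g ->
  (forall x, `|(x - m) * G x| <= A + B * (x - m) ^+ 2) ->
  (forall x, `|g x| <= C) ->
  N.-integrable setT (fun x => ((x - m) * G x)%:E) /\
  \int[N]_x ((x - m) * G x) = s ^+ 2 * \int[N]_x g x.
Proof.
move=> A0 B0 dG cg yG gC.
have cG : continuous G.
  move=> x; apply/differentiable_continuous/derivable1_diffP.
  by have [] := dG x.
have mG : measurable_fun [set: measurableTypeR R] G by exact: continuous_measurable_fun.
have mg : measurable_fun [set: measurableTypeR R] g by exact: continuous_measurable_fun.
have [i1 ->] : N.-integrable setT (fun x => ((x - m) * G x)%:E) /\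
  \int[N]_x ((x - m) * G x) = \int[leb]_x (((x - m) * G x) * p x).
  apply: (@Rintegral_normal _ m s s0 (fun x => (x - m) * G x) A B) => //.
  apply: measurable_funM => //; exact: measurable_funB.
have [i2 ->] : N.-integrable setT (fun x => (g x)%:E) /\ \int[N]_x g x = \int[leb]_x (g x * p x).
  by apply: (@Rintegral_normal _ m s s0 g C 0) => // x; rewrite mul0r addr0.
split => //; exact: (stein_identity s0 A0 B0 dG cg yG gC).
Qed.

(** Stein's identity for the constant function 1. *)
Lemma normal_mean : N.-integrable setT (fun x => (x - m)%:E) /\ \int[N]_x (x - m) = 0.
Proof.
have [|||||] := @normal_integral_stein (cst 1) (cst 0) 1 1 0 => //.
- by move=> x; apply: (@cvg_cst R).
- move=> x; rewrite /cst mulr1 mul1r.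
  rewrite -[(x - m) ^+ 2]real_normK ?num_real//.
  have := sqr_ge0 (`|x - m| - 1); have := normr_ge0 (x - m); nra.
- by move=> x; rewrite normr0.
move=> i; rewrite Rintegral_cst//= mul0r mulr0 => e.
by split; [apply: eq_integrable i => // x _|rewrite -[RHS]e; apply: eq_Rintegral => x _]; rewrite /cst mulr1.
Qed.

(** Stein's identity for x - m. *)
Lemma normal_second : N.-integrable setT (fun x => ((x - m) ^+ 2)%:E) /\
  \int[N]_x (x - m) ^+ 2 = s ^+ 2.
Proof.
have [||||||] := @normal_integral_stein (fun x => x - m) (cst 1) 0 1 1 => //.
- move=> x; apply: is_derive_eq; by rewrite subr0.
- by move=> x; apply: (@cvg_cst R).
- by move=> x; rewrite add0r mul1r -expr2 normrX real_normK ?num_real.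
- by move=> x; rewrite normr1.
move=> i; rewrite Rintegral_cst//= mul1r.
by rewrite probability_setT mulr1.
Qed.

Let int_dom : N.-integrable setT (EFin \o (fun x => `|x - m|)).
Proof. by have [i _] := normal_mean; exact: (integrable_abse i). Qed.

Let mlin (t : R) : measurable_fun [set: measurableTypeR R] (fun x => t * (x - m)).
Proof. by apply: measurable_funM => //; exact: measurable_funB. Qed.

(** Differentiation under the integral, then Stein's identity for the sine, shows that the transform
    solves F' = - s^2 t F; [gaussian_ode] integrates this equation. *)
Lemma normal_char_cos (r : R) :
  \int[N]_x cos (r * (x - m)) = expR (- (s ^+ 2 * r ^+ 2) / 2).
Proof.
pose F (t : R) := \int[N]_x cos (t * (x - m)).
have dcos (u x : R) : is_derive u 1 (fun u => cos (u * (x - m))) (- ((x - m) * sin (u * (x - m)))).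
  apply: is_derive_eq; rewrite /GRing.scale /=; ring.
have dF (t : R) : is_derive t 1 F (- (s ^+ 2 * t) * F t).
  have Ia : (`]t - 1, t + 1[%classic : set R) t by rewrite /= in_itv/= ltrBlDr ltrDl ltr01.
  have h1 (x : R) : (`]t - 1, t + 1[%classic : set R) x ->
      N.-integrable setT (EFin \o (fun y => cos (x * (y - m)))).
    by move=> _; exact: (Rint_cos N (mlin x)).
  have h2 (x y : R) : (`]t - 1, t + 1[%classic : set R) x -> setT y ->
    derivable ((fun u y => cos (u * (y - m))) ^~ y) x 1.
    by move=> _ _; have [] := dcos x y.
  have h3 (x y : R) : (`]t - 1, t + 1[%classic : set R) x -> setT y ->
     `|partial1of2 (fun u y => cos (u * (y - m))) x y| <= `|y - m|.
    move=> _ _; rewrite partial1of2E; have [_ ->] := dcos x y.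
    by rewrite normrN normrM ler_piMr// ler_norml sin_geN1 sin_le1.
  have D1 := @derivable_under_integral R _ _ N _ setT measurableT t _ _ Ia h1 h2 _ (fun y => normr_ge0 _) int_dom h3.
  have D2 := @differentiation_under_integral R _ _ N _ setT measurableT t _ _ Ia h1 h2 _ (fun y => normr_ge0 _) int_dom h3.
  apply: DeriveDef => //; rewrite -derive1E.
  rewrite D2.
  under eq_Rintegral => y _ do (rewrite partial1of2E; have [_ ->] := dcos t y).
  have [||||||] := @normal_integral_stein (fun x => sin (t * (x - m))) (fun x => t * cos (t * (x - m))) 1 1 `|t| => //.
  - move=> x; apply: is_derive_eq; rewrite /GRing.scale /=; ring.
  - move=> x; apply: cvgM; first exact: cvg_cst.
    apply: continuous_comp; last exact: continuous_cos.
    apply: cvgM; first exact: cvg_cst.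
    by apply: (@cvgB _ R^o) => //; exact: cvg_cst.
  - move=> x; rewrite normrM mul1r.
    apply: (@le_trans _ _ `|x - m|); first by rewrite ler_piMr// ler_norml sin_geN1 sin_le1.
    rewrite -[(x - m) ^+ 2]real_normK ?num_real//.
    have := sqr_ge0 (`|x - m| - 1); have := normr_ge0 (x - m); nra.
  - by move=> x; rewrite normrM ler_piMr// ler_norml cos_geN1 cos_le1.
  move=> i e.
  under eq_Rintegral do rewrite -mulN1r.
  rewrite RintegralZl// e mulN1r mulNr; congr (- _).
  rewrite RintegralZl//; last exact: (Rint_cos N (mlin t)).
  by rewrite mulrA.
have := gaussian_ode dF r; rewrite /F => ->.
under eq_Rintegral do rewrite mul0r cos0.
by rewrite Rintegral_cst//= probability_setT mulr1 mul1r.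
Qed.

(** The sine transform solves the same differential equation and vanishes at 0. *)
Lemma normal_char_sin (r : R) : \int[N]_x sin (r * (x - m)) = 0.
Proof.
pose F (t : R) := \int[N]_x sin (t * (x - m)).
have dsin (u x : R) : is_derive u 1 (fun u => sin (u * (x - m))) ((x - m) * cos (u * (x - m))).
  apply: is_derive_eq; rewrite /GRing.scale /=; ring.
have dF (t : R) : is_derive t 1 F (- (s ^+ 2 * t) * F t).
  have Ia : (`]t - 1, t + 1[%classic : set R) t by rewrite /= in_itv/= ltrBlDr ltrDl ltr01.
  have h1 (x : R) : (`]t - 1, t + 1[%classic : set R) x ->
      N.-integrable setT (EFin \o (fun y => sin (x * (y - m)))).
    by move=> _; exact: (Rint_sin N (mlin x)).
  have h2 (x y : R) : (`]t - 1, t + 1[%classic : set R) x -> setT y ->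
    derivable ((fun u y => sin (u * (y - m))) ^~ y) x 1.
    by move=> _ _; have [] := dsin x y.
  have h3 (x y : R) : (`]t - 1, t + 1[%classic : set R) x -> setT y ->
     `|partial1of2 (fun u y => sin (u * (y - m))) x y| <= `|y - m|.
    move=> _ _; rewrite partial1of2E; have [_ ->] := dsin x y.
    by rewrite normrM ler_piMr// ler_norml cos_geN1 cos_le1.
  have D1 := @derivable_under_integral R _ _ N _ setT measurableT t _ _ Ia h1 h2 _ (fun y => normr_ge0 _) int_dom h3.
  have D2 := @differentiation_under_integral R _ _ N _ setT measurableT t _ _ Ia h1 h2 _ (fun y => normr_ge0 _) int_dom h3.
  apply: DeriveDef => //; rewrite -derive1E.
  rewrite D2.
  under eq_Rintegral => y _ do (rewrite partial1of2E; have [_ ->] := dsin t y).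
  have [||||||] := @normal_integral_stein (fun x => cos (t * (x - m))) (fun x => - t * sin (t * (x - m))) 1 1 `|t| => //.
  - move=> x; apply: is_derive_eq; rewrite /GRing.scale /=; ring.
  - move=> x; apply: cvgM; first exact: cvg_cst.
    apply: continuous_comp; last exact: continuous_sin.
    apply: cvgM; first exact: cvg_cst.
    by apply: (@cvgB _ R^o) => //; exact: cvg_cst.
  - move=> x; rewrite normrM mul1r.
    apply: (@le_trans _ _ `|x - m|); first by rewrite ler_piMr// ler_norml cos_geN1 cos_le1.
    rewrite -[(x - m) ^+ 2]real_normK ?num_real//.
    have := sqr_ge0 (`|x - m| - 1); have := normr_ge0 (x - m); nra.
  - by move=> x; rewrite normrM normrN ler_piMr// ler_norml sin_geN1 sin_le1.
  move=> i e; rewrite e RintegralZl//; last exact: (Rint_sin N (mlin t)).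
  by rewrite mulrA mulrN.
have := gaussian_ode dF r; rewrite /F => ->.
under eq_Rintegral do rewrite mul0r sin0.
by rewrite Rintegral_cst//= !mul0r.
Qed.

End NormalMoments.

(** * Laws are determined by trigonometric moments *)

Section SignFunction.
Context {R : realType}.

(* Newton-Schulz iteration: odd polynomials converging to the sign function on [-1, 1]. *)
Fixpoint newton_sg (n : nat) (y : R) : R :=
  if n is n'.+1 then (3 * newton_sg n' y - newton_sg n' y ^+ 3) / 2 else y.

Lemma newton_sgN n y : newton_sg n (- y) = - newton_sg n y.
Proof. by elim: n => //= n ->; field. Qed.

(** One step sends the error 1 - z to (1 - z) (1 - z/2 - z^2/2). Since the iterates stay above y,
    the error contracts at least by the factor 1 - y/2. *)
Lemma newton_sg_pos n y : 0 < y <= 1 ->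
  y <= newton_sg n y <= 1 /\ 1 - newton_sg n y <= (1 - y) * (1 - y / 2) ^+ n.
Proof.
move=> /andP[y0 y1]; elim: n => [|n [/andP[h1 h2] h3]] /=.
  by rewrite expr0 mulr1 lexx y1.
set z := newton_sg n y in h1 h2 h3 *.
have e : 1 - (3 * z - z ^+ 3) / 2 = (1 - z) * ((1 - z) * (z + 2) / 2) by field.
have hz0 : 0 <= (1 - z) * (z + 2) / 2.
  by rewrite divr_ge0// mulr_ge0//; lra.
have hz : (1 - z) * (z + 2) / 2 <= 1 - y / 2.
  have -> : (1 - z) * (z + 2) / 2 = 1 - z / 2 - z ^+ 2 / 2 by field.
  have := sqr_ge0 z; lra.
have z1 : 0 <= 1 - z by lra.
have hz1 : (1 - z) * ((1 - z) * (z + 2) / 2) <= (1 - z) * (1 - y / 2).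
  exact: ler_wpM2l.
have hz2 : 0 <= (1 - z) * ((1 - z) * (z + 2) / 2) by exact: mulr_ge0.
split.
  have e2 : (3 * z - z ^+ 3) / 2 - z = z * (1 - z) * (1 + z) / 2 by field.
  have : 0 <= z * (1 - z) * (1 + z) / 2 by rewrite divr_ge0// !mulr_ge0//; lra.
  by rewrite -e2 => h4; apply/andP; split; lra.
rewrite e (le_trans hz1)// exprSr mulrA ler_wpM2r//; lra.
Qed.

Lemma newton_sg_bound n y : `|y| <= 1 -> `|newton_sg n y| <= 1.
Proof.
move=> hy; have [y0|y0|y0] := ltgtP 0 y.
- have [|/andP[a b] _] := @newton_sg_pos n y.
    by rewrite y0/=; move: hy; rewrite gtr0_norm.
  by rewrite ger0_norm// (le_trans _ a)// ltW.
- rewrite -normrN -newton_sgN.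
  have [|/andP[a b] _] := @newton_sg_pos n (- y).
    by rewrite oppr_gt0 y0/=; move: hy; rewrite ltr0_norm.
  by rewrite ger0_norm// (le_trans _ a)// oppr_ge0 ltW.
- have : newton_sg n 0 = 0 :> R by elim: n => //= n ->; rewrite expr0n/= mulr0 subr0 mul0r.
  by rewrite -y0 => ->; rewrite normr0.
Qed.

Lemma newton_sg_cvg y : `|y| <= 1 -> newton_sg n y @[n --> \oo] --> Num.sg y.
Proof.
have pos z : 0 < z <= 1 -> newton_sg n z @[n --> \oo] --> (1 : R).
  move=> hz; have /andP[z0 z1] := hz.
  apply/subr_cvg0.
  apply/cvgNP; rewrite oppr0; apply: norm_cvg0.
  apply: (@squeeze_cvgr _ _ _ _ (cst 0) (fun n => geometric (1 - z) (1 - z / 2) n)).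
  - apply: nearW => n /=; rewrite normr_ge0 /=.
    have [/andP[a b] c] := @newton_sg_pos n z hz.
    by rewrite /= opprB ger0_norm ?subr_ge0.
  - exact: cvg_cst.
  - apply: cvg_geometric; rewrite ltr_norml; lra.
move=> hy; have [y0|y0|y0] := ltgtP 0 y.
- rewrite gtr0_sg//; apply: pos; rewrite y0/=; by move: hy; rewrite gtr0_norm.
- rewrite ltr0_sg//.
  have -> : (newton_sg ^~ y) = (fun n => - newton_sg n (- y)).
    by apply/funext => n; rewrite newton_sgN opprK.
  apply: cvgN; apply: pos; rewrite oppr_gt0 y0/=; by move: hy; rewrite ltr0_norm.
- rewrite -y0 sgr0; under eq_fun => n.
    have -> : newton_sg n 0 = 0 :> R by elim: n => //= n ->; rewrite expr0n/= mulr0 subr0 mul0r.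
    over.
  exact: cvg_cst.
Qed.

(** Once |x / n| < pi, the sine has exactly the sign of x; the sign function thus becomes a limit of
    functions of trigonometric polynomials. *)
Lemma sg_sin_cvg (x : R) : Num.sg (sin (x / n.+1%:R)) @[n --> \oo] --> Num.sg x.
Proof.
apply: cvg_near_cst; near=> n.
have hn : `|x / n.+1%:R| < pi.
  rewrite normrM normfV (ger0_norm (_ : 0 <= n.+1%:R))// ltr_pdivrMr//.
  apply: (@le_lt_trans _ _ (1 * `|x|)); first by rewrite mul1r.
  apply: (@le_lt_trans _ _ (pi * `|x|)).
    by rewrite ler_wpM2r// (le_trans _ (pi_ge2 _))// ler1n.
  rewrite ltr_pM2l ?pi_gt0//.
  apply: (@le_lt_trans _ _ n%:R); last by rewrite ltr_nat.
  near: n; exact: nbhs_infty_ger.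
have n0 : 0 < n.+1%:R^-1 :> R by rewrite invr_gt0.
have [x0|x0|<-] := ltgtP 0 x.
- rewrite !gtr0_sg// sin_gt0_pi// mulr_gt0//=.
  by apply: le_lt_trans hn; rewrite ler_norm.
- rewrite ![Num.sg _]ltr0_sg// -oppr_gt0 -sinN sin_gt0_pi// oppr_gt0 pmulr_llt0// x0/=.
  by apply: le_lt_trans hn; rewrite -normrN ler_norm.
- by rewrite mul0r sin0.
Unshelve. all: end_near. Qed.

End SignFunction.

Section LawUniqueness.
Context {R : realType} (I : finType).
Context d1 d2 (T1 : measurableType d1) (T2 : measurableType d2).
Variables (P1 : probability T1 R) (P2 : probability T2 R).
Variables (X1 : I -> T1 -> R) (X2 : I -> T2 -> R).
Hypothesis mX1 : forall i, measurable_fun setT (X1 i).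
Hypothesis mX2 : forall i, measurable_fun setT (X2 i).
Hypothesis cosE : forall a : I -> R,
  \int[P1]_w cos (\sum_i a i * X1 i w) = \int[P2]_w cos (\sum_i a i * X2 i w).
Hypothesis sinE : forall a : I -> R,
  \int[P1]_w sin (\sum_i a i * X1 i w) = \int[P2]_w sin (\sum_i a i * X2 i w).

Let lin (c x : I -> R) := \sum_i c i * x i.
Let e1 w : I -> R := fun i => X1 i w.
Let e2 w : I -> R := fun i => X2 i w.

Let mlin1 c : measurable_fun setT (fun w => lin c (e1 w)).
Proof. by apply: measurable_sum => i; exact: (measurable_funM (measurable_cst _) (mX1 i)). Qed.
Let mlin2 c : measurable_fun setT (fun w => lin c (e2 w)).
Proof. by apply: measurable_sum => i; exact: (measurable_funM (measurable_cst _) (mX2 i)). Qed.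

(** Test functions on which the two laws agree. The cosine factor with arbitrary frequency and phase
    makes the class stable under multiplication by cosines. *)
Let testf (g : (I -> R) -> R) := [/\ measurable_fun setT (g \o e1),
  measurable_fun setT (g \o e2), exists C, forall x, `|g x| <= C &
  forall a b, \int[P1]_w (g (e1 w) * cos (lin a (e1 w) + b)) =
              \int[P2]_w (g (e2 w) * cos (lin a (e2 w) + b))].

(** Bounded functions of one linear form that preserve the class of test functions. They form an
    algebra closed under bounded pointwise limits; it contains cosines, hence signs, hence
    indicators of Borel sets. *)
Let mult (u : R -> R) := [/\ measurable_fun setT u, exists C, forall x, `|u x| <= C &
  forall g c, testf g -> testf (fun x => g x * u (lin c x))].

Let mcosD d (T : measurableType d) (f : T -> R) (b : R) : measurable_fun setT f ->
  measurable_fun setT (fun w => cos (f w + b)).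
Proof.
move=> mf; apply: (measurableT_comp (f := @cos R)).
  apply: continuous_measurable_fun; exact: continuous_cos.
exact: measurable_funD.
Qed.

Let bprod (u v : R) (A B : R) : `|u| <= A -> `|v| <= B -> `|u * v| <= A * B.
Proof. by move=> hu hv; rewrite normrM ler_pM. Qed.

Let normcos (x : R) : `|cos x| <= 1.
Proof. by rewrite ler_norml cos_geN1 cos_le1. Qed.

Let iprod d (T : measurableType d) (P : probability T R) (f h : T -> R) A B :
  measurable_fun setT f -> measurable_fun setT h ->
  (forall w, `|f w| <= A) -> (forall w, `|h w| <= B) ->
  P.-integrable setT (fun w => (f w * h w)%:E).
Proof.
move=> mf mh fA hB; apply: (@bounded_integrable _ _ _ P (fun w => f w * h w) (A * B)).
  exact: measurable_funM.
by move=> w; exact: bprod.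
Qed.

Let testf1 : testf (cst 1).
Proof.
split; [exact: measurable_cst|exact: measurable_cst|by exists 1 => x; rewrite normr1|].
move=> a b.
have H d (T : measurableType d) (P : probability T R) (X : I -> T -> R) :
  (forall i, measurable_fun setT (X i)) ->
  \int[P]_w (cst 1 (fun i => X i w) * cos (lin a (fun i => X i w) + b)) =
  \int[P]_w cos (\sum_i a i * X i w) * cos b - \int[P]_w sin (\sum_i a i * X i w) * sin b.
  move=> mX.
  have ml : measurable_fun setT (fun w => \sum_i a i * X i w).
    by apply: measurable_sum => i; apply: measurable_funM.
  under eq_Rintegral do rewrite mul1r cosD.
  have ic := Rint_cos P ml. have is_ := Rint_sin P ml.
  rewrite RintegralB//; last 2 first.
  - exact: (integrableZr measurableT (cos b) ic).
  - exact: (integrableZr measurableT (sin b) is_).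
  by rewrite RintegralZr// RintegralZr.
by rewrite (H _ _ P1 X1)// (H _ _ P2 X2)// cosE sinE.
Qed.

Let mult_cst k : mult (cst k).
Proof.
split; [exact: measurable_cst|by exists (`|k|)|].
move=> g c [m1 m2 [C gC] gE]; split.
- exact: measurable_funM.
- exact: measurable_funM.
- by exists (C * `|k|) => x; exact: bprod.
move=> a b; rewrite /cst.
under eq_Rintegral do rewrite mulrAC.
under [RHS]eq_Rintegral do rewrite mulrAC.
rewrite !RintegralZr// ?gE//.
- exact: (iprod P2 m2 (mcosD b (mlin2 a)) (fun w => gC _) (fun w => normcos _)).
- exact: (iprod P1 m1 (mcosD b (mlin1 a)) (fun w => gC _) (fun w => normcos _)).
Qed.

Let mult_mul u v : mult u -> mult v -> mult (fun x => u x * v x).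
Proof.
move=> [mu [A uA] hu] [mv [B vB] hv]; split.
- exact: measurable_funM.
- by exists (A * B) => x; exact: bprod.
move=> g c tg; have := hv _ c (hu _ c tg).
by congr testf; apply/funext => x; rewrite mulrA.
Qed.

Let mult_add u v : mult u -> mult v -> mult (fun x => u x + v x).
Proof.
move=> [mu [A uA] hu] [mv [B vB] hv]; split.
- exact: measurable_funD.
- by exists (A + B) => x; rewrite (le_trans (ler_normD _ _))// lerD.
move=> g c tg.
have [mu1 mu2 [Cu guC] guE] := hu _ c tg.
have [mv1 mv2 [Cv gvC] gvE] := hv _ c tg.
have gE x : g x * (u (lin c x) + v (lin c x)) = g x * u (lin c x) + g x * v (lin c x).
  by rewrite mulrDr.
split.
- by rewrite /comp/=; under eq_fun do rewrite gE; exact: measurable_funD.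
- by rewrite /comp/=; under eq_fun do rewrite gE; exact: measurable_funD.
- by exists (Cu + Cv) => x; rewrite gE (le_trans (ler_normD _ _))// lerD.
move=> a b.
under eq_Rintegral do rewrite gE mulrDl.
under [RHS]eq_Rintegral do rewrite gE mulrDl.
rewrite !RintegralD// ?guE ?gvE//.
- exact: (iprod P2 mu2 (mcosD b (mlin2 a)) (fun w => guC _) (fun w => normcos _)).
- exact: (iprod P2 mv2 (mcosD b (mlin2 a)) (fun w => gvC _) (fun w => normcos _)).
- exact: (iprod P1 mu1 (mcosD b (mlin1 a)) (fun w => guC _) (fun w => normcos _)).
- exact: (iprod P1 mv1 (mcosD b (mlin1 a)) (fun w => gvC _) (fun w => normcos _)).
Qed.

(** The product of two cosines is half the sum of the cosines of frequencies [ap] and [am], to which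
    the assumption on [g] applies. *)
Let mult_cos t s : mult (fun x => cos (t * x + s)).
Proof.
split.
- by apply: mcosD; apply: measurable_funM.
- by exists 1 => x; exact: normcos.
move=> g c [m1 m2 [C gC] gE].
have ml1 : measurable_fun setT (fun w => cos (t * lin c (e1 w) + s)).
  by apply: mcosD; exact: (measurable_funM (measurable_cst _) (mlin1 c)).
have ml2 : measurable_fun setT (fun w => cos (t * lin c (e2 w) + s)).
  by apply: mcosD; exact: (measurable_funM (measurable_cst _) (mlin2 c)).
split.
- exact: measurable_funM.
- exact: measurable_funM.
- by exists (C * 1) => x; exact: bprod.
move=> a b.
pose ap i := a i + t * c i; pose am i := a i - t * c i.
have linp x : lin ap x = lin a x + t * lin c x.
  rewrite /lin mulr_sumr -big_split /=; apply: eq_bigr => i _; rewrite /ap; ring.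
have linm x : lin am x = lin a x - t * lin c x.
  rewrite /lin mulr_sumr -sumrB; apply: eq_bigr => i _; rewrite /am; ring.
have key x : g x * cos (t * lin c x + s) * cos (lin a x + b) =
   2^-1 * (g x * cos (lin ap x + (b + s))) + 2^-1 * (g x * cos (lin am x + (b - s))).
  rewrite linp linm.
  have -> : lin a x + t * lin c x + (b + s) = (lin a x + b) + (t * lin c x + s) by ring.
  have -> : lin a x - t * lin c x + (b - s) = (lin a x + b) - (t * lin c x + s) by ring.
  move: (lin a x + b) (t * lin c x + s) => u v.
  by rewrite [cos (u + v)]cosD [cos (u - v)]cosB; field.
under eq_Rintegral do rewrite key.
under [RHS]eq_Rintegral do rewrite key.
have i1 a' b' := iprod P1 m1 (mcosD b' (mlin1 a')) (fun w => gC _) (fun w => normcos _).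
have i2 a' b' := iprod P2 m2 (mcosD b' (mlin2 a')) (fun w => gC _) (fun w => normcos _).
rewrite !RintegralD//; [|exact: (integrableZl measurableT _ (i2 _ _))|exact: (integrableZl measurableT _ (i2 _ _))|exact: (integrableZl measurableT _ (i1 _ _))|exact: (integrableZl measurableT _ (i1 _ _))].
rewrite !RintegralZl ?gE//; [exact: i2|exact: i2|exact: i1|exact: i1].
Qed.

Let mult_lim (u_ : nat -> R -> R) u (C : R) : (forall n, mult (u_ n)) ->
  (forall n x, `|u_ n x| <= C) -> (forall x, u_ n x @[n --> \oo] --> u x) -> mult u.
Proof.
move=> mu uC cu.
have measu : measurable_fun setT u.
  by apply: (@measurable_fun_cvg _ _ _ setT u_) => // n; have [] := mu n.
have ubC x : `|u x| <= C.
  apply: (ler_cvg_to (cvg_norm (cu x)) (cvg_cst C)).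
  by apply: nearW => n; exact: uC.
split => //; first by exists C.
move=> g c [m1 m2 [K gK] gE].
have mm1 : measurable_fun setT (fun w => u (lin c (e1 w))) by exact: measurableT_comp.
have mm2 : measurable_fun setT (fun w => u (lin c (e2 w))) by exact: measurableT_comp.
split.
- exact: measurable_funM.
- exact: measurable_funM.
- by exists (K * C) => x; exact: bprod.
move=> a b.
have H d (T : measurableType d) (P : probability T R) (e : T -> I -> R) :
  measurable_fun setT (g \o e) -> (forall c, measurable_fun setT (fun w => lin c (e w))) ->
  \int[P]_w (g (e w) * u_ n (lin c (e w)) * cos (lin a (e w) + b)) @[n --> \oo] -->
  \int[P]_w (g (e w) * u (lin c (e w)) * cos (lin a (e w) + b)).
  move=> mg ml; apply: (@Rintegral_cvg_bounded _ _ _ _ _ _ (K * C * 1)).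
  - move=> n; apply: measurable_funM; last exact: mcosD.
    apply: measurable_funM => //; have [m _ _] := mu n; exact: measurableT_comp.
  - by move=> n w; apply: bprod => //; apply: bprod.
  - move=> w; apply: cvgM; last exact: cvg_cst.
    by apply: cvgM; [exact: cvg_cst|exact: cu].
have h1 := H _ _ P1 e1 m1 mlin1. have h2 := H _ _ P2 e2 m2 mlin2.
rewrite -(cvg_lim _ h1)// -(cvg_lim _ h2)//; congr (lim (_ @ \oo)); apply/funext => n.
have [_ _ hn] := mu n; have [|_ _ _ ->//] := hn g c; split=> //; by exists K.
Qed.

Let mult_newton n u : mult u -> mult (fun x => newton_sg n (u x)).
Proof.
move=> mu; elim: n => //= n IH.
have -> : (fun x => (3 * newton_sg n (u x) - newton_sg n (u x) ^+ 3) / 2) =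
  (fun x => (3 / 2) * newton_sg n (u x) + (- 2^-1) * (newton_sg n (u x) * (newton_sg n (u x) * newton_sg n (u x)))).
  by apply/funext => x; field.
apply: mult_add; first exact: (mult_mul (mult_cst _) IH).
apply: (mult_mul (mult_cst _)).
by apply: mult_mul => //; apply: mult_mul.
Qed.

(** Two nested limits: the Newton-Schulz polynomials of sin ((x - y) / k) tend to its sign, which
    tends to the sign of x - y. The sine is a cosine shifted by pi/2. *)
Let mult_sg y : mult (fun x => Num.sg (x - y)).
Proof.
have sgle (z : R) : `|Num.sg z| <= 1 by rewrite normr_sg; case: (z != 0).
apply: (@mult_lim (fun k x => Num.sg (sin ((x - y) / k.+1%:R))) _ 1) => //.
  move=> k; apply: (@mult_lim (fun n x => newton_sg n (sin ((x - y) / k.+1%:R))) _ 1) => //.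
  - move=> n; apply: mult_newton.
    have := mult_cos k.+1%:R^-1 (- (y / k.+1%:R) - pi / 2).
    congr mult; apply/funext => x; rewrite addrA cosBpihalf; congr sin; ring.
  - by move=> n x; apply: newton_sg_bound; rewrite ler_norml sin_geN1 sin_le1.
  - by move=> x; apply: newton_sg_cvg; rewrite ler_norml sin_geN1 sin_le1.
by move=> x; exact: sg_sin_cvg.
Qed.

(** Dynkin induction from the open left half-lines; the disjoint unions are bounded limits of their
    partial sums. *)
Let mult_indic (A : set (measurableTypeR R)) : measurable A -> mult (\1_A).
Proof.
pose G := @RGenInftyO.G R.
have ME : measurable = <<s G >> by exact: RGenInftyO.measurableE.
move=> mA; have : <<s G >> A by rewrite -ME.
move: A {mA}; apply: (@dynkin_induction _ (measurableTypeR R) G (fun A => mult (\1_A))) => //.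
- move=> _ _ [x ->] [y ->]; exists (Order.min x y).
  apply/seteqP; split => z /=; rewrite !in_itv/= lt_min; first by move=> [-> ->].
  by move=> /andP[].
- by have := mult_cst 1; congr mult; apply/funext => x; rewrite indicT.
- move=> _ [y ->].
  have h := mult_sg y.
  (* The indicator of x < y is (s^2 - s) / 2 with s the sign of x - y, including at x = y. *)
  have := mult_add (mult_mul (mult_cst 2^-1) (mult_mul h h)) (mult_mul (mult_cst (- 2^-1)) h).
  congr mult; apply/funext => x; rewrite indicE /cst.
  have [xy|xy|->] := ltgtP x y.
  - rewrite ltr0_sg ?subr_lt0// mem_set /= ?in_itv//=; by field.
  - rewrite gtr0_sg ?subr_gt0// memNset /= ?in_itv/=; first by field.
    by apply/negP; rewrite -leNgt ltW.
  - rewrite subrr sgr0 memNset /= ?in_itv/=; first by field.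
    by rewrite ltxx.
- move=> S mS h.
  have := mult_add (mult_cst 1) (mult_mul (mult_cst (- 1)) h).
  congr mult; apply/funext => x; rewrite !indicE in_setC /cst.
  by case: (x \in S) => /=; ring.
- move=> F mF tF h.
  apply: (@mult_lim (fun n x => \1_(\big[setU/set0]_(i < n) F i) x) _ 1).
  + elim=> [|n IH].
      by rewrite big_ord0; have := mult_cst 0; congr mult; apply/funext => x; rewrite indic0.
    have := mult_add IH (h n); congr mult; apply/funext => x.
    rewrite big_ord_recr/= !indicE in_setU.
    have [xF|xF] := boolP (x \in F n); last by rewrite orbF addr0.
    rewrite memNset ?add0r//= => /mem_set.
    rewrite -bigcup_mkord inE => -[i /= iltn Fi].
    have e := tF i n Logic.I Logic.I (ex_intro _ x (conj Fi (set_mem xF))).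
    by move: iltn; rewrite e ltnn.
  + move=> n x; rewrite indicE; case: (x \in _) => //=; rewrite ?normr1 ?normr0//.
  + move=> x; apply: cvg_near_cst.
    have [[k _ Fk]|nF] := pselect ((\bigcup_k F k) x).
      near=> n; rewrite !indicE (mem_set (_ : (\bigcup_k F k) x)); last by exists k.
      rewrite mem_set// -bigcup_mkord; exists k => //=.
      by near: n; exists k.+1.
    near=> n; rewrite !indicE (memNset nF) memNset// -bigcup_mkord => -[k _ Fk].
    by apply: nF; exists k.
Unshelve. all: end_near. Qed.

(** The indicator of the event is a product of indicators of linear forms, so it is reached from the
    constant 1 by successive multipliers. *)
Lemma law_uniqueness (J : finType) (B : J -> I -> R) (A : J -> set (measurableTypeR R)) :
  (forall j, measurable (A j)) ->
  P1 [set w | forall j, A j (\sum_i B j i * X1 i w)] =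
  P2 [set w | forall j, A j (\sum_i B j i * X2 i w)].
Proof.
move=> mA.
have H : forall s : seq J, testf (fun x => \prod_(j <- s) \1_(A j) (lin (B j) x)).
  elim=> [|j s IH].
    by have := testf1; congr testf; apply/funext => x; rewrite big_nil.
  have [_ _ /(_ _ (B j) IH)] := mult_indic (mA j).
  by congr testf; apply/funext => x; rewrite big_cons mulrC.
(* Zero frequency and zero phase turn the cosine into 1. *)
have [_ _ _ /(_ (fun=> 0) 0)] := H (index_enum J).
have E d (T : measurableType d) (P : probability T R) (X : I -> T -> R) :
  (forall i, measurable_fun setT (X i)) ->
  (\int[P]_w (\prod_j \1_(A j) (lin (B j) (fun i => X i w)) * cos (lin (fun=> 0) (fun i => X i w) + 0)))%:E =
  P [set w | forall j, A j (\sum_i B j i * X i w)].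
  move=> mX.
  have mS : measurable [set w | forall j, A j (\sum_i B j i * X i w)].
    rewrite (_ : [set w | _] = \big[setI/setT]_(j <- index_enum J) ((fun w => \sum_i B j i * X i w) @^-1` A j)).
      apply: bigsetI_measurable => j _; rewrite -[X in measurable X]setTI.
      have ml : measurable_fun setT (fun w => \sum_i B j i * X i w).
        by apply: measurable_sum => i; apply: measurable_funM.
      exact: (ml measurableT _ (mA j)).
    apply/seteqP; split => w /=.
      by move=> h; rewrite -bigcap_seq => j _; exact: h.
    by rewrite -bigcap_seq => h j; apply: h; rewrite /= mem_index_enum.
  rewrite (_ : (fun w => _) = \1_[set w | forall j, A j (\sum_i B j i * X i w)]); last first.
    apply/funext => w; rewrite [lin (fun=> 0) _]big1; last by move=> i _; rewrite mul0r.
    rewrite addr0 cos0 mulr1 indicE.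
    have [|] := boolP (w \in _).
      by rewrite inE => h; rewrite big1// => j _; rewrite indicE mem_set.
    rewrite notin_setE/= => /existsNP[j Aj]; rewrite (bigD1 j)//= indicE memNset// mul0r//.
  rewrite /Rintegral integral_indic// setIT fineK// fin_num_measure//.
by move=> h; rewrite -(E _ _ P1 X1)// -(E _ _ P2 X2)//; congr EFin.
Qed.

End LawUniqueness.

(** * Gaussian vectors *)

Section ProductIntegral.
Context {R : realType} d1 d2 (T1 : measurableType d1) (T2 : measurableType d2).
Variables (P : probability T1 R) (Q : probability T2 R).

Definition pprod : probability (T1 * T2)%type R := (P \x Q)%E.

Lemma pprod_integral (f : T1 * T2 -> R) :
  pprod.-integrable setT (EFin \o f) ->
  \int[pprod]_z f z = fine (\int[P]_x \int[Q]_y (f (x, y))%:E)%E.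
Proof. by move=> fi; rewrite /Rintegral -(integral12_prod_meas1 fi). Qed.

Lemma pprodE (A : set (T1 * T2)) : measurable A ->
  pprod A = (\int[P]_x Q [set y | A (x, y)])%E.
Proof.
move=> mA; apply: eq_integral => x _ /=; congr (Q _).
by apply/seteqP; split => y; rewrite /xsection /= inE.
Qed.

Lemma measurable_sectionP (A : set (T1 * T2)) : measurable A ->
  (forall x, measurable [set y | A (x, y)]) /\
  measurable_fun setT (fun x => Q [set y | A (x, y)]).
Proof.
move=> mA.
have E x : [set y | A (x, y)] = xsection A x.
  by apply/seteqP; split => y; rewrite /xsection /= inE.
split; first by move=> x; rewrite E; exact: measurable_xsection.
under eq_fun do rewrite E.
exact: measurable_fun_xsection.
Qed.

Lemma Rintegral_prodM (f : T1 -> R) (g : T2 -> R) (A B : R) :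
  measurable_fun setT f -> measurable_fun setT g ->
  (forall x, `|f x| <= A) -> (forall y, `|g y| <= B) ->
  pprod.-integrable setT (fun z => (f z.1 * g z.2)%:E) /\
  \int[pprod]_z (f z.1 * g z.2) = (\int[P]_x f x) * (\int[Q]_y g y).
Proof.
move=> mf mg fA gB.
have i0 : pprod.-integrable setT (fun z => (f z.1 * g z.2)%:E).
  apply: (@bounded_integrable _ _ _ pprod (fun z => f z.1 * g z.2) (A * B)).
    apply: measurable_funM; first exact: (measurableT_comp mf measurable_fst).
    exact: (measurableT_comp mg measurable_snd).
  by move=> z; rewrite normrM ler_pM.
split => //.
have ig := bounded_integrable Q mg gB.
have if_ := bounded_integrable P mf fA.
rewrite (pprod_integral i0) -RintegralZr//.
rewrite /Rintegral; congr fine; apply: eq_integral => x _ /=.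
under eq_integral do rewrite EFinM.
by rewrite integralZl// EFinM fineK//; apply: integrable_fin_num.
Qed.

End ProductIntegral.

Section GaussianVectors.
Context {R : realType}.

Definition qform (I : finType) (S : I -> I -> R) (a : I -> R) :=
  \sum_i \sum_j a i * a j * S i j.

(* [X] is a centred Gaussian vector with covariance matrix [S], possibly degenerate. *)
Record gauss_vec (I : finType) d (T : measurableType d) (P : probability T R)
    (X : I -> T -> R) (S : I -> I -> R) : Prop := {
  gv_meas : forall i, measurable_fun setT (X i) ;
  gv_cos : forall a : I -> R,
    \int[P]_w cos (\sum_i a i * X i w) = expR (- qform S a / 2) ;
  gv_sin : forall a : I -> R, \int[P]_w sin (\sum_i a i * X i w) = 0 }.

Lemma gv_unique (I : finType) d1 (T1 : measurableType d1) (P1 : probability T1 R)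
    d2 (T2 : measurableType d2) (P2 : probability T2 R) X1 X2 (S : I -> I -> R)
    (J : finType) (B : J -> I -> R) (A : J -> set (measurableTypeR R)) :
  gauss_vec P1 X1 S -> gauss_vec P2 X2 S -> (forall j, measurable (A j)) ->
  P1 [set w | forall j, A j (\sum_i B j i * X1 i w)] =
  P2 [set w | forall j, A j (\sum_i B j i * X2 i w)].
Proof.
move=> [m1 c1 s1] [m2 c2 s2] mA.
apply: law_uniqueness => // a; first by rewrite c1 c2.
by rewrite s1 s2.
Qed.

Lemma sum_delta (I : finType) (F : I -> R) (j : I) : \sum_i (i == j)%:R * F i = F j.
Proof.
rewrite (bigD1 j)//= eqxx mul1r big1 ?addr0// => i ij.
by rewrite (negbTE ij) mul0r.
Qed.

Lemma gv_event (I : finType) d1 (T1 : measurableType d1) (P1 : probability T1 R)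
    d2 (T2 : measurableType d2) (P2 : probability T2 R) X1 X2 (S : I -> I -> R)
    (A : I -> set (measurableTypeR R)) :
  gauss_vec P1 X1 S -> gauss_vec P2 X2 S -> (forall j, measurable (A j)) ->
  P1 [set w | forall j, A j (X1 j w)] = P2 [set w | forall j, A j (X2 j w)].
Proof.
move=> g1 g2 mA.
have := gv_unique (fun j i => (i == j)%:R) g1 g2 mA.
under eq_set => w do under eq_forall => j do rewrite sum_delta.
move=> ->.
by under eq_set => w do under eq_forall => j do rewrite sum_delta.
Qed.

Lemma gv_lin (I J : finType) d (T : measurableType d) (P : probability T R)
    X (S : I -> I -> R) (B : J -> I -> R) :
  gauss_vec P X S -> gauss_vec P (fun j w => \sum_i B j i * X i w)
    (fun j k => \sum_i \sum_l B j i * B k l * S i l).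
Proof.
move=> [m c s].
have E (a : J -> R) w : \sum_j a j * (\sum_i B j i * X i w) =
   \sum_i (\sum_j a j * B j i) * X i w.
  under eq_bigr do rewrite mulr_sumr.
  rewrite exchange_big/=; apply: eq_bigr => i _.
  by rewrite mulr_suml; apply: eq_bigr => j _; rewrite mulrA.
split.
- by move=> j; apply: measurable_sum => i; apply: measurable_funM.
- move=> a; under eq_Rintegral do rewrite E.
  rewrite c; congr (expR (- _ / 2)); rewrite /qform.
  transitivity (\sum_i \sum_l \sum_j \sum_k (a j * a k * (B j i * B k l * S i l))).
    apply: eq_bigr => i _; apply: eq_bigr => l _.
    rewrite !mulr_suml; apply: eq_bigr => j _.
    by rewrite mulr_sumr mulr_suml; apply: eq_bigr => k _; ring.
  transitivity (\sum_i \sum_j \sum_l \sum_k (a j * a k * (B j i * B k l * S i l))).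
    by apply: eq_bigr => i _; rewrite exchange_big.
  rewrite exchange_big/=; apply: eq_bigr => j _.
  transitivity (\sum_i \sum_k \sum_l (a j * a k * (B j i * B k l * S i l))).
    by apply: eq_bigr => i _; rewrite exchange_big.
  rewrite exchange_big/=; apply: eq_bigr => k _.
  by rewrite mulr_sumr; apply: eq_bigr => i _; rewrite mulr_sumr.
- by move=> a; under eq_Rintegral do rewrite E; exact: s.
Qed.

Lemma gv_indep (I : finType) d1 (T1 : measurableType d1) (P : probability T1 R)
    d2 (T2 : measurableType d2) (Q : probability T2 R) X Y (S S' : I -> I -> R) :
  gauss_vec P X S -> gauss_vec Q Y S' ->
  gauss_vec (pprod P Q) (fun i z => X i z.1 + Y i z.2) (fun i j => S i j + S' i j).
Proof.
move=> [mX cX sX] [mY cY sY].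
have E (a : I -> R) z : \sum_i a i * (X i z.1 + Y i z.2) =
   \sum_i a i * X i z.1 + \sum_i a i * Y i z.2.
  by rewrite -big_split/=; apply: eq_bigr => i _; rewrite mulrDr.
have mx a : measurable_fun setT (fun w => \sum_i a i * X i w).
  by apply: measurable_sum => i; apply: measurable_funM.
have my a : measurable_fun setT (fun w => \sum_i a i * Y i w).
  by apply: measurable_sum => i; apply: measurable_funM.
have mc : measurable_fun setT (@cos R) by apply: continuous_measurable_fun; exact: continuous_cos.
have ms : measurable_fun setT (@sin R) by apply: continuous_measurable_fun; exact: continuous_sin.
have nc (x : R) : `|cos x| <= 1 by rewrite ler_norml cos_geN1 cos_le1.
have ns (x : R) : `|sin x| <= 1 by rewrite ler_norml sin_geN1 sin_le1.
have prod2 (f g : R -> R) a : measurable_fun setT f -> measurable_fun setT g ->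
   (forall x, `|f x| <= 1) -> (forall x, `|g x| <= 1) ->
   (pprod P Q).-integrable setT (fun z => (f (\sum_i a i * X i z.1) * g (\sum_i a i * Y i z.2))%:E) /\
   \int[pprod P Q]_z (f (\sum_i a i * X i z.1) * g (\sum_i a i * Y i z.2)) =
   (\int[P]_x f (\sum_i a i * X i x)) * (\int[Q]_y g (\sum_i a i * Y i y)).
  move=> mf mg f1 g1.
  apply: (@Rintegral_prodM _ _ _ _ _ P Q (fun x => f (\sum_i a i * X i x)) (fun y => g (\sum_i a i * Y i y)) 1 1) => //.
    exact: (measurableT_comp mf (mx a)).
  exact: (measurableT_comp mg (my a)).
split.
- move=> i; apply: measurable_funD; first exact: (measurableT_comp (mX i) measurable_fst).
  exact: (measurableT_comp (mY i) measurable_snd).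
- move=> a; under eq_Rintegral do rewrite E cosD.
  rewrite RintegralB//; [|exact: (prod2 _ _ _ mc mc nc nc).1|exact: (prod2 _ _ _ ms ms ns ns).1].
  rewrite (prod2 _ _ _ mc mc nc nc).2 (prod2 _ _ _ ms ms ns ns).2 cX cY sX mul0r subr0 -expRD; congr expR.
  rewrite -mulrDl -opprD; congr (- _ / 2); rewrite /qform -big_split/=.
  apply: eq_bigr => i _; rewrite -big_split/=; apply: eq_bigr => j _; ring.
- move=> a; under eq_Rintegral do rewrite E sinD.
  rewrite RintegralD//; [|exact: (prod2 _ _ _ ms mc ns nc).1|exact: (prod2 _ _ _ mc ms nc ns).1].
  by rewrite (prod2 _ _ _ ms mc ns nc).2 (prod2 _ _ _ mc ms nc ns).2 sX sY mul0r mulr0 addr0.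
Qed.

Lemma gv_rank1 (I : finType) (b : I -> R) :
  gauss_vec (normal_prob 0 1 : probability (measurableTypeR R) R)
    (fun i x => b i * x) (fun i j => b i * b j).
Proof.
have E (a : I -> R) (x : R) : \sum_i a i * (b i * x) = (\sum_i a i * b i) * (x - 0).
  by rewrite subr0 mulr_suml; apply: eq_bigr => i _; rewrite mulrA.
split.
- by move=> i; apply: measurable_funM.
- move=> a; under eq_Rintegral do rewrite E.
  rewrite normal_char_cos// expr1n mul1r; congr (expR (- _ / 2)).
  rewrite expr2 mulr_suml; apply: eq_bigr => i _; rewrite mulr_sumr.
  by apply: eq_bigr => j _; ring.
- by move=> a; under eq_Rintegral do rewrite E; rewrite normal_char_sin.
Qed.

Lemma gv_eq (I : finType) d (T : measurableType d) (P : probability T R)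
   (X X' : I -> T -> R) (S S' : I -> I -> R) :
  (forall i w, X i w = X' i w) -> (forall i j, S i j = S' i j) ->
  gauss_vec P X S -> gauss_vec P X' S'.
Proof.
move=> XE SE; have -> : X' = X by apply/funext => i; apply/funext => w.
by have -> : S' = S by apply/funext => i; apply/funext => w.
Qed.

Definition rank1_sum (I : finType) (bs : seq (I -> R)) (i j : I) := \sum_(b <- bs) b i * b j.

Definition psd (I : finType) (S : I -> I -> R) :=
  (forall i j, S i j = S j i) /\ (forall a, 0 <= qform S a).

(** One standard normal factor of a product space for each rank-one term; the empty sum is the null
    vector on the line. *)
Lemma gv_rank1_sum (I : finType) (bs : seq (I -> R)) :
  exists (d : measure_display) (T : measurableType d) (P : probability T R) (X : I -> T -> R),
    gauss_vec P X (rank1_sum bs).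
Proof.
elim: bs => [|b bs [d [T [P [X gX]]]]].
  exists _, (measurableTypeR R), (normal_prob 0 1), (fun i x => 0 * x).
  apply: (gv_eq _ _ (gv_rank1 (fun=> 0))) => // i j.
  by rewrite /rank1_sum big_nil mul0r.
exists _, _, (pprod P (normal_prob 0 1 : probability (measurableTypeR R) R)),
  (fun i z => X i z.1 + b i * z.2).
apply: (gv_eq _ _ (gv_indep gX (gv_rank1 b))) => // i j.
by rewrite /rank1_sum big_cons addrC.
Qed.

End GaussianVectors.

(** * Factorization of positive semidefinite matrices *)

Section PsdFactorization.
Context {R : realType} (I : finType).
Implicit Types S : I -> I -> R.

Definition bform S (a c : I -> R) := \sum_i \sum_j a i * c j * S i j.

Lemma bform_sym S a c : (forall i j, S i j = S j i) -> bform S a c = bform S c a.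
Proof.
move=> sS; rewrite /bform exchange_big/=; apply: eq_bigr => i _; apply: eq_bigr => j _.
by rewrite sS (mulrC (a j)).
Qed.

Lemma qformD S a c t : (forall i j, S i j = S j i) ->
  qform S (fun i => a i + t * c i) =
  qform S a + 2 * t * bform S a c + t ^+ 2 * qform S c.
Proof.
move=> sS.
have -> : 2 * t * bform S a c = t * bform S a c + t * bform S c a.
  by rewrite (bform_sym c a sS); ring.
rewrite /qform /bform !mulr_sumr -!big_split/=; apply: eq_bigr => i _.
rewrite !mulr_sumr -!big_split/=; apply: eq_bigr => j _; ring.
Qed.

Lemma bform_delta S a i0 : bform S a (fun i => (i == i0)%:R) = \sum_i a i * S i i0.
Proof.
apply: eq_bigr => i _; rewrite -[RHS]mul1r.
under eq_bigr do rewrite (mulrC (a i)) -mulrA.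
by rewrite sum_delta mul1r.
Qed.

Lemma qform_delta S i0 : qform S (fun i => (i == i0)%:R) = S i0 i0.
Proof.
have -> : qform S (fun i => (i == i0)%:R) = bform S (fun i => (i == i0)%:R) (fun i => (i == i0)%:R) by [].
by rewrite bform_delta sum_delta.
Qed.

Lemma psd_diag_ge0 S i : psd S -> 0 <= S i i.
Proof. by move=> [_ /(_ (fun j => (j == i)%:R))]; rewrite qform_delta. Qed.

Lemma psd_diag0 S i j : psd S -> S i i = 0 -> S i j = 0.
Proof.
move=> [sS pS] i0; apply/eqP; apply: contraT => ij.
pose a (k : I) : R := (k == j)%:R.
(* With [S i i = 0] the form is affine in the coefficient of the i-th coordinate; this coefficient
   gives it the value -1. *)
have := pS (fun k => a k + (- (S j j + 1) / (2 * S i j)) * (k == i)%:R).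
rewrite qformD// !qform_delta bform_delta i0 mulr0 addr0 /a sum_delta (sS j i).
have -> : 2 * (- (S j j + 1) / (2 * S i j)) * S i j = - (S j j + 1) by field.
by lra.
Qed.

(** The Schur complement, that is the covariance left after conditioning on the combination with
    coefficients [a]. Its value at [c] is the minimum over t of the form of [S] at c + t a. *)
Lemma psd_sub_rank1 S a : psd S -> 0 < qform S a ->
  psd (fun i j => S i j - (\sum_k a k * S k i) * (\sum_k a k * S k j) / qform S a).
Proof.
move=> [sS pS] V0; set u := fun i => \sum_k a k * S k i; set V := qform S a in V0 *.
split=> [i j|c]; first by rewrite sS (mulrC (\sum_k a k * S k i)).
pose t := - (bform S c a) / V.
have := pS (fun i => c i + t * a i); rewrite qformD//.
suff -> : qform (fun i j => S i j - u i * u j / V) c = qform S c - bform S c a ^+ 2 / V.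
  congr (_ <= _); rewrite /t -/V; field; exact: lt0r_neq0.
have -> : bform S c a = \sum_i c i * u i.
  rewrite bform_sym// /bform exchange_big/=; apply: eq_bigr => i _.
  by rewrite /u mulr_sumr; apply: eq_bigr => k _; ring.
rewrite /qform.
under eq_bigr do (under eq_bigr do rewrite mulrBr; rewrite sumrB).
rewrite sumrB; congr (_ - _).
rewrite expr2 mulr_suml mulr_suml; apply: eq_bigr => i _.
rewrite mulr_sumr mulr_suml; apply: eq_bigr => j _; ring.
Qed.

(** Cholesky elimination, by induction on the number of nonzero diagonal entries. A zero diagonal
    entry forces a zero row by [psd_diag0], so degenerate matrices cause no trouble. *)
Lemma psd_factor S : psd S -> exists bs, forall i j, S i j = rank1_sum bs i j.
Proof.
have [n] := ubnP #|[pred i | S i i != 0%R]|.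
elim: n S => // n IH S; rewrite ltnS => cS psdS.
have [sS pS] := psdS.
have [/eqP c0|] := boolP (#|[pred i | S i i != 0%R]| == 0%N).
  exists [::] => i j; rewrite /rank1_sum big_nil; apply: psd_diag0 => //.
  by have := card0_eq c0 i; rewrite inE => /negbFE/eqP.
rewrite -lt0n => /card_gt0P[i0]; rewrite inE => Si0.
set s := S i0 i0 in Si0; have s0 : 0 < s by rewrite lt_neqAle eq_sym Si0 psd_diag_ge0.
pose b j := S j i0 / Num.sqrt s.
pose S' i j := S i j - b i * b j.
have bb i j : b i * b j = S i i0 * S j i0 / s.
  rewrite /b mulrACA -invfM -expr2 sqr_sqrtr//; exact: ltW.
have psd' : psd S'.
  have := @psd_sub_rank1 S (fun i => (i == i0)%:R) psdS; rewrite qform_delta => /(_ s0).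
  congr psd; apply/funext => i; apply/funext => j.
  by rewrite !sum_delta /S' bb !(sS i0).
have lt' : (#|[pred i | S' i i != 0%R]| < n)%N.
  apply: leq_trans cS; apply: proper_card; apply/properP; split.
    apply/fintype.subsetP => i; rewrite !inE; apply: contraNN => /eqP Si.
    have : 0 <= S' i i by exact: psd_diag_ge0.
    rewrite /S' Si sub0r -expr2 oppr_ge0 => h.
    by rewrite oppr_eq0 eq_le h sqr_ge0.
  exists i0; rewrite !inE ?Si0//= /S' bb -/s negbK; apply/eqP; field.
  exact: Si0.
have [bs hbs] := IH S' lt' psd'.
exists (b :: bs) => i j; rewrite /rank1_sum big_cons.
by have := hbs i j; rewrite /S' /rank1_sum => /eqP; rewrite subr_eq addrC => /eqP.
Qed.

Lemma gv_exists S : psd S ->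
  exists (d : measure_display) (T : measurableType d) (P : probability T R) (X : I -> T -> R),
    gauss_vec P X S.
Proof.
move=> /psd_factor[bs hbs]; have [d [T [P [X gX]]]] := gv_rank1_sum bs.
by exists d, T, P, X; apply: (gv_eq _ _ gX).
Qed.

End PsdFactorization.

(** * Translations of the normal law *)

Section GaussianEvents.
Context {R : realType}.
Local Notation N01 := (normal_prob 0 1 : probability (measurableTypeR R) R).

Lemma measurable_gv_event (I : finType) d (T : measurableType d) (X : I -> T -> R)
    (A : I -> set (measurableTypeR R)) :
  (forall i, measurable_fun setT (X i)) -> (forall i, measurable (A i)) ->
  measurable [set w | forall i, A i (X i w)].
Proof.
move=> mX mA.
rewrite (_ : [set w | _] = \big[setI/setT]_(i <- index_enum I) (X i @^-1` A i)).
  apply: bigsetI_measurable => i _; rewrite -[X in measurable X]setTI.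
  exact: (mX i measurableT _ (mA i)).
apply/seteqP; split => w /=.
  by move=> h; rewrite -bigcap_seq => i _; exact: h.
by rewrite -bigcap_seq => h i; apply: h; rewrite /= mem_index_enum.
Qed.

Lemma prob_le d (T : measurableType d) (P : probability T R) (A B : set T) :
  measurable A -> measurable B -> A `<=` B -> (P A <= P B)%E.
Proof. by move=> mA mB AB; rewrite le_measure// inE. Qed.

(** The rescaled image measure [nu] agrees with Lebesgue measure on half-open intervals, hence
    everywhere. *)
Lemma lebesgue_affine (c e : R) (A : set (measurableTypeR R)) : 0 < c -> measurable A ->
  (lebesgue_measure [set x | A (c * x + e)%R] = c^-1%:E * lebesgue_measure A)%E.
Proof.
move=> c0 mA.
have mphi : measurable_fun [set: measurableTypeR R] ((fun x => c * x + e) : R -> measurableTypeR R).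
  by apply: measurable_funD => //; exact: measurable_funM.
pose nu : {measure set (measurableTypeR R) -> \bar R} :=
  mscale (NngNum (ltW c0)) (pushforward lebesgue_measure (fun x : R => c * x + e : measurableTypeR R)).
have nuE : nu mphi A = lebesgue_measure A.
  apply/esym/lebesgue_measure_unique => // _ [[a b]] _ <-.
  rewrite /nu /= /mscale /= /pushforward.
  have -> : (fun x : R => c * x + e) @^-1` `]a, b] = `](a - e) / c, (b - e) / c]%classic.
    apply/seteqP; split => x; rewrite /= !in_itv/= ltr_pdivrMr// ler_pdivlMr// ltrBlDr lerBrDr (mulrC x)//.
  rewrite !lebesgue_measure_itv /= !lte_fin ltr_pM2r ?invr_gt0// ltrD2r.
  case: ifPn => ab; last by rewrite mule0.
  rewrite -!EFinB -EFinM; congr EFin; field; exact: lt0r_neq0.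
by rewrite -nuE /nu /= /mscale /= muleA -EFinM mulVf ?gt_eqF// mul1e.
Qed.

Lemma normal_shiftE (s : R) (A : set (measurableTypeR R)) : measurable A ->
  measurable [set x : measurableTypeR R | A (x + s)] /\
  N01 A = (\int[lebesgue_measure]_(x in [set x | A (x + s)%R]) (normal_pdf 0 1 (x + s))%:E)%E.
Proof.
move=> mA.
have mphi : measurable_fun [set: measurableTypeR R] ((fun x => x + s) : R -> measurableTypeR R).
  exact: measurable_funD.
have mp := @measurable_normal_pdf R 0 1.
split; first by have := mphi measurableT _ mA; rewrite setTI.
rewrite /= /normal_prob.
rewrite -(@ge0_integral_pushforward _ _ (measurableTypeR R) (measurableTypeR R) R _ mphi lebesgue_measure A (fun y => (normal_pdf 0 1 y)%:E))//; first last.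
- by move=> y _; rewrite lee_fin normal_pdf_ge0.
- by apply/measurable_EFinP; exact: measurable_funTS.
apply: eq_measure_integral => B mB' _.
rewrite /pushforward.
have := @lebesgue_affine 1 s B ltr01 mB'.
rewrite invr1 => h; transitivity (lebesgue_measure [set x | B (1 * x + s)%R]); first by rewrite h mul1e.
congr (lebesgue_measure _).
by apply/seteqP; split => x; rewrite /= mul1r.
Qed.

(* Restricting the standard normal law to a half-line before the shift bounds the density factor by 1. *)
Lemma normal_shift (s : R) (A : set (measurableTypeR R)) : 0 <= s -> measurable A ->
  ((expR (- s ^+ 2 / 2))%:E * N01 [set x | (A (x + s) /\ x <= 0)%R] <= N01 A)%E.
Proof.
move=> s0 mA; have [mA' ->] := normal_shiftE s mA.
have mphi : measurable_fun [set: measurableTypeR R] ((fun x => x + s) : R -> measurableTypeR R).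
  exact: measurable_funD.
have mp := @measurable_normal_pdf R 0 1.
have mB : measurable [set x : measurableTypeR R | A (x + s) /\ x <= 0].
  apply: measurableI => //.
  by have := @measurable_itv R `]-oo, 0]; congr measurable; apply/seteqP; split => x; rewrite /= in_itv.
rewrite /= /normal_prob -ge0_integralZl//; first last.
- by move=> x _; rewrite lee_fin normal_pdf_ge0.
- by apply/measurable_EFinP; exact: measurable_funTS.
apply: (@le_trans _ _ (\int[lebesgue_measure]_(x in [set x | A (x + s)%R /\ (x <= 0)%R]) (normal_pdf 0 1 (x + s))%:E)%E); last first.
  apply: ge0_subset_integral => //.
  - by apply/measurable_EFinP; apply: measurable_funTS; exact: (measurableT_comp mp mphi).
  - by move=> x _; rewrite lee_fin normal_pdf_ge0.
  - by move=> x [].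
apply: ge0_le_integral => //.
- by move=> x _; rewrite -EFinM lee_fin mulr_ge0 ?expR_ge0 ?normal_pdf_ge0.
- apply/measurable_EFinP; apply: measurable_funM => //; exact: measurable_funTS.
- by apply/measurable_EFinP; apply: measurable_funTS; exact: (measurableT_comp mp mphi).
- move=> x [_ x0]; rewrite -EFinM lee_fin !normal_pdfE// mulrCA ler_wpM2l ?normal_peak_ge0//.
  rewrite /normal_fun -expRD ler_expR !subr0 !expr1n; nra.
Qed.

(** For x >= 0 the density at x + s is at most e^(-s^2/2) times the density at x. *)
Lemma normal_tail_shift (s : R) : 0 <= s ->
  (N01 [set x | (s <= x)%R] <= (expR (- s ^+ 2 / 2))%:E * N01 [set x | (0 <= x)%R])%E.
Proof.
move=> s0.
have mI (r : R) : measurable [set x : measurableTypeR R | r <= x].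
  by have := @measurable_itv R `[r, +oo[; congr measurable; apply/seteqP; split => x; rewrite /= in_itv/= andbT.
have [mA' ->] := normal_shiftE s (mI s).
have mphi : measurable_fun [set: measurableTypeR R] ((fun x => x + s) : R -> measurableTypeR R).
  exact: measurable_funD.
have mp := @measurable_normal_pdf R 0 1.
have -> : [set x : measurableTypeR R | s <= x + s] = [set x | 0 <= x].
  by apply/seteqP; split => x /=; lra.
rewrite /= /normal_prob -ge0_integralZl//; first last.
- by move=> x _; rewrite lee_fin normal_pdf_ge0.
- by apply/measurable_EFinP; exact: measurable_funTS.
apply: ge0_le_integral => //.
- by move=> x _; rewrite lee_fin normal_pdf_ge0.
- by apply/measurable_EFinP; apply: measurable_funTS; exact: (measurableT_comp mp mphi).
- apply/measurable_EFinP; apply: measurable_funM => //; exact: measurable_funTS.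
- move=> x /= x0; rewrite -EFinM lee_fin !normal_pdfE// mulrCA ler_wpM2l ?normal_peak_ge0//.
  rewrite /normal_fun -expRD ler_expR !subr0 !expr1n; nra.
Qed.

End GaussianEvents.

Section EventTools.
Context {R : realType}.

Lemma pprod_le d1 d2 (T1 : measurableType d1) (T2 : measurableType d2)
    (P : probability T1 R) (Q : probability T2 R) (A B : set (T1 * T2)) (c : R) :
  0 <= c -> measurable A -> measurable B ->
  (forall x, c%:E * Q [set y | A (x, y)] <= Q [set y | B (x, y)])%E ->
  (c%:E * pprod P Q A <= pprod P Q B)%E.
Proof.
move=> c0 mA mB h; rewrite !pprodE// -ge0_integralZl//; last first.
  exact: (measurable_sectionP Q mA).2.
apply: ge0_le_integral => //.
- by move=> x _; rewrite mule_ge0// lee_fin.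
- by apply: measurable_funeM; exact: (measurable_sectionP Q mA).2.
- exact: (measurable_sectionP Q mB).2.
Qed.

Lemma measurable_abs_le (g : bool) (l : R) :
  measurable ([set x | g -> `|x| <= l] : set (measurableTypeR R)).
Proof.
case: g; last first.
  by rewrite (_ : [set x | _] = setT)//; apply/seteqP; split.
have := @measurable_itv R `[- l, l]; congr measurable.
by apply/seteqP; split => x; rewrite /= in_itv/= -ler_norml; [move=> ->|exact].
Qed.

Lemma measurable_ge (g : bool) (l : R) :
  measurable ([set x | g -> l <= x] : set (measurableTypeR R)).
Proof.
case: g; last first.
  by rewrite (_ : [set x | _] = setT)//; apply/seteqP; split.
have := @measurable_itv R `[l, +oo[; congr measurable.
by apply/seteqP; split => x; rewrite /= in_itv/= andbT; [move=> ->|exact].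
Qed.

Lemma measurable_le (g : bool) (l : R) :
  measurable ([set x | g -> x <= l] : set (measurableTypeR R)).
Proof.
case: g; last first.
  by rewrite (_ : [set x | _] = setT)//; apply/seteqP; split.
have := @measurable_itv R `]-oo, l]; congr measurable.
by apply/seteqP; split => x; rewrite /= in_itv/=; [move=> ->|exact].
Qed.

Lemma gv_neg (I : finType) d (T : measurableType d) (P : probability T R)
    X (S : I -> I -> R) : gauss_vec P X S -> gauss_vec P (fun i w => - X i w) S.
Proof.
move=> [m c s].
have E (a : I -> R) w : \sum_i a i * (- X i w) = - \sum_i a i * X i w.
  by rewrite -sumrN; apply: eq_bigr => i _; rewrite mulrN.
split.
- by move=> i; exact: measurableT_comp.
- by move=> a; under eq_Rintegral do rewrite E cosN; exact: c.
- move=> a; under eq_Rintegral do rewrite E sinN -mulN1r.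
  rewrite RintegralZl ?s ?mulr0//.
  by apply: Rint_sin; apply: measurable_sum => i; apply: measurable_funM.
Qed.

Lemma gv_reindex (I J : finType) d (T : measurableType d) (P : probability T R)
    X (S : I -> I -> R) (f : J -> I) : gauss_vec P X S ->
  gauss_vec P (fun j => X (f j)) (fun j k => S (f j) (f k)).
Proof.
move=> /(gv_lin (fun j i => (i == f j)%:R)); apply: gv_eq.
  by move=> j w; rewrite sum_delta.
move=> j k; under eq_bigr => i _ do (under eq_bigr do rewrite -mulrA; rewrite -mulr_sumr sum_delta).
by rewrite sum_delta.
Qed.

End EventTools.

(** * The Cameron-Martin lower bound *)

Section CameronMartin.
Context {R : realType} (I : finType).
Local Notation N01 := (normal_prob 0 1 : probability (measurableTypeR R) R).

(** In law the vector is Z + b xi, with Z of covariance the Schur complement and xi standard normal,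
    where b = S a / sqrt V. Translating xi by l sqrt V adds l S a, which is at least l on [G], and
    only a one-dimensional translation is paid for. The factor 1/2 comes from the restriction xi <=
    0 in [normal_shift]. *)
Lemma cameron_martin d (T : measurableType d) (P : probability T R) X (S : I -> I -> R)
    (a : I -> R) (G : pred I) (l : R) : gauss_vec P X S -> psd S ->
  0 < qform S a -> 0 <= l -> (forall i, G i -> 1 <= \sum_j a j * S j i) ->
  ((2^-1 * expR (- (l ^+ 2 * qform S a) / 2))%:E *
     P [set w | forall i, (G i -> `|X i w| <= l)%R] <=
   P [set w | forall i, (G i -> 0 <= X i w)%R])%E.
Proof.
move=> gX psdS V0 l0 Gu.
set V := qform S a in V0 *; pose u i := \sum_j a j * S j i.
pose q := Num.sqrt V; have q0 : 0 < q by rewrite sqrtr_gt0.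
pose b i := u i / q.
have [d' [T' [Q [Z gZ]]]] := gv_exists (psd_sub_rank1 psdS V0).
(* [None] stands for xi itself: the constraint on the vector and the sign of xi have to be described
   jointly for the symmetry argument below. *)
pose Zo (o : option I) := if o is Some i then Z i else fun=> 0.
pose bo (o : option I) := if o is Some i then b i else 1.
have [So gZo] : exists So, gauss_vec Q Zo So.
  have gl := gv_lin (fun (o : option I) i => if o is Some k then (i == k)%:R else 0) gZ.
  eexists; apply: (gv_eq _ _ gl) => [[k|] w|i j]; last by [].
  - by rewrite /= sum_delta.
  - by rewrite /= big1// => i _; rewrite mul0r.
pose Yo o (z : T' * measurableTypeR R) := Zo o z.1 + bo o * z.2.
have gYo : gauss_vec (pprod Q N01) Yo (fun o o' => So o o' + bo o * bo o').
  exact: (gv_indep gZo (gv_rank1 bo)).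
pose Y i (z : T' * measurableTypeR R) := Z i z.1 + b i * z.2.
have gY : gauss_vec (pprod Q N01) Y S.
  apply: (gv_eq _ _ (gv_indep gZ (gv_rank1 b))) => // i j.
  rewrite /b mulrACA -invfM -expr2 sqr_sqrtr ?ltW// -/(u i) -/(u j) -/V.
  by rewrite subrK.
have mo o : measurable_fun setT (Yo o) by have [] := gYo.
have mA o : measurable ([set x | if o is Some i then G i -> `|x| <= l else x <= 0] : set (measurableTypeR R)).
  case: o => [i|]; first exact: measurable_abs_le.
  by have := @measurable_le R true 0; congr measurable; apply/seteqP; split => x /=; [exact|move=> + _].
rewrite (gv_event gX gY (fun i => measurable_abs_le (G i) l)).
rewrite (gv_event gX gY (fun i => measurable_ge (G i) 0)).
set E := [set w | _]; set F := [set w | forall i, G i -> 0 <= _].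
have mY i : measurable_fun setT (Y i) by have [] := gY.
have mE : measurable E by exact: (measurable_gv_event mY (fun i => measurable_abs_le (G i) l)).
have mF : measurable F by exact: (measurable_gv_event mY (fun i => measurable_ge (G i) 0)).
pose E1 := [set z | forall o, [set x | if o is Some i then G i -> `|x| <= l else x <= 0] (Yo o z)].
pose E2 := [set z | forall o, [set x | if o is Some i then G i -> `|x| <= l else x <= 0] (- Yo o z)].
have mE1 : measurable E1 by exact: measurable_gv_event mo mA.
have mE2 : measurable E2.
  apply: (measurable_gv_event _ mA) => o; exact: measurableT_comp.
have E12 : pprod Q N01 E1 = pprod Q N01 E2 by exact: (gv_event gYo (gv_neg gYo) mA).
(* [E] is invariant under a global change of sign, which exchanges the two signs of xi; hence at
   least half of its mass has xi <= 0. *)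
have EE : (pprod Q N01 E <= 2%:E * pprod Q N01 E1)%E.
  apply: (@le_trans _ _ (pprod Q N01 (E1 `|` E2))).
    apply: (prob_le _ mE (measurableU _ _ mE1 mE2)).
    move=> z Ez; have [z0|z0] := lerP z.2 0; [left|right].
      by move=> [i|] /=; [exact: Ez|rewrite /Yo /= add0r mul1r].
    by move=> [i|] /=; [rewrite normrN; exact: Ez|rewrite /Yo /= add0r mul1r oppr_le0 ltW].
  apply: (le_trans (measureU2 (pprod Q N01) mE1 mE2)).
  rewrite mule_natl mule2n; apply: leeD; first exact: lexx.
  by rewrite le_eqVlt; apply/orP; left; apply/eqP; exact: (esym E12).
have key : ((expR (- (l * q) ^+ 2 / 2))%:E * pprod Q N01 E1 <= pprod Q N01 F)%E.
  apply: (@pprod_le R _ _ _ _ Q N01 E1 F _ (expR_ge0 _) mE1 mF) => z.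
  apply: le_trans (normal_shift (mulr_ge0 l0 (ltW q0)) _); last exact: (measurable_sectionP N01 mF).1.
  apply: lee_wpmul2l; first by rewrite lee_fin expR_ge0.
  apply: (@prob_le _ _ _ N01).
  - exact: (measurable_sectionP N01 mE1).1.
  - have mS := (measurable_sectionP N01 mF).1 z.
    apply: measurableI.
      have mphi : measurable_fun [set: measurableTypeR R] ((fun x => x + l * q) : R -> measurableTypeR R).
        exact: measurable_funD.
      by have := mphi measurableT _ mS; rewrite setTI.
    by have := @measurable_itv R `]-oo, 0]; congr measurable; apply/seteqP; split => x; rewrite /= in_itv.
  - move=> x Ex; split; last by have := Ex None; rewrite /Yo /= add0r mul1r.
    move=> i Gi /=; have := Ex (Some i) Gi; rewrite /Yo /Y /= ler_norml => /andP[h _].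
    rewrite mulrDr addrA.
    have -> : b i * (l * q) = l * u i by rewrite /b; field; exact: lt0r_neq0.
    have := Gu i Gi; rewrite -/(u i) => ui.
    have : l * 1 <= l * u i by exact: ler_wpM2l.
    lra.
move: (pprod Q N01 F) (pprod Q N01 E) (pprod Q N01 E1) EE key => pF pE pE1; clear - V0 q0 => EE key.
have -> : l ^+ 2 * V = (l * q) ^+ 2 by rewrite exprMn sqr_sqrtr// ltW.
apply: le_trans key; rewrite EFinM -muleA muleCA lee_wpmul2l ?lee_fin ?expR_ge0//.
apply: (@le_trans _ _ (2^-1%:E * (2%:E * pE1))%E).
  by rewrite lee_wpmul2l// lee_fin.
by rewrite muleA -EFinM mulVf// mul1e.
Qed.

End CameronMartin.

(** * Log-concavity: the inequalities of Anderson and Sidak *)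

Section BrunnMinkowski.
Context {R : realType}.
Local Notation leb := (@lebesgue_measure R).
Local Notation RM := (measurableTypeR R).

(** Almost all the mass lies to the left of some point belonging to the set. Points near the
    supremum serve this purpose, whether or not the supremum is attained, because a single point is
    null. *)
Lemma leb_ray_sup (S : set RM) (k : R) : measurable S -> S !=set0 -> (k%:E < leb S)%E ->
  exists2 a : R, S a & (k%:E < leb (S `&` [set x | (x < a)%R]))%E.
Proof.
move=> mS [y Sy] kS.
have [k0|k0] := ltP k 0.
  by exists y => //; apply: (@lt_le_trans _ _ 0%E); rewrite ?lte_fin.
have mray (a : R) : measurable ([set x | (x < a)%R] : set RM).
  by have := @measurable_itv R `]-oo, a[; congr measurable; apply/seteqP; split => x; rewrite /= in_itv.
have mSr a : measurable (S `&` [set x | (x < a)%R] : set RM) by exact: measurableI.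
have aux (u : R^nat) : nondecreasing_seq u ->
    (k%:E < leb (\bigcup_n (S `&` [set x | (x < u n)%R])))%E ->
    exists n, (k%:E < leb (S `&` [set x | (x < u n)%R]))%E.
  move=> ndu kU; apply: contrapT => /forallNP h.
  have cv : leb (S `&` [set x | (x < u n)%R]) @[n --> \oo] --> leb (\bigcup_n (S `&` [set x | (x < u n)%R])).
    apply: (@nondecreasing_cvg_mu _ _ _ leb) => //.
      by apply: bigcup_measurable => n _; exact: mSr.
    move=> m n mn; apply/subsetPset; apply: setIS => x /= /lt_le_trans; apply; exact: ndu.
  move: kU; rewrite ltNge => /negP; apply.
  rewrite -(cvg_lim _ cv)//; apply: lime_le; first by apply/cvg_ex; eexists; exact: cv.
  by apply: nearW => n; rewrite leNgt; apply/negP; exact: h.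
have [n kn] : exists n, (k%:E < leb (S `&` [set x | (x < n%:R)%R]))%E.
  apply: (aux (fun n => n%:R)).
    by move=> m n mn; rewrite ler_nat.
  rewrite -setI_bigcupr (_ : \bigcup_n _ = setT) ?setIT//.
  apply/seteqP; split => // x _; have [n _ /(_ n (leqnn n)) xn] := nbhs_infty_gtr x.
  by exists n.
(* The set may be unbounded above; truncating first, at a small loss of mass, gives a finite
   supremum. *)
pose Sn := S `&` [set x | (x < n%:R)%R].
have Sn0 : Sn !=set0.
  apply/set0P; apply/negP => /eqP e; move: kn; rewrite -/Sn e measure0 lte_fin => h.
  by move: k0; rewrite leNgt h.
have hs : has_sup Sn by split=> //; exists n%:R => x [_ /=] /ltW.
pose sg := sup Sn.
have Sle x : Sn x -> x <= sg by move=> h; exact: ub_le_sup hs.2 _ h.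
have k1 : (k%:E < leb (\bigcup_m (S `&` [set x | (x < sg - m.+1%:R^-1)%R])))%E.
  rewrite -setI_bigcupr.
  have -> : \bigcup_m [set x | (x < sg - m.+1%:R^-1)%R] = [set x | (x < sg)%R].
    apply/seteqP; split => x /=; first by move=> [m _ /=] /lt_trans; apply; rewrite ltrBlDr ltrDl invr_gt0.
    move=> xs; have d0 : 0 < sg - x by rewrite subr_gt0.
    have [m hm] := ltr_add_invr d0; exists m => //=.
    by move: hm; rewrite add0r => hm; rewrite ltrBrDl -ltrBrDr.
  apply: (lt_le_trans kn).
  apply: (@le_trans _ _ (leb ((S `&` [set x | (x < sg)%R]) `|` [set sg]))).
    apply: le_measure; rewrite ?inE//.
      by apply: measurableU; [exact: mSr|exact: measurable_set1].
    move=> x Snx; have := Sle x Snx; rewrite le_eqVlt => /predU1P[->|xs]; first by right.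
    by left; split => //; case: Snx.
  apply: (le_trans (measureU2 _ (mSr _) (measurable_set1 _))).
  by rewrite [X in (_ + X)%E](_ : _ = 0%E) ?adde0//; exact: lebesgue_measure_set1.
have [|m km] := aux (fun m => sg - m.+1%:R^-1) _ k1; last first.
  have [|a Sna sa] := @sup_adherent _ Sn m.+1%:R^-1 _ hs; first by rewrite invr_gt0.
  exists a; first by case: Sna.
  apply: (lt_le_trans km); apply: le_measure; rewrite ?inE//.
  by apply: setIS => x /= /lt_trans; apply.
move=> i j ij; rewrite lerB// lef_pV2 ?posrE// ler_nat//.
Qed.

Lemma leb_ray_inf (S : set RM) (k : R) : measurable S -> S !=set0 -> (k%:E < leb S)%E ->
  exists2 a : R, S a & (k%:E < leb (S `&` [set x | (a < x)%R]))%E.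
Proof.
move=> mS [y Sy] kS.
have mop : measurable_fun [set: RM] ((fun x => - x) : R -> RM) by exact: measurable_funN.
have mN : measurable ([set x | S (- x)%R] : set RM).
  by have := mop measurableT _ mS; rewrite setTI.
have e1 : leb [set x | S (- x)%R] = leb S by exact: lebesgue_measureN.
have [||a Sa ka] := @leb_ray_sup [set x | S (- x)%R] k mN; [by exists (- y); rewrite /= opprK|by rewrite e1|].
exists (- a) => //; apply: (lt_le_trans ka).
have mray : measurable ([set x | (- a < x)%R] : set RM).
  by have := @measurable_itv R `]- a, +oo[; congr measurable; apply/seteqP; split => x; rewrite /= in_itv/= andbT.
rewrite -[leRHS]lebesgue_measureN; last exact: measurableI.
rewrite le_eqVlt; apply/orP; left; apply/eqP; rewrite /pushforward; congr (leb _).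
by apply/seteqP; split => x /=; rewrite ltrN2.
Qed.

Let affine_left (t x b : R) : 1 - t != 0 ->
  (1 - t) * ((1 - t)^-1 * x - t * b / (1 - t)) + t * b = x.
Proof. by move=> h; field. Qed.

Let affine_right (t x a : R) : t != 0 ->
  (1 - t) * a + t * (t^-1 * x - (1 - t) * a / t) = x.
Proof. by move=> h; field. Qed.

(** The point z = (1 - t) a + t b separates the two pieces of W built from points a of S and b of T.
    With a near the right end of S and b near the left end of T, these pieces carry almost all the
    measure. *)
Lemma brunn_minkowski (S T W : set RM) (t : R) : 0 < t < 1 ->
  measurable S -> measurable T -> measurable W ->
  S !=set0 -> T !=set0 -> (leb S < +oo)%E -> (leb T < +oo)%E ->
  (forall x y, S x -> T y -> W ((1 - t) * x + t * y)) ->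
  ((1 - t)%:E * leb S + t%:E * leb T <= leb W)%E.
Proof.
move=> /andP[t0 t1] mS mT mW S0 T0 Soo Too STW.
have t1' : 0 < 1 - t by rewrite subr_gt0.
(* A translate of the left part of [S] and one of the right part of [T] are disjoint subsets of [W]. *)
have key a b : S a -> T b ->
  ((1 - t)%:E * leb (S `&` [set x | (x < a)%R]) + t%:E * leb (T `&` [set x | (b < x)%R]) <= leb W)%E.
  move=> Sa Tb.
  pose z := (1 - t) * a + t * b.
  have mr1 : measurable ([set x | (x < a)%R] : set RM).
    by have := @measurable_itv R `]-oo, a[; congr measurable; apply/seteqP; split => x; rewrite /= in_itv.
  have mr2 : measurable ([set x | (b < x)%R] : set RM).
    by have := @measurable_itv R `]b, +oo[; congr measurable; apply/seteqP; split => x; rewrite /= in_itv/= andbT.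
  have mS1 : measurable (S `&` [set x | (x < a)%R] : set RM) by exact: measurableI.
  have mT1 : measurable (T `&` [set x | (b < x)%R] : set RM) by exact: measurableI.
  have h1 := @lebesgue_affine R (1 - t)^-1 (- (t * b / (1 - t))) _ _ mS1.
  have h2 := @lebesgue_affine R t^-1 (- ((1 - t) * a / t)) _ _ mT1.
  rewrite !invr_gt0 !invrK in h1 h2.
  rewrite -h1// -h2//.
  have maff (c e : R) (A : set RM) : measurable A -> measurable ([set x | A (c * x + e)] : set RM).
    move=> mA; have mphi : measurable_fun [set: RM] ((fun x => c * x + e) : R -> RM).
      by apply: measurable_funD => //; exact: measurable_funM.
    by have := mphi measurableT _ mA; rewrite setTI.
  rewrite -measureU//; last 3 first.
  - exact: maff.
  - exact: maff.
  - apply/seteqP; split => // x /= [[_ xa] [_ xb]].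
    rewrite (mulrC _ x) -mulrBl ltr_pdivrMr// in xa.
    rewrite (mulrC _ x) -mulrBl ltr_pdivlMr// in xb.
    clear -xa xb; lra.
  have mU := measurableU _ _ (maff (1 - t)^-1 (- (t * b / (1 - t))) _ mS1) (maff t^-1 (- ((1 - t) * a / t)) _ mT1).
  apply: le_measure; [by rewrite inE|by rewrite inE|].
  move=> x [[Sx _]|[Tx _]].
  - by have := STW _ _ Sx Tb; rewrite affine_left ?(lt0r_neq0 t1').
  - by have := STW _ _ Sa Tx; rewrite affine_right ?(lt0r_neq0 t0).
have [Woo|Woo] := leP +oo%E (leb W); first by rewrite (le_trans _ Woo)// leey.
have fin (A : set RM) : (leb A < +oo)%E -> leb A = (fine (leb A))%:E.
  by move=> h; rewrite fineK// ge0_fin_numE.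
move: (fin _ Soo) (fin _ Too) (fin _ Woo).
set s := fine (leb S); set u := fine (leb T); set w := fine (leb W) => Se Te We.
rewrite Se Te We -!EFinM -EFinD lee_fin leNgt; apply/negP => lt_w.
(* Half of the supposed defect: losing e in each of the two sets still contradicts the measure of
   W. *)
pose e := ((1 - t) * s + t * u - w) / 2.
have e0 : 0 < e by rewrite divr_gt0// subr_gt0.
have [a Sa ka] : exists2 a : R, S a & ((s - e)%:E < leb (S `&` [set x | (x < a)%R]))%E.
  by apply: leb_ray_sup => //; rewrite Se lte_fin ltrBlDr ltrDl.
have [b Tb kb] : exists2 b : R, T b & ((u - e)%:E < leb (T `&` [set x | (b < x)%R]))%E.
  by apply: leb_ray_inf => //; rewrite Te lte_fin ltrBlDr ltrDl.
have := key a b Sa Tb; rewrite We => h.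
have : (((1 - t) * (s - e) + t * (u - e))%:E <= w%:E)%E.
  apply: le_trans h; rewrite EFinD !EFinM; apply: leeD.
    by apply: lee_wpmul2l; [rewrite lee_fin ltW|exact: ltW].
  by apply: lee_wpmul2l; [rewrite lee_fin ltW|exact: ltW].
rewrite lee_fin.
have -> : (1 - t) * (s - e) + t * (u - e) = w + e by rewrite /e; field.
by rewrite gerDl leNgt e0.
Qed.

End BrunnMinkowski.

(** * The one-dimensional Prekopa-Leindler inequality *)

Section PrekopaLeindler.
Context {R : realType}.
Local Notation leb := (@lebesgue_measure R).
Local Notation RM := (measurableTypeR R).

Lemma measurable_superlevel (f : RM -> R) (l : R) : measurable_fun setT f ->
  measurable [set x : RM | 0 < l < f x].
Proof.
move=> mf; have [l0|l0] := boolP (0 < l); last first.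
  by rewrite (_ : [set x : RM | false && (l < f x)] = set0)//; apply/seteqP; split.
have := mf measurableT _ (@measurable_itv R `]l, +oo[); rewrite setTI; congr measurable.
by apply/seteqP; split => x; rewrite /= in_itv/= andbT.
Qed.

(** Tonelli's theorem for the region under the graph. The condition 0 < l inside the superlevel set
    allows the level to range over the whole line. *)
Lemma layer_cake (f : RM -> R) : measurable_fun setT f -> (forall x, 0 <= f x) ->
  measurable_fun setT (fun l : RM => leb [set x | 0 < l < f x]) /\
  (\int[leb]_x (f x)%:E = \int[leb]_l leb [set x | (0 < l < f x)%R])%E.
Proof.
move=> mf f0.
pose A : set (RM * RM) := [set z | 0 < z.2 < f z.1].
have mA : measurable A.
  have -> : A = ((fun z => z.2) @^-1` `]0, +oo[) `&` ((fun z => f z.1 - z.2) @^-1` `]0, +oo[).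
    by apply/seteqP; split => z; rewrite /A /= !in_itv/= !andbT subr_gt0; [move=> /andP|move=> [-> ->]].
  apply: measurableI; rewrite -[X in measurable X]setTI.
    by apply: (@measurable_snd _ _ RM RM).
  have : measurable_fun [set: RM * RM] (fun z => f z.1 - z.2).
    apply: measurable_funB => //; exact: (measurableT_comp mf measurable_fst).
  by apply.
have sy l : [set x | 0 < l < f x] = ysection A l.
  by apply/seteqP; split => x; rewrite /ysection /= inE.
split.
  by under eq_fun do rewrite sy; exact: measurable_fun_ysection.
under [RHS]eq_integral do rewrite sy.
have := @indic_fubini_tonelli _ _ RM RM R leb leb A mA.
rewrite (@indic_fubini_tonelli_FE _ _ RM RM R leb A mA).
rewrite (_ : fubini_G leb _ = leb \o ysection A); last exact: (@indic_fubini_tonelli_GE _ _ RM RM R leb A mA).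
move=> e; rewrite -[RHS]e.
apply: eq_integral => x _ /=.
have -> : xsection A x = `]0, f x[%classic.
  by apply/seteqP; split => l; rewrite /xsection /= inE /A /= in_itv.
rewrite lebesgue_measure_itv/= lte_fin; case: ltP => [_|h]; first by rewrite oppr0 adde0.
by apply/eqP; rewrite eqe eq_le f0 h.
Qed.

Lemma weighted_am_gm (t c : R) : 0 < t < 1 ->
  1 <= (1 - t) * expR (- (c * t)) + t * expR (c * (1 - t)).
Proof.
move=> /andP[t0 t1].
apply: (@le_trans _ _ ((1 - t) * (1 - c * t) + t * (1 + c * (1 - t)))); first by rewrite le_eqVlt; apply/orP; left; apply/eqP; ring.
apply: lerD; apply: ler_wpM2l.
- by rewrite subr_ge0 ltW.
- exact: expR_ge1Dx.
- exact: ltW.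
- exact: expR_ge1Dx.
Qed.

Section Main.
Variables (t : R) (f g h : RM -> R) (M : R).
Hypotheses (t01 : 0 < t < 1).
Hypotheses (mf : measurable_fun setT f) (mg : measurable_fun setT g) (mh : measurable_fun setT h).
Hypotheses (f0 : forall x, 0 <= f x) (g0 : forall x, 0 <= g x) (h0 : forall x, 0 <= h x).
Hypotheses (fM : forall x, f x <= M) (gM : forall x, g x <= M).
Hypotheses (intf : (\int[leb]_x (f x)%:E < +oo)%E) (intg : (\int[leb]_x (g x)%:E < +oo)%E).
(** For positive values, the choice e^c = f x / g y gives the usual bound of h from below by
    f(x)^(1-t) g(y)^t. *)
Hypothesis fgh : forall (x y c : R),
  Order.min (f x) (g y * expR c) <= h ((1 - t) * x + t * y) * expR (c * t).

Let level_fin (u : RM -> R) l : measurable_fun setT u -> (forall x, 0 <= u x) ->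
  (\int[leb]_x (u x)%:E < +oo)%E -> (leb [set x | (0 < l < u x)%R] < +oo)%E.
Proof.
move=> mu u0 iu; have [l0|l0] := boolP (0 < l); last first.
  by rewrite (_ : [set x | false && (l < u x)%R] = set0) ?measure0//; apply/seteqP; split.
have mL : measurable ([set x | true && (l < u x)] : set RM).
  by have := measurable_superlevel l mu; rewrite l0.
have h1 : (l%:E * leb [set x | true && (l < u x)%R] < +oo)%E.
  rewrite -(integral_cst leb mL); apply: le_lt_trans iu.
  apply: (@le_trans _ _ (\int[leb]_(x in [set x | true && (l < u x)%R]) (u x)%:E)%E).
    apply: ge0_le_integral => //.
    - by move=> x _; rewrite lee_fin ltW.
    - by apply/measurable_EFinP; exact: measurable_funTS.
    - by move=> x /= lx; rewrite lee_fin ltW.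
  by apply: ge0_subset_integral => //; [exact/measurable_EFinP|move=> x _; rewrite lee_fin].
rewrite ltey; apply/negP => /eqP e; move: h1; rewrite e gt0_muley ?lte_fin// ltxx//.
Qed.

(** After a tilt that equalises the suprema of [f] and [g], their superlevel sets are nonempty for
    the same levels. Brunn-Minkowski at each level, integrated by [layer_cake], bounds a weighted
    arithmetic mean of the integrals; [weighted_am_gm] removes the tilt. *)
Lemma prekopa_leindler :
  (Order.min (\int[leb]_x (f x)%:E) (\int[leb]_x (g x)%:E) <= \int[leb]_x (h x)%:E)%E.
Proof.
have /andP[t0 t1] := t01.
have min_case : (\int[leb]_x (f x)%:E = 0 \/ \int[leb]_x (g x)%:E = 0)%E ->
  (Order.min (\int[leb]_x (f x)%:E) (\int[leb]_x (g x)%:E) <= \int[leb]_x (h x)%:E)%E.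
  have ih : (0 <= \int[leb]_x (h x)%:E)%E by apply: integral_ge0 => x _; rewrite lee_fin.
  by case=> ->; rewrite ge_min ih ?orbT.
have [[x0 fx0]|/forallNP nf] := pselect (exists x, 0 < f x); last first.
  apply: min_case; left; apply: integral0_eq => x _; congr EFin.
  by apply/eqP; rewrite eq_le f0 andbT leNgt; apply/negP; exact: nf.
have [[y0 gy0]|/forallNP ng] := pselect (exists x, 0 < g x); last first.
  apply: min_case; right; apply: integral0_eq => x _; congr EFin.
  by apply/eqP; rewrite eq_le g0 andbT leNgt; apply/negP; exact: ng.
have sf : has_sup (range f) by split; [exists (f x0), x0|exists M => _ [x _ <-]].
have sg : has_sup (range g) by split; [exists (g y0), y0|exists M => _ [x _ <-]].
set A := sup (range f); set B := sup (range g).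
have fA x : f x <= A by apply: ub_le_sup; [exact: sf.2|exists x].
have gB x : g x <= B by apply: ub_le_sup; [exact: sg.2|exists x].
have A0 : 0 < A by exact: lt_le_trans (fA x0).
have B0 : 0 < B by exact: lt_le_trans (gB y0).
(* With this tilt g e^c has the same supremum as f. *)
pose c := ln (A / B).
have ec : B * expR c = A by rewrite /c lnK ?posrE ?divr_gt0// mulrC divfK// gt_eqF.
pose g' x := g x * expR c; pose h' x := h x * expR (c * t).
have mg' : measurable_fun setT g' by exact: measurable_funM.
have mh' : measurable_fun setT h' by exact: measurable_funM.
have g'0 x : 0 <= g' x by rewrite mulr_ge0 ?expR_ge0.
have h'0 x : 0 <= h' x by rewrite mulr_ge0 ?expR_ge0.
have int_scale (u : RM -> R) k : measurable_fun setT u -> (forall x, 0 <= u x) ->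
    (\int[leb]_x (u x * expR k)%:E = (expR k)%:E * \int[leb]_x (u x)%:E)%E.
  move=> mu u0; rewrite -(@ge0_integralZl _ RM R leb _ measurableT (fun x => (u x)%:E)) ?lee_fin ?expR_ge0//; [|exact/measurable_EFinP|by move=> x _; rewrite lee_fin].
  by apply: eq_integral => x _; rewrite mulrC EFinM.
have ig' : (\int[leb]_x (g' x)%:E < +oo)%E.
  by rewrite int_scale// lte_mul_pinfty// lee_fin expR_ge0.
have key : ((1 - t)%:E * \int[leb]_x (f x)%:E + t%:E * \int[leb]_x (g' x)%:E <= \int[leb]_x (h' x)%:E)%E.
  have [mLf ->] := layer_cake mf f0.
  have [mLg ->] := layer_cake mg' g'0.
  have [mLh ->] := layer_cake mh' h'0.
  rewrite -(@ge0_integralZl _ RM R leb _ measurableT (fun l : RM => leb [set x | (0 < l < f x)%R])) ?lee_fin ?subr_ge0 ?(ltW t1)//.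
  rewrite -(@ge0_integralZl _ RM R leb _ measurableT (fun l : RM => leb [set x | (0 < l < g' x)%R])) ?lee_fin ?(ltW t0)//.
  rewrite -ge0_integralD//; [|by move=> x _; rewrite mule_ge0// lee_fin subr_ge0 ltW|exact: measurable_funeM|by move=> x _; rewrite mule_ge0// lee_fin ltW|exact: measurable_funeM].
  apply: ge0_le_integral => //.
  - by move=> x _; rewrite adde_ge0// mule_ge0// lee_fin ?subr_ge0 ltW.
  - by apply: emeasurable_funD; exact: measurable_funeM.
  move=> l _.
  have [/andP[l0 lA]|] := boolP (0 < l < A); last first.
    move=> nl.
    have -> : [set x | 0 < l < f x] = set0.
      apply/seteqP; split => // x /= /andP[l0 lf]; move: nl; rewrite l0/= -leNgt => Al.
      by have := fA x; rewrite leNgt (le_lt_trans Al lf).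
    have -> : [set x | 0 < l < g' x] = set0.
      apply/seteqP; split => // x /= /andP[l0 lf]; move: nl; rewrite l0/= -leNgt => Al.
      have : g' x <= A by rewrite -ec ler_wpM2r ?expR_ge0.
      by rewrite leNgt (le_lt_trans Al lf).
    by rewrite measure0 !mule0 adde0.
  apply: brunn_minkowski => //; try exact: measurable_superlevel.
  - have [|_ [x _ <-]] := @sup_adherent _ (range f) (A - l) _ sf.
      by rewrite subr_gt0.
    by rewrite subKr => h1; exists x; rewrite /= l0.
  - have [|_ [x _ <-]] := @sup_adherent _ (range g) (B - l / expR c) _ sg.
      by rewrite subr_gt0 ltr_pdivrMr ?expR_gt0// ec.
    by rewrite subKr ltr_pdivrMr ?expR_gt0// => h1; exists x; rewrite /= l0.
  - exact: level_fin.
  - exact: level_fin.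
  - move=> x y /= /andP[_ lf] /andP[_ lg]; rewrite l0/=.
    apply: lt_le_trans (fgh x y c); by rewrite lt_min lf.
rewrite !int_scale// in key.
have ff : (\int[leb]_x (f x)%:E)%E \is a fin_num by rewrite ge0_fin_numE// integral_ge0// => x _; rewrite lee_fin.
have gf : (\int[leb]_x (g x)%:E)%E \is a fin_num by rewrite ge0_fin_numE// integral_ge0// => x _; rewrite lee_fin.
have : (0 <= \int[leb]_x (f x)%:E)%E by apply: integral_ge0 => x _; rewrite lee_fin.
have : (0 <= \int[leb]_x (g x)%:E)%E by apply: integral_ge0 => x _; rewrite lee_fin.
have : (0 <= \int[leb]_x (h x)%:E)%E by apply: integral_ge0 => x _; rewrite lee_fin.
move: key; rewrite -(fineK ff) -(fineK gf).
move: (fine _) (fine _) => b a; clear -t0 t1 t01.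
case: (\int[leb]_x (h x)%:E)%E => [w| |]; [|by move=> *; rewrite leey|by []].
rewrite -!EFinM -!EFinD -EFin_min !lee_fin => key w0 b0 a0.
(* It says that (1 - t) + t e^c >= e^(c t): the exact factor by which the integral of h was
   tilted. *)
have am := weighted_am_gm c t01.
pose m := Order.min a b.
have m0 : 0 <= m by rewrite le_min a0.
have ma : m <= a by rewrite ge_min lexx.
have mb : m <= b by rewrite ge_min lexx orbT.
rewrite -/m.
have e0 := expR_gt0 (c * t).
have k2 : m * ((1 - t) + t * expR c) <= w * expR (c * t).
  rewrite mulrC (mulrC w); apply: le_trans key.
  rewrite mulrDl -mulrA; apply: lerD.
    by apply: ler_wpM2l => //; rewrite subr_ge0 ltW.
  by apply: ler_wpM2l; [exact: ltW|apply: ler_wpM2l => //; exact: expR_ge0].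
have e1 : ((1 - t) * expR (- (c * t)) + t * expR (c * (1 - t))) * expR (c * t) = (1 - t) + t * expR c.
  by rewrite mulrDl -!mulrA -!expRD addNr expR0 mulr1; congr (_ + _ * expR _); ring.
rewrite -(ler_pM2r e0); apply: le_trans k2; rewrite ler_wpM2l// -e1.
by rewrite -[leLHS]mul1r ler_wpM2r// ltW.
Qed.

End Main.

End PrekopaLeindler.

Section Anderson.
Context {R : realType} (I : finType).
Local Notation leb := (@lebesgue_measure R).
Local Notation RM := (measurableTypeR R).
Local Notation N01 := (normal_prob 0 1 : probability (measurableTypeR R) R).

Record symconv (A : set RM) : Prop := {
  symconv_meas : measurable A ;
  symconv_opp : forall x, A x -> A (- x) ;
  symconv_mid : forall x y t, 0 < t < 1 -> A x -> A y -> A ((1 - t) * x + t * y) }.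

(* Log-concavity, stated as quasi-concavity of all exponential tilts in order to avoid real powers. *)
Definition log_concave (F : (I -> R) -> R) :=
  forall (x y : I -> R) t c, 0 < t < 1 ->
  Order.min (F x) (F y * expR c) <= F (fun i => (1 - t) * x i + t * y i) * expR (c * t).

Definition box_prob d (T : measurableType d) (P : probability T R) (Z : I -> T -> R)
    (A : I -> set RM) (v : I -> R) : R := fine (P [set w | forall i, A i (Z i w + v i)]).

Lemma measurable_shift (A : set RM) (e : R) : measurable A -> measurable ([set x | A (x + e)] : set RM).
Proof.
move=> mA; have mphi : measurable_fun [set: RM] ((fun x => x + e) : R -> RM).
  exact: measurable_funD.
by have := mphi measurableT _ mA; rewrite setTI.
Qed.

Lemma measurable_box d (T : measurableType d) (Z : I -> T -> R) (A : I -> set RM) (v : I -> R) :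
  (forall i, measurable_fun setT (Z i)) -> (forall i, measurable (A i)) ->
  measurable [set w | forall i, A i (Z i w + v i)].
Proof.
move=> mZ mA; have := @measurable_gv_event _ _ _ T Z (fun i => [set x | A i (x + v i)]) mZ.
by apply => i; exact: measurable_shift.
Qed.

Lemma box_probE d (T : measurableType d) (P : probability T R) (Z : I -> T -> R)
    (A : I -> set RM) (v : I -> R) :
  (forall i, measurable_fun setT (Z i)) -> (forall i, measurable (A i)) ->
  P [set w | forall i, A i (Z i w + v i)] = (box_prob P Z A v)%:E.
Proof. by move=> mZ mA; rewrite /box_prob fineK// fin_num_measure//; exact: measurable_box. Qed.

Lemma box_prob_ge0 d (T : measurableType d) (P : probability T R) Z A v : 0 <= box_prob P Z A v.
Proof. by rewrite fine_ge0. Qed.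

Lemma box_prob_le1 d (T : measurableType d) (P : probability T R) (Z : I -> T -> R) A v :
  (forall i, measurable_fun setT (Z i)) -> (forall i, measurable (A i)) ->
  box_prob P Z A v <= 1.
Proof.
by move=> mZ mA; rewrite -lee_fin -box_probE// probability_le1//; exact: measurable_box.
Qed.

(** The ratio of two normal densities is itself an exponential tilt, which shifts [c]. What is left
    over is t (1 - t) (x - y)^2 / 2 >= 0, the log-concavity of the density. *)
Lemma gaussian_tilt (x y t c a f g : R) : 0 < t < 1 -> 0 <= a ->
  Order.min f (g * expR (c - (y ^+ 2 - x ^+ 2) / 2)) <=
    a * expR ((c - (y ^+ 2 - x ^+ 2) / 2) * t) ->
  Order.min (f * normal_pdf 0 1 x) (g * normal_pdf 0 1 y * expR c) <=
  a * normal_pdf 0 1 ((1 - t) * x + t * y) * expR (c * t).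
Proof.
move=> /andP[t0 t1] a0 h.
pose p := normal_pdf (R := R) 0 1.
have pE u v : p v = p u * expR (- ((v ^+ 2 - u ^+ 2) / 2)).
  rewrite /p !normal_pdfE// -mulrA; congr (_ * _).
  rewrite /normal_fun -expRD !subr0 expr1n; congr expR; by field.
rewrite -/(p x) -/(p y) -/(p _) (pE x y).
set s := (1 - t) * x + t * y; rewrite (pE x s).
have p0 : 0 <= p x by exact: normal_pdf_ge0.
have -> : g * (p x * expR (- ((y ^+ 2 - x ^+ 2) / 2))) * expR c =
  g * expR (c - (y ^+ 2 - x ^+ 2) / 2) * p x.
  rewrite expRD; ring.
rewrite -minr_pMl//.
apply: (@le_trans _ _ (a * expR ((c - (y ^+ 2 - x ^+ 2) / 2) * t) * p x)).
  exact: ler_wpM2r.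
have -> : a * (p x * expR (- ((s ^+ 2 - x ^+ 2) / 2))) * expR (c * t) =
   a * p x * (expR (- ((s ^+ 2 - x ^+ 2) / 2)) * expR (c * t)) by ring.
have -> : a * expR ((c - (y ^+ 2 - x ^+ 2) / 2) * t) * p x = a * p x * expR ((c - (y ^+ 2 - x ^+ 2) / 2) * t) by ring.
apply: ler_wpM2l; first exact: mulr_ge0.
rewrite -expRD ler_expR.
have : 0 <= t * (1 - t) * (x - y) ^+ 2 by rewrite mulr_ge0 ?sqr_ge0// mulr_ge0 ?(ltW t0)// subr_ge0 (ltW t1).
have -> : t * (1 - t) * (x - y) ^+ 2 = (1 - t) * x ^+ 2 + t * y ^+ 2 - s ^+ 2 by rewrite /s; ring.
lra.
Qed.

(** Adding rank-one terms one at a time requires integrating out one real variable at each step, so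
    the one-dimensional Prekopa-Leindler inequality is enough. With no term left, the function is
    the indicator of a product of convex sets. *)
Lemma log_concave_box (bs : seq (I -> R)) (A : I -> set RM) : (forall i, symconv (A i)) ->
  exists (d : measure_display) (T : measurableType d) (P : probability T R) (Z : I -> T -> R),
    gauss_vec P Z (rank1_sum bs) /\ log_concave (box_prob P Z A).
Proof.
move=> sA; have mA i : measurable (A i) by have [] := sA i.
elim: bs => [|b bs [d [T [P [Z [gZ lcZ]]]]]].
  exists _, RM, N01, (fun i x => 0 * x); split.
    apply: (gv_eq _ _ (gv_rank1 (fun=> 0))) => // i j.
    by rewrite /rank1_sum big_nil mul0r.
  have bE v : (forall i, A i (v i)) -> box_prob N01 (fun i x => 0 * x) A v = 1.
    move=> h; rewrite /box_prob (_ : [set w | _] = setT) ?probability_setT//.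
    by apply/seteqP; split => // w _ i; rewrite mul0r add0r.
  have bE0 v : ~ (forall i, A i (v i)) -> box_prob N01 (fun i x => 0 * x) A v = 0.
    move=> h; rewrite /box_prob (_ : [set w | _] = set0) ?measure0//.
    by apply/seteqP; split => // w hw; apply: h => i; have := hw i; rewrite mul0r add0r.
  move=> x y t c t01.
  have h0 : 0 <= box_prob N01 (fun i x => 0 * x) A (fun i => (1 - t) * x i + t * y i) * expR (c * t).
    by rewrite mulr_ge0 ?expR_ge0 ?box_prob_ge0.
  have [hx|hx] := pselect (forall i, A i (x i)); last first.
    by rewrite (bE0 x)// ge_min h0.
  have [hy|hy] := pselect (forall i, A i (y i)); last first.
    by rewrite (bE0 y)// mul0r ge_min h0 orbT.
  rewrite !bE//; last by move=> i; apply: symconv_mid => //.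
  rewrite !mul1r ge_min -[X in (X <= _) || _]expR0 !ler_expR.
  have /andP[t0 t1] := t01; have [c0|c0] := leP 0 c.
    by rewrite mulr_ge0// ltW.
  by apply/orP; right; nra.
pose W i (z : RM * T) := b i * z.1 + Z i z.2.
have gW : gauss_vec (pprod N01 P) W (rank1_sum (b :: bs)).
  apply: (gv_eq _ _ (gv_indep (gv_rank1 b) gZ)) => // i j.
  by rewrite /rank1_sum big_cons.
exists _, _, (pprod N01 P), W; split => //.
have mZ i : measurable_fun setT (Z i) by have [] := gZ.
have mW i : measurable_fun setT (W i) by have [] := gW.
pose F := box_prob P Z A; pose p := normal_pdf (R := R) 0 1.
have secE v x : [set y | forall i, A i (W i (x, y) + v i)] =
   [set y | forall i, A i (Z i y + (v i + x * b i))].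
  apply/seteqP; split => y h i; have := h i; rewrite /W/=.
    by congr (A i _); ring.
  by congr (A i _); ring.
have mF v : measurable_fun [set: RM] (fun x => F (fun i => v i + x * b i)).
  apply/measurable_EFinP.
  have := (measurable_sectionP P (measurable_box v mW mA)).2.
  by congr (measurable_fun _ _); apply/funext => x; rewrite /= secE box_probE.
have mp : measurable_fun [set: RM] p by exact: measurable_normal_pdf.
have WE v : (box_prob (pprod N01 P) W A v)%:E =
   (\int[leb]_x (F (fun i => v i + x * b i) * p x)%:E)%E.
  rewrite -box_probE// pprodE; last exact: measurable_box.
  under eq_integral do rewrite secE box_probE//.
  rewrite ge0_integral_normal//.
  - by apply/measurable_EFinP; exact: mF.
  - by move=> x; rewrite lee_fin box_prob_ge0.
move=> u w t c t01.
rewrite -lee_fin EFin_min 2!EFinM !WE.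
have intle (k : R) v : 0 <= k -> ((\int[leb]_x (F (fun i => v i + x * b i) * p x)%:E) * k%:E =
   \int[leb]_x (F (fun i => v i + x * b i) * p x * k)%:E)%E.
  move=> k0; rewrite muleC -ge0_integralZl//.
  - by apply: eq_integral => x _; rewrite -EFinM mulrC.
  - by apply/measurable_EFinP; apply: measurable_funM => //; exact: mF.
  - by move=> x _; rewrite lee_fin mulr_ge0 ?box_prob_ge0 ?normal_pdf_ge0.
rewrite !intle ?expR_ge0//.
have fin v k : 0 <= k -> (\int[leb]_x (F (fun i => v i + x * b i) * p x * k)%:E < +oo)%E.
  move=> k0; apply: (@le_lt_trans _ _ (\int[leb]_x ((p x * k)%:E))%E).
    apply: ge0_le_integral => //.
    - by move=> x _; rewrite lee_fin !mulr_ge0 ?box_prob_ge0 ?normal_pdf_ge0.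
    - apply/measurable_EFinP; apply: measurable_funM => //; apply: measurable_funM => //; exact: mF.
    - by apply/measurable_EFinP; exact: measurable_funM.
    - move=> x _; rewrite lee_fin ler_wpM2r// -[leRHS]mul1r ler_wpM2r ?normal_pdf_ge0//.
      exact: box_prob_le1.
  have -> : (\int[leb]_x (p x * k)%:E = k%:E * \int[leb]_x (p x)%:E)%E.
    rewrite -ge0_integralZl//; [|exact/measurable_EFinP|by move=> x _; rewrite lee_fin normal_pdf_ge0].
    by apply: eq_integral => x _; rewrite mulrC EFinM.
  by rewrite integral_normal_pdf mule1 ltry.
(* The tilt [c] of the conclusion is put into the functions; the tilt [c'] of the inequality adds to
   it, and [gaussian_tilt] reduces the sum to the induction hypothesis. *)
have pl := @prekopa_leindler R t
  (fun x => F (fun i => u i + x * b i) * p x)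
  (fun x => F (fun i => w i + x * b i) * p x * expR c)
  (fun x => F (fun i => ((1 - t) * u i + t * w i) + x * b i) * p x * expR (c * t))
  (Order.max (normal_peak 1) (normal_peak 1 * expR c)) t01.
have pub x : p x <= normal_peak 1 by apply: normal_pdf_ub.
have FpE v x : 0 <= F (fun i => v i + x * b i) * p x <= normal_peak 1.
  rewrite mulr_ge0 ?box_prob_ge0 ?normal_pdf_ge0//=.
  apply: le_trans (pub x); rewrite -[leRHS]mul1r ler_wpM2r ?normal_pdf_ge0//.
  exact: box_prob_le1.
apply: pl.
- by apply: measurable_funM => //; exact: mF.
- by apply: measurable_funM => //; apply: measurable_funM => //; exact: mF.
- by apply: measurable_funM => //; apply: measurable_funM => //; exact: mF.
- by move=> x; have /andP[] := FpE u x.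
- by move=> x; rewrite mulr_ge0 ?expR_ge0//; have /andP[] := FpE w x.
- move=> x; rewrite mulr_ge0 ?expR_ge0//.
  by have /andP[] := FpE (fun i => (1 - t) * u i + t * w i) x.
- by move=> x; rewrite le_max; have /andP[_ ->] := FpE u x.
- by move=> x; rewrite le_max; apply/orP; right; rewrite ler_wpM2r ?expR_ge0//; have /andP[_ ->] := FpE w x.
- by have := fin u 1 ler01; under eq_integral do rewrite mulr1.
- by apply: fin; exact: expR_ge0.
- move=> x y c'; rewrite -mulrA -expRD -[leRHS]mulrA -expRD -mulrDl.
  apply: gaussian_tilt => //; first exact: box_prob_ge0.
  have := lcZ (fun i => u i + x * b i) (fun i => w i + y * b i) t ((c + c') - (y ^+ 2 - x ^+ 2) / 2) t01.
  congr (_ <= _ * _); congr (box_prob P Z A _); apply/funext => i; ring.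
Qed.

(** The probability is log-concave and even in the shift, and k v is a convex combination of v and -
    v with weight t = (1 - k) / 2. Log-concavity is used without tilt. *)
Lemma anderson d (T : measurableType d) (P : probability T R) Z S (A : I -> set RM)
    (v : I -> R) (k : R) : gauss_vec P Z S -> psd S -> (forall i, symconv (A i)) ->
  -1 < k < 1 ->
  (P [set w | forall i, A i (Z i w + v i)%R] <= P [set w | forall i, A i (Z i w + k * v i)%R])%E.
Proof.
move=> gZ pS sA /andP[k1 k2].
have mA i : measurable (A i) by have [] := sA i.
have [bs hbs] := psd_factor pS.
have [d' [T' [P' [Z' [gZ' lc]]]]] := log_concave_box bs sA.
have {}gZ' : gauss_vec P' Z' S by apply: (gv_eq _ _ gZ') => // i j; rewrite hbs.
have mZ' i : measurable_fun setT (Z' i) by have [] := gZ'.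
have E u : P [set w | forall i, A i (Z i w + u i)] = (box_prob P' Z' A u)%:E.
  rewrite -box_probE//.
  exact: (gv_event gZ gZ' (fun i => measurable_shift (u i) (mA i))).
rewrite !E lee_fin.
have ev : box_prob P' Z' A (fun i => - v i) = box_prob P' Z' A v.
  apply: EFin_inj; rewrite -!box_probE//.
  rewrite (gv_event gZ' (gv_neg gZ') (fun i => measurable_shift (- v i) (mA i))).
  congr (P' _); apply/seteqP; split => w h i.
    by have := symconv_opp (sA i) (h i); rewrite opprD !opprK.
  by have := symconv_opp (sA i) (h i); rewrite opprD.
pose t := (1 - k) / 2.
have t01 : 0 < t < 1 by rewrite /t; apply/andP; split; lra.
have := lc v (fun i => - v i) t 0 t01.
rewrite mul0r expR0 !mulr1 ev minxx; congr (_ <= box_prob P' Z' A _).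
by apply/funext => i; rewrite /t; field.
Qed.

Lemma symconv_abs_le (l : R) : symconv [set x : RM | `|x| <= l].
Proof.
split.
- by have := @measurable_abs_le R true l; congr measurable; apply/seteqP; split => x /=; [exact|move=> + _].
- by move=> x /=; rewrite normrN.
- move=> x y t /andP[t0 t1] /= hx hy; apply: (le_trans (ler_normD _ _)).
  rewrite !normrM (gtr0_norm t0) gtr0_norm ?subr_gt0//.
  have := normr_ge0 x; have := normr_ge0 y; nra.
Qed.

(** Write the vector as b xi + Z with xi the normalised coordinate [i0]. The conditional probability
    [phi] of the box given xi decreases with |xi| by [anderson], so it is positively associated with
    the event that |xi| is small. *)
Lemma sidak d (T : measurableType d) (P : probability T R) X S (A : I -> set RM)
    (i0 : I) (s : R) : gauss_vec P X S -> psd S -> (forall i, symconv (A i)) ->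
  0 < S i0 i0 ->
  (P [set w | forall i, A i (X i w)] * P [set w | `|X i0 w| <= s]%R <=
   P [set w | (forall i, A i (X i w)) /\ (`|X i0 w| <= s)%R])%E.
Proof.
move=> gX psdS sA V0.
have mA i : measurable (A i) by have [] := sA i.
have qV : qform S (fun i => (i == i0)%:R) = S i0 i0 by exact: qform_delta.
pose S' i j := S i j - S i0 i * S i0 j / S i0 i0.
have psd' : psd S'.
  have := @psd_sub_rank1 _ _ S (fun i => (i == i0)%:R) psdS; rewrite qV => /(_ V0).
  by congr psd; apply/funext => i; apply/funext => j; rewrite !sum_delta.
have [sS _] := psdS.
pose q := Num.sqrt (S i0 i0); have q0 : 0 < q by rewrite sqrtr_gt0.
have qq : q * q = S i0 i0 by rewrite -expr2 sqr_sqrtr// ltW.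
pose b i := S i0 i / q.
have [d' [T' [Q [Z gZ]]]] := gv_exists psd'.
(* [None] is a second copy of the coordinate [i0], without Z part since the Schur complement
   vanishes on row [i0]; its slab can then be kept apart from [A i0]. *)
pose f (o : option I) := if o is Some i then i else i0.
pose Zo (o : option I) := if o is Some i then Z i else fun=> 0.
pose bo (o : option I) := b (f o).
pose Y o (z : RM * T') := bo o * z.1 + Zo o z.2.
have gZo : gauss_vec Q Zo (fun o o' => S' (f o) (f o')).
  have gl := gv_lin (fun (o : option I) i => if o is Some k then (i == k)%:R else 0) gZ.
  apply: (gv_eq _ _ gl) => [[k|] w|[i|] [j|]] /=.
  - by rewrite sum_delta.
  - by rewrite big1// => i _; rewrite mul0r.
  - under eq_bigr => k _ do (under eq_bigr do rewrite -mulrA; rewrite -mulr_sumr sum_delta).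
    by rewrite sum_delta.
  - rewrite big1; last by move=> k _; rewrite big1// => l _; rewrite mulr0 mul0r.
    rewrite /S' (sS i i0); field; exact: lt0r_neq0.
  - rewrite big1; last by move=> k _; rewrite big1// => l _; rewrite !mul0r.
    rewrite /S'; field; exact: lt0r_neq0.
  - rewrite big1; last by move=> k _; rewrite big1// => l _; rewrite !mul0r.
    rewrite /S'; field; exact: lt0r_neq0.
have gY : gauss_vec (pprod N01 Q) Y (fun o o' => S (f o) (f o')).
  apply: (gv_eq _ _ (gv_indep (gv_rank1 bo) gZo)) => // o o'.
  rewrite /bo /b /S' mulrACA -invfM qq; field; exact: lt0r_neq0.
have gXo := gv_reindex f gX.
have mY o : measurable_fun setT (Y o) by have [] := gY.
have mZ i : measurable_fun setT (Z i) by have [] := gZ.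
have ms : measurable ([set x | `|x| <= s] : set RM) by case: (symconv_abs_le s).
pose Ao o := if o is Some i then A i else [set x : RM | `|x| <= s].
pose A1 o := if o is Some i then A i else [set: RM].
pose A2 (o : option I) := if o is Some i then [set: RM] else [set x : RM | `|x| <= s].
have mAo o : measurable (Ao o) by case: o.
have mA1 o : measurable (A1 o) by case: o => [i|]; [exact: mA|exact: measurableT].
have mA2 o : measurable (A2 o) by case: o => [i|]; [exact: measurableT|exact: ms].
have e0 : P [set w | (forall i, A i (X i w)) /\ `|X i0 w| <= s] =
    pprod N01 Q [set z | forall o, Ao o (Y o z)].
  rewrite -(gv_event gXo gY mAo); congr (P _); apply/seteqP; split => w /=.
    by move=> [h1 h2] [i|].
  by move=> h; split; [move=> i; exact: (h (Some i))|exact: (h None)].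
have e1 : P [set w | forall i, A i (X i w)] = pprod N01 Q [set z | forall o, A1 o (Y o z)].
  rewrite -(gv_event gXo gY mA1); congr (P _); apply/seteqP; split => w /=.
    by move=> h1 [i|].
  by move=> h i; exact: (h (Some i)).
have e2 : P [set w | `|X i0 w| <= s] = pprod N01 Q [set z | forall o, A2 o (Y o z)].
  rewrite -(gv_event gXo gY mA2); congr (P _); apply/seteqP; split => w /=.
    by move=> h1 [i|].
  by move=> h; exact: (h None).
rewrite e0 e1 e2.
pose phi (x : RM) := Q [set y | forall i, A i (Z i y + x * b i)%R].
pose D := [set x : RM | (`|q * x| <= s)%R].
have mD : measurable D.
  have mphi : measurable_fun [set: RM] ((fun x => q * x) : R -> RM) by exact: measurable_funM.
  by have := mphi measurableT _ ms; rewrite setTI.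
have bi0 : b i0 = q by rewrite /b -qq mulfK// gt_eqF.
have YN x y : Y None (x, y) = q * x by rewrite /Y /bo /= addr0 bi0.
have YS i x y : Y (Some i) (x, y) = Z i y + x * b i by rewrite /Y /bo /= addrC mulrC.
have mE0 := measurable_gv_event mY mAo.
have mE1 := measurable_gv_event mY mA1.
have mE2 := measurable_gv_event mY mA2.
have s1 x : Q [set y | [set z | forall o, A1 o (Y o z)] (x, y)] = phi x.
  congr (Q _); apply/seteqP; split => y /= h.
    by move=> i; have := h (Some i); rewrite /A1 YS.
  by move=> [i|] //; rewrite /A1 YS; exact: h.
have mphi : measurable_fun setT phi.
  have := (measurable_sectionP Q mE1).2.
  by congr measurable_fun; apply/funext => x; rewrite /= s1.
have phi0 x : (0 <= phi x)%E by exact: measure_ge0.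
have i1 : pprod N01 Q [set z | forall o, A1 o (Y o z)] = (\int[N01]_x phi x)%E.
  by rewrite pprodE//; apply: eq_integral => x _; rewrite s1.
have i2 : pprod N01 Q [set z | forall o, A2 o (Y o z)] = N01 D.
  have iD : N01 D = (\int[N01]_x (\1_D x)%:E)%E by rewrite integral_indic// setIT.
  rewrite pprodE// iD.
  apply: eq_integral => x _; rewrite indicE.
  have [xD|xD] := boolP (x \in D).
    rewrite (_ : [set y | _] = setT) ?probability_setT//; apply/seteqP; split => // y _ [i|]//.
    by rewrite /A2 YN; have := set_mem xD.
  rewrite (_ : [set y | _] = set0) ?measure0//; apply/seteqP; split => // y /= /(_ None).
  rewrite /A2 YN => h; move: xD; rewrite notin_setE; exact.
have i0' : pprod N01 Q [set z | forall o, Ao o (Y o z)] = (\int[N01]_(x in D) phi x)%E.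
  rewrite pprodE// [RHS]integral_mkcond; apply: eq_integral => x _; rewrite patchE.
  case: ifPn => xD.
    congr (Q _); apply/seteqP; split => y /= h.
      by move=> i; have := h (Some i); rewrite /Ao YS.
    by move=> [i|]; [rewrite /Ao YS; exact: h|rewrite /Ao YN; exact: (set_mem xD)].
  rewrite (_ : [set y | _] = set0) ?measure0//; apply/seteqP; split => // y /= /(_ None).
  rewrite /Ao YN => h; move: xD; rewrite notin_setE; exact.
(* Here |x| < |y|, and [anderson] is applied to the shift y b with the contraction factor x / y. *)
have phiD x y : D x -> ~ D y -> (phi y <= phi x)%E.
  rewrite /D /= !normrM => hx /negP; rewrite -ltNge => hy.
  have xy : `|x| < `|y| by rewrite -(ltr_pM2l (_ : 0 < `|q|)) ?normr_gt0 ?gt_eqF// (le_lt_trans hx).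
  have y0 : y != 0 by rewrite -normr_gt0 (le_lt_trans _ xy).
  have k1 : -1 < x / y < 1 by rewrite -ltr_norml normrM normfV ltr_pdivrMr ?mul1r// normr_gt0.
  have := anderson (fun i => y * b i) gZ psd' sA k1.
  have e : [set w | forall i, A i (Z i w + x / y * (y * b i))%R] =
      [set w | forall i, A i (Z i w + x * b i)%R].
    by apply/seteqP; split => w h i; have := h i; rewrite /= mulrA divfK.
  by rewrite e.
rewrite i0' i1 i2.
clear - phiD phi0 mphi mD; clearbody phi D; clear -phiD phi0 mphi mD.
(* Chebyshev's association inequality *)
have mDc : measurable (~` D) by exact: measurableC.
have mphiS (E : set RM) : measurable_fun E phi by exact: measurable_funTS.
set a := (\int[N01]_(x in D) phi x)%E; set n := N01 D.
pose b := (\int[N01]_(x in ~` D) phi x)%E; pose n' := N01 (~` D).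
have split : (\int[N01]_x phi x = a + b)%E.
  rewrite -(setvU D) ge0_integral_setU//; first by rewrite addeC.
  by apply/disj_setPS => x [].
have nn' : (n + n' = 1)%E.
  rewrite -(@probability_setT _ _ R N01) -(setvU D) measureU//; first by rewrite addeC.
  by apply/seteqP; split => // x [].
have a0 : (0 <= a)%E by exact: integral_ge0.
have b0 : (0 <= b)%E by exact: integral_ge0.
have n0 : (0 <= n)%E by exact: measure_ge0.
have n0' : (0 <= n')%E by exact: measure_ge0.
have hb x : D x -> (b <= phi x * n')%E.
  move=> Dx; rewrite -(integral_cst N01 mDc).
  by apply: ge0_le_integral => // y Dy /=; exact: phiD.
have ba : (b * n <= a * n')%E.
  rewrite -(integral_cst N01 mD) muleC -ge0_integralZl//.
  apply: ge0_le_integral => //.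
  - exact: measurable_funeM.
  - by move=> x Dx; rewrite muleC; exact: hb.
rewrite split; clearbody a b n n'; rewrite ge0_muleDl// -[leRHS]mule1 -nn' ge0_muleDr//.
exact: leeD2l.
Qed.

Lemma symconvT : symconv [set: RM].
Proof. by split => //; exact: measurableT. Qed.

Lemma symconvI (A B : set RM) : symconv A -> symconv B -> symconv (A `&` B).
Proof.
move=> [a b c] [a' b' c']; split; first exact: measurableI.
  by move=> x [/b ? /b' ?].
by move=> x y t t01 [h1 h2] [h3 h4]; split; [exact: c|exact: c'].
Qed.

(** At each step the new slab is absorbed into the symmetric convex set of its coordinate, which
    puts the event back into product form. *)
Lemma sidak_seq d (T : measurableType d) (P : probability T R) X S (A : I -> set RM) (l : R)
    (s : seq I) :
  gauss_vec P X S -> psd S -> (forall i, symconv (A i)) -> (forall i, i \in s -> 0 < S i i) ->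
  (P [set w | forall i, A i (X i w)] * \prod_(i <- s) P [set w | (`|X i w| <= l)%R] <=
   P [set w | (forall i, A i (X i w)) /\ (forall i, i \in s -> `|X i w| <= l)%R])%E.
Proof.
move=> gX psdS; elim: s A => [|i s IH] A sA s0.
  rewrite big_nil mule1 le_eqVlt; apply/orP; left; apply/eqP; congr (P _).
  by apply/seteqP; split => w /=; [|case].
pose A' j := if j == i then A j `&` [set x | `|x| <= l] else A j.
have sA' j : symconv (A' j).
  by rewrite /A'; case: ifP => // _; exact: symconvI (symconv_abs_le l).
have eA w : ((forall i, A i (X i w)) /\ `|X i w| <= l) <-> (forall i, A' i (X i w)).
  rewrite /A'; split => [[h1 h2] j|h].
    by case: eqP => [->|_].
  split; last by have := h i; rewrite eqxx => -[].
  by move=> j; have := h j; case: ifP => // _ [].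
have s0' j : j \in s -> 0 < S j j by move=> js; apply: s0; rewrite inE js orbT.
have h1 := IH A' sA' s0'.
have h2 := sidak l gX psdS sA (s0 i (mem_head _ _)).
rewrite big_cons muleA; apply: (le_trans _ (le_trans h1 _)).
  apply: lee_wpmul2r; first by apply: prode_ge0 => j _; exact: measure_ge0.
  apply: (le_trans h2); rewrite le_eqVlt; apply/orP; left; apply/eqP; congr (P _).
  by apply/seteqP; split => w /eA.
rewrite le_eqVlt; apply/orP; left; apply/eqP; congr (P _).
apply/seteqP; split => w /=.
  move=> [/eA[h3 h4] h5]; split => // j; rewrite inE => /orP[/eqP->//|]; exact: h5.
move=> [h3 h4]; split; last by move=> j js; apply: h4; rewrite inE js orbT.
by apply/eA; split => //; apply: h4; exact: mem_head.
Qed.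

End Anderson.

(** * Gaussian tails and the Fernique inequality *)

Section RealProbability.
Context {R : realType} d (T : measurableType d) (P : probability T R).
Implicit Types A B : set T.

Definition pr A : R := fine (P A).

Lemma prE A : measurable A -> P A = (pr A)%:E.
Proof. by move=> mA; rewrite /pr fineK// fin_num_measure. Qed.

Lemma pr_ge0 A : 0 <= pr A.
Proof. exact: fine_ge0. Qed.

Lemma pr_le1 A : measurable A -> pr A <= 1.
Proof. by move=> mA; rewrite -lee_fin -prE// probability_le1. Qed.

Lemma pr_le A B : measurable A -> measurable B -> A `<=` B -> pr A <= pr B.
Proof. by move=> mA mB AB; rewrite -lee_fin -!prE// le_measure// inE. Qed.

Lemma prC A : measurable A -> pr (~` A) = 1 - pr A.
Proof. by move=> mA; rewrite /pr probability_setC// prE. Qed.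

Lemma pr0 : pr set0 = 0.
Proof. by rewrite /pr measure0. Qed.

Lemma prT : pr setT = 1.
Proof. by rewrite /pr probability_setT. Qed.

Lemma prU_le A B : measurable A -> measurable B -> pr (A `|` B) <= pr A + pr B.
Proof.
move=> mA mB; rewrite -lee_fin EFinD -!prE//; last exact: measurableU.
exact: measureU2.
Qed.

Lemma pr_setD A B : measurable A -> measurable B -> pr (A `\` B) = pr A - pr (A `&` B).
Proof.
move=> mA mB; apply: EFin_inj; rewrite EFinB -!prE//; [|exact: measurableI|exact: measurableD].
by rewrite measureD// ltey_eq fin_num_measure.
Qed.

Lemma pr_seqU (I : eqType) (s : seq I) (F : I -> set T) : (forall i, measurable (F i)) ->
  measurable [set w | exists2 i, i \in s & F i w] /\
  pr [set w | exists2 i, i \in s & F i w] <= \sum_(i <- s) pr (F i).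
Proof.
move=> mF; elim: s => [|i s [mIH IH]].
  rewrite (_ : [set w | _] = set0); last by apply/seteqP; split => // w [].
  by rewrite pr0 big_nil.
have -> : [set w | exists2 j, j \in i :: s & F j w] = F i `|` [set w | exists2 j, j \in s & F j w].
  apply/seteqP; split => w /= [].
  - by move=> j; rewrite inE => /orP[/eqP->|js] Fj; [left|right; exists j].
  - by move=> Fi; exists i => //; exact: mem_head.
  - by move=> [j js Fj]; exists j => //; rewrite inE js orbT.
split; first exact: measurableU.
by rewrite big_cons (le_trans (prU_le _ _))// lerD2l.
Qed.

End RealProbability.

Section ProductProbability.
Context {R : realType} d1 d2 (T1 : measurableType d1) (T2 : measurableType d2).
Variables (P : probability T1 R) (Q : probability T2 R).

Lemma pr_pprodX (A : set T1) (B : set T2) : measurable A -> measurable B ->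
  pr (pprod P Q) (A `*` B) = pr P A * pr Q B.
Proof.
move=> mA mB; rewrite /pr /pprod /= product_measure1E// fineM// fin_num_measure//.
Qed.

Lemma pr_pprod_le (A : set (T1 * T2)) (c : R) : measurable A -> 0 <= c ->
  (forall x, pr Q [set y | A (x, y)] <= c) -> pr (pprod P Q) A <= c.
Proof.
move=> mA c0 h; rewrite -lee_fin -prE// pprodE//.
have [m1 m2] := measurable_sectionP Q mA.
apply: (@le_trans _ _ (\int[P]_x c%:E)%E); last first.
  by rewrite integral_cst//= probability_setT mule1.
apply: ge0_le_integral => //.
by move=> x _; rewrite prE// lee_fin.
Qed.

End ProductProbability.

Section NormalTail.
Context {R : realType}.
Local Notation N01 := (normal_prob 0 1 : probability (measurableTypeR R) R).

Definition ntail (u : R) : R := pr N01 [set x | u <= x].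

Lemma measurable_ray (r : R) : measurable [set x : measurableTypeR R | r <= x].
Proof. by have := @measurable_ge R true r; congr measurable; apply/seteqP; split => x /=; [exact|move=> + _]. Qed.

Lemma measurable_lray (r : R) : measurable [set x : measurableTypeR R | x <= r].
Proof. by have := @measurable_le R true r; congr measurable; apply/seteqP; split => x /=; [exact|move=> + _]. Qed.

Lemma ntail_ge0 u : 0 <= ntail u. Proof. exact: pr_ge0. Qed.

Lemma ntail_le1 u : ntail u <= 1. Proof. by apply: pr_le1; exact: measurable_ray. Qed.

Lemma ntail_anti u v : u <= v -> ntail v <= ntail u.
Proof.
by move=> uv; apply: pr_le; [exact: measurable_ray|exact: measurable_ray|move=> x /=; exact: le_trans].
Qed.

Lemma ntail_opp u : ntail (- u) = pr N01 [set x | x <= u].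
Proof.
have gX := @gv_rank1 R unit (fun=> 1).
have := gv_event (gv_neg gX) gX (fun=> measurable_ray (- u)).
rewrite /ntail /pr => e; congr fine.
transitivity (N01 [set w | forall i : unit, [set x : measurableTypeR R | - u <= x] (1 * w)]).
  by congr (N01 _); apply/seteqP; split => x /=; [move=> + _|move=> /(_ tt)]; rewrite mul1r.
rewrite -e; congr (N01 _).
by apply/seteqP; split => x /=; [move=> /(_ tt)|move=> + _]; rewrite mul1r lerN2.
Qed.

Lemma ntail0 : ntail 0 <= 2^-1.
Proof.
have h0 : pr N01 [set 0] = 0.
  rewrite /pr /= /normal_prob integral_set1//.
have := ntail_opp 0; rewrite oppr0 => e.
have : pr N01 ([set x | 0 <= x] `\` [set 0]) = ntail 0 - 0.
  rewrite pr_setD//; last exact: measurable_ray.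
  rewrite (_ : _ `&` _ = [set 0]) ?h0//.
  by apply/seteqP; split => x /=; [case|move=> ->].
have -> : [set x : measurableTypeR R | 0 <= x] `\` [set 0] = ~` [set x | x <= 0].
  apply/seteqP; split => x /=; first by move=> [h1 h2] h3; apply: h2; lra.
  by move=> /negP; rewrite -ltNge => h; split; [exact: ltW|apply/eqP; rewrite gt_eqF].
rewrite prC; last exact: measurable_lray.
rewrite -e; lra.
Qed.

Lemma ntail_upper u : 0 <= u -> ntail u <= 2^-1 * expR (- u ^+ 2 / 2).
Proof.
move=> u0; have := normal_tail_shift u0.
rewrite !prE; try exact: measurable_ray.
rewrite -EFinM lee_fin => /le_trans; apply.
by rewrite mulrC ler_wpM2r ?expR_ge0//; exact: ntail0.
Qed.

Lemma normal_itv_gt0 (a b : R) : a < b -> 0 < pr N01 `[a, b].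
Proof.
move=> ab.
pose M := Num.max `|a| `|b|.
have M0 : 0 <= M by rewrite /M le_max normr_ge0.
apply: (@lt_le_trans _ _ (normal_pdf 0 1 M * (b - a))).
  by rewrite mulr_gt0 ?subr_gt0// normal_pdfE// mulr_gt0 ?expR_gt0// normal_peak_gt0.
have mab : measurable (`[a, b]%classic : set (measurableTypeR R)) by exact: measurable_itv.
rewrite -lee_fin -prE//.
have -> : (normal_pdf 0 1 M * (b - a))%:E = (\int[lebesgue_measure]_(x in `[a, b]) (normal_pdf 0 1 M)%:E)%E.
  by rewrite integral_cst//= lebesgue_measure_itv /= lte_fin ab -EFinB -EFinM.
rewrite /= /normal_prob; apply: ge0_le_integral => //.
- by move=> x _; rewrite lee_fin normal_pdf_ge0.
- by apply/measurable_EFinP; apply: measurable_funTS; exact: measurable_normal_pdf.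
- move=> x; rewrite /= in_itv /= => /andP[ax xb].
  rewrite lee_fin !normal_pdfE// ler_wpM2l ?normal_peak_ge0// /normal_fun ler_expR !subr0 expr1n.
  have xM : `|x| <= M.
    rewrite /M le_max !ler_norml; case: (leP 0 x) => x0; apply/orP; [right|left].
      by have := ler_norm b; lra.
    by have := ler_norm (- a); rewrite normrN; lra.
  have : `|x| ^+ 2 <= M ^+ 2 by rewrite ler_sqr ?nnegrE.
  rewrite real_normK ?num_real//; lra.
Qed.

(** A translation by u + 1 rather than u leaves the interval [-1, 0] below the half-line restriction
    of [normal_shift]; its mass is the constant. *)
Lemma ntail_lower : exists2 c : R, 0 < c & forall u, 0 <= u -> c * expR (- (u + 1) ^+ 2 / 2) <= ntail u.
Proof.
exists (pr N01 `[-1, 0]); first by apply: normal_itv_gt0; lra.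
move=> u u0; have u1 : 0 <= u + 1 by lra.
have := normal_shift u1 (measurable_ray u).
have -> : [set x : measurableTypeR R | [set x0 | u <= x0] (x + (u + 1)) /\ x <= 0] = `[-1, 0]%classic.
  apply/seteqP; split => x; rewrite /= in_itv /=; first by move=> [? ?]; apply/andP; split; lra.
  by move=> /andP[? ?]; split; lra.
rewrite !prE; [|exact: measurable_ray|exact: measurable_itv].
by rewrite -EFinM lee_fin mulrC.
Qed.

(* A bound of the normal distribution function whose logarithm is affine, so that it
   can be averaged without convexity. *)
Lemma ntail_affine x0 x : 0 <= x0 ->
  ntail (- x) <= expR (- (ntail (x0 + 2) / (2 * (1 + x0)) * (1 + x0 - x))).
Proof.
move=> x00; set t := ntail (x0 + 2).
have t0 : 0 <= t by exact: ntail_ge0.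
have t1 : t <= 2^-1 by rewrite (le_trans _ ntail0)// ntail_anti//; lra.
set A := t / _.
have A0 : 0 <= A by rewrite divr_ge0//; lra.
have At : A * (1 + x0) = t / 2 by rewrite /A; field; lra.
have A4 : A <= t / 2 by rewrite -At ler_peMr//; lra.
(* Beyond x0 + 1 the affine exponent is nonnegative. Between 0 and x0 + 1 the mass above x0 + 2 is
   missing, hence 1 - t <= e^(-t) with A (1 + x0) = t / 2. For x < 0 the Gaussian decay beats any
   affine exponent of slope at most 1/4. *)
have [hx|hx] := leP x (x0 + 1); last first.
  rewrite (le_trans (ntail_le1 _))// -[leLHS]expR0 ler_expR; nra.
have [x0'|x0'] := leP 0 x.
  apply: (@le_trans _ _ (1 - t)).
    rewrite ntail_opp.
    have -> : [set x1 : measurableTypeR R | x1 <= x] = ~` [set y | x < y].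
      by apply/seteqP; split => y /=; rewrite leNgt => /negP.
    have mlt : measurable [set y : measurableTypeR R | x < y].
      have := measurableC (measurable_lray x); congr measurable.
      by apply/seteqP; split => y /=; rewrite ltNge => /negP.
    rewrite prC// lerD2l lerN2; apply: pr_le => //; first exact: measurable_ray.
    by move=> y /=; lra.
  apply: (le_trans (expR_ge1Dx (- t))); rewrite ler_expR; nra.
have := @ntail_upper (- x); rewrite oppr_ge0 => /(_ (ltW x0')) /le_trans; apply.
have h1 : 1 + - 2^-1 <= expR (- 2^-1) :> R by exact: expR_ge1Dx.
have h2 : 2^-1 <= expR (- 2^-1) :> R by apply: le_trans h1; lra.
apply: (le_trans (ler_wpM2r (expR_ge0 _) h2)); rewrite -expRD ler_expR sqrrN.
nra.
Qed.

End NormalTail.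

Section GaussianTails.
Context {R : realType}.
Local Notation N01 := (normal_prob 0 1 : probability (measurableTypeR R) R).
Local Notation RM := (measurableTypeR R).

Lemma measurable_fun_le d (T : measurableType d) (X : T -> R) (t : R) :
  measurable_fun setT X -> measurable [set w | t <= X w] /\ measurable [set w | `|X w| <= t].
Proof.
move=> mX; split.
  by have := mX measurableT _ (measurable_ray t); rewrite setTI.
have mA : measurable [set x : RM | `|x| <= t] by case: (symconv_abs_le t).
by have := mX measurableT _ mA; rewrite setTI.
Qed.

Lemma gv_tail (I : finType) d (T : measurableType d) (P : probability T R) X (S : I -> I -> R)
    (i : I) (v t : R) : gauss_vec P X S -> psd S -> S i i <= v -> 0 < v -> 0 <= t ->
  pr P [set w | t <= X i w] <= expR (- t ^+ 2 / (2 * v)).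
Proof.
move=> gX psdS Sv v0 t0.
have S0 := psd_diag_ge0 i psdS.
set q := Num.sqrt (S i i); have qq : q ^+ 2 = S i i by rewrite sqr_sqrtr.
have q0 : 0 <= q by exact: sqrtr_ge0.
have g1 := gv_reindex (fun _ : unit => i) gX.
have g2 : gauss_vec N01 (fun (_ : unit) x => q * x) (fun _ _ => S i i).
  by apply: (gv_eq _ _ (gv_rank1 (fun=> q))) => // *; rewrite -expr2.
have := gv_event g1 g2 (fun=> measurable_ray t) => e.
have -> : pr P [set w | t <= X i w] = pr N01 [set x | t <= q * x].
  rewrite /pr; congr fine.
  transitivity (P [set w | unit -> (t <= X i w)%R]).
    by congr (P _); apply/seteqP; split => x /=; [move=> + _|move=> /(_ tt)].
  rewrite [LHS]e; congr (N01 _); apply/seteqP; split => x /=; [exact|by move=> + _].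
have [qE|qN] := eqVneq q 0.
  have [tE|tN] := eqVneq t 0.
    by rewrite tE expr0n/= oppr0 mul0r expR0 pr_le1//; apply: (measurable_fun_le _ _).1; exact: measurable_funM.
  rewrite (_ : [set x | _] = set0) ?pr0 ?expR_ge0//; apply/seteqP; split => x //=.
  by rewrite qE mul0r leNgt lt_neqAle eq_sym tN t0.
have q1 : 0 < q by rewrite lt_neqAle eq_sym qN.
have -> : [set x | t <= q * x] = [set x | t / q <= x].
  by apply/seteqP; split => x; rewrite /= ler_pdivrMr// mulrC.
apply: (le_trans (ntail_upper _)); first exact: divr_ge0.
apply: (@le_trans _ _ (1 * expR (- (t / q) ^+ 2 / 2))).
  by rewrite ler_wpM2r ?expR_ge0//; lra.
rewrite mul1r ler_expR !mulNr lerN2 expr_div_n qq -[leRHS]mulrA -invfM ler_wpM2l ?sqr_ge0//.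
have S1 : 0 < S i i by rewrite -qq exprn_gt0.
by rewrite lef_pV2 ?posrE ?mulr_gt0// mulrC ler_wpM2l.
Qed.

Lemma gv_abs_le (I : finType) d (T : measurableType d) (P : probability T R) X (S : I -> I -> R)
    (i : I) (v t : R) : gauss_vec P X S -> psd S -> S i i <= v -> 0 < v -> 0 <= t ->
  1 - 2 * expR (- t ^+ 2 / (2 * v)) <= pr P [set w | `|X i w| <= t].
Proof.
move=> gX psdS Sv v0 t0.
have mX : measurable_fun setT (X i) by have [] := gX.
have mN : measurable_fun setT (fun w => - X i w) by have [] := gv_neg gX.
have [m1 m3] := measurable_fun_le t mX; have [m2 _] := measurable_fun_le t mN.
have h1 := gv_tail gX psdS Sv v0 t0; have h2 := gv_tail (gv_neg gX) psdS Sv v0 t0.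
have : pr P (~` [set w | `|X i w| <= t]) <= pr P ([set w | t <= X i w] `|` [set w | t <= - X i w]).
  apply: pr_le; [exact: measurableC|exact: measurableU|move=> w /= /negP; rewrite -ltNge => h].
  by case: (leP 0 (X i w)) h => ?; [rewrite ger0_norm//|rewrite ltr0_norm//] => ?; [left|right]; exact: ltW.
rewrite prC//; have := prU_le P m1 m2; lra.
Qed.

(** Replacing one coordinate by a fresh normal on a product space leaves the law unchanged, and its
    event becomes a factor of a rectangle. *)
Lemma gv_iid (I : finType) d (T : measurableType d) (P : probability T R) X (m : R) (c : I -> R)
    (s : seq I) : 0 < m -> uniq s ->
  gauss_vec P X (fun i j => (i == j)%:R * m) ->
  pr P [set w | forall i, i \in s -> - c i <= X i w] = \prod_(i <- s) ntail (- (c i / Num.sqrt m)).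
Proof.
move=> m0 + gX; elim: s => [|i s IH].
  rewrite big_nil => _; rewrite (_ : [set w | _] = setT) ?prT//; exact/seteqP.
move=> /= /andP[si us]; rewrite big_cons -IH//.
set q := Num.sqrt m; have qq : q ^+ 2 = m by rewrite sqr_sqrtr// ltW.
have q0 : 0 < q by rewrite sqrtr_gt0.
pose b (j : I) : R := (j == i)%:R * q.
pose gZ := gv_lin (fun j k => (j == k)%:R * (j != i)%:R) gX.
have gY : gauss_vec (pprod N01 P) (fun j z => b j * z.1 + (j != i)%:R * X j z.2)
    (fun j k => (j == k)%:R * m).
  apply: (gv_eq _ _ (gv_indep (gv_rank1 b) gZ)) => [j [x w]|j k] /=.
    congr (_ + _); rewrite (bigD1 j)//= eqxx mul1r big1 ?addr0// => l /negPf lj.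
    by rewrite eq_sym lj mul0r mul0r.
  rewrite (bigD1 j)//= [X in _ + (_ + X)]big1 ?addr0; last first.
    by move=> l /negPf lj; rewrite big1// => l' _; rewrite (eq_sym j) lj !mul0r.
  rewrite (bigD1 k)//= big1 ?addr0; last first.
    by move=> l /negPf lk; rewrite (eq_sym k) lk !mul0r mulr0 mul0r.
  rewrite !eqxx /b !mul1r; have [->|ji] := eqVneq j i.
    by case: (boolP (k == i)) => [/eqP ->|/negPf ki]; rewrite ?eqxx /= ?(eq_sym i) ?ki /= ?qq -?expr2 ?qq; nra.
  rewrite !mul0r add0r mul1r; case: (boolP (k == i)) => [/eqP ->|ki] /=; last by rewrite mul1r.
  by rewrite (negPf ji) !mul0r.
pose A j := [set x : RM | j \in i :: s -> - c j <= x].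
have mA j : measurable (A j) by exact: measurable_ge.
have -> : pr P [set w | forall j, j \in i :: s -> - c j <= X j w] =
    pr (pprod N01 P) ([set x | - (c i / q) <= x] `*` [set w | forall j, j \in s -> - c j <= X j w]).
  rewrite /pr; congr fine; rewrite [LHS](gv_event gX gY mA); congr (pprod N01 P _).
  have si' j : j \in s -> j != i by move=> js; apply: contraNneq si => <-.
  apply/seteqP; split => -[x w] /=.
    move=> h; split.
      have := h i; rewrite /A /= mem_head /b eqxx /= mul0r addr0 mul1r => /(_ isT).
      by rewrite -mulNr ler_pdivrMr// mulrC.
    move=> j js; have := h j; rewrite /A /= inE js orbT /b (negPf (si' _ js)) mul0r mul0r add0r mul1r; exact.
  move=> [h1 h2] j; rewrite /A /= inE => /orP[/eqP->|js].
    by rewrite /b eqxx /= mul0r addr0 mul1r mulrC -ler_pdivrMr// mulNr.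
  by rewrite /b (negPf (si' _ js)) !mul0r add0r mul1r; exact: h2.
rewrite pr_pprodX//; first exact: measurable_ray.
have [mX _ _] := gX.
exact: (@measurable_gv_event R I _ _ X (fun j => [set x | j \in s -> - c j <= x]) mX (fun j => measurable_ge _ _)).
Qed.

(** It suffices that each of the driving normals lie in [-1, 1]. The bound depends on their number
    but not on the number of coordinates, which is why finitely many atoms cost only a constant. *)
Lemma rank1_sum_small (I : finType) d (T : measurableType d) (P : probability T R) X
    (bs : seq (I -> R)) (C : R) : (forall b, List.In b bs -> forall i, `|b i| <= C) ->
  gauss_vec P X (rank1_sum bs) ->
  pr N01 [set x | `|x| <= 1] ^+ size bs <= pr P [set w | forall i, `|X i w| <= C *+ size bs].
Proof.
move=> hC gX.
suff [d' [T' [P' [X' [gX' h]]]]] : exists (d' : measure_display) (T' : measurableType d')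
    (P' : probability T' R) (X' : I -> T' -> R), gauss_vec P' X' (rank1_sum bs) /\
    pr N01 [set x | `|x| <= 1] ^+ size bs <= pr P' [set w | forall i, `|X' i w| <= C *+ size bs].
  apply: (le_trans h); rewrite /pr.
  by rewrite (gv_event gX' gX (A := fun=> [set x | `|x| <= C *+ size bs])) => // i; case: (symconv_abs_le (C *+ size bs)).
elim: bs hC {X gX} => [|b bs IH] hC.
  exists _, RM, N01, (fun i x => 0 * x); split.
    by apply: (gv_eq _ _ (gv_rank1 (fun=> 0))) => // i j; rewrite /rank1_sum big_nil mul0r.
  have -> : [set w : RM | I -> `|0 * w| <= C *+ size ([::] : seq (I -> R))] = setT.
    by apply/seteqP; split => // x _ i; rewrite mul0r normr0.
  by rewrite prT.
have [|d' [T' [P' [X' [gX' h]]]]] := IH; first by move=> b' hb'; apply: hC; right.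
exists _, (RM * T')%type, (pprod N01 P'), (fun i z => b i * z.1 + X' i z.2); split.
  by apply: (gv_eq _ _ (gv_indep (gv_rank1 b) gX')) => // i j; rewrite /rank1_sum big_cons.
have m1 : measurable [set x : RM | `|x| <= 1] by case: (symconv_abs_le (1:R)).
have mA (r : R) (i : I) : measurable [set x : RM | `|x| <= r] by case: (symconv_abs_le r).
have [mX' _ _] := gX'.
have mX2 := measurable_gv_event mX' (mA (C *+ size bs)).
rewrite /= exprS; apply: (@le_trans _ _ (pr (pprod N01 P') ([set x | `|x| <= 1] `*` [set w | forall i, `|X' i w| <= C *+ size bs]))).
  by rewrite pr_pprodX//; apply: ler_wpM2l => //; exact: pr_ge0.
apply: pr_le; first exact: measurableX.
  have gY := gv_indep (gv_rank1 b) gX'; have [mY _ _] := gY.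
  exact: (measurable_gv_event mY (mA (C *+ (size bs).+1))).
move=> -[x w] /= [h1 h2] i; rewrite mulrS (le_trans (ler_normD _ _))// lerD//.
rewrite normrM; have := hC b (or_introl erefl) i.
have := normr_ge0 (b i); have := normr_ge0 x; nra.
Qed.


(* Rotation by pi/4 leaves the law of two independent copies invariant. *)
Lemma fernique_step (I : finType) d (T : measurableType d) (P : probability T R) X (S : I -> I -> R)
    (s t : R) : gauss_vec P X S ->
  pr P [set w | forall i, `|X i w| <= s] * (1 - pr P [set w | forall i, `|X i w| <= s + Num.sqrt 2 * t]) <=
  (1 - pr P [set w | forall i, `|X i w| <= t]) ^+ 2.
Proof.
move=> gX; set q := Num.sqrt 2; set t' := s + _.
have qq : q ^+ 2 = 2 :> R by rewrite sqr_sqrtr.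
have q0 : 0 < q by rewrite sqrtr_gt0.
have qv : q^-1 * q^-1 = 2^-1 :> R by rewrite -invfM -expr2 qq.
pose B1 (o : I + I) i : R := match o with inl j => (i == j)%:R | inr j => 0 end.
pose B2 (o : I + I) i : R := match o with inl j => 0 | inr j => (i == j)%:R end.
pose C1 (o : I + I) i : R := match o with inl j => (i == j)%:R * q^-1 | inr j => (i == j)%:R * q^-1 end.
pose C2 (o : I + I) i : R := match o with inl j => (i == j)%:R * - q^-1 | inr j => (i == j)%:R * q^-1 end.
pose S2 (o o' : I + I) : R := match o, o' with inl j, inl k => S j k | inr j, inr k => S j k | _, _ => 0 end.
have dd (j k : I) (a b : R) : \sum_i \sum_l (i == j)%:R * a * ((l == k)%:R * b) * S i l = a * b * S j k.
  transitivity (\sum_i (i == j)%:R * \sum_l (l == k)%:R * (a * b * S i l)); last by rewrite !sum_delta.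
  by apply: eq_bigr => i _; rewrite mulr_sumr; apply: eq_bigr => l _; ring.
have dd1 (j k : I) : \sum_i \sum_l (i == j)%:R * (l == k)%:R * S i l = S j k.
  have := dd j k 1 1; rewrite !mul1r => <-.
  by apply: eq_bigr => i _; apply: eq_bigr => l _; rewrite !mulr1.
have g1 : gauss_vec (pprod P P) (fun o z => match o with inl j => X j z.1 | inr j => X j z.2 end) S2.
  apply: (gv_eq _ _ (gv_indep (gv_lin B1 gX) (gv_lin B2 gX))) => [[] j z|[] j [] k] /=.
  - by rewrite sum_delta big1 ?addr0// => i _; rewrite mul0r.
  - by rewrite sum_delta big1 ?add0r// => i _; rewrite mul0r.
  - rewrite [X in _ + X]big1 ?addr0; last by move=> i _; rewrite big1// => l _; rewrite mul0r mul0r.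
    exact: dd1.
  - by rewrite !big1 ?addr0// => i _; rewrite big1// => l _; rewrite ?mulr0 mul0r// mul0r.
  - by rewrite !big1 ?addr0// => i _; rewrite big1// => l _; rewrite ?mulr0 mul0r// mul0r.
  - rewrite big1 ?add0r; last by move=> i _; rewrite big1// => l _; rewrite mul0r mul0r.
    exact: dd1.
have sd (j : I) (a : R) w : \sum_i (i == j)%:R * a * X i w = a * X j w.
  by under eq_bigr => i _ do rewrite -mulrA; rewrite sum_delta.
have g2 : gauss_vec (pprod P P) (fun o z => match o with
    inl j => q^-1 * (X j z.1 - X j z.2) | inr j => q^-1 * (X j z.1 + X j z.2) end) S2.
  apply: (gv_eq _ _ (gv_indep (gv_lin C1 gX) (gv_lin C2 gX))) => [[] j z|[] j [] k] /=;
    rewrite ?sd ?dd; first [ring|by rewrite ?mulrN ?mulNr ?opprK ?qv; field].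
have [mX _ _] := gX.
have mA (r : R) : measurable [set x : RM | `|x| <= r] by case: (symconv_abs_le r).
have mE (r : R) := measurable_gv_event mX (fun=> mA r).
pose A r r' (o : I + I) := match o with inl _ => [set x : RM | `|x| <= r] | inr _ => [set x : RM | `|x| <= r'] end.
have mAo r r' o : measurable (A r r' o) by case: o => i; exact: mA.
pose E r := [set w | forall i, `|X i w| <= r].
pose V z := forall i, `|q^-1 * (X i z.1 - X i z.2)| <= s.
pose U z := forall i, `|q^-1 * (X i z.1 + X i z.2)| <= t'.
have mVU : measurable [set z | V z /\ U z].
  have [mY _ _] := g2.
  have := measurable_gv_event mY (mAo s t'); congr measurable.
  apply/seteqP; split => z /=; first by move=> h; split => i; [exact: (h (inl i))|exact: (h (inr i))].
  by move=> [h1 h2] [i|i]; [exact: h1|exact: h2].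
have mV : measurable [set z | V z].
  have [mY _ _] := gv_reindex inl g2.
  exact: (measurable_gv_event mY (fun=> mA s)).
have e1 : pr P (E s) * pr P (E t') = pr (pprod P P) [set z | V z /\ U z].
  rewrite -pr_pprodX//; [|exact: mE|exact: mE].
  rewrite /pr; congr fine.
  transitivity (pprod P P [set z | forall o, A s t' o (match o with inl j => X j z.1 | inr j => X j z.2 end)]).
    congr (pprod P P _); apply/seteqP; split => -[x y] /=; first by move=> [h1 h2] [i|i]; [exact: h1|exact: h2].
    by move=> h; split => i; [exact: (h (inl i))|exact: (h (inr i))].
  rewrite [LHS](gv_event g1 g2 (mAo s t')); congr (pprod P P _).
  apply/seteqP; split => z /=; first by move=> h; split => i; [exact: (h (inl i))|exact: (h (inr i))].
  by move=> [h1 h2] [i|i]; [exact: h1|exact: h2].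
have e2 : pr P (E s) = pr (pprod P P) [set z | V z].
  rewrite -[LHS]mulr1 -(prT P) -pr_pprodX//; [|exact: mE].
  rewrite /pr; congr fine.
  have h1 := gv_reindex inl g1; have h2 := gv_reindex inl g2.
  have := gv_event h1 h2 (fun=> mA s) => /= <-.
  by congr (pprod P P _); apply/seteqP; split => -[x y] /=; [case|].
rewrite -/(E s) -/(E t') -/(E t) mulrBr mulr1 e1 e2.
have -> : [set z | V z /\ U z] = [set z | V z] `&` [set z | V z /\ U z].
  by apply/seteqP; split => z /=; [move=> [? ?]|case].
rewrite -pr_setD// -prC; last exact: mE.
rewrite expr2 -pr_pprodX; [|exact: measurableC (mE t)|exact: measurableC (mE t)].
apply: pr_le; [exact: measurableD|apply: measurableX; exact: measurableC (mE t)|].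
move=> [x y] /= [hV hU].
have {hU} [i hi] : exists i, t' < `|q^-1 * (X i x + X i y)|.
  apply: contrapT => h; apply: hU; split=> // i; rewrite leNgt; apply/negP => h'.
  by apply: h; exists i.
have hv := hV i; rewrite /= in hv.
have nq z : `|q^-1 * z| = `|z| / q by rewrite normrM gtr0_norm ?invr_gt0// mulrC.
rewrite nq ltr_pdivlMr// in hi.
rewrite nq ler_pdivrMr// in hv.
have hi' : s * q + 2 * t < `|X i x + X i y|.
  suff e : t' * q = s * q + 2 * t by rewrite -e.
  rewrite -[X in X * t]qq /t'; ring.
have tri1 : `|X i x + X i y| <= 2 * `|X i x| + `|X i x - X i y|.
  rewrite (_ : X i x + X i y = 2 * X i x - (X i x - X i y)); last by ring.
  by rewrite (le_trans (ler_normB _ _))// normrM ger0_norm.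
have tri2 : `|X i x + X i y| <= 2 * `|X i y| + `|X i x - X i y|.
  rewrite (_ : X i x + X i y = 2 * X i y + (X i x - X i y)); last by ring.
  by rewrite (le_trans (ler_normD _ _))// normrM ger0_norm.
by split => h; have := h i; rewrite leNgt => /negP; apply; lra.
Qed.

(** Along the levels s (4 q^n - 3), with q = sqrt 2, twice the failure probability is squared at
    each application of [fernique_step], because the initial probability is at least 1/2. These
    levels fit together since s + q s (4 q^n - 3) <= s (4 q^(n+1) - 3), that is 4 <= 3 q. *)
Lemma fernique (I : finType) d (T : measurableType d) (P : probability T R) X (S : I -> I -> R)
    (s b : R) n : gauss_vec P X S -> 0 <= s -> b <= 2^-1 ->
  1 - b <= pr P [set w | forall i, `|X i w| <= s] ->
  1 - (2 * b) ^+ (2 ^ n) <= pr P [set w | forall i, `|X i w| <= 4 * s * Num.sqrt 2 ^+ n].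
Proof.
move=> gX s0 b2 hb; set q := Num.sqrt 2; have qq : q ^+ 2 = 2 :> R by rewrite sqr_sqrtr.
have q0 : 0 < q by rewrite sqrtr_gt0.
have q4 : 4 <= 3 * q by have := sqr_ge0 (3 * q - 4); nra.
have [mX _ _] := gX.
have mA (r : R) : measurable [set x : RM | `|x| <= r] by case: (symconv_abs_le r).
have mE (r : R) := measurable_gv_event mX (fun=> mA r).
pose F r := pr P [set w | forall i, `|X i w| <= r].
have F1 r : F r <= 1 by exact: (pr_le1 P (mE r)).
have b0 : 0 <= b by have := F1 s; rewrite /F; lra.
suff h : 2 * (1 - F (s * (4 * q ^+ n - 3))) <= (2 * b) ^+ (2 ^ n).
  have : F (s * (4 * q ^+ n - 3)) <= F (4 * s * q ^+ n).
    by apply: pr_le; [exact: mE|exact: mE|move=> w /= + i => /(_ i); have := exprn_gt0 n q0; nra].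
  have : 0 <= (2 * b) ^+ (2 ^ n) by rewrite exprn_ge0//; lra.
  by change (pr P [set w | forall i, `|X i w| <= 4 * s * q ^+ n]) with (F (4 * s * q ^+ n)); lra.
elim: n => [|n IH].
  by rewrite expr0 mulr1 expn0 expr1 (_ : 4 - 3 = 1) ?mulr1; [rewrite /F; lra|ring].
have st := @fernique_step I _ _ P X S s (s * (4 * q ^+ n - 3)) gX.
rewrite -/q -/(F _) -/(F _) -/(F _) in st.
have mono : F (s + q * (s * (4 * q ^+ n - 3))) <= F (s * (4 * q ^+ n.+1 - 3)).
  apply: pr_le; [exact: mE|exact: mE|move=> w /= + i => /(_ i) /le_trans; apply].
  rewrite exprS; have := exprn_gt0 n q0; nra.
rewrite expnS mulnC exprM.
have h0 : 0 <= 2 * (1 - F (s * (4 * q ^+ n - 3))) by have := F1 (s * (4 * q ^+ n - 3)); lra.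
have h1 : (2 * (1 - F (s * (4 * q ^+ n - 3)))) ^+ 2 <= ((2 * b) ^+ (2 ^ n)) ^+ 2.
  by rewrite ler_sqr ?nnegrE//; apply: le_trans IH.
apply: le_trans h1; have Fs : 2^-1 <= F s by rewrite /F; lra.
have := F1 (s + q * (s * (4 * q ^+ n - 3))).
rewrite exprMn; nra.
Qed.

End GaussianTails.

(** * Covariance kernels *)

Section Dot.
Context {R : realType} {d : nat}.
Implicit Types x y z : 'rV[R]_d.

Lemma dotDr x y z : dot x (y + z) = dot x y + dot x z.
Proof. by rewrite /dot -big_split /=; apply: eq_bigr => i _; rewrite mxE mulrDr. Qed.

Lemma dotNr x y : dot x (- y) = - dot x y.
Proof. by rewrite /dot -sumrN; apply: eq_bigr => i _; rewrite mxE mulrN. Qed.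

Lemma dotBr x y z : dot x (y - z) = dot x y - dot x z.
Proof. by rewrite dotDr dotNr. Qed.

Lemma dot0r x : dot x 0 = 0.
Proof. by rewrite /dot big1// => i _; rewrite mxE mulr0. Qed.

Lemma dotC x y : dot x y = dot y x.
Proof. by apply: eq_bigr => i _; rewrite mulrC. Qed.

Lemma dot_ge0 x : 0 <= dot x x.
Proof. by apply: sumr_ge0 => i _; rewrite -expr2 sqr_ge0. Qed.

Lemma continuous_borel (g : 'rV[R]_d -> R) : continuous g ->
  measurable_fun [set: borel R d] (g : borel R d -> measurableTypeR R).
Proof.
move=> cg; apply: (measurability _ (RGenOInfty.measurableE R)) => // _ [_ [x ->] <-].
rewrite setTI; apply: sub_sigma_algebra => /=.
have /continuousP := cg; apply.
rewrite (_ : `]x, +oo[%classic = [set y | x < y]); first exact: open_gt.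
by apply/seteqP; split => y; rewrite /= in_itv/= andbT.
Qed.

Lemma measurable_coord (i : 'I_d) :
  measurable_fun [set: borel R d] ((fun l : 'rV[R]_d => l 0 i) : borel R d -> measurableTypeR R).
Proof. by apply: continuous_borel; exact: coord_continuous. Qed.

Lemma measurable_dot x : measurable_fun [set: borel R d] (fun l : borel R d => dot l x : measurableTypeR R).
Proof. by apply: measurable_sum => i; apply: measurable_funM => //; exact: measurable_coord. Qed.

End Dot.

Section Integrals.
Context {R : realType} d (T : measurableType d) (mu : {measure set T -> \bar R}).

Lemma integrable_Rsum (I : Type) (s : seq I) (F : I -> T -> R) :
  (forall i, mu.-integrable setT (EFin \o F i)) ->
  mu.-integrable setT (EFin \o (fun x => \sum_(i <- s) F i x)) /\
  \int[mu]_x (\sum_(i <- s) F i x) = \sum_(i <- s) \int[mu]_x F i x.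
Proof.
move=> iF; elim: s => [|i s [IH1 IH2]].
  have -> : (fun x => \sum_(i <- [::]) F i x) = cst 0 by apply/funext => x; rewrite big_nil.
  split; first exact: integrable0.
  by rewrite big_nil /Rintegral integral0.
have -> : (fun x => \sum_(j <- i :: s) F j x) = (fun x => F i x + \sum_(j <- s) F j x).
  by apply/funext => x; rewrite big_cons.
split; first by have := integrableD measurableT (iF i) IH1; exact.
by rewrite RintegralD// IH2 big_cons.
Qed.

Lemma Rintegral_ge0 (F : T -> R) : (forall x, 0 <= F x) -> 0 <= \int[mu]_x F x.
Proof. by move=> F0; apply: fine_ge0; apply: integral_ge0 => x _; rewrite lee_fin. Qed.

Lemma le_RintegralT (F G : T -> R) : mu.-integrable setT (EFin \o F) -> mu.-integrable setT (EFin \o G) ->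
  (forall x, F x <= G x) -> \int[mu]_x F x <= \int[mu]_x G x.
Proof.
move=> iF iG FG; rewrite -subr_ge0 -RintegralB//.
by apply: Rintegral_ge0 => x; rewrite subr_ge0.
Qed.

End Integrals.

Section WeightedKernel.
Context {R : realType} {d : nat} (nu : {finite_measure set (borel R d) -> \bar R}).
Implicit Types (w : borel R d -> R) (x : 'rV[R]_d).

Definition phase (l x : 'rV[R]_d) : R := 2 * pi * dot l x.

Lemma phaseB l x y : phase l (x - y) = phase l x - phase l y.
Proof. by rewrite /phase dotBr mulrBr. Qed.

Lemma measurable_phase x : measurable_fun [set: borel R d] (fun l => phase l x : measurableTypeR R).
Proof. by apply: measurable_funM => //; exact: measurable_dot. Qed.

(** Keeping the cosine alone symmetrises the weighted measure, so that any piece cut out of a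
    spectral measure yields a covariance. *)
Definition kernel w x : R := \int[nu]_l (w l * cos (phase l x)).

Definition bounded_weight w := measurable_fun setT w /\ forall l, 0 <= w l <= 1.

Section TrigPoly.
Variables (I : finType) (a : I -> R) (y : I -> 'rV[R]_d).

Definition trig_cos l := \sum_i a i * cos (phase l (y i)).
Definition trig_sin l := \sum_i a i * sin (phase l (y i)).
(** The squared modulus of the Fourier transform of the weights [a] placed at the points [y]. Its
    integral is the quadratic form of the kernel matrix, so bounds on covariances become pointwise
    bounds in frequency. *)
Definition trig_sqr l := trig_cos l ^+ 2 + trig_sin l ^+ 2.

Lemma trig_sqr_ge0 l : 0 <= trig_sqr l.
Proof. by rewrite addr_ge0 ?sqr_ge0. Qed.

Lemma trig_sqrE l : trig_sqr l = \sum_i \sum_j a i * a j * cos (phase l (y i - y j)).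
Proof.
rewrite /trig_sqr /trig_cos /trig_sin !expr2 !mulr_suml -big_split /=; apply: eq_bigr => i _.
rewrite !mulr_sumr -big_split /=; apply: eq_bigr => j _.
by rewrite phaseB cosB; ring.
Qed.

Lemma measurable_trig_cos : measurable_fun [set: borel R d] (trig_cos : _ -> measurableTypeR R).
Proof.
apply: measurable_sum => i; apply: measurable_funM => //; apply: measurableT_comp; last exact: measurable_phase.
by apply: continuous_measurable_fun; exact: continuous_cos.
Qed.

Lemma measurable_trig_sin : measurable_fun [set: borel R d] (trig_sin : _ -> measurableTypeR R).
Proof.
apply: measurable_sum => i; apply: measurable_funM => //; apply: measurableT_comp; last exact: measurable_phase.
by apply: continuous_measurable_fun; exact: continuous_sin.
Qed.

Lemma measurable_trig_sqr : measurable_fun [set: borel R d] (trig_sqr : _ -> measurableTypeR R).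
Proof.
by apply: measurable_funD; apply: measurable_funX; [exact: measurable_trig_cos|exact: measurable_trig_sin].
Qed.

Lemma trig_sqr_bound l : trig_sqr l <= (\sum_i `|a i|) ^+ 2.
Proof.
rewrite trig_sqrE expr2 mulr_suml; apply: ler_sum => i _.
rewrite mulr_sumr; apply: ler_sum => j _.
rewrite (le_trans (ler_norm _))// !normrM ler_piMr ?mulr_ge0//.
by rewrite ler_norml cos_geN1 cos_le1.
Qed.

End TrigPoly.

Lemma integrable_weighted w (F : borel R d -> R) (C : R) : bounded_weight w ->
  measurable_fun setT F -> (forall l, `|F l| <= C) -> nu.-integrable setT (EFin \o (fun l => w l * F l)).
Proof.
move=> [mw w01] mF FC; apply: (@bounded_integrable _ _ _ nu (fun l => w l * F l) C).
  exact: measurable_funM.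
move=> l; have /andP[w0 w1] := w01 l.
by rewrite normrM (ger0_norm w0) -[leRHS]mul1r; apply: ler_pM.
Qed.

Lemma integrable_weighted_cos w x : bounded_weight w ->
  nu.-integrable setT (EFin \o (fun l => w l * cos (phase l x))).
Proof.
move=> bw; apply: (integrable_weighted bw (C := 1)).
  apply: measurableT_comp; last exact: measurable_phase.
  by apply: continuous_measurable_fun; exact: continuous_cos.
by move=> l; rewrite ler_norml cos_geN1 cos_le1.
Qed.

Lemma integrable_weighted_trig w (I : finType) (a : I -> R) y : bounded_weight w ->
  nu.-integrable setT (EFin \o (fun l => w l * trig_sqr a y l)).
Proof.
move=> bw; apply: (integrable_weighted bw (C := (\sum_i `|a i|) ^+ 2)).
  exact: measurable_trig_sqr.
by move=> l; rewrite ger0_norm ?trig_sqr_ge0// trig_sqr_bound.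
Qed.

Definition kernel_mx w (I : finType) (y : I -> 'rV[R]_d) (i j : I) := kernel w (y i - y j).

Lemma qform_kernel w (I : finType) (y : I -> 'rV[R]_d) a : bounded_weight w ->
  qform (kernel_mx w y) a = \int[nu]_l (w l * trig_sqr a y l).
Proof.
move=> bw; rewrite /qform /kernel_mx.
have intij i j : nu.-integrable setT (EFin \o (fun l => a i * a j * (w l * cos (phase l (y i - y j))))).
  exact: (integrableZl measurableT (a i * a j) (integrable_weighted_cos (y i - y j) bw)).
transitivity (\sum_i \int[nu]_l \sum_j (a i * a j * (w l * cos (phase l (y i - y j))))).
  apply: eq_bigr => i _; rewrite (integrable_Rsum _ (intij i)).2.
  by apply: eq_bigr => j _; rewrite RintegralZl//; exact: integrable_weighted_cos.
rewrite -(integrable_Rsum _ (fun i => (integrable_Rsum _ (intij i)).1)).2.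
apply: eq_Rintegral => l _; rewrite trig_sqrE mulr_sumr; apply: eq_bigr => i _.
by rewrite mulr_sumr; apply: eq_bigr => j _; rewrite mulrCA.
Qed.

Lemma kernelN w x : kernel w (- x) = kernel w x.
Proof.
apply: eq_Rintegral => l _; congr (_ * _).
by rewrite /phase dotNr mulrN cosN.
Qed.

Lemma psd_kernel w (I : finType) (y : I -> 'rV[R]_d) : bounded_weight w -> psd (kernel_mx w y).
Proof.
move=> bw; split=> [i j|a]; first by rewrite /kernel_mx -[y j - y i]opprB kernelN.
rewrite qform_kernel//; apply: Rintegral_ge0 => l; apply: mulr_ge0; last exact: trig_sqr_ge0.
by have [_ /(_ l)/andP[]] := bw.
Qed.

Lemma bounded_weight1 : bounded_weight (fun=> 1).
Proof. by split => // l; rewrite ler01 lexx. Qed.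

Lemma bounded_weight_indic (A : set (borel R d)) : measurable A -> bounded_weight \1_A.
Proof.
move=> mA; split; first exact: measurable_indic.
by move=> l; rewrite indicE; case: (l \in A); rewrite ?ler01 ?lexx.
Qed.

Lemma bounded_weightC w : bounded_weight w -> bounded_weight (fun l => 1 - w l).
Proof.
move=> [mw w01]; split; first exact: measurable_funB.
by move=> l; have /andP[? ?] := w01 l; apply/andP; split; lra.
Qed.

Lemma kernel0 w : kernel w 0 = \int[nu]_l w l.
Proof. by apply: eq_Rintegral => l _; rewrite /phase dot0r mulr0 cos0 mulr1. Qed.

End WeightedKernel.

(** * Moments of the field and laws of finitely many sites *)

Section GaussianLaw.
Context {R : realType} d (T : measurableType d) (P : probability T R).
Local Notation RM := (measurableTypeR R).

Lemma law_integral d' (T' : measurableType d') (X : T -> T') (N : probability T' R) (g : T' -> R) :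
  measurable_fun setT X ->
  (forall A : set T', measurable A -> P (X @^-1` A) = N A) ->
  measurable_fun setT (g : T' -> RM) -> N.-integrable setT (EFin \o g) ->
  P.-integrable setT (EFin \o (g \o X)) /\ \int[P]_w g (X w) = \int[N]_x g x.
Proof.
move=> mX law mg ig.
pose X' : {mfun T >-> T'} := HB.pack X (isMeasurableFun.Build _ _ _ _ _ mX).
have mg' : measurable_fun setT (EFin \o g) by exact/measurable_EFinP.
have e h : (\int[distribution P X']_x h x = \int[N]_x h x)%E.
  by apply: eq_measure_integral => A mA _; exact: law.
have ig2 : P.-integrable setT (EFin \o (g \o X)).
  have /integrableP[_ h] := ig; apply/integrableP; split.
    by apply/measurable_EFinP; exact: measurableT_comp.
  move: h; rewrite -e (@ge0_integral_distribution _ _ _ _ _ _ X')//.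
  by apply: measurableT_comp.
split => //; rewrite /Rintegral; congr fine.
by rewrite -[RHS]e (@integral_distribution _ _ _ _ _ _ X').
Qed.

Lemma gaussian_law_moments (X : T -> R) (m s : R) : measurable_fun setT (X : T -> RM) ->
  (forall A : set RM, measurable A -> P [set w | A (X w)] = gaussian_law m s A) ->
  [/\ P.-integrable setT (EFin \o X), \int[P]_w X w = m,
      P.-integrable setT (EFin \o (fun w => (X w - m) ^+ 2)), \int[P]_w (X w - m) ^+ 2 = s ^+ 2 &
      \int[P]_w cos (X w - m) = expR (- s ^+ 2 / 2) /\ \int[P]_w sin (X w - m) = 0].
Proof.
move=> mX law.
have mB : measurable_fun setT ((fun x => x - m) : RM -> RM) by exact: measurable_funB.
have mS : measurable_fun setT ((fun x => (x - m) ^+ 2) : RM -> RM) by exact: measurable_funX.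
have mc : measurable_fun setT ((fun x => cos (x - m)) : RM -> RM).
  by apply: measurableT_comp => //; apply: continuous_measurable_fun; exact: continuous_cos.
have ms : measurable_fun setT ((fun x => sin (x - m)) : RM -> RM).
  by apply: measurableT_comp => //; apply: continuous_measurable_fun; exact: continuous_sin.
suff [N [law' [iB eB] [iS eS] [ec es]]] : exists N : probability RM R,
    [/\ forall A : set RM, measurable A -> P [set w | A (X w)] = N A,
     N.-integrable setT (EFin \o (fun x => x - m)) /\ \int[N]_x (x - m) = 0,
     N.-integrable setT (EFin \o (fun x => (x - m) ^+ 2)) /\ \int[N]_x (x - m) ^+ 2 = s ^+ 2 &
     \int[N]_x cos (x - m) = expR (- s ^+ 2 / 2) /\ \int[N]_x sin (x - m) = 0].
  have [h1 h2] := law_integral mX law' mB iB.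
  have [h3 h4] := law_integral mX law' mS iS.
  have [_ h5] := law_integral mX law' mc (Rint_cos N mB).
  have [_ h6] := law_integral mX law' ms (Rint_sin N mB).
  have im : P.-integrable setT (EFin \o (fun=> m)).
    by apply: (@bounded_integrable _ _ _ P (fun=> m) `|m|).
  have eX : X = (fun w => (X w - m) + m) by apply/funext => w; rewrite subrK.
  split => //.
  - by rewrite eX; exact: (integrableD measurableT h1 im).
  - rewrite {1}eX RintegralD// h2 eB add0r Rintegral_cst//.
    by rewrite [X in fine X]probability_setT mulr1.
  - by rewrite h4.
  - by rewrite h5 h6.
have [s0|s0] := eqVneq s 0.
  have dE (h : RM -> RM) : measurable_fun setT h ->
      (dirac (m : RM) : probability RM R).-integrable setT (EFin \o h) /\
      \int[(dirac (m : RM) : probability RM R)]_x h x = h m.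
    move=> mh; have mh' : measurable_fun setT (EFin \o h) by exact/measurable_EFinP.
    split; last by rewrite /Rintegral integral_dirac// diracT mul1e.
    apply/integrableP; split => //.
    by rewrite integral_dirac//; [rewrite diracT mul1e ltry|exact: measurableT_comp].
  exists (dirac (m : RM) : probability RM R); rewrite s0; split.
  - by move=> A mA; rewrite law// /gaussian_law s0 eqxx.
  - by have [h1 h2] := dE _ mB; split => //; rewrite h2 subrr.
  - by have [h1 h2] := dE _ mS; split => //; rewrite h2 subrr.
  - have [_ ->] := dE _ mc; have [_ ->] := dE _ ms.
    by rewrite subrr cos0 sin0 expr0n oppr0 mul0r expR0.
exists (normal_prob m s); split.
- by move=> A mA; rewrite law// /gaussian_law (negPf s0).
- exact: normal_mean.
- exact: normal_second.
- have := normal_char_cos m s0 1; have := normal_char_sin m s0 1.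
  by under eq_Rintegral do rewrite mul1r; move=> ->; under eq_Rintegral do rewrite mul1r; rewrite expr1n mulr1.
Qed.

(** Stationarity is expressed on rectangles; these form a pi-system generating the product
    sigma-algebra, so the joint laws agree and so do the mixed moments. *)
Lemma joint_law_product (X1 X2 Y1 Y2 : T -> R) :
  measurable_fun setT (X1 : T -> RM) -> measurable_fun setT (X2 : T -> RM) ->
  measurable_fun setT (Y1 : T -> RM) -> measurable_fun setT (Y2 : T -> RM) ->
  (forall A B : set RM, measurable A -> measurable B ->
     P [set w | A (X1 w) /\ B (X2 w)] = P [set w | A (Y1 w) /\ B (Y2 w)]) ->
  P.-integrable setT (EFin \o (fun w => X1 w * X2 w)) ->
  P.-integrable setT (EFin \o (fun w => Y1 w * Y2 w)) ->
  \int[P]_w (X1 w * X2 w) = \int[P]_w (Y1 w * Y2 w).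
Proof.
move=> mX1 mX2 mY1 mY2 law iX iY.
pose X w : RM * RM := (X1 w, X2 w); pose Y w : RM * RM := (Y1 w, Y2 w).
have mX : measurable_fun setT X by exact: measurable_fun_pair.
have mY : measurable_fun setT Y by exact: measurable_fun_pair.
pose G : set (set (RM * RM)) := [set A `*` B | A in measurable & B in measurable].
pose Y' : {mfun T >-> (RM * RM)%type} := HB.pack Y (isMeasurableFun.Build _ _ _ _ _ mY).
pose X' : {mfun T >-> (RM * RM)%type} := HB.pack X (isMeasurableFun.Build _ _ _ _ _ mX).
have e (A : set (RM * RM)) : measurable A -> P (X @^-1` A) = distribution P Y' A.
  move=> mA.
  apply: (@measure_unique _ _ _ G (fun=> setT) (measurable_prod_measurableType _ _) _ _ _
    (distribution P X') (distribution P Y') _ _ A mA).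
  - move=> _ _ [A1 mA1 [B1 mB1 <-]] [A2 mA2 [B2 mB2 <-]].
    exists (A1 `&` A2); first exact: measurableI.
    by exists (B1 `&` B2); [exact: measurableI|rewrite setXI].
  - by move=> _; exists setT => //; exists setT => //; rewrite setXTT.
  - by rewrite bigcup_const.
  - by move=> _ [A1 mA1 [B1 mB1 <-]]; exact: law.
  - by move=> _; rewrite -[X in (X < _)%E]/(P setT) [X in (X < _)%E]probability_setT ltry.
pose g (z : RM * RM) : R := z.1 * z.2.
have mg : measurable_fun setT (g : _ -> RM).
  by apply: measurable_funM; [exact: measurable_fst|exact: measurable_snd].
have mg' : measurable_fun setT (EFin \o g) by exact/measurable_EFinP.
have iN : (distribution P Y').-integrable setT (EFin \o g).
  apply/integrableP; split => //.
  rewrite (@ge0_integral_distribution _ _ _ _ _ _ Y')//; last by apply: measurableT_comp.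
  by have /integrableP[] := iY.
have [_ ->] := law_integral mX e mg iN.
by rewrite /Rintegral (@integral_distribution _ _ _ _ _ _ Y').
Qed.

End GaussianLaw.

Section FieldVectors.
Context {R : realType} {d : nat} {D : domain}.
Context {disp : measure_display} {Omega : measurableType disp}.
Variables (P : probability Omega R) (f : site R d D -> {RV P >-> R}).
Variable mu : {finite_measure set (borel R d) -> \bar R}.
Hypotheses (f_SGF : SGF f) (f_mu : spectral_measure f mu).
Local Notation RM := (measurableTypeR R).

Lemma covariance_kernelE x : covariance_kernel f x = kernel mu (fun=> 1) (pos x).
Proof.
have := spectral_fourier f_mu x; rewrite /fourier /cintegral => -[-> _].
apply: eq_Rintegral => l _; rewrite mul1r /cis /=.
by rewrite !mul1r mul0r subr0 cosN.
Qed.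

Let mf x : measurable_fun setT (f x : Omega -> RM) := measurable_funP (f x).

Lemma field_moments x : exists s,
  P.-integrable setT (EFin \o f x) /\ \int[P]_w f x w = 0 /\
  P.-integrable setT (EFin \o (fun w => f x w ^+ 2)) /\
  (forall A : set RM, measurable A -> P [set w | A (f x w)] = gaussian_law 0 s A).
Proof.
have [m [s law]] := SGF_gaussian f_SGF (fun _ : 'I_1 => x) (fun=> 1).
have law' (A : set RM) : measurable A -> P [set w | A (f x w)] = gaussian_law m s A.
  by move=> mA; rewrite -law//; congr (P _); apply/seteqP; split => w /=; rewrite big_ord1 mul1r.
have [h1 h2 h3 _ _] := gaussian_law_moments (mf x) law'.
have m0 : m = 0.
  by rewrite -h2 /Rintegral; have := SGF_centred f_SGF x; rewrite unlock /expectation => ->.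
exists s; rewrite -m0; split => //; split => //; split => //.
by move: h3; rewrite m0; under eq_fun do rewrite /= subr0.
Qed.

Lemma field_integrable_prod x y : P.-integrable setT (EFin \o (fun w => f x w * f y w)).
Proof.
have [_ [_ [_ [hx _]]]] := field_moments x; have [_ [_ [_ [hy _]]]] := field_moments y.
apply: (le_integrable measurableT _ _ (integrableD measurableT hx hy)).
  by apply/measurable_EFinP; exact: measurable_funM.
move=> w _ /=; rewrite lee_fin normrM [leRHS]ger0_norm; last by rewrite addr_ge0 ?sqr_ge0.
rewrite -(real_normK (num_real (f x w))) -(real_normK (num_real (f y w))).
have := normr_ge0 (f x w); have := normr_ge0 (f y w); nra.
Qed.

Lemma field_covariance x y : \int[P]_w (f x w * f y w) = covariance_kernel f (y - x).
Proof.
rewrite /covariance_kernel unlock /expectation -/(Rintegral _ _ _).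
apply/esym; apply: joint_law_product; try exact: mf; last 2 first.
- exact: field_integrable_prod.
- exact: field_integrable_prod.
move=> A B mA mB.
pose xs (i : 'I_2) : site R d D := if i == 0 then 0 else y - x.
pose As (i : 'I_2) := if i == 0 then A else B.
have mAs i : measurable (As i) by rewrite /As; case: ifP.
have := SGF_stationary f_SGF xs x mAs.
have E (t : site R d D) : [set w | forall i, As i (f (xs i + t) w)] =
    [set w | A (f (0 + t) w) /\ B (f (y - x + t) w)].
  apply/seteqP; split => w /=; first by move=> h; split; [exact: (h 0)|exact: (h 1)].
  by move=> [h1 h2] i; rewrite /As /xs; case: ifP.
rewrite E add0r subrK => ->; congr (P _).
apply/seteqP; split => w /=; first by move=> [h1 h2] i; rewrite /As /xs; case: ifP.
by move=> h; split; [exact: (h 0)|exact: (h 1)].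
Qed.

Lemma posB (x y : site R d D) : pos (x - y) = pos x - pos y.
Proof.
case: D x y => x y //=; apply/rowP => i; rewrite !mxE.
by rewrite intrD mulrNz.
Qed.

(** Each linear combination has a one-dimensional Gaussian law; its mean vanishes because the field
    is centred and its variance is the quadratic form of the covariance, which [field_covariance]
    reads off stationarity. *)
Lemma field_gauss_vec (I : finType) (y : I -> site R d D) :
  gauss_vec P (fun i w => f (y i) w) (kernel_mx mu (fun=> 1) (fun i => pos (y i))).
Proof.
have key (a : I -> R) : \int[P]_w cos (\sum_i a i * f (y i) w) =
    expR (- qform (kernel_mx mu (fun=> 1) (fun i => pos (y i))) a / 2) /\
    \int[P]_w sin (\sum_i a i * f (y i) w) = 0.
  pose X w := \sum_i a i * f (y i) w.
  have mX : measurable_fun setT (X : _ -> RM).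
    by apply: measurable_sum => i; apply: measurable_funM => //; exact: mf.
  have [m [s law]] := SGF_gaussian f_SGF (fun k : 'I_#|I| => y (enum_val k)) (fun k => a (enum_val k)).
  have law' (A : set RM) : measurable A -> P [set w | A (X w)] = gaussian_law m s A.
    move=> mA; rewrite -law//; congr (P _).
    have eX w : X w = \sum_(k < #|I|) a (enum_val k) * f (y (enum_val k)) w.
      by rewrite -(big_enum_val (fun i => a i * f (y i) w)); apply: eq_bigl => i; rewrite inE.
    by apply/seteqP; split => w /=; rewrite eX.
  have [h1 h2 h3 h4 [h5 h6]] := gaussian_law_moments mX law'.
  have iF i : P.-integrable setT (EFin \o (fun w => a i * f (y i) w)).
    have [_ [hi _]] := field_moments (y i).
    exact: (integrableZl measurableT (a i) hi).
  have m0 : m = 0.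
    rewrite -h2 /X (integrable_Rsum _ iF).2 big1// => i _.
    have [_ [hi [ei _]]] := field_moments (y i).
    by rewrite RintegralZl// ei mulr0.
  have iFF i j : P.-integrable setT (EFin \o (fun w => a i * a j * (f (y i) w * f (y j) w))).
    exact: (integrableZl measurableT (a i * a j) (field_integrable_prod (y i) (y j))).
  have s2 : s ^+ 2 = qform (kernel_mx mu (fun=> 1) (fun i => pos (y i))) a.
    rewrite -h4 m0.
    transitivity (\int[P]_w \sum_i \sum_j (a i * a j * (f (y i) w * f (y j) w))).
      apply: eq_Rintegral => w _; rewrite subr0 /X expr2 mulr_suml; apply: eq_bigr => i _.
      by rewrite mulr_sumr; apply: eq_bigr => j _; ring.
    rewrite (integrable_Rsum _ (fun i => (integrable_Rsum _ (iFF i)).1)).2.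
    apply: eq_bigr => i _; rewrite (integrable_Rsum _ (iFF i)).2; apply: eq_bigr => j _.
    rewrite RintegralZl//; last exact: field_integrable_prod.
    by rewrite field_covariance covariance_kernelE posB /kernel_mx -(opprB (pos (y i))) kernelN.
  rewrite -s2; move: h5 h6; rewrite m0.
  by under eq_Rintegral do rewrite subr0; move=> ->; under eq_Rintegral do rewrite subr0; move=> ->.
split => [i|a|a]; [exact: mf|exact: (key a).1|exact: (key a).2].
Qed.

End FieldVectors.

(** * Capacity and energy *)

Section Enorm.
Context {R : realType} {d : nat}.
Implicit Types x y : 'rV[R]_d.

Lemma enorm_ge0 x : 0 <= enorm x. Proof. exact: sqrtr_ge0. Qed.

Lemma enorm_sqr x : enorm x ^+ 2 = dot x x.
Proof. by rewrite sqr_sqrtr// dot_ge0. Qed.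

Lemma dotDl x y z : dot (x + y) z = dot x z + dot y z.
Proof. by rewrite dotC dotDr !(dotC z). Qed.

Lemma dotZr (a : R) x y : dot x (a *: y) = a * dot x y.
Proof. by rewrite /dot mulr_sumr; apply: eq_bigr => i _; rewrite mxE mulrCA. Qed.

Lemma dotZl (a : R) x y : dot (a *: x) y = a * dot x y.
Proof. by rewrite dotC dotZr dotC. Qed.

Lemma dot_sqr_le x y : dot x y ^+ 2 <= dot x x * dot y y.
Proof.
have h (t : R) : 0 <= dot x x + 2 * t * dot x y + t ^+ 2 * dot y y.
  have := dot_ge0 (x + t *: y).
  by rewrite dotDr !dotDl !dotZr !dotZl (dotC y x) [X in _ + _ + X](_ : _ = t * dot x y + t ^+ 2 * dot y y); [lra|ring].
have [y0|yN] := eqVneq (dot y y) 0.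
  have [->|n0] := eqVneq (dot x y) 0; first by rewrite expr0n mulr_ge0 ?dot_ge0.
  have := h (- (dot x x + 1) / (2 * dot x y)); rewrite y0.
  have -> : 2 * (- (dot x x + 1) / (2 * dot x y)) * dot x y = - (dot x x + 1) by field.
  by rewrite mulr0; lra.
have y0 : 0 < dot y y by rewrite lt_neqAle eq_sym yN dot_ge0.
have := h (- dot x y / dot y y).
have -> : dot x x + 2 * (- dot x y / dot y y) * dot x y + (- dot x y / dot y y) ^+ 2 * dot y y =
  (dot x x * dot y y - dot x y ^+ 2) / dot y y by field.
by rewrite pmulr_lge0 ?invr_gt0// subr_ge0.
Qed.

Lemma dot_le x y : `|dot x y| <= enorm x * enorm y.
Proof.
rewrite -ler_sqr ?nnegrE ?mulr_ge0 ?enorm_ge0// exprMn !enorm_sqr real_normK ?num_real//.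
exact: dot_sqr_le.
Qed.

Lemma enormD x y : enorm (x + y) <= enorm x + enorm y.
Proof.
rewrite -ler_sqr ?nnegrE ?addr_ge0 ?enorm_ge0// enorm_sqr sqrrD !enorm_sqr.
rewrite dotDr !dotDl (dotC y x).
have := dot_le x y; rewrite ler_norml => /andP[_]; lra.
Qed.

Lemma enormZ (a : R) x : enorm (a *: x) = `|a| * enorm x.
Proof. by rewrite /enorm dotZr dotZl mulrA -expr2 sqrtrM ?sqr_ge0// sqrtr_sqr. Qed.

Lemma enormN x : enorm (- x) = enorm x.
Proof. by rewrite -scaleN1r enormZ normrN1 mul1r. Qed.

Lemma enorm0 : enorm (0 : 'rV[R]_d) = 0.
Proof. by rewrite /enorm dot0r sqrtr0. Qed.

Lemma coord_le_enorm x i : `|x 0 i| <= enorm x.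
Proof.
rewrite -ler_sqr ?nnegrE ?enorm_ge0// enorm_sqr real_normK ?num_real//.
by rewrite /dot (bigD1 i)//= -expr2 lerDl sumr_ge0// => j _; rewrite -expr2 sqr_ge0.
Qed.

Lemma enorm_le_coord x (c : R) : (forall i, `|x 0 i| <= c) -> enorm x <= Num.sqrt d%:R * c.
Proof.
move=> h; have [d0|d0] := posnP d.
  rewrite /enorm /dot big1; first by rewrite d0 sqrtr0 mul0r.
  by move=> i _; have := ltn_ord i; rewrite [X in (_ < X)%N]d0 ltn0.
have c0 : 0 <= c by rewrite (le_trans _ (h (Ordinal d0))).
rewrite -ler_sqr ?nnegrE ?mulr_ge0 ?enorm_ge0 ?sqrtr_ge0// enorm_sqr exprMn sqr_sqrtr// /dot.
apply: (@le_trans _ _ (\sum_(i < d) c ^+ 2)).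
  by apply: ler_sum => i _; rewrite -expr2 -(real_normK (num_real (x 0 i))) ler_sqr ?nnegrE.
by rewrite sumr_const card_ord mulr_natl.
Qed.

Lemma measurable_enorm : measurable_fun [set: borel R d] (enorm : borel R d -> measurableTypeR R).
Proof.
apply: measurableT_comp; first by apply: continuous_measurable_fun; exact: sqrt_continuous.
by apply: measurable_sum => i; apply: measurable_funM; exact: measurable_coord.
Qed.

Lemma measurable_cball (r : R) : measurable (cball r : set (borel R d)).
Proof. by have := measurable_enorm measurableT (measurable_lray r); rewrite setTI. Qed.

End Enorm.

Section Periodicity.
Context {R : realType}.

Lemma cosDint (x : R) (k : int) : cos (x + 2 * pi * k%:~R) = cos x.
Proof.
have nat_case (y : R) (n : nat) : cos (y + 2 * pi * n%:R) = cos y.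
  elim: n => [|n IH]; first by rewrite mulr0 addr0.
  rewrite (_ : y + 2 * pi * n.+1%:R = (y + 2 * pi * n%:R) + pi *+ 2); first by rewrite cosD2pi.
  by rewrite mulr2n; ring.
case: k => n; first exact: nat_case.
by rewrite NegzE mulrNz mulrN -(nat_case (x - _) n.+1) subrK.
Qed.

Lemma sinDint (x : R) (k : int) : sin (x + 2 * pi * k%:~R) = sin x.
Proof.
have nat_case (y : R) (n : nat) : sin (y + 2 * pi * n%:R) = sin y.
  elim: n => [|n IH]; first by rewrite mulr0 addr0.
  rewrite (_ : y + 2 * pi * n.+1%:R = (y + 2 * pi * n%:R) + pi *+ 2); first by rewrite sinD2pi.
  by rewrite mulr2n; ring.
case: k => n; first exact: nat_case.
by rewrite NegzE mulrNz mulrN -(nat_case (x - _) n.+1) subrK.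
Qed.

Lemma norm_sin_le (x : R) : `|sin x| <= `|x|.
Proof.
wlog x0 : x / 0 <= x => [h|].
  by have [/h//|x0] := leP 0 x; rewrite -normrN -sinN -(normrN x); apply: h; lra.
have [xE|xN] := eqVneq x 0; first by rewrite xE sin0.
have x1 : 0 < x by rewrite lt_neqAle eq_sym xN.
have ds (y : R) : y \in `]0, x[ -> is_derive y 1 sin (cos y) by move=> _; exact: is_derive_sin.
have [c _] := MVT x1 ds (continuous_subspaceT (@continuous_sin R)).
rewrite sin0 !subr0 => ->; rewrite normrM ler_piMl//.
by rewrite ler_norml cos_geN1 cos_le1.
Qed.

Lemma cos_ge_quadratic (x : R) : 1 - x ^+ 2 / 2 <= cos x.
Proof.
have e : cos x = 1 - 2 * sin (x / 2) ^+ 2.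
  rewrite -[X in cos X](_ : (x / 2) *+ 2 = x); last by rewrite mulr2n; field.
  by rewrite cos_mulr2n cos2sin2; ring.
have : `|sin (x / 2)| ^+ 2 <= `|x / 2| ^+ 2 by rewrite ler_sqr ?nnegrE// norm_sin_le.
rewrite !real_normK ?num_real// e exprMn => h; have : 2^-1 ^+ 2 = 4^-1 :> R by field.
by move=> h'; rewrite h' in h; lra.
Qed.

End Periodicity.

Lemma sum_option {R : realType} (I : finType) (F : option I -> R) :
  \sum_(o : option I) F o = F None + \sum_i F (Some i).
Proof.
rewrite (bigD1 None)//=; congr (_ + _).
rewrite (reindex_omap Some id) /=; last by case.
by apply: eq_bigl => i; rewrite eqxx.
Qed.

Section Capacity.
Context {R : realType} {d : nat} {D : domain}.
Context {disp : measure_display} {Omega : measurableType disp}.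
Variables (P : probability Omega R) (f : site R d D -> {RV P >-> R}).
Variable mu : {finite_measure set (borel R d) -> \bar R}.
Hypotheses (f_SGF : SGF f) (f_mu : spectral_measure f mu).
Local Notation RM := (measurableTypeR R).

Definition wprob (I : finType) (a : I -> R) := (forall i, 0 <= a i) /\ \sum_i a i = 1.

Definition energy (I : finType) (a : I -> R) (y : I -> site R d D) :=
  \int[mu]_l trig_sqr a (fun i => pos (y i)) l.

Lemma integrable_trig_sqr (I : finType) (a : I -> R) (y : I -> 'rV[R]_d) :
  mu.-integrable setT (EFin \o trig_sqr a y).
Proof.
by have := integrable_weighted_trig mu a y bounded_weight1; under eq_fun do rewrite /= mul1r.
Qed.

Lemma energy_ge0 (I : finType) (a : I -> R) (y : I -> site R d D) : 0 <= energy a y.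
Proof. by apply: Rintegral_ge0 => l; exact: trig_sqr_ge0. Qed.

Lemma energy_qform (I : finType) (a : I -> R) (y : I -> site R d D) :
  energy a y = qform (kernel_mx mu (fun=> 1) (fun i => pos (y i))) a.
Proof.
rewrite qform_kernel; last exact: bounded_weight1.
by apply: eq_Rintegral => l _; rewrite mul1r.
Qed.

Lemma integrable_sin_phase x : mu.-integrable setT (EFin \o (fun l => sin (phase l x))).
Proof. by apply: Rint_sin; exact: measurable_phase. Qed.

Lemma integrable_cos_phase x : mu.-integrable setT (EFin \o (fun l => cos (phase l x))).
Proof. by apply: Rint_cos; exact: measurable_phase. Qed.

Lemma Rintegral_sin_phase (x : site R d D) : \int[mu]_l sin (phase l (pos x)) = 0.
Proof.
have := spectral_fourier f_mu x; rewrite /fourier /cintegral => -[_ /esym h].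
rewrite -[RHS]oppr0 -[in RHS]h -mulN1r -RintegralZl//; last first.
  under eq_fun do rewrite /= mul1r mul0r addr0.
  by apply: (Rint_sin mu (f := fun l => - phase l (pos x))); apply: measurableT_comp => //; exact: measurable_phase.
by apply: eq_Rintegral => l _; rewrite /= mul1r mul0r addr0 sinN mulN1r opprK.
Qed.

Lemma rkhs_eval (h : site R d D -> R) g : rkhs_repr mu h g -> forall x,
  h x = \int[mu]_l (complex.Re (g l) * cos (phase l (pos x)) + complex.Im (g l) * sin (phase l (pos x))).
Proof.
move=> [_ _ hg] x; have := hg x; rewrite /fourier /cintegral => -[-> _].
apply: eq_Rintegral => l _; case: (g l) => a b /=.
by rewrite cosN sinN mulrN opprK.
Qed.

Lemma rkhs_integrable (h : site R d D -> R) g : rkhs_repr mu h g ->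
  mu.-integrable setT (EFin \o (fun l => sqr_modulus (g l))) /\
  forall x : site R d D, mu.-integrable setT
    (EFin \o (fun l => complex.Re (g l) * cos (phase l (pos x)) + complex.Im (g l) * sin (phase l (pos x)))).
Proof.
move=> [[mre mim fin] _ _].
have mq : measurable_fun setT (fun l : borel R d => sqr_modulus (g l)).
  by apply: measurable_funD; exact: measurable_funX.
have i1 : mu.-integrable setT (EFin \o (fun l => sqr_modulus (g l))).
  apply/integrableP; split; first exact/measurable_EFinP.
  move: fin; rewrite /sqr_L2norm; congr (_ < _)%E.
  apply: eq_integral => l _ /=; rewrite ger0_norm//.
  by rewrite addr_ge0 ?sqr_ge0.
split=> // x.
have i2 : mu.-integrable setT (EFin \o (fun=> 1 : R)).
  by apply: (@bounded_integrable _ _ _ mu (fun=> 1) 1) => // l; rewrite normr1.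
have i3 := integrableD measurableT i2 i1.
apply: (le_integrable measurableT _ _ i3).
  apply/measurable_EFinP; apply: measurable_funD; apply: measurable_funM => //.
    apply: measurableT_comp; last exact: measurable_phase.
    by apply: continuous_measurable_fun; exact: continuous_cos.
  apply: measurableT_comp; last exact: measurable_phase.
  by apply: continuous_measurable_fun; exact: continuous_sin.
move=> l _ /=; rewrite lee_fin [leRHS]ger0_norm; last by rewrite /sqr_modulus !addr_ge0 ?sqr_ge0.
rewrite /sqr_modulus; move: (complex.Re (g l)) (complex.Im (g l)) => a b.
have := cos2Dsin2 (phase l (pos x)); set c := cos _; set s := sin _ => cs.
have := sqr_ge0 (a - c); have := sqr_ge0 (a + c); have := sqr_ge0 (b - s); have := sqr_ge0 (b + s).
have := sqr_ge0 a; have := sqr_ge0 b; rewrite !sqrrD !sqrrN !mulrN ler_norml => *; apply/andP; split; lra.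
Qed.

(* Cauchy-Schwarz between the representing function and the Fourier transform of the weights,
   in the additive form [2 u v <= e u^2 + v^2 / e]. *)
Lemma capacity_ge (I : finType) (a : I -> R) (y : I -> site R d D) (A : set 'rV[R]_d) (e : R) :
  wprob a -> (forall i, A (pos (y i))) -> 0 < e -> energy a y <= e ->
  ((e^-1)%:E <= capacity D mu A)%E.
Proof.
move=> [a0 a1] Ay e0 Ee; apply: le_ereal_inf_tmp => _ [h [g [rk hA ->]]].
have [ig ix] := rkhs_integrable rk; have hE := rkhs_eval rk.
have -> : sqr_L2norm mu g = (\int[mu]_l sqr_modulus (g l))%:E.
  rewrite /Rintegral fineK//; have [[_ _ fin] _ _] := rk.
  by rewrite ge0_fin_numE//; apply: integral_ge0 => l _; rewrite lee_fin addr_ge0 ?sqr_ge0.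
set G := Rintegral _ _ _; rewrite lee_fin.
suff : 2 <= e * G + 1 by move=> h'; rewrite -[e^-1]mulr1 ler_pdivrMl//; lra.
have h1 : 1 <= \sum_i a i * h (y i).
  by rewrite -a1; apply: ler_sum => i _; rewrite -{1}[a i]mulr1 ler_wpM2l// hA.
have iax i : mu.-integrable setT (EFin \o (fun l => a i *
   (complex.Re (g l) * cos (phase l (pos (y i))) + complex.Im (g l) * sin (phase l (pos (y i)))))).
  exact: (integrableZl measurableT (a i) (ix (y i))).
have h2 : \sum_i a i * h (y i) = \int[mu]_l (\sum_i a i *
   (complex.Re (g l) * cos (phase l (pos (y i))) + complex.Im (g l) * sin (phase l (pos (y i))))).
  rewrite (integrable_Rsum _ iax).2; apply: eq_bigr => i _.
  by rewrite RintegralZl// -hE.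
have i1 : mu.-integrable setT (EFin \o (fun l => e * sqr_modulus (g l))).
  exact: (integrableZl measurableT e ig).
have i2 : mu.-integrable setT (EFin \o (fun l => e^-1 * trig_sqr a (fun i => pos (y i)) l)).
  exact: (integrableZl measurableT e^-1 (integrable_trig_sqr a (fun i => pos (y i)))).
have h3 : 2 * (\sum_i a i * h (y i)) <= e * G + e^-1 * energy a y.
  rewrite h2 -RintegralZl//; last exact: (integrable_Rsum _ iax).1.
  rewrite /G /energy -!RintegralZl//; last exact: integrable_trig_sqr.
  rewrite -RintegralD//; apply: le_RintegralT.
  - exact: (integrableZl measurableT 2 (integrable_Rsum _ iax).1).
  - exact: (integrableD measurableT i1 i2).
  move=> l; set S := \sum_i _.
  have -> : S = complex.Re (g l) * trig_cos a (fun i => pos (y i)) l + complex.Im (g l) * trig_sin a (fun i => pos (y i)) l.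
    rewrite /S /trig_cos /trig_sin !mulr_sumr -big_split /=; apply: eq_bigr => i _; ring.
  rewrite /trig_sqr /sqr_modulus.
  move: (complex.Re _) (complex.Im _) (trig_cos _ _ _) (trig_sin _ _ _) => u v c s.
  rewrite -subr_ge0.
  have -> : e * (u ^+ 2 + v ^+ 2) + e^-1 * (c ^+ 2 + s ^+ 2) - 2 * (u * c + v * s) =
    e^-1 * ((e * u - c) ^+ 2 + (e * v - s) ^+ 2) by field; exact: lt0r_neq0.
  by apply: mulr_ge0; [rewrite invr_ge0 ltW|apply: addr_ge0; exact: sqr_ge0].
have h4 : e^-1 * energy a y <= 1 by rewrite ler_pdivrMl// mulr1.
lra.
Qed.

Definition potential (I : finType) (a : I -> R) (y : I -> site R d D) (x : site R d D) :=
  \sum_i a i * kernel mu (fun=> 1) (pos x - pos (y i)).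

(** On the torus, negation is followed by an integer translation back to the cell, which changes the
    phase at an integer site by a multiple of 2 pi. *)
Lemma pos_int_phase (l : 'rV[R]_d) (y : site R d D) : exists k : int,
  phase (spectral_opp D l) (pos y) = - phase l (pos y) + 2 * pi * k%:~R.
Proof.
case: D y => y /=.
  by exists 0; rewrite mulr0 addr0 /phase dotC dotNr dotC mulrN.
exists (- \sum_i Num.floor (- l 0 i + 2^-1) * y 0 i)%R.
rewrite /phase -mulrN -mulrDr; congr (_ * _).
rewrite mulrNz rmorph_sum /= /dot -sumrN -sumrB; apply: eq_bigr => i _.
by rewrite !mxE intrM; ring.
Qed.

(** The potential of the weights lies in the reproducing kernel Hilbert space, represented by their
    Fourier transform, and its squared norm is the energy; dividing by [k] makes it admissible. *)
Lemma capacity_le (I : finType) (a : I -> R) (y : I -> site R d D) (A : set 'rV[R]_d) (k : R) :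
  0 < k -> (forall x, A (pos x) -> k <= potential a y x) ->
  (capacity D mu A <= (energy a y / k ^+ 2)%:E)%E.
Proof.
move=> k0 hA; apply: ereal_inf_lbound.
pose z i := pos (y i).
pose g l : R[i] := ((trig_cos a z l / k) +i* (trig_sin a z l / k))%C.
have mc : measurable_fun setT (fun l : borel R d => trig_cos a z l / k : RM).
  by apply: measurable_funM => //; exact: measurable_trig_cos.
have ms : measurable_fun setT (fun l : borel R d => trig_sin a z l / k : RM).
  by apply: measurable_funM => //; exact: measurable_trig_sin.
have sm l : sqr_modulus (g l) = k ^- 2 * trig_sqr a z l.
  by rewrite /sqr_modulus /= /trig_sqr !expr_div_n; field; exact: lt0r_neq0.
have nE : sqr_L2norm mu g = (energy a y / k ^+ 2)%:E.
  rewrite /sqr_L2norm; under eq_integral do rewrite sm.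
  rewrite /energy mulrC -RintegralZl//; last exact: integrable_trig_sqr.
  rewrite /Rintegral fineK//.
  apply: integrable_fin_num => //.
  exact: (integrableZl measurableT (k ^- 2) (integrable_trig_sqr a z)).
exists (fun x => potential a y x / k), g; split => //; last first.
  by move=> x Ax; rewrite ler_pdivlMr// mul1r hA.
split.
- by split => //; rewrite nE ltry.
- apply: aeW => l; rewrite /g /=; apply/eqP; rewrite eq_complex /=; apply/andP; split; apply/eqP.
    congr (_ / _); apply: eq_bigr => i _; have [n ->] := pos_int_phase l (y i).
    by rewrite cosDint cosN.
  rewrite -mulNr; congr (_ / _); rewrite /trig_sin -sumrN; apply: eq_bigr => i _.
  by have [n ->] := pos_int_phase l (y i); rewrite sinDint sinN mulrN.
- move=> x.
  have ic i : mu.-integrable setT (EFin \o (fun l => a i / k * cos (phase l (pos x - z i)))).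
    exact: (integrableZl measurableT (a i / k) (integrable_cos_phase _)).
  have isn i : mu.-integrable setT (EFin \o (fun l => a i / k * sin (phase l (z i - pos x)))).
    exact: (integrableZl measurableT (a i / k) (integrable_sin_phase _)).
  apply/eqP; rewrite eq_complex /=; apply/andP; split; apply/eqP.
    transitivity (\int[mu]_l \sum_i (a i / k * cos (phase l (pos x - z i)))).
      rewrite (integrable_Rsum _ ic).2 /potential mulr_suml; apply: eq_bigr => i _.
      rewrite RintegralZl//; last exact: integrable_cos_phase.
      rewrite mulrAC; congr (_ * _); by apply: eq_Rintegral => l _; rewrite mul1r.
    apply: eq_Rintegral => l _; rewrite cosN sinN mulrN opprK.
    rewrite /trig_cos /trig_sin !mulr_suml -big_split /=; apply: eq_bigr => i _.
    by rewrite phaseB cosB -/(phase l (pos x)); ring.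
  transitivity (\int[mu]_l \sum_i (a i / k * sin (phase l (z i - pos x)))).
    rewrite (integrable_Rsum _ isn).2 big1// => i _.
    rewrite RintegralZl//; last exact: integrable_sin_phase.
    by rewrite /z -posB Rintegral_sin_phase mulr0.
  apply: eq_Rintegral => l _; rewrite cosN sinN.
  rewrite /trig_cos /trig_sin !mulr_suml -big_split /=; apply: eq_bigr => i _.
  by rewrite phaseB sinB -/(phase l (pos x)); ring.
Qed.

Lemma bform_potential (I : finType) (a : I -> R) (y : I -> site R d D) (x : site R d D) (t : R) :
  energy (fun o : option I => if o is Some i then (1 - t) * a i else t)
         (fun o => if o is Some i then y i else x) =
  (1 - t) ^+ 2 * energy a y + 2 * t * (1 - t) * potential a y x + t ^+ 2 * kernel mu (fun=> 1) 0.
Proof.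
rewrite !energy_qform /qform sum_option /= sum_option /= /kernel_mx subrr.
have h1 : \sum_i t * ((1 - t) * a i) * kernel mu (fun=> 1) (pos x - pos (y i)) = t * (1 - t) * potential a y x.
  by rewrite /potential mulr_sumr; apply: eq_bigr => i _; ring.
have h2 i : \sum_(o : option I) (1 - t) * a i * (if o is Some j then (1 - t) * a j else t) *
      kernel mu (fun=> 1) (pos (y i) - pos (if o is Some j then y j else x)) =
    (1 - t) * t * (a i * kernel mu (fun=> 1) (pos x - pos (y i))) +
    (1 - t) ^+ 2 * (\sum_j a i * a j * kernel mu (fun=> 1) (pos (y i) - pos (y j))).
  rewrite sum_option /= -(opprB (pos x)) kernelN mulr_sumr; congr (_ + _); first by ring.
  by apply: eq_bigr => j _; ring.
rewrite h1; under eq_bigr do rewrite h2.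
by rewrite big_split /= -!mulr_sumr -/(potential a y x); ring.
Qed.

Lemma kernel_total : kernel mu (fun=> 1) 0 = fine (mu setT).
Proof. by rewrite kernel0 Rintegral_cst// mul1r. Qed.

Definition config (A : set 'rV[R]_d) (E : R) := exists (I : finType) (a : I -> R) (y : I -> site R d D),
  [/\ wprob a, forall i, A (pos (y i)) & energy a y = E].

(** Variational argument with slack. If the energy is within t^2 of its infimum, moving a mass t to
    a point x cannot lower it by more than t^2, so to first order in t the potential at x is nearly
    as large as the energy. [capacity_le] and [capacity_ge] then tie the energy to the inverse
    capacity. *)
Lemma near_minimizer (A : set 'rV[R]_d) (c eta : R) (x0 : site R d D) : A (pos x0) ->
  capacity D mu A = c%:E -> 0 < c -> 0 < eta <= 1 ->
  exists (I : finType) (a : I -> R) (y : I -> site R d D) (k : R),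
  [/\ wprob a, forall i, A (pos (y i)), 0 < k /\ 0 < energy a y,
      forall x, A (pos x) -> k <= potential a y x &
      energy a y / k ^+ 2 <= (1 + eta) * c /\ c * energy a y <= 1 + eta].
Proof.
move=> Ax0 capc c0 /andP[eta0 eta1].
have Ec (I : finType) (a : I -> R) (y : I -> site R d D) : wprob a -> (forall i, A (pos (y i))) -> 1 <= c * energy a y.
  move=> wa Ay; have E0 := energy_ge0 a y.
  have h e : 0 < e -> energy a y <= e -> 1 <= c * e.
    move=> e0 Ee; have := capacity_ge wa Ay e0 Ee; rewrite capc lee_fin.
    by rewrite -div1r ler_pdivrMr.
  have [E1|E1] := leP (energy a y) 0; last exact: h.
  have := h (c^-1 / 2); rewrite divr_gt0 ?invr_gt0// => /(_ isT).
  have : 0 < c^-1 / 2 by rewrite divr_gt0 ?invr_gt0.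
  have -> : c * (c^-1 / 2) = 2^-1 by field; exact: lt0r_neq0.
  by move=> h1 /(_ (le_trans E1 (ltW h1))); lra.
set K0 := kernel mu (fun=> 1) 0.
have K00 : 0 <= K0 by rewrite /K0 kernel_total fine_ge0.
pose eps := eta / 4; have eps0 : 0 < eps by rewrite /eps; lra.
have eps1 : eps <= 4^-1 by rewrite /eps; lra.
(* The mass moved, whose square is also the tolerance on the energy: the second-order error t (1 +
   K0) is then at most eps / c, hence at most eps times the energy. *)
pose t := Num.min (4^-1) (eps / (c * (1 + K0))).
have cK : 0 < c * (1 + K0) by rewrite mulr_gt0//; lra.
have t0 : 0 < t by rewrite /t lt_min divr_gt0// invr_gt0 ltr0n.
have t1 : t <= 4^-1 by rewrite /t ge_min lexx.
have t2 : t * (1 + K0) <= eps / c.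
  have : t <= eps / (c * (1 + K0)) by rewrite /t ge_min lexx orbT.
  rewrite ler_pdivlMr// => h; rewrite ler_pdivlMr//; lra.
have hs : has_inf [set E | config A E].
  split.
    exists (energy (fun=> 1) (fun _ : unit => x0)), unit, (fun=> 1), (fun=> x0); split => //.
    by split => //; rewrite big_const card_unit /= addr0.
  by exists 0 => _ [I [a [y [_ _ <-]]]]; exact: energy_ge0.
have t20 : 0 < t ^+ 2 by rewrite exprn_gt0.
have [E [I [a [y [wa Ay aE]]]] hE] := inf_adherent t20 hs.
have inf_le E' : config A E' -> inf [set E | config A E] <= E'.
  by move=> h; apply: ge_inf => //; case: hs.
have E1 := Ec _ _ _ wa Ay.
have E0 : 0 < energy a y.
  rewrite lt_neqAle energy_ge0 andbT; apply/eqP => h; move: E1; rewrite -h mulr0; lra.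
have cE : c^-1 <= energy a y by rewrite -div1r ler_pdivrMr// mulrC.
have pot x : A (pos x) -> energy a y - eps * energy a y <= potential a y x.
  move=> Ax.
  have : config A (energy (fun o : option I => if o is Some i then (1 - t) * a i else t)
         (fun o => if o is Some i then y i else x)).
    exists (option I), (fun o => if o is Some i then (1 - t) * a i else t), (fun o => if o is Some i then y i else x).
    split=> //; last by case.
    have [a0 a1] := wa; split; first by case=> [i|]; [rewrite mulr_ge0//; lra|exact: ltW].
    by rewrite sum_option /= -mulr_sumr a1; ring.
  move=> /inf_le; rewrite bform_potential -/K0 => h.
  have h1 : energy a y - t ^+ 2 <= (1 - t) ^+ 2 * energy a y + 2 * t * (1 - t) * potential a y x + t ^+ 2 * K0.
    by move: hE; rewrite -aE; lra.
  have h2 : 2 * t * (1 - t) * (energy a y - potential a y x) <= t ^+ 2 * (1 + K0).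
    have := mulr_ge0 (ltW t20) (ltW E0); lra.
  have h3 : 2 * (1 - t) * (energy a y - potential a y x) <= t * (1 + K0).
    rewrite -(ler_pM2l t0); lra.
  have h4 : eps / c <= eps * energy a y by rewrite ler_wpM2l// ltW.
  have [h5|h5] := leP (energy a y - potential a y x) 0.
    have := mulr_ge0 (ltW eps0) (ltW E0); lra.
  nra.
exists I, a, y, (energy a y * (1 - eps)).
have k0 : 0 < energy a y * (1 - eps) by rewrite mulr_gt0//; lra.
have q : (energy a y / (energy a y * (1 - eps)) ^+ 2) = ((energy a y) * (1 - eps) ^+ 2)^-1.
  have n1 := lt0r_neq0 E0; have n2 : 1 - eps != 0 by rewrite lt0r_neq0//; lra.
  by field; rewrite n1 n2.
have q0 : 0 < (1 - eps) ^+ 2 by rewrite exprn_gt0//; lra.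
have q1 : 1 <= (1 - eps) ^+ 2 * (1 + eta).
  have -> : eta = 4 * eps by rewrite /eps; lra.
  have -> : (1 - eps) ^+ 2 * (1 + 4 * eps) = 1 + eps * (2 - 7 * eps + 4 * eps ^+ 2) by ring.
  have : 0 <= eps * (2 - 7 * eps + 4 * eps ^+ 2) by rewrite mulr_ge0//; nra.
  lra.
have potk x : A (pos x) -> energy a y * (1 - eps) <= potential a y x by move=> /pot; lra.
split=> //; rewrite q; split.
  rewrite -div1r ler_pdivrMr ?mulr_gt0//; nra.
have := capacity_le k0 potk; rewrite capc lee_fin q => h.
have e1 : 0 < 1 - eps by lra.
move: h; rewrite -div1r ler_pdivlMr ?mulr_gt0// => h.
have := mulr_gt0 c0 E0; nra.
Qed.

(** For frequencies of norm at most 1 / (8 S) all phases in the ball are at most 1 in absolute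
    value, so every cosine is at least 1/2. *)
Lemma energy_ge (I : finType) (a : I -> R) (y : I -> site R d D) (S : R) : 0 < S -> wprob a ->
  (forall i, cball S (pos (y i))) -> fine (mu (cball (8 * S)^-1)) / 4 <= energy a y.
Proof.
move=> S0 [a0 a1] yS.
have mB := @measurable_cball R d (8 * S)^-1.
have bw := @bounded_weight_indic R d _ mB.
have -> : fine (mu (cball (8 * S)^-1)) / 4 = \int[mu]_l (4^-1 * \1_(cball (8 * S)^-1) l).
  rewrite RintegralZl//; last first.
    by apply: (@bounded_integrable _ _ _ mu _ 1) => // l; rewrite indicE; case: (_ \in _); rewrite ?normr1// normr0.
  by rewrite /Rintegral integral_indic// setIT mulrC.
apply: le_RintegralT.
- apply: (@bounded_integrable _ _ _ mu (fun l => 4^-1 * \1_(cball (8 * S)^-1) l) 1).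
    exact: measurable_funM.
  by move=> l; rewrite indicE; case: (_ \in _); rewrite ?mulr1 ?mulr0 ?normr0// ger0_norm//; lra.
- exact: integrable_trig_sqr.
move=> l; rewrite indicE; case: (boolP (l \in _)) => lB; last by rewrite mulr0 trig_sqr_ge0.
have {}lB := set_mem lB; rewrite mulr1 /trig_sqr.
suff : 2^-1 <= trig_cos a (fun i => pos (y i)) l.
  have := sqr_ge0 (trig_sin a (fun i => pos (y i)) l); nra.
have -> : 2^-1 = \sum_i a i * 2^-1 by rewrite -mulr_suml a1 mul1r.
apply: ler_sum => i _; apply: ler_wpM2l => //.
have h : `|phase l (pos (y i))| <= 1.
  rewrite /phase normrM ger0_norm; last by rewrite mulr_ge0 ?pi_ge0.
  have p4 : pi <= 4 :> R by have := @pihalf_lt2 R; lra.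
  have h1 := dot_le l (pos (y i)).
  have h2 : enorm l * enorm (pos (y i)) <= (8 * S)^-1 * S by apply: ler_pM; rewrite ?enorm_ge0//; exact: yS.
  have h3 : (8 * S)^-1 * S = 8^-1 by field; exact: lt0r_neq0.
  have p0 := @pi_ge0 R; rewrite h3 in h2; have := normr_ge0 (dot l (pos (y i))); nra.
have := cos_ge_quadratic (phase l (pos (y i))).
have : `|phase l (pos (y i))| ^+ 2 <= 1 by rewrite expr_le1.
rewrite real_normK ?num_real//; lra.
Qed.

End Capacity.

(** * Growth of the capacity *)

Section Growth.
Context {R : realType}.

Lemma powRDp (x a b : R) : 0 < x -> x `^ (a + b) = x `^ a * x `^ b.
Proof. by move=> x0; rewrite powRD//; apply/implyP => _; rewrite gt_eqF. Qed.

Lemma near_powR_ge (c a : R) : 0 < a -> \forall T \near +oo%R, c <= T `^ a.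
Proof.
move=> a0; near=> T.
have T1 : Num.max 1 c `^ a^-1 <= T by near: T; apply: nbhs_pinfty_ge; rewrite num_real.
have M0 : 0 <= Num.max 1 c by rewrite le_max ler01.
apply: (@le_trans _ _ (Num.max 1 c)); first by rewrite le_max lexx orbT.
rewrite -[leLHS](powRr1 M0) -(mulVf (lt0r_neq0 a0)) powRrM.
by apply: ge0_ler_powR; rewrite ?nnegrE ?powR_ge0// ltW// (le_trans _ T1) ?powR_ge0.
Unshelve. all: by end_near. Qed.

Lemma near_powR_dominates (c a b : R) : a < b -> \forall T \near +oo%R, c * T `^ a <= T `^ b.
Proof.
move=> ab; near=> T.
have T0 : 0 < T by near: T; apply: nbhs_pinfty_gt; rewrite num_real.
rewrite -[b](subrK a) powRDp// ler_wpM2r ?powR_ge0//.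
by near: T; apply: near_powR_ge; rewrite subr_gt0.
Unshelve. all: by end_near. Qed.

Lemma ln_le_powR (T a : R) : 0 < T -> 0 < a -> ln T <= a^-1 * T `^ a.
Proof.
move=> T0 a0; rewrite ler_pdivlMl// -ln_powR.
by rewrite ltW// ln_sublinear// powR_gt0.
Qed.

Lemma near_ln_ge (c : R) : \forall T \near +oo%R, c <= ln T.
Proof.
near=> T.
have T1 : expR c <= T by near: T; apply: nbhs_pinfty_ge; rewrite num_real.
by rewrite -[leLHS]expRK ler_ln ?posrE ?expR_gt0// (lt_le_trans _ T1)// expR_gt0.
Unshelve. all: by end_near. Qed.

End Growth.

Section SpectralSingularity.
Context {R : realType} {d : nat} (mu : {finite_measure set (borel R d) -> \bar R}) (alpha : R).

Definition ball_mass (delta : R) : R := fine (mu (cball delta)).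

Hypothesis sing : (lne (mu (cball delta)) / (ln delta)%:E)%E @[delta --> 0^'+] --> alpha%:E.

Lemma ball_massE (r : R) : mu (cball r) = (ball_mass r)%:E.
Proof. by rewrite /ball_mass fineK// fin_num_measure//; exact: measurable_cball. Qed.

(** Exponentiation of the logarithmic ratio; [ln delta] is negative, so the larger exponent gives
    the lower bound. *)
Lemma ball_mass_bounds (eps : R) : 0 < eps -> exists2 delta0 : R, 0 < delta0 &
  forall delta, 0 < delta < delta0 ->
  delta `^ (alpha + eps) <= ball_mass delta <= delta `^ (alpha - eps).
Proof.
move=> eps0.
have /fine_cvgP[fin cv] := sing.
have h : \forall delta \near 0^'+, delta `^ (alpha + eps) <= ball_mass delta <= delta `^ (alpha - eps).
  near=> delta.
  have d0 : 0 < delta by near: delta; exact: nbhs_right_gt.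
  have d1 : delta < 1 by near: delta; exact: nbhs_right_lt.
  have ld : ln delta < 0 by rewrite ln_lt0// d0.
  have f1 : (lne (mu (cball delta)) / (ln delta)%:E)%E \is a fin_num by near: delta.
  have f2 : `|alpha - fine (lne (mu (cball delta)) / (ln delta)%:E)%E| < eps.
    by near: delta; move/cvgrPdist_lt : cv; exact.
  move: f1 f2; rewrite ball_massE /lne; case: (ltP 0 (ball_mass delta)) => m0.
    rewrite inver lt_eqF//= => _.
    rewrite ltr_norml => /andP[h1 h2].
    have e : ln (ball_mass delta) = (ln (ball_mass delta) / ln delta) * ln delta.
      by rewrite divfK// lt_eqF.
    rewrite -(lnK (m0 : ball_mass delta \in Num.pos)) /powR (gt_eqF d0) !ler_expR e.
    by rewrite !ler_nM2r//; apply/andP; split; lra.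
  (* A ball of mass zero would make the ratio infinite, against the finiteness in [f1]. *)
  by rewrite inver lt_eqF//= mulNyr sgrV ltr0_sg//= EFinN mulN1e.
have [e /= e0 he] := h.
exists e => // delta /andP[d0 de]; apply: he => //=.
by rewrite sub0r normrN gtr0_norm.
Unshelve. all: by end_near. Qed.

End SpectralSingularity.

(** * Fejer kernels and test measures on grids *)

Section Dirichlet.
Context {R : realType}.

Lemma sin_pi_sqr_ge (x : R) : `|x| <= 2^-1 -> x ^+ 2 / 4 <= sin (pi * x) ^+ 2.
Proof.
wlog x0 : x / 0 <= x => [h|].
  have [/h//|x0 xb] := leP 0 x.
  by rewrite -(sqrrN x) -(sqrrN (sin _)) -sinN -mulrN; apply: h; [lra|rewrite normrN].
rewrite ger0_norm// => x1.
have p2 := @pi_ge2 R; have p4 := @pihalf_lt2 R.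
have [->|xN] := eqVneq x 0; first by rewrite mulr0 sin0 !expr0n mul0r.
have x0' : 0 < x by rewrite lt_neqAle eq_sym xN.
pose u := pi * x / 2.
have u0 : 0 < u by rewrite /u divr_gt0// mulr_gt0// pi_gt0.
have u1 : u <= 1 by rewrite /u; nra.
have ch v : 0 <= v <= u -> 2^-1 <= cos v.
  by move=> /andP[v0 vu]; apply: le_trans (cos_ge_quadratic v); nra.
have ds (y : R) : y \in `]0, u[ -> is_derive y 1 sin (cos y) by move=> _; exact: is_derive_sin.
have [c] := MVT u0 ds (continuous_subspaceT (@continuous_sin R)).
rewrite in_itv /= sin0 !subr0 => /andP[c0 cu] su.
have hc : 2^-1 <= cos c by apply: ch; rewrite !ltW.
have hu : 2^-1 <= cos u by apply: ch; rewrite lexx ltW.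
have e : sin (pi * x) = 2 * (cos c * u) * cos u.
  rewrite -[X in sin X](_ : u *+ 2 = pi * x); last by rewrite /u mulr2n; field.
  by rewrite sin_mulr2n -su; ring.
have h1 : x / 2 <= sin (pi * x).
  rewrite e; apply: (@le_trans _ _ (2 * (2^-1 * u) * 2^-1)).
    by rewrite /u; nra.
  have hh : 2^-1 * u <= cos c * u by rewrite ler_wpM2r// ltW.
  have : 0 <= 2^-1 * u by rewrite mulr_ge0// ltW.
  move: hh hu; move: (cos c * u) (cos u) (2^-1 * u) => X Y Z; nra.
have : (x / 2) ^+ 2 <= sin (pi * x) ^+ 2 by rewrite ler_sqr ?nnegrE//; lra.
by rewrite expr_div_n (_ : 2 ^+ 2 = 4) //; ring.
Qed.

(** The Fejer kernel sin^2 (2^J pi x) / (4^J sin^2 (pi x)), normalised to 1 at the origin and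
    written as a product so that it is the transform of a convolution of two-point measures. *)
Definition dirichlet (J : nat) (x : R) := \prod_(j < J) cos (pi * (2 ^+ j * x)) ^+ 2.

Lemma dirichlet_ge0 J x : 0 <= dirichlet J x.
Proof. by apply: prodr_ge0 => j _; exact: sqr_ge0. Qed.

Lemma dirichlet_le1 J x : dirichlet J x <= 1.
Proof.
apply: prodr_ile1 => j _; rewrite sqr_ge0 -(real_normK (num_real (cos _))) expr_le1//.
exact: cos_max.
Qed.

Lemma dirichlet_sin J x : 4 ^+ J * sin (pi * x) ^+ 2 * dirichlet J x = sin (pi * (2 ^+ J * x)) ^+ 2.
Proof.
elim: J => [|J IH]; first by rewrite /dirichlet big_ord0 !expr0 !mul1r mulr1.
rewrite /dirichlet big_ord_recr /= -/(dirichlet J x).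
have -> : pi * (2 ^+ J.+1 * x) = (pi * (2 ^+ J * x)) *+ 2 by rewrite exprS mulr2n; ring.
rewrite sin_mulr2n mulr2n.
set C := cos _; set S := sin (pi * (2 ^+ J * x)) in IH *.
have -> : (C * S + C * S) ^+ 2 = 4 * C ^+ 2 * S ^+ 2 by ring.
by rewrite -IH exprS; ring.
Qed.

Lemma dirichlet_bound J x (b : R) : 0 < b -> b <= `|x| -> `|x| <= 2^-1 ->
  dirichlet J x <= (4 ^+ J * b ^+ 2 / 4)^-1.
Proof.
move=> b0 bx x2.
have p0 : 0 < 4 ^+ J * b ^+ 2 / 4 by rewrite divr_gt0// mulr_gt0// exprn_gt0.
rewrite -div1r ler_pdivlMr//.
apply: (@le_trans _ _ (4 ^+ J * sin (pi * x) ^+ 2 * dirichlet J x)).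
  rewrite mulrC ler_wpM2r ?dirichlet_ge0// -mulrA ler_wpM2l ?exprn_ge0//.
  apply: le_trans (sin_pi_sqr_ge x2); rewrite ler_wpM2r ?invr_ge0//.
  by rewrite -(real_normK (num_real x)) ler_sqr ?nnegrE// ltW.
rewrite dirichlet_sin -(real_normK (num_real (sin _))) expr_le1//; exact: sin_max.
Qed.

End Dirichlet.

Section Spread.
Context {R : realType} {d : nat} (D : domain).
Implicit Types phi : 'rV[R]_d -> R.

(* [phi] is the squared modulus of the Fourier transform of a finitely supported probability
   on the sites at distance at most [r]; convolution multiplies such functions. *)
Definition spread (r : R) phi := exists (I : finType) (a : I -> R) (y : I -> site R d D),
  [/\ wprob a, forall i, enorm (pos (y i)) <= r & forall l, trig_sqr a (fun i => pos (y i)) l = phi l].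

Lemma pos0 : pos (0 : site R d D) = 0.
Proof. by case: D => //=; apply/rowP => i; rewrite !mxE. Qed.

Lemma posD (x y : site R d D) : pos (x + y) = pos x + pos y.
Proof. by case: D x y => x y //=; apply/rowP => i; rewrite !mxE intrD. Qed.

Lemma spread_le r r' phi : r <= r' -> spread r phi -> spread r' phi.
Proof.
move=> rr' [I [a [y [wa ya e]]]]; exists I, a, y; split => // i.
by rewrite (le_trans (ya i)).
Qed.

Lemma spread1 : spread 0 (fun=> 1).
Proof.
exists unit, (fun=> 1), (fun=> 0); split.
- by split => //; rewrite big_const card_unit /= addr0.
- by move=> _; rewrite pos0 enorm0.
- move=> l; rewrite trig_sqrE !big_const card_unit /= !addr0 subrr /phase dot0r mulr0 cos0.
  by rewrite !mulr1.
Qed.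

Lemma trig_sqr_conv (I1 I2 : finType) (a1 : I1 -> R) (a2 : I2 -> R) (y1 : I1 -> 'rV[R]_d)
    (y2 : I2 -> 'rV[R]_d) l :
  trig_sqr (fun i : I1 * I2 => a1 i.1 * a2 i.2) (fun i => y1 i.1 + y2 i.2) l =
  trig_sqr a1 y1 l * trig_sqr a2 y2 l.
Proof.
pose z (i : I1 * I2) := y1 i.1 + y2 i.2.
rewrite -[LHS]/(trig_sqr (fun i : I1 * I2 => a1 i.1 * a2 i.2) z l) /trig_sqr.
have hc : trig_cos (fun i : I1 * I2 => a1 i.1 * a2 i.2) z l =
    trig_cos a1 y1 l * trig_cos a2 y2 l - trig_sin a1 y1 l * trig_sin a2 y2 l.
  rewrite /trig_cos /trig_sin !mulr_suml -sumrB.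
  rewrite -(pair_big xpredT xpredT (fun i j => a1 i * a2 j * cos (phase l (z (i, j))))) /=.
  apply: eq_bigr => i _; rewrite !mulr_sumr -sumrB; apply: eq_bigr => j _.
  by rewrite /z /= /phase dotDr mulrDr cosD; ring.
have hs : trig_sin (fun i : I1 * I2 => a1 i.1 * a2 i.2) z l =
    trig_sin a1 y1 l * trig_cos a2 y2 l + trig_cos a1 y1 l * trig_sin a2 y2 l.
  rewrite /trig_cos /trig_sin !mulr_suml -big_split /=.
  rewrite -(pair_big xpredT xpredT (fun i j => a1 i * a2 j * sin (phase l (z (i, j))))) /=.
  apply: eq_bigr => i _; rewrite !mulr_sumr -big_split /=; apply: eq_bigr => j _.
  by rewrite /z /= /phase dotDr mulrDr sinD; ring.
by rewrite hc hs; ring.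
Qed.

Lemma wprobM (I1 I2 : finType) (a1 : I1 -> R) (a2 : I2 -> R) : wprob a1 -> wprob a2 ->
  wprob (fun i : I1 * I2 => a1 i.1 * a2 i.2).
Proof.
move=> [p1 s1] [p2 s2]; split; first by move=> i; rewrite mulr_ge0.
rewrite -(pair_big xpredT xpredT (fun i j => a1 i * a2 j)) /=.
by under eq_bigr do rewrite -mulr_sumr s2 mulr1.
Qed.

Lemma spreadM r1 phi1 r2 phi2 : spread r1 phi1 -> spread r2 phi2 ->
  spread (r1 + r2) (fun l => phi1 l * phi2 l).
Proof.
move=> [I1 [a1 [y1 [w1 h1 e1]]]] [I2 [a2 [y2 [w2 h2 e2]]]].
exists (I1 * I2)%type, (fun i => a1 i.1 * a2 i.2), (fun i => y1 i.1 + y2 i.2); split.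
- exact: wprobM.
- by move=> i; rewrite posD (le_trans (enormD _ _))// lerD.
by move=> l; rewrite -e1 -e2 -trig_sqr_conv; congr trig_sqr; apply/funext => i; rewrite posD.
Qed.

Lemma spread_two (e : site R d D) : spread (enorm (pos e)) (fun l => cos (pi * dot l (pos e)) ^+ 2).
Proof.
exists bool, (fun=> 2^-1), (fun b => if b then e else 0); split.
- by split => //; rewrite big_bool /=; lra.
- by case; rewrite ?pos0 ?enorm0 ?enorm_ge0.
move=> l; rewrite /trig_sqr /trig_cos /trig_sin !big_bool /= pos0 /phase dot0r !mulr0 cos0 sin0.
set u := pi * dot l (pos e).
have -> : 2 * pi * dot l (pos e) = u *+ 2 by rewrite /u mulr2n; ring.
have := cos2Dsin2 u; rewrite cos_mulr2n sin_mulr2n mulr0 addr0 => h.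
have hs : sin u ^+ 2 = 1 - cos u ^+ 2 by rewrite -h; ring.
have -> : (2^-1 * (cos u * sin u *+ 2)) ^+ 2 = cos u ^+ 2 * sin u ^+ 2.
  by rewrite -mulr_natl; field.
move: (cos u ^+ 2) (sin u ^+ 2) hs => C S ->; rewrite mulr2n; by field.
Qed.

Lemma spreadX r phi k : spread r phi -> spread (k%:R * r) (fun l => phi l ^+ k).
Proof.
move=> h; elim: k => [|k IH].
  by rewrite mul0r; have := spread1; congr spread; apply/funext => l; rewrite expr0.
have := spreadM h IH; rewrite -{1}[r]mul1r -mulrDl -natr1 addrC; congr spread.
by apply/funext => l; rewrite exprS.
Qed.

Lemma spread_prod (s : seq 'I_d) r (phi : 'I_d -> 'rV[R]_d -> R) : (forall i, spread r (phi i)) ->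
  spread ((size s)%:R * r) (fun l => \prod_(i <- s) phi i l).
Proof.
move=> h; elim: s => [|i s IH] /=.
  by rewrite mul0r; have := spread1; congr spread; apply/funext => l; rewrite big_nil.
have := spreadM (h i) IH; rewrite -{1}[r]mul1r -mulrDl -natr1 addrC; congr spread.
by apply/funext => l; rewrite big_cons.
Qed.

Definition grid_scale (h : R) := forall k : 'rV[int]_d, exists x : site R d D, pos x = h *: map_mx intr k.

(** Two-point measures at distances h, 2 h, 4 h, ... along one axis are convolved. The radius h 2^J
    exceeds the sum of the distances and doubles exactly at each step. *)
Lemma spread_dirichlet (h : R) (i : 'I_d) J : 0 <= h -> grid_scale h ->
  spread (h * 2 ^+ J) (fun l => dirichlet J (h * l 0 i)).
Proof.
move=> h0 hg; elim: J => [|J IH].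
  have := spread_le (_ : 0 <= h * 2 ^+ 0) spread1; rewrite expr0 mulr1 => /(_ h0); congr spread.
  by apply/funext => l; rewrite /dirichlet big_ord0.
have [e pe] := hg (\row_j ((2 ^ J)%N * (j == i))%:Z).
have de l : dot l (pos e) = 2 ^+ J * (h * l 0 i).
  rewrite pe dotZr /dot (bigD1 i)//= big1 ?addr0.
    by rewrite !mxE eqxx muln1 pmulrn -natrX; ring.
  by move=> j /negPf ji; rewrite !mxE ji muln0 mulr0.
have ne : enorm (pos e) = h * 2 ^+ J.
  have := de (pos e); rewrite -enorm_sqr pe mxE !mxE eqxx muln1 -[(2 ^ J)%N%:~R]/((2 ^ J)%:R) natrX => n2.
  apply: (@pexpIrn _ 2) => //; rewrite ?nnegrE ?enorm_ge0 ?mulr_ge0 ?exprn_ge0//.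
  by rewrite n2; ring.
have := spreadM IH (spread_two e); rewrite ne.
have -> : h * 2 ^+ J + h * 2 ^+ J = h * 2 ^+ J.+1 by rewrite exprS; ring.
congr spread; apply/funext => l; rewrite /dirichlet big_ord_recr /= de.
by [].
Qed.

End Spread.

(** * The polynomial lower bound on the capacity *)

Section CapacityGrowth.
Context {R : realType} {d : nat} {D : domain}.
Context {disp : measure_display} {Omega : measurableType disp}.
Variables (P : probability Omega R) (f : site R d D -> {RV P >-> R}).
Variable mu : {finite_measure set (borel R d) -> \bar R}.
Hypotheses (f_SGF : SGF f) (f_mu : spectral_measure f mu).

(** Frequencies beyond the Nyquist cube of a grid of mesh h, where the periodic kernels may be large
    again. *)
Definition far (h : R) : set (borel R d) := [set l | exists i, 2^-1 < `|h * l 0 i|].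

Lemma measurable_far h : measurable (far h).
Proof.
rewrite (_ : far h = \bigcup_(i : 'I_d) [set l : borel R d | 2^-1 < `|h * l 0 i|]); last first.
  by apply/seteqP; split => l /=; [move=> [i hi]; exists i|move=> [i _ hi]; exists i].
apply: fin_bigcup_measurable => // i _.
have mi : measurable_fun setT ((fun l : 'rV[R]_d => h * l 0 i) : borel R d -> measurableTypeR R).
  by apply: measurable_funM => //; exact: measurable_coord.
have [_ m] := measurable_fun_le 2^-1 mi.
have := measurableC m; congr measurable; apply/seteqP; split => l /=.
  by move=> /negP; rewrite -ltNge.
by move=> h1; apply/negP; rewrite -ltNge.
Qed.

Lemma measurable_cell : measurable (@spectral_cell R d D).
Proof.
case: D => /=; first exact: measurableT.
have := @measurable_gv_event R 'I_d _ (borel R d) (fun i l => (l : 'rV[R]_d) 0 i)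
  (fun=> `[- 2^-1, 2^-1[%classic) (fun i => measurable_coord i) (fun i => measurable_itv _).
by congr measurable; apply/seteqP; split => l /= h i; have := h i; rewrite /= in_itv.
Qed.

(* A grid fine enough for the Dirichlet kernels to see no aliasing, up to mass [e]. *)
Lemma fine_grid (e : R) : 0 < e -> exists h : R,
  [/\ 0 < h <= 1, @grid_scale R d D h & fine (mu (far h)) <= e].
Proof.
move=> e0; have carrier := spectral_carrier f_mu.
have mcell := measurable_cell.
have scale h : D = Euclidean -> @grid_scale R d D h.
  by move=> ->; move=> k; exists (h *: map_mx intr k).
have scale1 : @grid_scale R d D 1.
  by move=> k; case: D; exists (map_mx intr k : 'rV[R]_d) || exists k; rewrite scale1r.
have [DE|DE] : D = Euclidean \/ D = Lattice by case: D; [left|right].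
  pose F n := far n.+1%:R^-1.
  have mF n : measurable (F n) by exact: measurable_far.
  have F0 : \bigcap_n F n = set0.
    apply/seteqP; split => // l /= h.
    pose n := Num.truncn (2 * enorm l).
    have [i hi] := h n I; move: hi; apply/negP; rewrite -leNgt normrM gtr0_norm ?invr_gt0// ler_pdivrMl//.
    have h1 := coord_le_enorm l i; have := truncnS_gt (2 * enorm l); rewrite -/n; lra.
  have niF : nonincreasing_seq F.
    move=> n m nm; apply/subsetPset => l [i hi]; exists i; apply: (lt_le_trans hi).
    rewrite !normrM ler_wpM2r// !gtr0_norm ?invr_gt0// lef_pV2 ?posrE//.
    by rewrite ler_nat ltnS.
  have fF0 : (mu (F 0%N) < +oo)%E by rewrite ltey_eq fin_num_measure.
  have := nonincreasing_cvg_mu fF0 mF _ niF; rewrite F0 measure0 => /(_ measurable0).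
  move=> /fine_cvgP[_ /cvgrPdist_lt /(_ e e0) [n _ /(_ n (leqnn n))]] /=.
  rewrite sub0r normrN => hn; exists n.+1%:R^-1; split; last by rewrite ltW// (le_lt_trans (ler_norm _)).
    by rewrite invr_gt0 ltr0n /= invf_le1 ?ltr0n// ler1n.
  exact: scale.
exists 1; split => //; first by rewrite ltr01 lexx.
suff -> : mu (far 1) = 0%E by rewrite ltW.
apply: (@subset_measure0 _ _ _ mu (far 1) (~` spectral_cell D)) => //.
- exact: measurable_far.
- exact: measurableC.
rewrite DE => l [i h1] /= h2; rewrite mul1r in h1.
have /andP[h3 h4] := h2 i; move: h1; apply/negP; rewrite -leNgt ler_norml; lra.
Qed.

(** The test measure has transform a product over the axes of k-th powers of Fejer kernels. Its
    energy is estimated by 1 near the origin and on the aliased frequencies; elsewhere some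
    coordinate is at least delta and its kernel is small. *)
Lemma spread_energy (h delta : R) (J k : nat) : 0 < h -> 0 < delta -> @grid_scale R d D h ->
  exists (I : finType) (a : I -> R) (y : I -> site R d D),
  [/\ wprob a, forall i, cball (d%:R * (k%:R * (h * 2 ^+ J))) (pos (y i)) &
   energy mu a y <= ball_mass mu ((Num.sqrt d%:R + 1) * delta) + fine (mu (far h)) +
     fine (mu setT) * (4 ^+ J * (h * delta) ^+ 2 / 4)^-1 ^+ k].
Proof.
move=> h0 de0 hg.
have := spread_prod (index_enum 'I_d) (fun i => spreadX k (spread_dirichlet i J (ltW h0) hg)).
have -> : size (index_enum 'I_d) = d by rewrite [index_enum _]unlock -enumT size_enum_ord.
move=> [I [a [y [wa ya e]]]]; exists I, a, y; split => //.
set q := (_)^-1; set s := Num.sqrt _ + 1; rewrite /energy.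
have q0 : 0 <= q ^+ k by rewrite exprn_ge0// invr_ge0 divr_ge0// mulr_ge0 ?sqr_ge0// exprn_ge0.
have mB := @measurable_cball R d (s * delta); have mF := measurable_far h.
have iB (A : set (borel R d)) : measurable A -> mu.-integrable setT (EFin \o (\1_A : borel R d -> R)).
  move=> mA; apply: (@bounded_integrable _ _ _ mu (\1_A) 1); first exact: measurable_indic.
  by move=> l; rewrite indicE; case: (_ \in _); rewrite ?normr1// normr0.
have iQ : mu.-integrable setT (EFin \o (fun _ : borel R d => q ^+ k)).
  by apply: (@bounded_integrable _ _ _ mu (fun=> q ^+ k) `|q ^+ k|).
have rB (A : set (borel R d)) : measurable A -> \int[mu]_l (\1_A l : R) = fine (mu A).
  by move=> mA; rewrite /Rintegral integral_indic// setIT.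
have i2 := integrableD measurableT (iB _ mB) (iB _ mF).
have i3 := integrableD measurableT i2 iQ.
have -> : ball_mass mu (s * delta) + fine (mu (far h)) + fine (mu setT) * q ^+ k =
    \int[mu]_l ((\1_(cball (s * delta)) l + \1_(far h) l) + q ^+ k).
  rewrite (@RintegralD _ _ _ mu setT (fun l => \1_(cball (s * delta)) l + \1_(far h) l) (fun=> q ^+ k))//.
  rewrite (@RintegralD _ _ _ mu setT (\1_(cball (s * delta))) (\1_(far h)))//; [|exact: iB|exact: iB].
  by rewrite (rB _ mB) (rB _ mF) Rintegral_cst// (mulrC (q ^+ k)).
apply: le_RintegralT => //; first exact: integrable_trig_sqr.
move=> l; rewrite e.
have phi1 i : 0 <= dirichlet J (h * l 0 i) ^+ k <= 1.
  by rewrite exprn_ge0 ?dirichlet_ge0//= exprn_ile1 ?dirichlet_ge0 ?dirichlet_le1.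
have i0 (A : set (borel R d)) : 0 <= (\1_A l : R) by rewrite indicE; case: (_ \in _).
have iA (A : set (borel R d)) : A l -> (\1_A l : R) = 1 by move=> Al; rewrite indicE mem_set.
have p1 : \prod_(i < d) dirichlet J (h * l 0 i) ^+ k <= 1 by apply: prodr_ile1 => i _; exact: phi1.
have [lF|lF] := pselect (far h l); first by rewrite (iA (far h))//; have := i0 (cball (s * delta)); lra.
have [lB|lB] := pselect (cball (s * delta) l); first by rewrite (iA (cball (s * delta)))//; have := i0 (far h); lra.
have [i hi] : exists i, delta <= `|l 0 i|.
  apply: contrapT => hn; apply: lB; rewrite /cball /=.
  apply: (le_trans (enorm_le_coord (c := delta) _)).
    by move=> i; rewrite leNgt; apply/negP => hi; apply: hn; exists i; exact: ltW.
  by rewrite ler_wpM2r ?ltW// /s ltrDl.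
have hi2 : `|h * l 0 i| <= 2^-1 by rewrite leNgt; apply/negP => h2; apply: lF; exists i.
have hi1 : h * delta <= `|h * l 0 i| by rewrite normrM (gtr0_norm h0) ler_wpM2l// ltW.
have := dirichlet_bound J (mulr_gt0 h0 de0) hi1 hi2; rewrite -/q => hq.
have : \prod_(i < d) dirichlet J (h * l 0 i) ^+ k <= q ^+ k.
  rewrite (bigD1 i)//= -[leRHS]mulr1; apply: ler_pM.
  - by have /andP[] := phi1 i.
  - by apply: prodr_ge0 => j _; have /andP[] := phi1 j.
  - by rewrite lerXn2r ?nnegrE ?dirichlet_ge0// (le_trans _ hq)// dirichlet_ge0.
  - by apply: prodr_ile1 => j _; exact: phi1.
have := i0 (cball (s * delta)); have := i0 (far h); lra.
Qed.

Lemma dyadic_floor (X : R) : 1 <= X -> exists J, 2 ^+ J <= X < 2 ^+ J.+1.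
Proof.
move=> X1; have ex : exists n, X < 2 ^+ n.
  exists (Num.truncn X).+1; apply: (lt_le_trans (truncnS_gt X)).
  by rewrite -natrX ler_nat ltnW// ltn_expl.
have [n hn nmin] := ex_minnP ex; case: n hn nmin => [|J] hJ nmin.
  by move: hJ; rewrite expr0; lra.
by exists J; rewrite hJ andbT leNgt; apply/negP => /nmin; rewrite ltnn.
Qed.

(** Test measures of width about T^(1 - e1), with frequencies separated at delta = T^(-(1 - 2 e1)):
    the ball of radius comparable to delta has mass about delta^alpha, and the kernel outside it is
    at most 16 T^(-2 e1). *)
Lemma capacity_growth (alpha beta : R) : 0 <= alpha ->
  (lne (mu (cball delta)) / (ln delta)%:E)%E @[delta --> 0^'+] --> alpha%:E -> beta < alpha ->
  \forall T \near +oo%R, ((T `^ beta)%:E <= capacity D mu (cball T))%E.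
Proof.
move=> al0 sing ba.
pose g := alpha - beta; have g0 : 0 < g by rewrite /g; lra.
pose e2 := g / 4; have e20 : 0 < e2 by rewrite /e2; lra.
(* Small enough that (1 - 2 e1) (alpha - e2) >= alpha - g / 2 = beta + g / 2, which leaves half of
   the gap to absorb constants. *)
pose e1 := Num.min 4^-1 (g / (8 * (alpha + 1))).
have den0 : 0 < 8 * (alpha + 1) by lra.
have e10 : 0 < e1 by rewrite /e1 lt_min invr_gt0 ltr0n /= divr_gt0.
have e14 : e1 <= 4^-1 by rewrite /e1 ge_min lexx.
have e1a : 2 * e1 * alpha <= g / 4.
  have : e1 <= g / (8 * (alpha + 1)) by rewrite /e1 ge_min lexx orbT.
  by rewrite ler_pdivlMr//; lra.
have ex1 : alpha - g / 2 <= (1 - 2 * e1) * (alpha - e2).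
  by have := mulr_ge0 (ltW e10) (ltW e20); rewrite /e2 in e20 *; nra.
have [d0 d00 hm] := ball_mass_bounds sing e20.
pose s : R := Num.sqrt d%:R + 1; have s0 : 0 < s by rewrite ltr_wpDl ?sqrtr_ge0.
(* Enough convolution powers for T^(-2 e1 k) to be smaller than T^(- beta). *)
pose k := (Num.truncn (`|beta| / (2 * e1))).+1.
have kb : beta < 2 * e1 * k%:R.
  have := truncnS_gt (`|beta| / (2 * e1)); rewrite ltr_pdivrMr ?mulr_gt0// -/k.
  by have := ler_norm beta; lra.
pose M := fine (mu setT); have M0 : 0 <= M by exact: fine_ge0.
have n1 : \forall T \near +oo%R, s / d0 + 1 <= T `^ (1 - 2 * e1).
  by apply: near_powR_ge; lra.
have n2 : \forall T \near +oo%R, s `^ (alpha - e2) * 4 * T `^ (- (alpha - g / 2)) <= T `^ (- beta).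
  by apply: near_powR_dominates; rewrite /g in g0 *; lra.
have n3 : \forall T \near +oo%R, M * 16 ^+ k * 4 * T `^ (- (2 * e1) * k%:R) <= T `^ (- beta).
  by apply: near_powR_dominates; lra.
have n4 : \forall T \near +oo%R, d%:R * k%:R * T `^ (1 - e1) <= T `^ 1.
  by apply: near_powR_dominates; lra.
near=> T.
have T1 : 1 <= T by near: T; apply: nbhs_pinfty_ge; rewrite num_real.
have T0 : 0 < T by lra.
pose delta := T `^ (- (1 - 2 * e1)).
have de0 : 0 < delta by exact: powR_gt0.
pose e := T `^ (- beta) / 4; have ee0 : 0 < e by rewrite divr_gt0// powR_gt0.
have [h [/andP[h0 h1] hg hf]] := fine_grid ee0.
have [|J /andP[J1 J2]] := @dyadic_floor (T `^ (1 - e1) / h).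
  rewrite ler_pdivlMr// mul1r (le_trans h1)// -[leLHS](powRr0 T) ler_powR//; lra.
rewrite ler_pdivlMr// in J1; rewrite ltr_pdivrMr// in J2.
have [I [a [y [wa ya hE]]]] := spread_energy J k h0 de0 hg.
have key : energy mu a y <= T `^ (- beta).
  apply: (le_trans hE).
  have b1 : ball_mass mu ((Num.sqrt d%:R + 1) * delta) <= e.
    rewrite -/s.
    have sd : 0 < s * delta < d0.
      rewrite mulr_gt0//= /delta powRN ltr_pdivrMr ?powR_gt0// -ltr_pdivrMl//.
      have : s / d0 + 1 <= T `^ (1 - 2 * e1) by near: T.
      by rewrite (mulrC d0^-1); lra.
    have /andP[_ /le_trans] := hm _ sd; apply.
    rewrite (powRM _ (ltW s0) (ltW de0)) /delta -powRrM.
    apply: (@le_trans _ _ (s `^ (alpha - e2) * T `^ (- (alpha - g / 2)))).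
      by rewrite ler_wpM2l ?powR_ge0// ler_powR// mulNr lerN2.
    rewrite /e ler_pdivlMr// mulrAC.
    by near: T.
  have b3 : M * (4 ^+ J * (h * delta) ^+ 2 / 4)^-1 ^+ k <= e.
    apply: (@le_trans _ _ (M * (16 * T `^ (- (2 * e1))) ^+ k)).
      rewrite ler_wpM2l//; set Q := _ / 4.
      have Q0 : 0 < Q by rewrite divr_gt0// mulr_gt0 ?exprn_gt0// mulr_gt0.
      have QE : Q = (2 ^+ J * h) ^+ 2 * delta ^+ 2 / 4.
        by rewrite /Q (_ : 4 = 2 ^+ 2 :> R); [rewrite -exprM mulnC exprM; field|rewrite expr2; lra].
      have x1 : T `^ (1 - e1) / 2 <= 2 ^+ J * h by rewrite ler_pdivrMr//; move: J2; rewrite exprS; lra.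
      have x2 : (T `^ (1 - e1) / 2) ^+ 2 <= (2 ^+ J * h) ^+ 2.
        by rewrite lerXn2r ?nnegrE ?divr_ge0 ?powR_ge0// mulr_ge0 ?exprn_ge0// ltW.
      have x3 : T `^ (2 * e1) = (T `^ (1 - e1)) ^+ 2 * delta ^+ 2.
        rewrite /delta -!powR_mulrn ?powR_ge0// -!powRrM -powRDp//; congr (_ `^ _); ring.
      have x4 : T `^ (2 * e1) / 16 <= Q.
        rewrite QE x3; have := ltW (exprn_gt0 2 de0); move: x2.
        rewrite expr_div_n (_ : 2 ^+ 2 = 4 :> R); last by rewrite expr2; lra.
        by move: (_ ^+ 2) (_ ^+ 2) (delta ^+ 2) => u v w; nra.
      have x5 : Q^-1 <= 16 * T `^ (- (2 * e1)).
        rewrite powRN (_ : 16 * _ = (T `^ (2 * e1) / 16)^-1); last by rewrite invfM invrK mulrC.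
        have x6 : 0 < T `^ (2 * e1) / 16 by rewrite divr_gt0// powR_gt0.
        by rewrite lef_pV2 ?posrE.
      by rewrite lerXn2r ?nnegrE ?invr_ge0 ?(ltW Q0)// mulr_ge0 ?powR_ge0.
    have -> : (16 * T `^ (- (2 * e1))) ^+ k = 16 ^+ k * T `^ (- (2 * e1) * k%:R).
      by rewrite exprMn powRrM powR_mulrn ?powR_ge0.
    rewrite mulrA /e ler_pdivlMr// mulrAC.
    by near: T.
  apply: (@le_trans _ _ (e + e + e)); last by have := powR_ge0 T (- beta); rewrite /e; lra.
  by apply: lerD; [apply: lerD|exact: b3].
have Tb : T `^ beta = (T `^ (- beta))^-1 by rewrite powRN invrK.
rewrite Tb; apply: (capacity_ge wa _ _ key); last exact: powR_gt0.
move=> i; rewrite /cball /=; apply: (le_trans (ya i)).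
apply: (@le_trans _ _ (d%:R * k%:R * T `^ (1 - e1))).
  by rewrite mulrA ler_wpM2l ?mulr_ge0// mulrC.
rewrite -[leRHS](powRr1 (ltW T0)).
by near: T.
Unshelve. all: by end_near. Qed.

End CapacityGrowth.

(** * Dyadic cells and characters *)

Section DyadicCells.
Context {R : realType} {d : nat}.
Implicit Types x y : 'rV[R]_d.

Definition cell (k : nat) x : 'rV[int]_d := map_mx (fun t => Num.floor (2 ^+ k * t)) x.

Lemma floor_half (u v : R) : Num.floor (2 * u) = Num.floor (2 * v) -> Num.floor u = Num.floor v.
Proof.
move=> e; apply/eqP; rewrite eq_le; apply/andP.
have h (a b : R) : Num.floor (2 * a) = Num.floor (2 * b) -> Num.floor a <= Num.floor b.
  move=> e'; rewrite floor_ge_int.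
  have h1 : 2 * Num.floor a <= Num.floor (2 * a).
    by rewrite floor_ge_int intrM; have := floor_le_tmp a; lra.
  rewrite e' floor_ge_int intrM in h1; lra.
by split; apply: h.
Qed.

Lemma cell_le k k' x y : (k <= k')%N -> cell k' x = cell k' y -> cell k x = cell k y.
Proof.
move=> /subnK <-; elim: (k' - k)%N => // n IH; rewrite addSn => /rowP h; apply: IH.
apply/rowP => i; have := h i; rewrite !mxE exprS -!mulrA; exact: floor_half.
Qed.

Lemma cell_close k x y i : cell k x = cell k y -> `|x 0 i - y 0 i| < 2 ^- k.
Proof.
move=> /rowP /(_ i); rewrite !mxE => e.
have k0 : 0 < 2 ^+ k :> R by rewrite exprn_gt0.
have := floor_le_tmp (2 ^+ k * x 0 i); have := floorD1_gt (2 ^+ k * x 0 i).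
have := floor_le_tmp (2 ^+ k * y 0 i); have := floorD1_gt (2 ^+ k * y 0 i).
rewrite e intrD => h1 h2 h3 h4.
rewrite -(ltr_pM2l k0) mulfV ?gt_eqF// -{1}(gtr0_norm k0) -normrM mulrBr ltr_norml.
by apply/andP; split; lra.
Qed.

(** Unions of dyadic cells of side 2^-k. *)
Definition level k (B : set 'rV[R]_d) := forall x y, cell k x = cell k y -> B x -> B y.

Lemma level_le k k' B : (k <= k')%N -> level k B -> level k' B.
Proof. by move=> kk' h x y e; apply: h; exact: cell_le e. Qed.

(** The k-th set consists of the cells of level k contained in [V]. As there are countably many
    cells, topology enters the measurability proofs only here. *)
Lemma open_level (V : set 'rV[R]_d) : open V ->
  exists2 F : nat -> set 'rV[R]_d, (forall k, level k (F k)) & V = \bigcup_k F k.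
Proof.
move=> oV; exists (fun k => [set x | forall y, cell k x = cell k y -> V y]).
  by move=> k x y e h z e'; apply: h; rewrite e.
apply/seteqP; split => [x Vx|x [k _ h]]; last exact: h.
have /nbhs_ballP[e /= e0 he] := open_nbhs_nbhs (conj oV Vx).
pose k := (Num.truncn e^-1).+1; exists k => // y xy; apply: he.
split=> // i j; rewrite (ord1 i) /ball /= (lt_trans (cell_close j xy))//.
rewrite invf_plt ?posrE ?exprn_gt0//; apply: (lt_le_trans (truncnS_gt _)).
by rewrite -natrX ler_nat ltnW// ltn_expl.
Qed.

Lemma measurable_level_comp k dT (T : measurableType dT) (F : T -> 'rV[R]_d) (B : set 'rV[int]_d) :
  (forall i, measurable_fun setT ((fun w => F w 0 i) : T -> measurableTypeR R)) ->
  measurable [set w | B (cell k (F w))].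
Proof.
move=> mF.
have -> : [set w | B (cell k (F w))] = \bigcup_z (if `[< B z >] then [set w | cell k (F w) = z] else set0).
  apply/seteqP; split => [w Bw|w [z _]]; first by exists (cell k (F w)) => //; case: asboolP.
  by case: asboolP => // Bz /= ->.
apply: countable_bigcupT_measurable; first exact: countableP.
move=> z; case: asboolP => // _.
have mG i : measurable_fun setT ((fun w => 2 ^+ k * F w 0 i) : T -> measurableTypeR R) by apply: measurable_funM => //; exact: mF.
have := @measurable_gv_event R 'I_d _ T (fun i w => 2 ^+ k * F w 0 i)
  (fun i => `[(z 0 i)%:~R, (z 0 i + 1)%:~R[%classic) mG (fun i => measurable_itv _).
congr measurable; apply/seteqP; split => w /=.
  move=> h; apply/rowP => i; rewrite !mxE; have := h i; rewrite /= in_itv /=; exact: floor_def.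
move=> <- i; rewrite /= in_itv /= !mxE.
by rewrite floor_le_tmp floorD1_gt.
Qed.

Lemma measurable_level k (B : set 'rV[R]_d) : level k B -> measurable (B : set (borel R d)).
Proof.
move=> lB.
have := @measurable_level_comp k _ (borel R d) id [set z | exists2 x, B x & cell k x = z] (fun i => measurable_coord i).
congr measurable; apply/seteqP; split => x /=; first by move=> [y By e]; exact: lB e By.
by move=> Bx; exists x.
Qed.

Lemma measurable_rV dT (T : measurableType dT) (F : T -> 'rV[R]_d) :
  (forall i, measurable_fun setT ((fun w => F w 0 i) : T -> measurableTypeR R)) ->
  measurable_fun setT (F : T -> borel R d).
Proof.
move=> mF; apply: (@measurability _ _ T (borel R d) setT F (@open 'rV[R]_d) erefl) => // _ [V oV <-]; rewrite setTI.
have [G lG ->] := open_level oV; rewrite preimage_bigcup; apply: bigcupT_measurable => k.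
have := @measurable_level_comp k _ T F [set z | exists2 x, G k x & cell k x = z] mF.
congr measurable; apply/seteqP; split => w /=; first by move=> [y By e]; exact: lG e By.
by move=> Bx; exists (F w).
Qed.

Lemma measurable_cell_fun k (c : 'rV[int]_d -> R) :
  measurable_fun setT ((fun x => c (cell k x)) : borel R d -> measurableTypeR R).
Proof.
move=> _ Y mY; rewrite setTI.
exact: (@measurable_level_comp k _ (borel R d) id [set z | Y (c z)] (fun i => measurable_coord i)).
Qed.

End DyadicCells.

(** * Orthogonality of characters on dyadic cells *)

Section OneDimension.
Context {R : realType}.
Local Notation leb := (@lebesgue_measure R).

(** The cell has length 1 / q and the cosine performs k full periods on it. The constant [C] keeps
    the integrand nonnegative, so that cells can be added up in [cells_integral]. *)
Lemma cell_integral (q z th c C : R) (j : int) (k : int) : 0 < q -> z = k%:~R -> k != 0 -> `|c| <= C ->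
  (\int[leb]_(t in `[(j%:~R / q)%R, ((j + 1)%:~R / q)%R[) (c * cos (2 * pi * (q * t * z) + th) + C)%:E)%E = (C / q)%:E.
Proof.
move=> q0 zk k0 cC.
have z0 : z != 0 by rewrite zk intr_eq0.
pose om := 2 * pi * q * z.
have om0 : om != 0 by rewrite /om mulf_neq0// mulf_neq0 ?gt_eqF// mulr_gt0 ?pi_gt0.
pose F t := c / om * sin (om * t + th) + C * t.
have ab : j%:~R / q < (j + 1)%:~R / q by rewrite ltr_pM2r ?invr_gt0// ltr_int ltrDl.
have dF (t : R) : is_derive t 1 F (c * cos (2 * pi * (q * t * z) + th) + C).
  have -> : 2 * pi * (q * t * z) + th = om * t + th by rewrite /om; ring.
  apply: is_derive_eq; rewrite /GRing.scale /=; field; exact: om0.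
have cf : continuous (fun t : R => c * cos (2 * pi * (q * t * z) + th) + C).
  move=> t; apply: cvgD; last exact: cvg_cst.
  apply: cvgM; first exact: cvg_cst.
  apply: continuous_comp; last exact: continuous_cos.
  apply: cvgD; last exact: cvg_cst.
  apply: cvgM; first exact: cvg_cst.
  by apply: cvgM; [apply: cvgM; [exact: cvg_cst|exact: cvg_id]|exact: cvg_cst].
have cF : continuous F.
  by move=> t; apply: differentiable_continuous; apply/derivable1_diffP; have [] := dF t.
rewrite integral_itv_bndo_bndc; last first.
  by apply/measurable_EFinP; apply: measurable_funTS; exact: continuous_measurable_fun.
rewrite (continuous_FTC2 ab (continuous_subspaceT cf) (F := F)).
- rewrite -EFinB; congr EFin; rewrite /F.
  have -> : om * ((j + 1)%:~R / q) + th = om * (j%:~R / q) + th + 2 * pi * k%:~R.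
    by rewrite /om zk intrD; field; rewrite gt_eqF.
  by rewrite sinDint intrD; field; rewrite om0 gt_eqF.
- split.
  + by move=> t _; have [] := dF t.
  + exact/cvg_at_right_filter/cF.
  + exact/cvg_at_left_filter/cF.
- by move=> t _; rewrite derive1E; have [_ ->] := dF t.
Qed.

Lemma measurable_floor_fun (c : int -> R) :
  measurable_fun setT ((fun y => c (Num.floor y)) : measurableTypeR R -> measurableTypeR R).
Proof.
move=> _ Y mY; rewrite setTI.
have -> : (fun y : R => c (Num.floor y)) @^-1` Y =
    \bigcup_(m : int) (if `[< Y (c m) >] then `[m%:~R, (m + 1)%:~R[%classic else set0).
  apply/seteqP; split => [y Yy|y [m _]].
    exists (Num.floor y) => //; case: asboolP => // _.
    by rewrite /= in_itv /= floor_le_tmp floorD1_gt.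
  by case: asboolP => // Ym; rewrite /= in_itv /= => /floor_def ->.
apply: countable_bigcupT_measurable; first exact: countableP.
by move=> m; case: asboolP => // _; exact: measurable_itv.
Qed.

Lemma cells_integral (q z th C : R) (c : int -> R) (a : int) (k : int) (n : nat) :
  0 < q -> z = k%:~R -> k != 0 -> (forall j, `|c j| <= C) ->
  (\int[leb]_(t in `[(a%:~R / q)%R, ((a + n%:Z)%:~R / q)%R[)
     (c (Num.floor (q * t)) * cos (2 * pi * (q * t * z) + th) + C)%:E)%E = (C * n%:R / q)%:E.
Proof.
move=> q0 zk k0 cC.
pose G t := c (Num.floor (q * t)) * cos (2 * pi * (q * t * z) + th) + C.
have G0 t : 0 <= G t.
  rewrite /G; have : `|c (Num.floor (q * t)) * cos (2 * pi * (q * t * z) + th)| <= C.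
    by rewrite normrM -[leRHS]mulr1; apply: ler_pM => //; exact: cos_max.
  by rewrite ler_norml; lra.
have mG : measurable_fun setT (G : measurableTypeR R -> measurableTypeR R).
  apply: measurable_funD => //; apply: measurable_funM.
    have mq : measurable_fun setT ((fun t => q * t) : measurableTypeR R -> measurableTypeR R) by exact: measurable_funM.
    exact: (measurableT_comp (measurable_floor_fun c) mq).
  apply: measurableT_comp; first by apply: continuous_measurable_fun; exact: continuous_cos.
  by apply: measurable_funD => //; apply: measurable_funM => //; apply: measurable_funM => //; exact: measurable_funM.
have mGE (E : set (measurableTypeR R)) : measurable_fun E (EFin \o G).
  by apply/measurable_EFinP; exact: measurable_funTS.
rewrite -/(G _); elim: n => [|n IH].
  by rewrite addr0 set_itvco0 integral_set0 mulr0 mul0r.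
have le1 : a%:~R / q <= (a + n%:Z)%:~R / q by rewrite ler_pM2r ?invr_gt0// ler_int lerDl.
have le2 : (a + n%:Z)%:~R / q <= (a + n%:Z + 1)%:~R / q by rewrite ler_pM2r ?invr_gt0// ler_int lerDl.
have -> : (a + n.+1%:Z) = a + n%:Z + 1 by rewrite -addn1 PoszD addrA.
rewrite (@itv_bndbnd_setU _ _ _ (BLeft ((a + n%:Z)%:~R / q)))//.
rewrite ge0_integral_setU//=; last 2 first.
- by move=> x _; rewrite lee_fin; exact: G0.
- apply/disj_setPS => x [/=]; rewrite !in_itv/= => /andP[_ h1] /andP[h2 _].
  by move: h2; rewrite leNgt h1.
rewrite IH.
have -> : (\int[leb]_(x in `[((a + n%:Z)%:~R / q)%R, ((a + n%:Z + 1)%:~R / q)%R[) (G x)%:E =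
   \int[leb]_(t in `[((a + n%:Z)%:~R / q)%R, ((a + n%:Z + 1)%:~R / q)%R[) (c (a + n%:Z) * cos (2 * pi * (q * t * z) + th) + C)%:E)%E.
  apply: eq_integral => t; rewrite inE /= in_itv /= ler_pdivrMr// ltr_pdivlMr// !(mulrC t) => /andP[h1 h2].
  by rewrite /G (_ : Num.floor (q * t) = a + n%:Z)//; apply: floor_def; rewrite h1 h2.
rewrite (cell_integral _ _ q0 zk k0 (cC _)) -EFinD; congr EFin.
by rewrite -(natr1 n) mulrDr mulr1 mulrDl.
Qed.

Lemma uniform_orthogonality (N k : nat) (hN : - N%:R < N%:R :> R) (z : int) (th C : R) (c : int -> R) :
  z != 0 -> (forall j, `|c j| <= C) ->
  \int[uniform_prob hN]_t (c (Num.floor (2 ^+ k * t)) * cos (2 * pi * (2 ^+ k * t * z%:~R) + th)) = 0.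
Proof.
move=> z0 cC; set G := fun t => _.
have q0 : 0 < 2 ^+ k :> R by rewrite exprn_gt0.
have mq : measurable_fun setT ((fun t => 2 ^+ k * t) : measurableTypeR R -> measurableTypeR R) by exact: measurable_funM.
have mG : measurable_fun setT (G : measurableTypeR R -> measurableTypeR R).
  apply: measurable_funM; first exact: (measurableT_comp (measurable_floor_fun c) mq).
  apply: measurableT_comp; first by apply: continuous_measurable_fun; exact: continuous_cos.
  by apply: measurable_funD => //; apply: measurable_funM => //; exact: measurable_funM.
have GC t : `|G t| <= C.
  by rewrite /G normrM -[leRHS]mulr1; apply: ler_pM => //; exact: cos_max.
have C0 : 0 <= C := le_trans (normr_ge0 _) (cC 0).
have iG := bounded_integrable (uniform_prob hN) mG GC.
have iC : (uniform_prob hN).-integrable setT (EFin \o (fun=> C)).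
  by apply: (bounded_integrable (uniform_prob hN) (f := fun=> C) (C := C)) => // x; rewrite ger0_norm.
have N0 : 0 < N%:R :> R by have := hN; lra.
have pos t : 0 <= G t + C by have := GC t; rewrite ler_norml; lra.
have mGC : measurable_fun setT (EFin \o (fun t => G t + C)).
  by apply/measurable_EFinP; exact: measurable_funD.
suff : \int[uniform_prob hN]_t (G t + C) = C.
  rewrite (@RintegralD _ _ _ (uniform_prob hN) setT G (fun=> C))// Rintegral_cst//.
  by rewrite [X in fine X]probability_setT mulr1; lra.
rewrite /Rintegral integral_uniform//.
have e : (\int[leb]_(t in `[(- N%:R)%R, N%:R%R]) (G t + C)%:E)%E = (C * (2 * N%:R))%:E.
  rewrite -integral_itv_bndo_bndc; last exact: measurable_funTS.
  have := @cells_integral (2 ^+ k) z%:~R th C c (- (N * 2 ^ k)%N%:Z) z (2 * N * 2 ^ k)%N q0 erefl z0 cC.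
  have nz : (2 ^+ k : R) != 0 by rewrite gt_eqF.
  have -> : (- (N * 2 ^ k)%N%:Z)%:~R / 2 ^+ k = - N%:R :> R.
    by rewrite intrN -[_%:~R]/((N * 2 ^ k)%N%:R) natrM natrX; field.
  have -> : (- (N * 2 ^ k)%N%:Z + (2 * N * 2 ^ k)%N%:Z)%:~R / 2 ^+ k = N%:R :> R.
    rewrite intrD intrN -[((N * 2 ^ k)%N%:Z)%:~R]/((N * 2 ^ k)%N%:R) -[((2 * N * 2 ^ k)%N%:Z)%:~R]/((2 * N * 2 ^ k)%N%:R).
    by rewrite !natrM natrX; field.
  move=> ->; congr EFin; rewrite !natrM natrX; field; exact: nz.
rewrite e -EFinM /=; field; lra.
Qed.

End OneDimension.

Section BoxProbability.
Context {R : realType}.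
Local Notation leb := (@lebesgue_measure R).
Local Notation RM := (measurableTypeR R).

Definition box (n : nat) (N : nat) : set (borel R n) := [set x : 'rV[R]_n | forall i, - N%:R <= x 0 i <= N%:R].

Arguments box : clear implicits.

Lemma measurable_box_rV n N : measurable (box n N).
Proof.
have := @measurable_gv_event R 'I_n _ (borel R n) (fun i l => (l : 'rV[R]_n) 0 i)
  (fun=> `[- N%:R, N%:R]%classic) (fun i => measurable_coord i) (fun i => measurable_itv _).
by congr measurable; apply/seteqP; split => l /= h i; have := h i; rewrite /= in_itv.
Qed.

Lemma lebesgue_rV0 n : @lebesgue_rV R n set0 = 0%E.
Proof.
elim: n => [|n IH] /=; first by rewrite indicE in_set0.
rewrite integral0_eq// => t _; rewrite -[RHS]IH; congr (lebesgue_rV _).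
Qed.

Definition cons_rV n (z : RM * borel R n) : borel R n.+1 := row_mx (const_mx z.1 : 'rV[R]_1) (z.2 : 'rV[R]_n).

Lemma cons_rV0 n (z : RM * borel R n) : (cons_rV z : 'rV[R]_n.+1) 0 ord0 = z.1.
Proof.
rewrite /cons_rV (_ : ord0 = @lshift 1 n ord0); last exact/val_inj.
by rewrite (@row_mxEl _ 1 1 n) mxE.
Qed.

Lemma cons_rVS n (z : RM * borel R n) (i : 'I_n) : (cons_rV z : 'rV[R]_n.+1) 0 (lift ord0 i) = (z.2 : 'rV[R]_n) 0 i.
Proof.
rewrite /cons_rV (_ : lift ord0 i = @rshift 1 n i); last exact/val_inj.
by rewrite (@row_mxEr _ 1 1 n).
Qed.

Lemma measurable_cons_rV n : measurable_fun setT (@cons_rV n).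
Proof.
apply: measurable_rV => i; have [j ->|->] := unliftP ord0 i.
  under eq_fun do rewrite cons_rVS.
  exact: (measurableT_comp (measurable_coord j) measurable_snd).
under eq_fun do rewrite cons_rV0.
exact: measurable_fst.
Qed.

(** The phase [th] receives the contribution of the first coordinate when the dimension is lowered
    by one. *)
Definition cell_trig n (c : 'rV[int]_n -> R) (k : nat) (z : 'rV[int]_n) (th : R) (x : borel R n) : R :=
  c (cell k x) * cos (2 * pi * (2 ^+ k * dot x (map_mx intr z)) + th).

Lemma measurable_cell_trig n c k z th :
  measurable_fun setT (@cell_trig n c k z th : borel R n -> RM).
Proof.
apply: measurable_funM; first exact: measurable_cell_fun.
apply: measurableT_comp; first by apply: continuous_measurable_fun; exact: continuous_cos.
by apply: measurable_funD => //; apply: measurable_funM => //; apply: measurable_funM => //; exact: measurable_dot.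
Qed.

Lemma cell_trig_bound n c k z th C x : (forall j, `|c j| <= C) -> `|@cell_trig n c k z th x| <= C.
Proof.
by move=> cC; rewrite normrM -[leRHS]mulr1; apply: ler_pM => //; exact: cos_max.
Qed.

Definition tail_rV (T : Type) n (z : 'rV[T]_n.+1) : 'rV[T]_n := \row_i z 0 (lift ord0 i).

Lemma dot_cons n (x : RM * borel R n) (z : 'rV[R]_n.+1) :
  dot (cons_rV x : 'rV[R]_n.+1) z = x.1 * z 0 ord0 + dot (x.2 : 'rV[R]_n) (tail_rV z).
Proof.
rewrite /dot big_ord_recl cons_rV0; congr (_ + _); apply: eq_bigr => i _.
by rewrite cons_rVS mxE.
Qed.

Definition consz n (m : int) (v : 'rV[int]_n) : 'rV[int]_n.+1 :=
  \row_i (if unlift ord0 i is Some j then v 0 j else m).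

Lemma cell_cons n k (x : RM * borel R n) :
  cell k (cons_rV x : 'rV[R]_n.+1) = consz (Num.floor (2 ^+ k * x.1)) (cell k (x.2 : 'rV[R]_n)).
Proof.
apply/rowP => i; rewrite [LHS]mxE [RHS]mxE; have [j ->|->] := unliftP ord0 i.
  by rewrite cons_rVS mxE.
by rewrite cons_rV0.
Qed.

(* [U] is the uniform probability on the box. Functions that are constant on the dyadic cells of
   level [k] are orthogonal to the nontrivial characters with frequencies in [2^k Z^n]. *)
Lemma box_probability n (N : nat) : (0 < N)%N -> exists U : probability (borel R n) R,
  (forall A, measurable A -> lebesgue_rV (A `&` box n N) = (((2 * N%:R) ^+ n)%:E * U A)%E) /\
  (forall c C k z th, (forall j, `|c j| <= C) -> z != 0 ->
     \int[U]_x @cell_trig n c k z th x = 0).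
Proof.
move=> N0; elim: n => [|n [U [U1 U2]]].
  exists (dirac ((0 : 'rV[R]_0) : borel R 0) : probability (borel R 0) R); split.
    move=> A mA; rewrite /= expr0 mul1e diracE indicE; congr ((_ : bool)%:R%:E).
    by apply/idP/idP; rewrite !inE; [case|move=> h; split => // -[]].
  by move=> c C k z th _; rewrite (_ : z = 0) ?eqxx//; apply/rowP; case.
have N0' : 0 < N%:R :> R by rewrite ltr0n.
have hN : - N%:R < N%:R :> R by lra.
pose u : probability RM R := uniform_prob hN.
pose F : {mfun (RM * borel R n)%type >-> borel R n.+1} :=
  HB.pack (@cons_rV n) (isMeasurableFun.Build _ _ _ _ _ (@measurable_cons_rV n)).
pose U' : probability (borel R n.+1) R := distribution (pprod u U) F.
have secE (A : set (borel R n.+1)) : measurable A ->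
    measurable_fun setT (fun t => U [set v | A (cons_rV (t, v))]) /\
    U' A = (\int[u]_t U [set v | A (cons_rV (t, v))])%E.
  move=> mA; have mFA : measurable (@cons_rV n @^-1` A).
    by have := @measurable_cons_rV n measurableT _ mA; rewrite setTI.
  by split; [have [_] := measurable_sectionP U mFA|rewrite -[LHS]/(pprod u U (@cons_rV n @^-1` A)) pprodE].
exists U'; split.
  move=> A mA; have [ms ->] := secE A mA.
  rewrite integral_uniform//=.
  pose s t := U [set v | A (cons_rV (t, v))].
  have h t : lebesgue_rV [set v : borel R n | (A `&` box n.+1 N) (row_mx (const_mx t : 'rV[R]_1) (v : 'rV[R]_n))] =
      (((2 * N%:R) ^+ n)%:E * (s \_ (`[(- N%:R)%R, N%:R%R]%classic : set RM)) t)%E.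
    rewrite patchE; case: ifPn => tN.
      have mAt : measurable [set v | A (cons_rV (t, v))].
        have mFA : measurable (@cons_rV n @^-1` A).
          by have := @measurable_cons_rV n measurableT _ mA; rewrite setTI.
        by have [m _] := measurable_sectionP U mFA; exact: m.
      rewrite /s -U1//; congr (lebesgue_rV _).
      have tb : - N%:R <= t <= N%:R by move: tN; rewrite inE /= in_itv.
      apply/seteqP; split => v /= [Av bv]; split => // i.
        by have := bv (lift ord0 i); rewrite (cons_rVS (t, v)).
      have [j ->|->] := unliftP ord0 i; first by rewrite (cons_rVS (t, v)).
      by rewrite (cons_rV0 (t, v)).
    rewrite mule0 -[RHS](lebesgue_rV0 n); congr (lebesgue_rV _).
    apply/seteqP; split => v //= [_ bv]; move: tN; rewrite notin_setE /= in_itv /=; apply.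
    by have := bv ord0; rewrite (cons_rV0 (t, v)).
  under eq_integral do rewrite h.
  have c0 : 0 <= (2 * N%:R) ^+ n :> R by rewrite exprn_ge0// mulr_ge0.
  have mI : measurable (`[(- N%:R)%R, N%:R%R]%classic : set RM) by exact: measurable_itv.
  rewrite ge0_integralZl//; first last.
  - by move=> t _; rewrite patchE; case: ifP.
  - by apply/(measurable_restrictT _ mI); exact: measurable_funTS.
  - rewrite -integral_mkcond muleA -EFinM; congr ((_ * _)%E); congr EFin.
    by rewrite exprS; field; lra.
move=> c C k z th cC z0.
have mG := @measurable_cell_trig n.+1 c k z th.
have GC x := @cell_trig_bound n.+1 c k z th C x cC.
have iG := bounded_integrable U' mG GC.
have C0 : 0 <= C := le_trans (normr_ge0 _) (cC 0).
pose g (x : RM * borel R n) := cell_trig c k z th (cons_rV x).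
have mg : measurable_fun setT (g : _ -> RM) by exact: (measurableT_comp mG (@measurable_cons_rV n)).
have ig := bounded_integrable (pprod u U) mg (fun x => GC (cons_rV x)).
have -> : \int[U']_x cell_trig c k z th x = \int[pprod u U]_x g x.
  rewrite /Rintegral (@integral_distribution _ _ _ _ _ _ F)//.
  exact/measurable_EFinP.
have tm : tail_rV (map_mx intr z) = map_mx intr (tail_rV z) :> 'rV[R]_n by apply/rowP => i; rewrite !mxE.
have gE t v : g (t, v) = cell_trig (fun j => c (consz (Num.floor (2 ^+ k * t)) j)) k (tail_rV z)
    (2 * pi * (2 ^+ k * t * (z 0 ord0)%:~R) + th) v.
  rewrite /g /cell_trig cell_cons dot_cons /= mxE; congr (_ * cos _).
  by rewrite tm; ring.
(* If the other frequencies vanish, the first one does not, and Fubini is applied so as to integrate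
   over the first coordinate; otherwise the inner integral over the other coordinates vanishes by
   induction. *)
have [tz|tz] := eqVneq (tail_rV z) 0.
  have z00 : z 0 ord0 != 0.
    apply: contra_neq z0 => z00; apply/rowP => i; rewrite mxE.
    have [j ->|->//] := unliftP ord0 i.
    by move/rowP : tz => /(_ j); rewrite !mxE.
  rewrite /Rintegral -(integral21_prod_meas1 ig) integral0_eq// => v _ /=.
  have iv : u.-integrable setT (EFin \o (fun t => g (t, v))).
    apply: (@bounded_integrable _ _ _ u (fun t => g (t, v)) C); last by move=> t; exact: GC.
    exact: (measurableT_comp mg (measurable_pair2 v)).
  rewrite -[LHS](@fineK R); last exact: integrable_fin_num.
  congr EFin.
  have := @uniform_orthogonality R N k hN (z 0 ord0) th C (fun m => c (consz m (cell k v))) z00 (fun=> cC _).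
  rewrite /Rintegral => <-; congr fine; apply: eq_integral => t _; congr EFin.
  rewrite /g /cell_trig cell_cons dot_cons tm tz /= mxE.
  by rewrite (_ : map_mx intr 0 = 0) ?dot0r ?addr0 ?mulrA//; apply/rowP => i; rewrite !mxE.
rewrite (pprod_integral ig) integral0_eq// => t _.
have mGt := @measurable_cell_trig n (fun j => c (consz (Num.floor (2 ^+ k * t)) j)) k (tail_rV z) (2 * pi * (2 ^+ k * t * (z 0 ord0)%:~R) + th).
under eq_integral do rewrite gE.
rewrite -[LHS](@fineK R); last first.
  apply: integrable_fin_num => //.
  exact: (@bounded_integrable _ _ _ U _ C mGt (fun x => cell_trig_bound _ _ _ _ (fun j => cC _))).
congr EFin; exact: (U2 _ C).
Qed.

End BoxProbability.

(** * Periodization of an absolutely continuous measure *)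

Section LevelApproximation.
Context {R : realType} {d : nat} (U : probability (borel R d) R).
Local Notation RM := (measurableTypeR R).
Import HBSimple.

Definition level_fun k (s : 'rV[R]_d -> R) := forall x y, cell k x = cell k y -> s x = s y.

Lemma level_fun_le k k' s : (k <= k')%N -> level_fun k s -> level_fun k' s.
Proof. by move=> kk' h x y e; apply: h; exact: cell_le e. Qed.

Lemma level_funE k s : level_fun k s ->
  s = (fun j : 'rV[int]_d => s (2 ^- k *: map_mx intr j)) \o cell k.
Proof.
move=> ls; apply/funext => x; apply: ls; apply/rowP => i; rewrite !mxE.
by rewrite mulrA mulfV ?mul1r ?intrKfloor// expf_neq0.
Qed.

Lemma measurable_level_fun k s : level_fun k s -> measurable_fun setT (s : borel R d -> RM).
Proof. by move=> /level_funE ->; exact: measurable_cell_fun. Qed.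

Definition setsd (A B : set (borel R d)) := (A `\` B) `|` (B `\` A).

Lemma measurable_setsd A B : measurable A -> measurable B -> measurable (setsd A B).
Proof. by move=> mA mB; apply: measurableU; exact: measurableD. Qed.

(** Approximability in the measure of the symmetric difference; the sets with this property form a
    sigma-algebra that contains the open sets. *)
Definition level_approx (A : set (borel R d)) := measurable A /\ forall e : R, 0 < e ->
  exists k B, level k B /\ pr U (setsd A B) <= e.

Lemma level_approx_level k B : level k B -> level_approx B.
Proof.
move=> lB; split; first exact: measurable_level lB.
move=> e e0; exists k, B; split => //.
by rewrite (_ : setsd B B = set0) ?pr0 ?ltW//; rewrite /setsd setDv setU0.
Qed.

Lemma level_approxC A : level_approx A -> level_approx (~` A).
Proof.
move=> [mA hA]; split; first exact: measurableC.
move=> e /hA[k [B [lB AB]]]; exists k, (~` B); split.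
  by move=> x y e' nB By; apply: nB; exact: lB (esym e') By.
rewrite (_ : setsd _ _ = setsd A B)//; apply/seteqP; split => x /=.
  by move=> [[h1 /contrapT h2]|[h1 /contrapT h2]]; [right|left].
by move=> [[h1 h2]|[h1 h2]]; [right|left]; split => // h3.
Qed.

Lemma level_approxU A B : level_approx A -> level_approx B -> level_approx (A `|` B).
Proof.
move=> [mA hA] [mB hB]; split; first exact: measurableU.
move=> e e0; have e2 : 0 < e / 2 by lra.
have [k1 [A' [lA' AA']]] := hA _ e2; have [k2 [B' [lB' BB']]] := hB _ e2.
exists (maxn k1 k2), (A' `|` B'); split.
  have l1 := level_le (leq_maxl k1 k2) lA'; have l2 := level_le (leq_maxr k1 k2) lB'.
  by move=> x y e' [h|h]; [left; exact: l1 e' h|right; exact: l2 e' h].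
have mA' := measurable_level lA'; have mB' := measurable_level lB'.
have m1 := measurable_setsd mA mA'; have m2 := measurable_setsd mB mB'.
apply: (@le_trans _ _ (pr U (setsd A A' `|` setsd B B'))).
  apply: pr_le; [apply: measurable_setsd; exact: measurableU|exact: measurableU|].
  move=> x [[[h1|h1] /not_orP[h2 h3]]|[[h1|h1] /not_orP[h2 h3]]].
  - by left; left.
  - by right; left.
  - by left; right.
  - by right; right.
by have := prU_le U m1 m2; lra.
Qed.

Lemma level_approx_bigcup (F : nat -> set (borel R d)) : (forall n, level_approx (F n)) ->
  level_approx (\bigcup_n F n).
Proof.
move=> hF; have mF n : measurable (F n) by have [] := hF n.
split; first exact: bigcupT_measurable.
move=> e e0; have e2 : 0 < e / 2 by lra.
pose G n := \big[setU/set0]_(i < n.+1) F i.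
have hG n : level_approx (G n).
  rewrite /G; elim: (n.+1) => [|m IH]; last by rewrite big_ord_recr /=; exact: level_approxU.
  by rewrite big_ord0; exact: (@level_approx_level 0).
have mG n : measurable (G n) by have [] := hG n.
have GF : \bigcup_n G n = \bigcup_n F n by rewrite bigcup_bigsetU_bigcup.
have ndG : nondecreasing_seq G.
  by apply/nondecreasing_seqP => n; apply/subsetPset; rewrite /G (big_ord_recr n.+1) => x; left.
have mU := bigcupT_measurable G mG.
have h := nondecreasing_cvg_mu (mu := U) mG mU ndG.
have h' : (U \o G) n @[n --> \oo] --> (pr U (\bigcup_n G n))%:E by rewrite -(prE U mU).
have [_ /cvgrPdist_lt /(_ _ e2) [n _ /(_ n (leqnn n))]] := (fine_cvgP _ _).1 h'.
rewrite /=.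
rewrite GF in mU *; rewrite -/(pr U (G n)) => hn.
have [k [B [lB hB]]] := (hG n).2 _ e2; exists k, B; split => //.
have mB := measurable_level lB; have mD := measurable_setsd (mG n) mB.
have mE : measurable (\bigcup_n F n `\` G n) by exact: measurableD.
apply: (@le_trans _ _ (pr U ((\bigcup_n F n `\` G n) `|` setsd (G n) B))).
  apply: pr_le; [exact: measurable_setsd|exact: measurableU|].
  move=> x [[h1 h2]|[h1 h2]].
    by have [h3|h3] := pselect (G n x); [right; left|left].
  by right; right; split => // h3; apply: h2; rewrite -GF; exists n.
have : pr U (\bigcup_n F n `\` G n) <= e / 2.
  rewrite pr_setD// (_ : _ `&` G n = G n).
    by move: hn; rewrite ltr_norml => /andP[_ /ltW].
  by apply/seteqP; split => x; [case|move=> hx; split => //; rewrite -GF; exists n].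
by have := prU_le U mE mD; lra.
Qed.

Lemma measurable_level_approx (A : set (borel R d)) : measurable A -> level_approx A.
Proof.
suff h : <<s @open 'rV[R]_d >> `<=` level_approx by exact: h.
apply: smallest_sub.
  split.
  - exact: (@level_approx_level 0).
  - by move=> B /level_approxC; rewrite setTD.
  - exact: level_approx_bigcup.
move=> V oV; have [F lF ->] := open_level oV.
by apply: level_approx_bigcup => n; exact: level_approx_level (lF n).
Qed.

Definition fun_approx (g : borel R d -> R) := [/\ measurable_fun setT (g : _ -> RM),
  exists C, forall x, `|g x| <= C & forall e : R, 0 < e ->
  exists k s C, [/\ level_fun k s, forall x, `|s x| <= C & \int[U]_x `|g x - s x| <= e]].

Lemma fun_approx_indic A : measurable A -> fun_approx \1_A.
Proof.
move=> mA; have ind1 (B : set (borel R d)) x : `|\1_B x : R| <= 1.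
  by rewrite indicE; case: (_ \in _); rewrite ?normr1 ?normr0.
split; [exact: measurable_indic|by exists 1|].
move=> e e0; have [_ /(_ e e0)[k [B [lB hB]]]] := measurable_level_approx mA.
exists k, \1_B, 1; split => //.
  by move=> x y xy; rewrite !indicE; congr ((_ : bool)%:R); apply/idP/idP; rewrite !inE; apply: lB.
have mB := measurable_level lB.
have ei : pr U (setsd A B) = \int[U]_x \1_(setsd A B) x.
  by rewrite /Rintegral integral_indic ?setIT//; exact: measurable_setsd.
apply: le_trans hB; rewrite ei; apply: le_RintegralT.
- apply: (@bounded_integrable _ _ _ U (fun x => `|\1_A x - \1_B x|) 2).
    by apply: measurableT_comp => //; apply: measurable_funB; exact: measurable_indic.
  by move=> x; rewrite normr_id (le_trans (ler_normB _ _))//; have := ind1 A x; have := ind1 B x; lra.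
- apply: (@bounded_integrable _ _ _ U \1_(setsd A B) 1) => //.
  by apply: measurable_indic; exact: measurable_setsd.
- move=> x; rewrite !indicE /setsd in_setU !in_setD.
  by case: (x \in A); case: (x \in B); rewrite /= ?subrr ?subr0 ?sub0r ?normrN ?normr1 ?normr0.
Qed.

Lemma fun_approxD g h : fun_approx g -> fun_approx h -> fun_approx (fun x => g x + h x).
Proof.
move=> [mg [Cg gC] ag] [mh [Ch hC] ah]; split; first exact: measurable_funD.
  by exists (Cg + Ch) => x; rewrite (le_trans (ler_normD _ _))// lerD.
move=> e e0; have e2 : 0 < e / 2 by lra.
have [k1 [s1 [C1 [l1 b1 i1]]]] := ag _ e2; have [k2 [s2 [C2 [l2 b2 i2]]]] := ah _ e2.
exists (maxn k1 k2), (fun x => s1 x + s2 x), (C1 + C2); split.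
- move=> x y e'; rewrite (level_fun_le (leq_maxl k1 k2) l1 e').
  by rewrite (level_fun_le (leq_maxr k1 k2) l2 e').
- by move=> x; rewrite (le_trans (ler_normD _ _))// lerD.
have m1 := measurable_level_fun l1; have m2 := measurable_level_fun l2.
have ii (u v : borel R d -> R) (Cu Cv : R) : measurable_fun setT (u : _ -> RM) -> measurable_fun setT (v : _ -> RM) ->
    (forall x, `|u x| <= Cu) -> (forall x, `|v x| <= Cv) -> U.-integrable setT (EFin \o (fun x => `|u x - v x|)).
  move=> mu mv bu bv; apply: (@bounded_integrable _ _ _ U (fun x => `|u x - v x|) (Cu + Cv)).
    by apply: measurableT_comp => //; exact: measurable_funB.
  by move=> x; rewrite normr_id (le_trans (ler_normB _ _))// lerD.
have j1 := ii _ _ _ _ mg m1 gC b1; have j2 := ii _ _ _ _ mh m2 hC b2.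
apply: (@le_trans _ _ (\int[U]_x (`|g x - s1 x| + `|h x - s2 x|))); last first.
  by rewrite RintegralD//; lra.
apply: le_RintegralT.
- apply: (ii (fun x => g x + h x) (fun x => s1 x + s2 x) (Cg + Ch) (C1 + C2)).
  + exact: measurable_funD.
  + exact: measurable_funD.
  + by move=> x; rewrite (le_trans (ler_normD _ _))// lerD.
  + by move=> x; rewrite (le_trans (ler_normD _ _))// lerD.
- exact: (integrableD measurableT j1 j2).
- by move=> x; rewrite opprD addrACA ler_normD.
Qed.

Lemma fun_approxZ r g : fun_approx g -> fun_approx (fun x => r * g x).
Proof.
move=> [mg [Cg gC] ag]; split; first exact: measurable_funM.
  by exists (`|r| * Cg) => x; rewrite normrM ler_wpM2l.
move=> e e0; have r0 : 0 < `|r| + 1 by rewrite ltr_wpDl.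
have [k [s [C [l b i]]]] := ag (e / (`|r| + 1)) (divr_gt0 e0 r0).
exists k, (fun x => r * s x), (`|r| * C); split.
- by move=> x y e'; rewrite (l _ _ e').
- by move=> x; rewrite normrM ler_wpM2l.
have m := measurable_level_fun l.
under eq_Rintegral do rewrite -mulrBr normrM.
rewrite RintegralZl//; last first.
  apply: (@bounded_integrable _ _ _ U (fun x => `|g x - s x|) (Cg + C)).
    by apply: measurableT_comp => //; exact: measurable_funB.
  by move=> x; rewrite normr_id (le_trans (ler_normB _ _))// lerD.
apply: (@le_trans _ _ (`|r| * (e / (`|r| + 1)))); first by rewrite ler_wpM2l.
by rewrite mulrA ler_pdivrMr// mulrC ler_wpM2l ?ltW//; lra.
Qed.

Lemma fun_approx_sum n (r : nat -> R) (A : nat -> set (borel R d)) : (forall i, measurable (A i)) ->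
  fun_approx (fun x => \sum_(i < n) r i * \1_(A i) x).
Proof.
move=> mA; elim: n => [|n IH].
  have -> : (fun x : borel R d => \sum_(i < 0) r i * \1_(A i) x) = fun=> 0.
    by apply/funext => x; rewrite big_ord0.
  split => //; first by exists 0 => x; rewrite normr0.
  - move=> e e0; exists 0%N, (fun=> 0), 0; split => //; first by move=> x; rewrite normr0.
    by under eq_Rintegral do rewrite subrr normr0; rewrite Rintegral_cst// mul0r ltW.
under eq_fun do rewrite big_ord_recr /=.
by apply: fun_approxD => //; apply: fun_approxZ; exact: fun_approx_indic.
Qed.

(** Simple functions approximate the density in L^1, and cell functions approximate simple
    functions. Replacing negative values by 0 does not increase the distance to a nonnegative
    density. *)
Lemma integrable_level_approx (p : borel R d -> R) (e : R) : U.-integrable setT (EFin \o p) ->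
  (forall x, 0 <= p x) -> 0 < e ->
  exists k s C, [/\ level_fun k s, forall x, 0 <= s x <= C & \int[U]_x `|p x - s x| <= e].
Proof.
move=> ip p0 e0; have e2 : 0 < e / 2 by lra.
have [g [ig _ hg]] := approximation_sfun_integrable measurableT ip.
have [_ /cvgrPdist_lt /(_ _ e2) [n _ /(_ n (leqnn n))]] := (fine_cvgP _ _).1 hg.
rewrite /= sub0r normrN => hn.
have hn' : \int[U]_x `|p x - g n x| <= e / 2.
  by apply: le_trans (ltW hn); rewrite (le_trans _ (ler_norm _)).
have [mg [Cg gC] ag] : fun_approx (g n).
  pose r := finmap.enum_fset (fset_set (range (g n))).
  have := @fun_approx_sum (size r) (fun i => r`_i) (fun i => g n @^-1` [set r`_i])
    (fun i => measurable_sfunP (g n) (measurable_set1 _)).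
  by congr fun_approx; apply/funext => x; rewrite [RHS]fimfunEord.
have [k [s [C [l b i]]]] := ag _ e2.
have m := measurable_level_fun l.
exists k, (fun x => Num.max 0 (s x)), C; split.
- by move=> x y xy; rewrite (l _ _ xy).
- move=> x; have := b x; rewrite le_max lexx ge_max /= => h.
  by rewrite (le_trans _ h)//= (le_trans (ler_norm _) h).
have j1 : U.-integrable setT (EFin \o (fun x => `|p x - g n x|)).
  have := integrable_abse (integrableB measurableT ip (ig n)).
  by apply: eq_integrable => // x _.
have j2 : U.-integrable setT (EFin \o (fun x => `|g n x - s x|)).
  apply: (@bounded_integrable _ _ _ U (fun x => `|g n x - s x|) (Cg + C)).
    by apply: measurableT_comp => //; exact: measurable_funB.
  by move=> x; rewrite normr_id (le_trans (ler_normB _ _))// lerD.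
have j3 := integrableD measurableT j1 j2.
apply: (@le_trans _ _ (\int[U]_x (`|p x - g n x| + `|g n x - s x|))); last by rewrite RintegralD//; lra.
have pt x : `|p x - Num.max 0 (s x)| <= `|p x - g n x| + `|g n x - s x|.
  apply: (@le_trans _ _ `|p x - s x|).
    case: (leP 0 (s x)) => h; first by [].
    by rewrite subr0 !ger0_norm//; have := p0 x; lra.
  by rewrite (_ : p x - s x = (p x - g n x) + (g n x - s x)) ?ler_normD//; ring.
apply: le_RintegralT => //.
apply: (le_integrable measurableT _ _ j3); last first.
  by move=> x _ /=; rewrite lee_fin normr_id (le_trans (pt x))// ler_norm.
apply/measurable_EFinP; apply: measurableT_comp => //; apply: measurable_funB.
  by apply/measurable_EFinP; have /integrableP[] := ip.
by apply: measurable_maxr.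
Qed.

End LevelApproximation.

Section PeriodizedDensity.
Context {R : realType} {d : nat} (nu : {finite_measure set (borel R d) -> \bar R}).
Local Notation RM := (measurableTypeR R).

(* Replacing the density of [nu] by a smaller one, itself dominated by a function constant on the
   dyadic cells of side [1 / r], makes the exponentials with frequencies in [r Z^d] nearly orthogonal. *)
Lemma periodized_density (e : R) : nu `<< @lebesgue_rV R d -> 0 < e ->
  exists (w : borel R d -> R) (r : nat), [/\ bounded_weight w, (0 < r)%N,
    fine (nu setT) - e <= \int[nu]_l w l &
    forall (I : finType) (a : I -> R) (z : I -> 'rV[int]_d), injective z ->
      \int[nu]_l (w l * trig_sqr a (fun i => r%:R *: map_mx intr (z i)) l) <=
      (fine (nu setT) + e) * \sum_i a i ^+ 2].
Proof.
move=> nu_ac e0; have e2 : 0 < e / 2 by lra.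
have [N [N0 hN]] : exists N, (0 < N)%N /\ fine (nu (~` @box R d N)) <= e / 2.
  pose F n := ~` @box R d n.+1.
  have mF n : measurable (F n) by apply: measurableC; exact: measurable_box_rV.
  have F0 : \bigcap_n F n = set0.
    apply/seteqP; split => // l h.
    pose n := Num.truncn (enorm l).
    apply: (h n I) => i; have := coord_le_enorm l i; have := truncnS_gt (enorm l).
    by rewrite -/n -ler_norml; lra.
  have niF : nonincreasing_seq F.
    move=> n m nm; apply/subsetPset => l h h'; apply: h => i; have := h' i.
    have : n.+1%:R <= m.+1%:R :> R by rewrite ler_nat ltnS.
    by move=> h1 /andP[h2 h3]; apply/andP; split; lra.
  have fF0 : (nu (F 0%N) < +oo)%E by rewrite ltey_eq fin_num_measure.
  have := nonincreasing_cvg_mu fF0 mF _ niF; rewrite F0 measure0 => /(_ measurable0).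
  move=> /fine_cvgP[_ /cvgrPdist_lt /(_ _ e2) [n _ /(_ n (leqnn n))]] /=.
  by rewrite sub0r normrN => hn; exists n.+1; split => //; rewrite ltW// (le_lt_trans (ler_norm _)).
have [U [U1 U2]] := @box_probability R d N N0.
have mb := @measurable_box_rV R d N.
have fb : (nu (@box R d N) < +oo)%E by rewrite ltey_eq fin_num_measure.
pose nub : {finite_measure set (borel R d) -> \bar R} := mfrestr mb fb.
have nubE A : nub A = nu (A `&` @box R d N) by [].
have nub_ac : nub `<< U.
  apply/null_content_dominatesP => A mA UA0; rewrite nubE.
  apply: (nu_ac (A `&` @box R d N)) => //; last exact: measurableI.
  move=> B mB BA; have -> : B = B `&` @box R d N by rewrite setIidl// => x /BA[].
  rewrite U1//; have -> : U B = 0%E; last by rewrite mule0.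
  by apply: (subset_measure0 mB mA _ UA0) => x /BA[].
have [f [f0 ffin fi fE]] := radon_nikodym_sigma_finite nub_ac.
pose p x := fine (f x).
have pE x : f x = (p x)%:E by rewrite fineK.
have p0 x : 0 <= p x by exact: fine_ge0.
have ip : U.-integrable setT (EFin \o p).
  by move: fi; congr (integrable _ _ _); apply/funext => x; rewrite /= -pE.
have mp : measurable_fun setT (p : _ -> RM) by apply/measurable_EFinP; have /integrableP[] := ip.
have nubP A : measurable A -> nub A = (\int[U]_(x in A) (p x)%:E)%E.
  by move=> mA; rewrite fE//; apply: eq_integral => x _; rewrite pE.
have [k [s [C [ls sC hs]]]] := integrable_level_approx ip p0 e2.
have ms := measurable_level_fun ls.
have s0 x : 0 <= s x by have /andP[] := sC x.
(* The largest weight at most 1 that lowers the density p below the cell function s: the weighted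
   density is min (p, s). Orthogonality is then exact for s. *)
pose w0 x := if p x == 0 then 0 else Num.min 1 (s x / p x).
have w0p x : w0 x * p x = Num.min (p x) (s x).
  rewrite /w0; case: eqP => [->|/eqP px]; first by rewrite mul0r min_l.
  have px0 : 0 < p x by rewrite lt_neqAle eq_sym px p0.
  by rewrite minr_pMl// mul1r divfK.
have w01 x : 0 <= w0 x <= 1.
  by rewrite /w0; case: eqP => [_|_]; rewrite ?lexx ?ler01// le_min ler01 divr_ge0//= ge_min lexx.
have mw0 : measurable_fun setT (w0 : _ -> RM).
  apply: measurable_fun_ifT => //.
    by apply: (measurable_fun_eqr mp); exact: measurable_cst.
  apply: measurable_minr => //; apply: measurable_funM => //.
  under eq_fun do rewrite -powR_inv1//.
  exact: (measurableT_comp (measurable_powR (-1)) mp).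
pose w x := w0 x * \1_(@box R d N) x.
have bw : bounded_weight w.
  split; first by apply: measurable_funM => //; exact: measurable_indic.
  move=> x; rewrite /w indicE; case: (_ \in _); rewrite ?mulr1 ?mulr0 ?lexx ?ler01//; exact: w01.
have i01 x : 0 <= (\1_(@box R d N) x : R) by rewrite indicE; case: (_ \in _).
have nubI A : measurable A -> nub A = (\int[nu]_(x in A) (\1_(@box R d N) x)%:E)%E.
  by move=> mA; rewrite integral_indic// nubE setIC.
have transfer (F : borel R d -> R) : measurable_fun setT (F : _ -> RM) -> (forall x, 0 <= F x) ->
    \int[nu]_l (w l * F l) = \int[U]_l (Num.min (p l) (s l) * F l).
  move=> mF F0; rewrite /Rintegral; congr fine.
  have mwF : measurable_fun setT (EFin \o (fun l => w0 l * F l)).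
    by apply/measurable_EFinP; exact: measurable_funM.
  have wF0 l : (0 <= (EFin \o (fun l => (w0 l * F l)%R)) l)%E.
    by rewrite /= lee_fin mulr_ge0//; have /andP[] := w01 l.
  have h1 := ge0_integral_density i01 (bounded_weight_indic mb).1 nubI mwF wF0.
  have h2 := ge0_integral_density p0 mp nubP mwF wF0.
  transitivity (\int[nub]_x (EFin \o (fun l => w0 l * F l)%R) x)%E.
    by rewrite h1; apply: eq_integral => x _; rewrite /= -EFinM /w; congr EFin; ring.
  by rewrite h2; apply: eq_integral => x _; rewrite /= -EFinM -w0p; congr EFin; ring.
have mmin : measurable_fun setT ((fun l => Num.min (p l) (s l)) : _ -> RM) by exact: measurable_minr.
have imin : U.-integrable setT (EFin \o (fun l => Num.min (p l) (s l))).
  apply: (bounded_integrable U mmin (C := C)) => x.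
  have /andP[h1 h2] := sC x.
  by rewrite ger0_norm ?le_min ?p0 ?h1// ge_min h2 orbT.
have is' : U.-integrable setT (EFin \o s).
  by apply: (bounded_integrable U ms (C := C)) => x; have /andP[h1 h2] := sC x; rewrite ger0_norm.
have iabs : U.-integrable setT (EFin \o (fun x => `|p x - s x|)).
  have := integrable_abse (integrableB measurableT ip is').
  by apply: eq_integrable => // x _.
have intp : \int[U]_x p x = fine (nu (@box R d N)).
  by rewrite /Rintegral -nubP// nubE setTI.
have nuT : fine (nu setT) = fine (nu (@box R d N)) + fine (nu (~` @box R d N)).
  rewrite -fineD ?fin_num_measure//; last exact: measurableC.
  rewrite -measureU ?setUv ?setICr//; exact: measurableC.
have nuc0 : 0 <= fine (nu (~` @box R d N)) by exact: fine_ge0.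
exists w, (2 ^ k)%N; split => //; first by rewrite expn_gt0.
  have -> : \int[nu]_l w l = \int[U]_l Num.min (p l) (s l).
    have := transfer (fun=> 1) _ _.
    under eq_Rintegral do rewrite mulr1; move=> ->//; by under eq_Rintegral do rewrite mulr1.
  (* Both p and s are at least p - |p - s|, so the mass lost is controlled by the L^1 error. *)
  have : \int[U]_x (p x - `|p x - s x|) <= \int[U]_l Num.min (p l) (s l).
    apply: le_RintegralT => //; first exact: (integrableB measurableT ip iabs).
    move=> x; rewrite le_min; apply/andP; split; first by rewrite gerBl.
    by rewrite lerBlDr -lerBlDl ler_norm.
  rewrite RintegralB// intp; lra.
move=> I a z zinj.
have mF := @measurable_trig_sqr R d I a (fun i => (2 ^ k)%N%:R *: map_mx intr (z i)).
rewrite transfer//; last by move=> x; exact: trig_sqr_ge0.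
have cE (i j : I) l : cos (phase l ((2 ^ k)%N%:R *: map_mx intr (z i) - (2 ^ k)%N%:R *: map_mx intr (z j))) =
    cos (2 * pi * (2 ^+ k * dot l (map_mx intr (z i - z j))) + 0).
  rewrite -scalerBr /phase dotZr natrX addr0; congr (cos (_ * (_ * dot _ _))).
  by apply/rowP => m; rewrite !mxE intrB.
have bs x : `|s x| <= C by rewrite ger0_norm//; have /andP[] := sC x.
have int_c (i j : I) : \int[U]_l (s l * cos (phase l ((2 ^ k)%N%:R *: map_mx intr (z i) - (2 ^ k)%N%:R *: map_mx intr (z j)))) =
    (i == j)%:R * \int[U]_l s l.
  have [->|ij] := eqVneq i j.
    by rewrite mul1r; apply: eq_Rintegral => l _; rewrite subrr /phase dot0r mulr0 cos0 mulr1.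
  rewrite mul0r -(U2 (fun j : 'rV[int]_d => s (2 ^- k *: map_mx intr j)) C k (z i - z j) 0) //.
    by apply: eq_Rintegral => l _; rewrite cE /cell_trig {1}(level_funE ls).
  by rewrite subr_eq0; apply: contra_neq ij => /zinj.
have icos (i j : I) : U.-integrable setT (EFin \o (fun l => a i * a j * (s l * cos (phase l ((2 ^ k)%N%:R *: map_mx intr (z i) - (2 ^ k)%N%:R *: map_mx intr (z j)))))).
  apply: (@integrableZl _ _ _ U setT measurableT (a i * a j) (EFin \o (fun l => s l * cos (phase l ((2 ^ k)%N%:R *: map_mx intr (z i) - (2 ^ k)%N%:R *: map_mx intr (z j)))))).
  apply: (@bounded_integrable _ _ _ U _ C).
    apply: measurable_funM => //; apply: measurableT_comp; last exact: measurable_phase.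
    by apply: continuous_measurable_fun; exact: continuous_cos.
  by move=> x; rewrite normrM -[leRHS]mulr1; apply: ler_pM => //; exact: cos_max.
have sF : \int[U]_l (s l * trig_sqr a (fun i => (2 ^ k)%N%:R *: map_mx intr (z i)) l) = (\sum_i a i ^+ 2) * \int[U]_l s l.
  transitivity (\int[U]_l \sum_i \sum_j (a i * a j * (s l * cos (phase l ((2 ^ k)%N%:R *: map_mx intr (z i) - (2 ^ k)%N%:R *: map_mx intr (z j)))))).
    apply: eq_Rintegral => l _; rewrite trig_sqrE mulr_sumr; apply: eq_bigr => i _.
    by rewrite mulr_sumr; apply: eq_bigr => j _; rewrite mulrCA.
  rewrite (integrable_Rsum _ (fun i => (integrable_Rsum _ (icos i)).1)).2 mulr_suml; apply: eq_bigr => i _.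
  rewrite (integrable_Rsum _ (icos i)).2 (bigD1 i)//= big1 ?addr0.
    rewrite RintegralZl// ?int_c ?eqxx ?mul1r ?expr2//; last first.
    apply: (@bounded_integrable _ _ _ U _ C).
      apply: measurable_funM => //; apply: measurableT_comp; last exact: measurable_phase.
      by apply: continuous_measurable_fun; exact: continuous_cos.
    by move=> x; rewrite normrM -[leRHS]mulr1; apply: ler_pM => //; exact: cos_max.
  move=> j ji; rewrite RintegralZl// ?int_c 1?eq_sym ?(negPf ji) ?mul0r ?mulr0//.
  apply: (@bounded_integrable _ _ _ U _ C).
    apply: measurable_funM => //; apply: measurableT_comp; last exact: measurable_phase.
    by apply: continuous_measurable_fun; exact: continuous_cos.
  by move=> x; rewrite normrM -[leRHS]mulr1; apply: ler_pM => //; exact: cos_max.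
have tb l : `|trig_sqr a (fun i => (2 ^ k)%N%:R *: map_mx intr (z i)) l| <= (\sum_i `|a i|) ^+ 2.
  by rewrite ger0_norm ?trig_sqr_ge0// trig_sqr_bound.
apply: (@le_trans _ _ (\int[U]_l (s l * trig_sqr a (fun i => (2 ^ k)%N%:R *: map_mx intr (z i)) l))).
  apply: le_RintegralT.
  - apply: (@bounded_integrable _ _ _ U _ (C * (\sum_i `|a i|) ^+ 2)); first exact: measurable_funM.
    move=> x; rewrite normrM; apply: ler_pM => //.
    by rewrite ger0_norm ?le_min ?p0 ?s0// ge_min; have /andP[_ ->] := sC x; rewrite orbT.
  - apply: (@bounded_integrable _ _ _ U _ (C * (\sum_i `|a i|) ^+ 2)); first exact: measurable_funM.
    by move=> x; rewrite normrM; apply: ler_pM.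
  - by move=> l; rewrite ler_wpM2r ?trig_sqr_ge0// ge_min lexx orbT.
rewrite sF mulrC ler_wpM2r ?sumr_ge0//; first by move=> i _; exact: sqr_ge0.
have : \int[U]_x s x <= \int[U]_x (p x + `|p x - s x|).
  apply: le_RintegralT => //; first exact: (integrableD measurableT ip iabs).
  by move=> x; rewrite -lerBlDl -normrN opprB ler_norm.
rewrite RintegralD// intp; lra.
Qed.

End PeriodizedDensity.

(** * Coarse graining of the field *)

Section SidakDegenerate.
Context {R : realType} (I : finType).
Local Notation RM := (measurableTypeR R).

(** Coordinates of variance zero may be replaced by 0 without changing the law. This extends the
    inequality of Sidak to degenerate covariances, where the slab of such a coordinate is satisfied
    identically. *)
Lemma gv_degenerate d (T : measurableType d) (P : probability T R) X (S : I -> I -> R) :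
  gauss_vec P X S -> psd S -> gauss_vec P (fun i w => (S i i != 0)%:R * X i w) S.
Proof.
move=> gX psdS; have := gv_lin (fun j i => (i == j)%:R * (S j j != 0)%:R) gX.
apply: gv_eq => [j w|j k].
  by under eq_bigr => i _ do rewrite -mulrA; rewrite sum_delta.
transitivity (\sum_i (i == j)%:R * \sum_l (l == k)%:R * ((S j j != 0)%:R * (S k k != 0)%:R * S i l)).
  by apply: eq_bigr => i _; rewrite mulr_sumr; apply: eq_bigr => l _; ring.
rewrite !sum_delta; have [j0|j0] := eqVneq (S j j) 0; first by rewrite (psd_diag0 k psdS j0) !mulr0.
have [k0|k0] := eqVneq (S k k) 0; last by rewrite !mul1r.
by have [sS _] := psdS; rewrite (sS j k) (psd_diag0 j psdS k0) !mulr0.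
Qed.

Lemma sidak_seq_ge0 d (T : measurableType d) (P : probability T R) X S (A : I -> set RM) (l : R)
    (s : seq I) : gauss_vec P X S -> psd S -> (forall i, symconv (A i)) -> 0 <= l ->
  pr P [set w | forall i, A i (X i w)] * \prod_(i <- s) pr P [set w | `|X i w| <= l] <=
  pr P [set w | (forall i, A i (X i w)) /\ (forall i, i \in s -> `|X i w| <= l)].
Proof.
move=> gX psdS sA l0; have gX' := gv_degenerate gX psdS.
have [mX _ _] := gX; have [mX' _ _] := gX'.
have mA i : measurable (A i) by have [] := sA i.
have mB : measurable [set x : RM | `|x| <= l] by case: (symconv_abs_le l).
pose B (t : seq I) i := A i `&` [set x | i \in t -> `|x| <= l].
have mBi t i : measurable (B t i).
  by apply: measurableI => //; exact: (measurable_abs_le (i \in t) l).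
have BE t (Y : I -> T -> R) : [set w | (forall i, A i (Y i w)) /\ (forall i, i \in t -> `|Y i w| <= l)] =
    [set w | forall i, B t i (Y i w)].
  apply/seteqP; split => w /=; first by move=> [h1 h2] i; split => //; exact: h2.
  by move=> h; split => i; [have [] := h i|have [_] := h i].
pose s' := [seq i <- s | 0 < S i i].
have -> : pr P [set w | (forall i, A i (X i w)) /\ (forall i, i \in s -> `|X i w| <= l)] =
    pr P [set w | (forall i, A i (X i w)) /\ (forall i, i \in s' -> `|X i w| <= l)].
  rewrite !BE /pr (gv_event gX gX' (mBi s)) (gv_event gX gX' (mBi s')); congr (fine (P _)).
  apply/seteqP; split => w /= h i; have [h1 h2] := h i; split => // si.
    by apply: h2; move: si; rewrite mem_filter => /andP[].
  have [Si|Si] := boolP (0 < S i i); first by apply: h2; rewrite mem_filter Si.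
  have -> : S i i = 0.
    by apply/eqP; move: Si; rewrite lt_neqAle psd_diag_ge0// andbT negbK eq_sym.
  by rewrite eqxx /= mul0r normr0.
have mT := measurable_gv_event mX mA.
have h := sidak_seq l gX psdS sA (s := s') _.
have {h} := h _; have s0 : forall i, i \in s' -> 0 < S i i by move=> i; rewrite mem_filter => /andP[].
move=> /(_ s0); rewrite BE => h.
have mBw := measurable_gv_event mX (mBi s').
have mS i : measurable [set w | `|X i w| <= l] by exact: (measurable_fun_le l (mX i)).2.
have prodE (t : seq I) : (\prod_(i <- t) P [set w | (`|X i w| <= l)%R])%E = (\prod_(i <- t) pr P [set w | `|X i w| <= l])%:E.
  elim: t => [|i t IH]; first by rewrite !big_nil.
  by rewrite !big_cons IH prE// -EFinM.
rewrite prodE prE// prE// -EFinM lee_fin in h.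
apply: le_trans h; apply: ler_wpM2l; first exact: pr_ge0.
rewrite big_filter (big_mkcond (fun i => 0 < S i i)); apply: ler_prod => i _.
rewrite pr_ge0 /=; case: ifP => // _; exact: pr_le1.
Qed.

(** Conditionally on the added independent vector, the box is merely shifted; [anderson] with factor
    0 says that no shift is best. *)
Lemma anderson_sum d1 (T1 : measurableType d1) (P1 : probability T1 R)
    d2 (T2 : measurableType d2) (P2 : probability T2 R)
    d3 (T3 : measurableType d3) (P3 : probability T3 R) X Y Z (S1 S2 S3 : I -> I -> R) (u : R) :
  gauss_vec P1 X S1 -> gauss_vec P2 Y S2 -> gauss_vec P3 Z S3 -> psd S1 -> psd S2 ->
  (forall i j, S3 i j = S1 i j + S2 i j) ->
  pr P3 [set w | forall i, `|Z i w| <= u] <= pr P2 [set w | forall i, `|Y i w| <= u].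
Proof.
move=> gX gY gZ p1 p2 SE.
have gW : gauss_vec (pprod P1 P2) (fun i z => X i z.1 + Y i z.2) S3.
  by apply: (gv_eq _ _ (gv_indep gX gY)) => // i j; rewrite SE.
have mB i : measurable ((fun _ : I => [set x : RM | `|x| <= u]) i) by case: (symconv_abs_le u).
have -> : pr P3 [set w | forall i, `|Z i w| <= u] =
    pr (pprod P1 P2) [set z | forall i, `|X i z.1 + Y i z.2| <= u].
  by rewrite /pr (gv_event gZ gW mB).
have [mW _ _] := gW; have [mY _ _] := gY.
apply: pr_pprod_le; [exact: (measurable_gv_event mW mB)|exact: pr_ge0|].
move=> x; have k01 : -1 < (0 : R) < 1 by rewrite ltr01 ltrN10.
have := anderson (fun i => X i x) gY p2 (fun=> symconv_abs_le u) k01.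
have mYv (v : I -> R) : measurable [set w | forall i, `|Y i w + v i| <= u].
  have mYi i : measurable_fun setT (fun w => Y i w + v i : RM) by exact: measurable_funD.
  exact: (measurable_gv_event mYi mB).
rewrite prE; last exact: mYv.
rewrite prE; last exact: (mYv (fun i => 0 * X i x)).
rewrite lee_fin; congr (_ <= _); congr pr; apply/seteqP; split => w /= h i; have := h i.
- by rewrite addrC.
- by rewrite addrC.
- by rewrite mul0r addr0.
- by rewrite mul0r addr0.
Qed.

End SidakDegenerate.

(** * Removing finitely many atoms *)

Section Atoms.
Context {R : realType} {d : nat} (mu : {finite_measure set (borel R d) -> \bar R}).
Local Notation RM := (measurableTypeR R).

Lemma measurable_point (x : 'rV[R]_d) : measurable ([set x] : set (borel R d)).
Proof.
have := @measurable_gv_event R 'I_d _ (borel R d) (fun i l => (l : 'rV[R]_d) 0 i)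
  (fun i => [set x 0 i]) (fun i => measurable_coord i) (fun i => measurable_set1 _).
congr measurable; apply/seteqP; split => l /=; first by move=> h; apply/rowP.
by move=> -> i.
Qed.

Definition points (g : nat -> 'rV[R]_d) n : set (borel R d) := [set x | exists2 i, (i < n)%N & x = g i].

Lemma pointsS g n : points g n.+1 = points g n `|` [set g n].
Proof.
apply/seteqP; split => x /=.
  by move=> [i ni ->]; move: ni; rewrite ltnS leq_eqVlt => /orP[/eqP->|h]; [right|left; exists i].
by move=> [[i h ->]|->]; [exists i => //; rewrite ltnS ltnW|exists n].
Qed.

Lemma measurable_points g n : measurable (points g n).
Proof.
elim: n => [|n IH]; last by rewrite pointsS; apply: measurableU => //; exact: measurable_point.
by rewrite (_ : points g 0 = set0)//; apply/seteqP; split => // x [].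
Qed.

Lemma kernel_point (a x : 'rV[R]_d) : kernel mu \1_([set a] : set (borel R d)) x = fine (mu [set a]) * cos (phase a x).
Proof.
rewrite /kernel mulrC.
have ma := measurable_point a.
transitivity (\int[mu]_l (cos (phase a x) * \1_([set a] : set (borel R d)) l)).
  apply: eq_Rintegral => l _; rewrite indicE; case: (boolP (l \in _)) => la; last by rewrite mul0r mulr0.
  by have /= -> := set_mem la; rewrite mulrC.
rewrite RintegralZl//; last first.
  apply: (@bounded_integrable _ _ _ mu \1_([set a] : set (borel R d)) 1); first exact: measurable_indic.
  by move=> l; rewrite indicE; case: (_ \in _); rewrite ?normr1 ?normr0.
by rewrite /Rintegral integral_indic// setIT.
Qed.

Lemma kernel_indicU (A B : set (borel R d)) x : measurable A -> measurable B -> A `&` B = set0 ->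
  kernel mu \1_(A `|` B) x = kernel mu \1_A x + kernel mu \1_B x.
Proof.
move=> mA mB AB; rewrite /kernel -RintegralD//; last 2 first.
- exact: integrable_weighted_cos (bounded_weight_indic mA).
- exact: integrable_weighted_cos (bounded_weight_indic mB).
apply: eq_Rintegral => l _; rewrite -mulrDl; congr (_ * _); rewrite !indicE in_setU.
case: (boolP (l \in A)) => la; case: (boolP (l \in B)) => lb; rewrite ?addr0 ?add0r//.
suff : (A `&` B) l by rewrite AB.
by split; exact: set_mem.
Qed.

(** Each atom contributes a cosine and a sine vector, by the addition formula. A point listed twice
    is counted only once. *)
Lemma points_rank1 g n (I : finType) (y : I -> 'rV[R]_d) : exists bs : seq (I -> R),
  [/\ (size bs <= n.*2)%N, forall b, List.In b bs -> forall i, `|b i| <= Num.sqrt (fine (mu setT)) &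
   forall i j, kernel_mx mu \1_(points g n) y i j = rank1_sum bs i j].
Proof.
elim: n => [|n [bs [sbs bbs kbs]]].
  exists [::]; split => // i j; rewrite /rank1_sum big_nil /kernel_mx /kernel.
  rewrite (_ : points g 0 = set0); last by apply/seteqP; split => // x [].
  by under eq_Rintegral do rewrite indicE in_set0 mul0r; rewrite Rintegral_cst// mul0r.
rewrite pointsS; have [gn|gn] := pselect (points g n (g n)).
  exists bs; split => //; first by rewrite (leq_trans sbs)// leq_double.
  rewrite (_ : _ `|` _ = points g n)//; apply/seteqP; split => x /=; last by left.
  by move=> [//|->].
pose q := Num.sqrt (fine (mu [set g n])).
have mp := measurable_point (g n).
have qq : q ^+ 2 = fine (mu [set g n]) by rewrite sqr_sqrtr// fine_ge0.
have qM : q <= Num.sqrt (fine (mu setT)).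
  rewrite ler_sqrt ?fine_ge0//; apply: fine_le; rewrite ?fin_num_measure//.
  by apply: le_measure; rewrite ?inE.
have q0 : 0 <= q by exact: sqrtr_ge0.
exists ((fun i => q * cos (phase (g n) (y i))) :: (fun i => q * sin (phase (g n) (y i))) :: bs); split.
- by rewrite /= doubleS !ltnS.
- move=> b [<-|[<-|h]] i; last exact: bbs.
    by rewrite normrM ger0_norm// (le_trans _ qM)// ler_piMr// cos_max.
  by rewrite normrM ger0_norm// (le_trans _ qM)// ler_piMr// sin_max.
move=> i j; rewrite /rank1_sum !big_cons -/(rank1_sum bs i j) -kbs /kernel_mx.
rewrite kernel_indicU//; [|exact: measurable_points|]; last first.
  by apply/seteqP; split => // x [h1 /= h2]; apply: gn; rewrite -h2.
by rewrite kernel_point -qq phaseB cosB; ring.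
Qed.

(** The complements of the first n listed points decrease to a set without discrete mass. The
    absence of a singular continuous part leaves only the absolutely continuous mass. *)
Lemma remove_atoms (mu_ac mu_d mu_sc : {finite_measure set (borel R d) -> \bar R}) (e : R) :
  lebesgue_decomposition mu mu_ac mu_d mu_sc -> mu_sc setT = 0%E -> 0 < e ->
  exists g n, fine (mu (~` points g n)) <= fine (mu_ac setT) + e.
Proof.
move=> dec sc0 e0; have [S cS Sd] := decomp_d dec.
have /countable_injP[io ioi] := cS.
(* An index that codes no atom is sent to the origin; listing an extra point only decreases the
   remaining mass. *)
pose g n : 'rV[R]_d := xget 0 [set x | S x /\ io x = n].
have gio x : S x -> g (io x) = x.
  move=> Sx; rewrite /g; case: xgetP => [y _ [Sy e']|/(_ x)]; last by case.
  by apply: ioi; rewrite ?inE.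
exists g; pose F n := ~` points g n.
have mF n : measurable (F n) by apply: measurableC; exact: measurable_points.
have mI : measurable (\bigcap_n F n) by exact: bigcapT_measurable.
have niF : nonincreasing_seq F.
  move=> n m nm; apply/subsetPset => l h [i hi e']; apply: h; exists i => //.
  exact: leq_trans nm.
have fF0 : (mu_d (F 0%N) < +oo)%E by rewrite ltey_eq fin_num_measure.
have IS : \bigcap_n F n `<=` ~` S.
  by move=> x h Sx; apply: (h (io x).+1 I); exists (io x) => //; rewrite gio.
have mS0 : mu_d (\bigcap_n F n) = 0%E.
  have mS : measurable (~` S : set (borel R d)).
    by apply: measurableC; apply: countable_measurable cS => x; exact: measurable_point.
  exact: (subset_measure0 mI mS IS Sd).
have : mu_d (F k) @[k --> \oo] --> 0%E by rewrite -mS0; exact: (nonincreasing_cvg_mu fF0 mF mI niF).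
move=> /fine_cvgP[_ /cvgrPdist_lt /(_ e e0) [n _ /(_ n (leqnn n))]] /=.
rewrite sub0r normrN => hn; exists n.
have sc0' : mu_sc (~` points g n) = 0%E.
  by apply: (subset_measure0 _ _ _ sc0) => //; exact: mF.
rewrite (decomp_sum dec); last exact: mF.
rewrite sc0' adde0 fineD ?fin_num_measure//; [|exact: mF|exact: mF].
apply: lerD; last by rewrite (le_trans _ (ltW hn))// ler_norm.
apply: fine_le; rewrite ?fin_num_measure//; first exact: mF.
by apply: le_measure; rewrite ?inE//; exact: mF.
Qed.

End Atoms.

Lemma count_int_box (d : nat) (s : seq 'rV[int]_d) (M : nat) : uniq s ->
  (forall z : 'rV[int]_d, z \in s -> forall i, (`|z 0 i| <= M%:Z)) -> (size s <= (2 * M + 1) ^ d)%N.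
Proof.
move=> us hs.
pose h (z : 'rV[int]_d) : {ffun 'I_d -> 'I_(2 * M).+1} := [ffun i => inord (absz (z 0 i + M%:Z)%R)].
have hb (z : 'rV[int]_d) i : z \in s -> (absz (z 0 i + M%:Z)%R < (2 * M).+1)%N.
  by move=> zs; move: (hs z zs i); move: (z 0 i) => a; lia.
have hinj : {in s &, injective h}.
  move=> z z' zs zs' /ffunP e; apply/rowP => i; have := e i; rewrite !ffunE => /(congr1 val).
  rewrite /= !inordK; [|exact: hb|exact: hb].
  move: (hs z zs i) (hs z' zs' i); move: (z 0 i) (z' 0 i) => a b; lia.
rewrite -(size_map h); apply: (@leq_trans #|{ffun 'I_d -> 'I_(2 * M).+1}|).
  by rewrite cardE; apply: uniq_leq_size; [rewrite map_inj_in_uniq|move=> u _; rewrite mem_enum].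
by rewrite card_ffun !card_ord addn1.
Qed.

(** * Partition of the sites into cells of small oscillation *)

Section CoarseGrid.
Context {R : realType} {d : nat}.

Lemma rational_near (x : 'rV[R]_d) (e : R) : 0 < e -> exists q : 'rV[rat]_d,
  forall i, `|x 0 i - ratr (q 0 i)| < e.
Proof.
move=> e0; have h i : exists q : rat, `|x 0 i - ratr q| < e.
  have xe : x 0 i < x 0 i + e by rewrite ltrDl.
  have [q] := rat_in_itvoo xe; rewrite in_itv /= => /andP[h1 h2].
  by exists q; rewrite ltr_norml; apply/andP; split; lra.
exists (\row_i xchoose (h i)) => i; rewrite mxE; exact: (xchooseP (h i)).
Qed.

End CoarseGrid.

Lemma coarse_count {R : realType} {d : nat} {D : domain} (eta : R) (k : site R d D -> 'rV[int]_d) (s : seq (site R d D)) (T : R) :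
  0 < eta <= 1 -> 1 <= T -> (forall x, x \in s -> forall i, `|k x 0 i|%:~R <= T / eta + 1) ->
  uniq [seq k x | x <- s] -> (size s)%:R <= (7 / eta) ^+ d * T `^ d%:R.
Proof.
move=> /andP[e0 e1] T1 ks us.
pose M := (Num.truncn (T / eta + 1)).
have TE : 1 <= T / eta by rewrite ler_pdivlMr// mul1r (le_trans e1).
have := count_int_box (s := [seq k x | x <- s]) (M := M) us; rewrite size_map => h.
have {}h : (size s <= (2 * M + 1) ^ d)%N.
  apply: h => _ /mapP[x xs ->] i; have := ks x xs i => h1.
  have : (absz (k x 0%R i))%:R <= T / eta + 1 :> R by rewrite natr_absz.
  rewrite -truncn_ge_nat; last by lra.
  by rewrite -/M; lia.
apply: (@le_trans _ _ ((2 * M + 1) ^ d)%N%:R); first by rewrite ler_nat.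
rewrite natrX powR_mulrn; last by lra.
rewrite -exprMn; apply: lerXn2r; rewrite ?nnegrE ?mulr_ge0//; try lra.
  by rewrite invr_ge0; lra.
have : M%:R <= T / eta + 1 :> R by rewrite truncn_le; lra.
rewrite natrD natrM mulrAC -mulrA; lra.
Qed.

Section CoarseField.
Context {R : realType} {d : nat} {D : domain}.
Context {disp : measure_display} {Omega : measurableType disp}.
Variables (P : probability Omega R) (f : site R d D -> {RV P >-> R}).
Variable mu : {finite_measure set (borel R d) -> \bar R}.
Hypotheses (f_SGF : SGF f) (f_mu : spectral_measure f mu).
Local Notation RM := (measurableTypeR R).

(* A partition of the sites into cells, polynomially many of which meet a ball,
   such that the oscillation on a given cell is rarely larger than 1. *)
Definition coarse_map (b C : R) (g : site R d D -> site R d D) :=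
  (forall (I : finType) (x : I -> site R d D) y,
     1 - b <= pr P [set w | forall i, `|(g (x i) == y)%:R * (f (x i) w - f y w)| <= 1]) /\
  (forall T, 1 <= T -> forall s : seq (site R d D), (forall x, x \in s -> cball T (pos x)) ->
     uniq [seq g x | x <- s] -> (size s)%:R <= C * T `^ d%:R).

(** The translated family has the same kernel matrix. Thus one cell at the origin sets the
    oscillation on every cell. *)
Lemma shift_increments (I : finType) (z : I -> site R d D) (y : site R d D) :
  pr P [set w | forall i, `|f (z i + y) w - f y w| <= 1] =
  pr P [set w | forall i, `|f (z i) w - f 0 w| <= 1].
Proof.
pose zo (o : option I) := if o is Some i then z i else 0.
have g1 := field_gauss_vec f_SGF f_mu zo.
have g2 : gauss_vec P (fun o w => f (zo o + y) w) (kernel_mx mu (fun=> 1) (fun i => pos (zo i))).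
  apply: gv_eq (field_gauss_vec f_SGF f_mu (fun o => zo o + y)) => // i j.
  by rewrite /kernel_mx -!posB; congr (kernel _ _ (pos _)); rewrite opprD addrACA subrr addr0.
pose B i (o : option I) : R := (o == Some i)%:R - (o == None)%:R.
have h (X : option I -> Omega -> R) i w : \sum_o B i o * X o w = X (Some i) w - X None w.
  rewrite /B; under eq_bigr do rewrite mulrBl; rewrite big_split/= sumrN !sum_delta //.
have := gv_unique B g2 g1 (fun i => measurable_abs_le true 1).
have E (X : option I -> Omega -> R) : [set w | forall j, [set x : measurableTypeR R | true -> `|x| <= 1] (\sum_i B j i * X i w)] =
    [set w | forall i, `|X (Some i) w - X None w| <= 1].
  by apply/seteqP; split => w /= H i; have := H i; rewrite h /=; [exact|move=> H' _].
by rewrite /pr !E /= add0r => ->.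
Qed.

End CoarseField.

Section CoarseEuclid.
Context {R : realType} {d : nat}.
Context {disp : measure_display} {Omega : measurableType disp}.
Variables (P : probability Omega R) (f : site R d Euclidean -> {RV P >-> R}).
Variable mu : {finite_measure set (borel R d) -> \bar R}.
Hypotheses (f_SGF : SGF f) (f_mu : spectral_measure f mu).

(** Rational increments make the event measurable; by continuity it controls all increments in the
    open cube. *)
Definition small_osc (n : nat) : set Omega := [set w | forall q : 'rV[rat]_d,
  (forall i, `|ratr (q 0 i)| < n.+1%:R^-1 :> R) -> `|f (map_mx ratr q) w - f 0 w| <= 1].

Lemma small_oscP n w (z : 'rV[R]_d) : small_osc n w -> (forall i, `|z 0 i| < n.+1%:R^-1) ->
  `|f z w - f 0 w| <= 1.
Proof.
move=> ow zn; rewrite leNgt; apply/negP => h1.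
have cf : {for z, continuous (fun x : 'rV[R]_d => `|f x w - f 0 w|)}.
  apply: continuous_comp; last exact: norm_continuous.
  by apply: continuousB; [exact: (SGF_continuous f_SGF)|exact: cst_continuous].
have n1 : \forall x \near z, 1 < `|f x w - f 0 w| by exact: (cvgr_gt _ cf).
have n2 : \forall x \near z, forall i, `|(x : 'rV[R]_d) 0 i| < n.+1%:R^-1.
  apply: (@filter_forall _ _ (fun i (x : 'rV[R]_d) => `|x 0 i| < n.+1%:R^-1) (nbhs z) _) => i.
  have ci : {for z, continuous (fun x : 'rV[R]_d => `|x 0 i|)}.
    by apply: continuous_comp; [exact: coord_continuous|exact: norm_continuous].
  exact: (cvgr_lt _ ci).
have /nbhs_ballP[e /= e0 he] : nbhs z [set x | 1 < `|f x w - f 0 w| /\ forall i, `|x 0 i| < n.+1%:R^-1].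
  by near=> x; split; near: x.
have [q qe] := rational_near z e0.
have [|h2 h3] := he (map_mx ratr q).
  by split => // i j; rewrite (ord1 i) mxE /ball/=; exact: qe.
have : 1 < 1 :> R by apply: (lt_le_trans h2); apply: ow => i; have := h3 i; rewrite mxE.
by rewrite ltxx.
Unshelve. all: by end_near. Qed.

Lemma measurable_small_osc n : measurable (small_osc n).
Proof.
pose F (q : 'rV[rat]_d) := [set w | (forall i, `|ratr (q 0 i)| < n.+1%:R^-1 :> R) ->
  `|f (map_mx ratr q) w - f 0 w| <= 1].
have -> : small_osc n = \bigcap_q F q by apply/seteqP; split => w h q *; apply: h.
rewrite -[\bigcap_q F q]setCK setC_bigcap; apply: measurableC.
apply: countable_bigcupT_measurable => [|q]; first exact: countableP.
apply: measurableC; rewrite /F; have [p|p] := pselect (forall i, `|ratr (q 0 i)| < n.+1%:R^-1 :> R).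
  rewrite (_ : [set w | _] = [set w | `|f (map_mx ratr q) w - f 0 w| <= 1]).
    have mY : measurable_fun setT (fun w => f (map_mx ratr q) w - f 0 w).
      exact: measurable_funB.
    exact: (measurable_fun_le 1 mY).2.
  by apply/seteqP; split => w /=; [exact|].
rewrite (_ : [set w | _] = setT); first exact: measurableT.
by apply/seteqP; split => // w _ /= p'; case: p.
Qed.

(** Continuity of each path at the origin makes these increasing events exhaust the space. *)
Lemma small_osc_likely (b : R) : 0 < b -> exists n, 1 - b <= pr P (small_osc n).
Proof.
move=> b0; have ndG : nondecreasing_seq small_osc.
  move=> n m nm; apply/subsetPset => w h q qm; apply: h => i; apply: lt_le_trans (qm i) _.
  by rewrite lef_pV2 ?posrE ?ltr0n// ler_nat ltnS.
have mU := bigcupT_measurable small_osc measurable_small_osc.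
have UT : \bigcup_n small_osc n = setT.
  apply/seteqP; split => // w _.
  have cf : {for (0 : 'rV[R]_d), continuous (fun x : 'rV[R]_d => `|f x w - f 0 w|)}.
    apply: continuous_comp; last exact: norm_continuous.
    by apply: continuousB; [exact: (SGF_continuous f_SGF)|exact: cst_continuous].
  have n1 : \forall x \near (0 : 'rV[R]_d), `|f x w - f 0 w| < 1.
    by apply: (cvgr_lt _ cf); rewrite subrr normr0.
  have /nbhs_ballP[e /= e0 he] := n1.
  have [n hn] : exists n : nat, n.+1%:R^-1 < e.
    by have [n _ /(_ n (leqnn n)) hn] := near_infty_natSinv_lt (PosNum e0); exists n.
  exists n => // q hq; apply: ltW; apply: he; split => // i j; rewrite (ord1 i) !mxE /ball/= sub0r normrN.
  exact: lt_trans (hq j) hn.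
have h := nondecreasing_cvg_mu (mu := P) measurable_small_osc mU ndG.
have h' : (P \o small_osc) n @[n --> \oo] --> 1%:E by rewrite -(probability_setT P) -UT.
have [_ /cvgrPdist_lt /(_ _ b0) [n _ /(_ n (leqnn n))]] := (fine_cvgP _ _).1 h'.
rewrite /= ltr_norml => /andP[_ hn]; exists n; rewrite /pr; lra.
Qed.

Lemma coarse_map_euclid (b : R) : 0 < b -> exists C g, coarse_map f b C g.
Proof.
move=> b0; have [n hn] := small_osc_likely b0.
pose eta : R := n.+1%:R^-1.
have eta0 : 0 < eta by rewrite invr_gt0 ltr0n.
have eta1 : eta <= 1 by rewrite /eta invf_le1 ?ltr0n// ler1n.
pose k (x : 'rV[R]_d) : 'rV[int]_d := \row_i Num.floor (x 0 i / eta).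
(* The lower corner of the half-open cube of side eta that contains x; increments from it have
   coordinates in [0, eta[. *)
pose g (x : 'rV[R]_d) : 'rV[R]_d := map_mx (fun z => eta * z%:~R) (k x).
have kx (x : 'rV[R]_d) i : 0 <= x 0 i - g x 0 i < eta.
  rewrite !mxE; have := floor_le_tmp (x 0 i / eta); have := floorD1_gt (x 0 i / eta).
  rewrite intrD; move: (Num.floor _)%:~R => z h1 h2; rewrite ler_pdivlMr// in h2.
  rewrite ltr_pdivrMr// in h1; apply/andP; split; nra.
exists ((7 / eta) ^+ d), g; split.
  move=> I x y; pose z i := if g (x i) == y then x i - y else 0.
  have := shift_increments f_SGF f_mu z y => hz.
  rewrite (_ : [set w | _] = [set w | forall i, `|f (z i + y) w - f y w| <= 1]); last first.
    apply/seteqP; split => w /= h i; have := h i; rewrite /z; case: eqVneq => _;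
      by rewrite ?mul1r ?mul0r ?subrK ?add0r ?subrr.
  rewrite {}hz (le_trans hn)//; apply: pr_le; first exact: measurable_small_osc.
    have mY i : measurable_fun setT (fun w => f (z i) w - f 0 w) by exact: measurable_funB.
    have mB : measurable [set x : measurableTypeR R | `|x| <= 1] by case: (symconv_abs_le (1 : R)).
    exact: (measurable_gv_event mY (fun i => mB)).
  move=> w ow i; apply: (small_oscP ow) => j; rewrite /z.
  case: eqVneq => [<-|_]; last by rewrite mxE normr0.
  by have /andP[h1 h2] := kx (x i) j; rewrite mxE [X in _ + X]mxE ger0_norm.
move=> T T1 s sT us; apply: (@coarse_count R d Euclidean eta k s T) => //; first by rewrite eta0.
  move=> x xs i; rewrite mxE; have := sT x xs; rewrite /cball /= => /(le_trans (coord_le_enorm x i)).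
  have := floor_le_tmp (x 0 i / eta); have := floorD1_gt (x 0 i / eta).
  rewrite intrD intr_norm; move: (Num.floor _)%:~R => u h1 h2.
  rewrite ler_norml => /andP[h3 h4].
  have h5 : x 0 i / eta <= T / eta by rewrite ler_pM2r ?invr_gt0.
  have h6 : - (T / eta) <= x 0 i / eta by rewrite -mulNr ler_pM2r ?invr_gt0.
  by rewrite ler_norml; apply/andP; split; lra.
rewrite (_ : [seq g x | x <- s] = [seq (fun z : 'rV[int]_d => map_mx (fun z => eta * z%:~R) z) z | z <- [seq k x | x <- s]]) in us.
  exact: map_uniq us.
by rewrite -map_comp.
Qed.

End CoarseEuclid.

Section CoarseExists.
Context {R : realType} {d : nat} {D : domain}.
Context {disp : measure_display} {Omega : measurableType disp}.
Variables (P : probability Omega R) (f : site R d D -> {RV P >-> R}).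
Variable mu : {finite_measure set (borel R d) -> \bar R}.
Hypotheses (f_SGF : SGF f) (f_mu : spectral_measure f mu).

Lemma coarse_map_exists (b : R) : 0 < b -> exists C g, coarse_map f b C g.
Proof.
move=> b0; case: D f f_SGF f_mu => f' s' m'; first exact: (coarse_map_euclid s' m' b0).
exists ((7 / 1) ^+ d), id; split.
  move=> I x y; rewrite (_ : [set w | _] = setT); first by rewrite prT; lra.
  apply/seteqP; split => // w _ i /=; case: eqVneq => [->|_].
    by rewrite subrr mulr0 normr0.
  by rewrite mul0r normr0.
move=> T T1 s sT us; apply: (@coarse_count R d Lattice 1 id s T) => //; first by rewrite ltr01 lexx.
move=> x xs i; have := sT x xs; rewrite /cball /= => /(le_trans (coord_le_enorm _ i)).
by rewrite mxE intr_norm divr1; lra.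
Qed.

End CoarseExists.

(** * The lower bound on the persistence probability *)

Section SmallBallGauss.
Context {R : realType} (I : finType).
Local Notation RM := (measurableTypeR R).

Lemma measurable_abs (u : R) : measurable [set x : RM | `|x| <= u].
Proof. by case: (symconv_abs_le u). Qed.

Lemma measurable_all_abs d (T : measurableType d) (X : I -> T -> R) (u : R) :
  (forall i, measurable_fun setT (X i)) -> measurable [set w | forall i, `|X i w| <= u].
Proof. move=> mX; exact: (measurable_gv_event mX (fun i => measurable_abs u)). Qed.

Lemma gv_sum_small d1 (T1 : measurableType d1) (P1 : probability T1 R)
    d2 (T2 : measurableType d2) (P2 : probability T2 R)
    d3 (T3 : measurableType d3) (P3 : probability T3 R) X Y Z (S1 S2 S3 : I -> I -> R) (u t : R) :
  gauss_vec P1 X S1 -> gauss_vec P2 Y S2 -> gauss_vec P3 Z S3 ->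
  (forall i j, S3 i j = S1 i j + S2 i j) ->
  pr P1 [set w | forall i, `|X i w| <= u] * pr P2 [set w | forall i, `|Y i w| <= t] <=
  pr P3 [set w | forall i, `|Z i w| <= u + t].
Proof.
move=> gX gY gZ SE.
have gW : gauss_vec (pprod P1 P2) (fun i z => X i z.1 + Y i z.2) S3.
  by apply: (gv_eq _ _ (gv_indep gX gY)) => // i j; rewrite SE.
have -> : pr P3 [set w | forall i, `|Z i w| <= u + t] =
    pr (pprod P1 P2) [set z | forall i, `|X i z.1 + Y i z.2| <= u + t].
  by rewrite /pr (gv_event gZ gW (fun=> measurable_abs (u + t))).
have [mW _ _] := gW; have [mY _ _] := gY; have [mX _ _] := gX.
have h1 := measurable_all_abs u mX; have h2 := measurable_all_abs t mY.
rewrite -pr_pprodX//; apply: pr_le; first exact: measurableX.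
  exact: measurable_all_abs mW.
by move=> [x y] [/= hx hy] i; apply: (le_trans (ler_normD _ _)); exact: lerD.
Qed.

Lemma psd_lin (J : finType) (B : J -> I -> R) (S : I -> I -> R) : psd S ->
  psd (fun j k => \sum_i \sum_l B j i * B k l * S i l).
Proof.
move=> [sS pS]; split=> [j k|a].
  rewrite exchange_big; apply: eq_bigr => i _; apply: eq_bigr => l _; rewrite sS; ring.
suff -> : qform (fun j k => \sum_i \sum_l B j i * B k l * S i l) a = qform S (fun i => \sum_j a j * B j i).
  exact: pS.
rewrite /qform.
transitivity (\sum_j \sum_k \sum_i \sum_l (a j * B j i) * (a k * B k l) * S i l).
  apply: eq_bigr => j _; apply: eq_bigr => k _; rewrite mulr_sumr; apply: eq_bigr => i _.
  by rewrite mulr_sumr; apply: eq_bigr => l _; ring.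
transitivity (\sum_i \sum_l \sum_j \sum_k (a j * B j i) * (a k * B k l) * S i l).
  under eq_bigr do rewrite exchange_big /=; rewrite exchange_big; apply: eq_bigr => i _ /=.
  by under eq_bigr do rewrite exchange_big /=; rewrite exchange_big.
apply: eq_bigr => i _; apply: eq_bigr => l _; rewrite mulr_suml mulr_suml; apply: eq_bigr => j _.
by rewrite mulr_sumr mulr_suml.
Qed.

(** Increments and values are put into one Gaussian vector. The event on the increments is kept as a
    single symmetric convex event, so the number of factors is that of the representatives only. *)
Lemma sidak_coarse d (T : measurableType d) (P : probability T R) X (S : I -> I -> R)
    (rep : I -> I) (s : seq I) (v l u : R) :
  gauss_vec P X S -> psd S -> (forall i, rep i \in s) -> (forall i, S i i <= v) -> 0 < v -> 0 <= l ->
  0 <= 1 - 2 * expR (- l ^+ 2 / (2 * v)) ->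
  pr P [set w | forall i, `|X i w - X (rep i) w| <= u] * (1 - 2 * expR (- l ^+ 2 / (2 * v))) ^+ size s <=
  pr P [set w | forall i, `|X i w| <= l + u].
Proof.
move=> gX psdS hrep Sv v0 l0 e0.
pose B (j : I + I) (i : I) : R := match j with
  | inl k => (i == k)%:R - (i == rep k)%:R | inr k => (i == k)%:R end.
have gY := gv_lin B gX; have psdY := psd_lin B psdS.
pose A (j : I + I) : set RM := if j is inl _ then [set x | `|x| <= u] else setT.
have sA j : symconv (A j) by case: j => k; [exact: symconv_abs_le|exact: symconvT].
have := sidak_seq_ge0 [seq inr i | i <- s] gY psdY sA l0.
pose Y j w := \sum_i B j i * X i w; rewrite -/Y.
have Yl k w : Y (inl k) w = X k w - X (rep k) w.
  by rewrite /Y /B; under eq_bigr do rewrite mulrBl; rewrite sumrB !sum_delta.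
have Yr k w : Y (inr k) w = X k w by rewrite /Y /B sum_delta.
have [mX _ _] := gX; have [mY _ _] := gY.
have -> : [set w | forall j, A j (Y j w)] = [set w | forall i, `|X i w - X (rep i) w| <= u].
  apply/seteqP; split => w /= h; first by move=> i; rewrite -Yl; exact: (h (inl i)).
  by case=> k //=; rewrite Yl.
move=> h; apply: (le_trans (le_trans _ h)).
  rewrite big_map ler_wpM2l ?pr_ge0//.
  have -> : (1 - 2 * expR (- l ^+ 2 / (2 * v))) ^+ size s = \prod_(i <- s) (1 - 2 * expR (- l ^+ 2 / (2 * v))).
    by rewrite big_const_seq count_predT iter_mulr_1.
  apply: ler_prod => i _; rewrite e0 /=.
  rewrite (_ : [set w | _] = [set w | `|X i w| <= l]); last first.
    by apply/seteqP; split => w /=; rewrite sum_delta.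
  exact: (gv_abs_le gX psdS (Sv i) v0 l0).
apply: pr_le; last 2 first.
- exact: measurable_all_abs mX.
- move=> w [h1 h2] i; have h3 : `|Y (inl i) w| <= u := h1 (inl i); rewrite Yl in h3.
  have h4 : `|Y (inr (rep i)) w| <= l := h2 (inr (rep i)) (map_f _ (hrep i)); rewrite Yr in h4.
  by rewrite -(subrK (X (rep i) w) (X i w)) addrC (le_trans (ler_normD _ _))// lerD.
rewrite (_ : [set w | _] = [set w | forall j, (A j `&` [set x | j \in [seq inr i | i <- s] -> `|x| <= l]) (Y j w)]).
  have mB j : measurable (A j `&` [set x : RM | j \in [seq inr i | i <- s] -> `|x| <= l]).
    by apply: measurableI; [case: (sA j)|exact: measurable_abs_le].
  exact: (measurable_gv_event (X := Y) mY mB).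
apply/seteqP; split => w /=; first by move=> [h1 h2] j; split => //; exact: h2.
by move=> h'; split => j; [have [] := h' j|have [_] := h' j].
Qed.

End SmallBallGauss.

Section SmallBallField.
Context {R : realType} {d : nat} {D : domain}.
Context {disp : measure_display} {Omega : measurableType disp}.
Variables (P : probability Omega R) (f : site R d D -> {RV P >-> R}).
Variables mu : {finite_measure set (borel R d) -> \bar R}.
Hypotheses (f_SGF : SGF f) (f_mu : spectral_measure f mu).
Local Notation N01 := (normal_prob 0 1 : probability (measurableTypeR R) R).
Local Notation RM := (measurableTypeR R).

(** [fernique] on each cell, with increments measured from the reference site of the cell, and a
    union bound over the representatives. Passing through that site doubles 4 into 8. *)
Lemma oscillation_bound (b C : R) g (I : finType) (x : I -> site R d D) (rep : I -> I) (s : seq I) n :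
  coarse_map f b C g -> b <= 2^-1 -> (forall i, rep i \in s) -> (forall i, g (x (rep i)) = g (x i)) ->
  1 - (size s)%:R * (2 * b) ^+ (2 ^ n) <=
  pr P [set w | forall i, `|f (x i) w - f (x (rep i)) w| <= 8 * Num.sqrt 2 ^+ n].
Proof.
move=> [cm _] b2 hrep grep.
pose E k := [set w | forall i, `|(g (x i) == g (x k))%:R * (f (x i) w - f (g (x k)) w)| <= 4 * Num.sqrt 2 ^+ n].
pose xo k (o : option I) := if o is Some i then x i else g (x k).
pose B k i (o : option I) : R := (g (x i) == g (x k))%:R * ((o == Some i)%:R - (o == None)%:R).
have BE k i w : \sum_o B k i o * f (xo k o) w = (g (x i) == g (x k))%:R * (f (x i) w - f (g (x k)) w).
  under eq_bigr do rewrite -mulrA; rewrite -mulr_sumr; congr (_ * _).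
  by under eq_bigr do rewrite mulrBl; rewrite sumrB !sum_delta.
have gE k := gv_lin (B k) (field_gauss_vec f_SGF f_mu (xo k)).
have gE' k : gauss_vec P (fun i w => (g (x i) == g (x k))%:R * (f (x i) w - f (g (x k)) w)) _ :=
  gv_eq (BE k) (fun i j => erefl) (gE k).
have mE k : measurable (E k) by have [m _ _] := gE' k; exact: measurable_all_abs.
have pE k : pr P (~` E k) <= (2 * b) ^+ (2 ^ n).
  have := fernique n (gE' k) ler01 b2 (cm I x (g (x k))); rewrite mulr1 -/(E k) prC//; lra.
have [mU] := pr_seqU P s (fun k => measurableC (mE k)).
move=> /le_trans - /(_ ((size s)%:R * (2 * b) ^+ (2 ^ n))) hU.
have {}hU : pr P [set w | exists2 i, i \in s & (~` E i) w] <= (size s)%:R * (2 * b) ^+ (2 ^ n).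
  by apply: hU; rewrite mulr_natl -(count_predT s) -iter_addr_0 -big_const_seq; apply: ler_sum => k _.
apply: (@le_trans _ _ (pr P (~` [set w | exists2 i, i \in s & (~` E i) w]))); first by rewrite prC//; lra.
apply: pr_le; first exact: measurableC.
  have mY i : measurable_fun setT (fun w => f (x i) w - f (x (rep i)) w) by exact: measurable_funB.
  exact: measurable_all_abs mY.
move=> w h i; have Ei : E (rep i) w by apply: contrapT => h'; apply: h; exists (rep i).
have := Ei i; have := Ei (rep i); rewrite eqxx grep eqxx !mul1r => h1 h2.
rewrite (_ : _ - _ = (f (x i) w - f (g (x i)) w) - (f (x (rep i)) w - f (g (x i)) w)); last by ring.
rewrite (le_trans (ler_normB _ _))// (_ : 8 = 4 + 4); last by ring.
by rewrite mulrDl lerD.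
Qed.

(** The atoms give an independent part of finite rank, small with a probability that does not depend
    on the sites; the remainder has variance at most v and is treated by [sidak_coarse]. *)
Lemma small_ball (b C v l u t : R) g a N n (I : finType) (x : I -> site R d D) (T : R) :
  coarse_map f b C g -> 0 <= b <= 2^-1 -> 1 <= T -> (forall i, cball T (pos (x i))) ->
  fine (mu (~` points a N)) <= v -> 0 < v -> 0 <= l ->
  0 <= 1 - 2 * expR (- l ^+ 2 / (2 * v)) ->
  8 * Num.sqrt 2 ^+ n <= u -> Num.sqrt (fine (mu setT)) *+ N.*2 <= t ->
  exists K : nat, K%:R <= C * T `^ d%:R /\
  pr N01 [set x : RM | `|x| <= 1] ^+ N.*2 *
    ((1 - K%:R * (2 * b) ^+ (2 ^ n)) * (1 - 2 * expR (- l ^+ 2 / (2 * v))) ^+ K) <=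
  pr P [set w | forall i, `|f (x i) w| <= t + (l + u)].
Proof.
move=> cm /andP[b0 b2] T1 xT hv v0 l0 e0 hu ht.
(* One index for each occupied cell; the default never occurs because i itself qualifies. *)
pose rep i := odflt i [pick k | g (x k) == g (x i)].
have grep i : g (x (rep i)) = g (x i).
  by rewrite /rep; case: pickP => [k /eqP|/(_ i)] //=; rewrite eqxx.
have repE i j : g (x i) = g (x j) -> rep i = rep j.
  move=> ij; rewrite /rep ij; case: pickP => // /(_ j); by rewrite eqxx.
pose s := undup [seq rep i | i <- enum I].
have hrep i : rep i \in s by rewrite mem_undup map_f// mem_enum.
have [_ cm2] := cm.
exists (size s); split.
  rewrite -(size_map x); apply: cm2 => // [_ /mapP[i _ ->]//|].
  rewrite -map_comp map_inj_in_uniq ?undup_uniq// => i j; rewrite !mem_undup.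
  move=> /mapP[i' _ ->] /mapP[j' _ ->] /=; rewrite !grep; exact: repE.
pose y i := pos (x i).
have mA := measurable_points a N.
have bA := bounded_weight_indic mA; have bC := bounded_weight_indic (measurableC mA).
have [d1 [T1' [P1 [X1 gX1]]]] := gv_exists (psd_kernel mu y bA).
have [d2 [T2 [P2 [X2 gX2]]]] := gv_exists (psd_kernel mu y bC).
have gf := field_gauss_vec f_SGF f_mu x.
have kE i j : kernel_mx mu (fun=> 1) y i j = kernel_mx mu \1_(points a N) y i j + kernel_mx mu \1_(~` points a N) y i j.
  rewrite /kernel_mx -kernel_indicU//; [|exact: measurableC|by rewrite setICr].
  by rewrite setUCr; congr (kernel _ _ _); apply/funext => z; rewrite indicT.
have h3 := gv_sum_small t (l + u) gX1 gX2 gf kE.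
have [neg|pos_] := ltP (1 - (size s)%:R * (2 * b) ^+ (2 ^ n)) 0.
  apply: (@le_trans _ _ 0); last exact: pr_ge0.
  by rewrite mulr_ge0_le0 ?exprn_ge0 ?pr_ge0// mulr_le0_ge0 ?exprn_ge0// ltW.
apply: le_trans h3; apply: ler_pM.
- by rewrite exprn_ge0 ?pr_ge0.
- by rewrite mulr_ge0 ?exprn_ge0.
- have [bs [sbs bbs kbs]] := points_rank1 mu a N y.
  have gX1' := gv_eq (fun i w => erefl (X1 i w)) kbs gX1.
  have h := rank1_sum_small bbs gX1'.
  apply: (le_trans _ (le_trans h _)).
    by apply: ler_wiXn2l sbs; [exact: pr_ge0|apply: pr_le1; exact: measurable_abs].
  have [mX1 _ _] := gX1; apply: pr_le; [exact: measurable_all_abs|exact: measurable_all_abs|].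
  move=> w hw i; apply: (le_trans (hw i)); apply: le_trans ht.
  by rewrite -!(mulr_natr (Num.sqrt _)) ler_wpM2l ?sqrtr_ge0// ler_nat.
have S2 i : kernel_mx mu \1_(~` points a N) y i i <= v.
  rewrite /kernel_mx subrr kernel0 /Rintegral integral_indic ?setIT//; exact: measurableC.
have h4 := sidak_coarse u gX2 (psd_kernel mu y bC) hrep S2 v0 l0 e0.
apply: le_trans h4; apply: ler_wpM2r; first by rewrite exprn_ge0.
pose B (j i : I) : R := (i == j)%:R - (i == rep j)%:R.
have BE d' (T' : measurableType d') (X : I -> T' -> R) j w : \sum_i B j i * X i w = X j w - X (rep j) w.
  by under eq_bigr do rewrite mulrBl; rewrite sumrB !sum_delta.
(* Oscillations are known for the field, not for the part without atoms; since the field adds an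
   independent vector to that part, [anderson_sum] transfers the bound. *)
have hB := anderson_sum u (gv_lin B gX1) (gv_lin B gX2) (gv_lin B gf) (psd_lin B (psd_kernel mu y bA)) (psd_lin B (psd_kernel mu y bC)).
have hE : [set w | forall i, `|\sum_i0 B i i0 * X2 i0 w| <= u] = [set w | forall i, `|X2 i w - X2 (rep i) w| <= u].
  by apply/seteqP; split => w /= h i; have := h i; rewrite BE.
have hE' : [set w | forall i, `|\sum_i0 B i i0 * f (x i0) w| <= u] = [set w | forall i, `|f (x i) w - f (x (rep i)) w| <= u].
  by apply/seteqP; split => w /= h i; have := h i; rewrite (BE _ _ (fun i w => f (x i) w)).
rewrite hE hE' in hB; apply: le_trans (hB _); last first.
  move=> i j; rewrite -big_split; apply: eq_bigr => k _; rewrite -big_split; apply: eq_bigr => m _ /=.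
  by rewrite kE mulrDr.
apply: (le_trans (oscillation_bound n cm b2 hrep grep)).
have mY i : measurable_fun setT (fun w => f (x i) w - f (x (rep i)) w) by exact: measurable_funB.
apply: pr_le; [exact: measurable_all_abs mY|exact: measurable_all_abs mY|].
by move=> w hw i; exact: le_trans hu.
Qed.

End SmallBallField.

Lemma slack_bound {R : realType} (e : R) : 0 <= e <= 200^-1 -> (1 + 2 * e) ^+ 2 * (1 + e) ^+ 3 <= 1 + 100 * e.
Proof.
move=> /andP[e0 e1]; have ee : e ^+ 2 <= e by rewrite expr2 ler_piMl//; lra.
have q1 : (1 + 2 * e) ^+ 2 <= 1 + 8 * e by nra.
have q2 : (1 + e) ^+ 2 <= 1 + 3 * e by nra.
have q3 : (1 + e) ^+ 3 <= (1 + 3 * e) * (1 + e) by rewrite exprSr ler_wpM2r//; lra.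
have q4 : (1 + e) ^+ 3 <= 1 + 7 * e by nra.
apply: (@le_trans _ _ ((1 + 8 * e) * (1 + 7 * e))); last by nra.
by apply: ler_pM => //; rewrite exprn_ge0//; lra.
Qed.

Lemma cancel_ratio {R : realType} (q k x : R) : q != 0 -> k != 0 -> q * x / (128 * q / k) = k * x / 64 / 2.
Proof. by move=> q0 k0; field; rewrite q0 k0. Qed.

Lemma absorb_constants {R : realType} (A q c M h g L : R) : q <= c -> 0 < c -> 1 <= c * M -> 0 < h -> 0 < g ->
  (1 + (`|A| + ln 2) * M) / (h * g) <= L -> ln 2 + (A + q) <= h * (g * c * L).
Proof.
move=> qc c0 cM h0 g0; rewrite ler_pdivrMr; last exact: mulr_gt0.
move=> hL; apply: (@le_trans _ _ (c * (1 + (`|A| + ln 2) * M))).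
  have hA : A <= `|A| by exact: ler_norm.
  have ln20 : 0 <= ln 2 :> R by rewrite ln_ge0//; lra.
  have : `|A| + ln 2 <= c * M * (`|A| + ln 2) by rewrite ler_peMl ?addr_ge0 ?normr_ge0.
  nra.
rewrite (_ : h * _ = c * (L * (h * g))); last by ring.
by rewrite ler_pM2l.
Qed.

Lemma combine_exponents {R : realType} (eps W X Y Z : R) : X / 2 <= (1 + eps / 2) * W ->
  Y + Z <= eps / 2 * W -> - ((1 + eps) * W) <= - Y + - X / 2 - Z.
Proof. by rewrite !mulrDl !mul1r; lra. Qed.

Section LowerBound.
Context {R : realType} {d : nat} {D : domain}.
Context {disp : measure_display} {Omega : measurableType disp}.
Variables (P : probability Omega R) (f : site R d D -> {RV P >-> R}).
Variables mu mu_ac mu_d mu_sc : {finite_measure set (borel R d) -> \bar R}.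
Hypotheses (f_SGF : SGF f) (f_mu : spectral_measure f mu).
Hypothesis mu_decomp : lebesgue_decomposition mu mu_ac mu_d mu_sc.
Hypothesis sc_eq0 : mu_sc [set: borel R d] = 0%E.
Variable alpha : R.
Hypothesis alpha_bounds : 0 <= alpha < d%:R.
Hypothesis sing : (lne (mu (cball delta)) / (ln delta)%:E)%E @[delta --> 0^'+] --> alpha%:E.
Hypothesis ac_neq0 : mu_ac [set: borel R d] != 0%E.
Local Notation N01 := (normal_prob 0 1 : probability (measurableTypeR R) R).
Local Notation m := (fine (mu_ac [set: borel R d])).
Local Notation gam := (d%:R - alpha).

Lemma ac_gt0 : 0 < m.
Proof. by rewrite fine_gt0// lt0e ac_neq0 measure_ge0 ltey_eq fin_num_measure. Qed.

Lemma abs1_gt0 : 0 < pr N01 [set x : measurableTypeR R | `|x| <= 1].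
Proof.
rewrite (_ : [set x | _] = `[- 1, 1]%classic); first by apply: normal_itv_gt0; lra.
by apply/seteqP; split => x /=; rewrite in_itv /= ler_norml.
Qed.

Lemma total_mass_gt0 : 0 < fine (mu setT).
Proof.
apply: (lt_le_trans ac_gt0); rewrite (decomp_sum mu_decomp)// sc_eq0 adde0 fineD ?fin_num_measure//.
by rewrite lerDl fine_ge0.
Qed.

Lemma capacity_ge_mass T : 0 <= T -> ((fine (mu setT))^-1%:E <= capacity D mu (cball T))%E.
Proof.
move=> T0; have T0in : cball T (pos (0 : site R d D)) by rewrite /cball /= pos0 enorm0.
have wu : wprob (fun _ : 'I_1 => 1 : R) by split => //; rewrite big_ord1.
have eM : energy mu (fun _ : 'I_1 => 1) (fun=> 0 : site R d D) <= fine (mu setT).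
  by rewrite energy_qform /qform big_ord1 big_ord1 !mul1r /kernel_mx subrr kernel_total.
exact: (capacity_ge wu (fun=> T0in) total_mass_gt0 eM).
Qed.

Lemma exp_le_pow (y : R) K : 0 <= y <= 2^-1 -> expR (- (2 * y * K%:R)) <= (1 - y) ^+ K.
Proof.
move=> /andP[y0 y1]; rewrite mulrC -mulrN expRM_natl; apply: lerXn2r; rewrite ?nnegrE ?expR_ge0//.
  lra.
rewrite expRN -div1r ler_pdivrMr ?expR_gt0//.
have := expR_ge1Dx (2 * y); have : 0 <= y * (1 - 2 * y) by apply: mulr_ge0; lra.
move=> h1 h2; have : (1 - y) * (1 + 2 * y) <= (1 - y) * expR (2 * y) by apply: ler_wpM2l => //; lra.
nra.
Qed.

Lemma pow2_between (X : R) : 1 <= X -> exists n : nat, (2 ^ n)%:R <= X /\ X < 2 * (2 ^ n)%:R.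
Proof.
move=> X1; exists (trunc_log 2 (Num.truncn X)).
have t0 : (0 < Num.truncn X)%N by rewrite truncn_gt0.
have /andP[h1 h2] := trunc_log_bounds (isT : (1 < 2)%N) t0.
split; first by rewrite -truncn_ge_nat//; lra.
apply: (lt_le_trans (truncnS_gt X)); rewrite -natrM -expnS ler_nat; exact: h2.
Qed.

(** The number n of Fernique steps is such that 2^n is of order ln T. The oscillation scale 8 sqrt
    2^n then stays below e l, while the failure probability (2 b)^(2^n) is a power of T whose
    exponent is set by b. *)
Lemma small_ball_asymp (e : R) : 0 < e <= 1 -> exists A C, \forall T \near +oo,
  forall (I : finType) (x : I -> site R d D), (forall i, cball T (pos (x i))) ->
  expR (- (A + C * T `^ (d%:R - gam * (1 + e)))) <=
  pr P [set w | forall i, `|f (x i) w| <= (1 + 2 * e) * Num.sqrt (2 * (m * (1 + e)) * (gam * (1 + e)) * ln T)].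
Proof.
move=> /andP[e0 e1]; have m0 := ac_gt0.
have g0 : 0 < gam by have /andP[_ h] := alpha_bounds; rewrite subr_gt0.
have me0 : 0 < m * e by rewrite mulr_gt0.
have [a [N hv]] := remove_atoms mu_decomp sc_eq0 me0.
pose v : R := m * (1 + e); have v0 : 0 < v by rewrite mulr_gt0//; lra.
have {}hv : fine (mu (~` points a N)) <= v by rewrite /v mulrDr mulr1.
pose ga : R := gam * (1 + e); have ga0 : 0 < ga by rewrite mulr_gt0//; lra.
pose kap : R := e ^+ 2 * (2 * v * ga); have kap0 : 0 < kap by rewrite mulr_gt0 ?exprn_gt0// mulr_gt0// mulr_gt0.
(* As 2^n > kap ln T / 128 below, 2 b = e^(- B) gives (2 b)^(2^n) <= T^(-(d+1)), one power less than
   the inverse number of cells. *)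
pose B : R := 128 * d.+1%:R / kap; have B0 : 0 < B by rewrite divr_gt0// mulr_gt0 ?ltr0n.
pose b := expR (- B) / 2; have b0 : 0 < b by rewrite divr_gt0// expR_gt0.
have b1 : 0 <= b <= 2^-1.
  by rewrite ltW//= /b -[leRHS]mul1r ler_pM2r// -expR0 ler_expR; lra.
have [C [g cm]] := coarse_map_exists f_SGF f_mu b0.
pose p1 := pr N01 [set x : measurableTypeR R | `|x| <= 1].
have p10 : 0 < p1 ^+ N.*2 / 2 by apply: divr_gt0 => //; apply: exprn_gt0; exact: abs1_gt0.
exists (- ln (p1 ^+ N.*2 / 2)), (4 * C).
have n1 : \forall T \near +oo, 4 <= T `^ ga by exact: near_powR_ge.
have n2 : \forall T \near +oo, 64 / kap <= ln T by exact: near_ln_ge.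
have n3 : \forall T \near +oo, (Num.sqrt (fine (mu setT)) *+ N.*2 / e) ^+ 2 / (2 * v * ga) <= ln T.
  exact: near_ln_ge.
near=> T => I x xT.
have T1 : 1 < T by near: T; apply: nbhs_pinfty_gt; rewrite num_real.
have T0 : 0 < T := lt_trans ltr01 T1.
have CT : 2 * C <= T by near: T; apply: nbhs_pinfty_ge; rewrite num_real.
have h1 : 4 <= T `^ ga by near: T.
have h2 : 64 / kap <= ln T by near: T.
have h3 : (Num.sqrt (fine (mu setT)) *+ N.*2 / e) ^+ 2 / (2 * v * ga) <= ln T by near: T.
have lnT0 : 0 < ln T by rewrite ln_gt0.
rewrite -/v -/ga; pose l := Num.sqrt (2 * v * ga * ln T); rewrite -/l.
have l0 : 0 <= l by exact: sqrtr_ge0.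
have q0 : 0 < 2 * v * ga by rewrite mulr_gt0// mulr_gt0.
have l2 : l ^+ 2 = 2 * v * ga * ln T by rewrite sqr_sqrtr// mulr_ge0// ltW.
(* The upper bound is (8 sqrt 2^n)^2 <= (e l)^2, since (e l)^2 = kap ln T; the lower bound feeds the
   choice of B. *)
have [n [hn1 hn2]] : exists n : nat, (2 ^ n)%:R <= kap * ln T / 64 /\ kap * ln T / 64 < 2 * (2 ^ n)%:R.
  by apply: pow2_between; rewrite ler_pdivlMr// mul1r mulrC -ler_pdivrMr.
have hu : 8 * Num.sqrt 2 ^+ n <= e * l.
  rewrite -ler_sqr ?nnegrE ?mulr_ge0 ?exprn_ge0 ?sqrtr_ge0//; last exact: ltW.
  rewrite !exprMn l2 -exprM mulnC exprM sqr_sqrtr//; rewrite natrX in hn1.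
  rewrite (_ : e ^+ 2 * (2 * v * ga * ln T) = kap * ln T); last by rewrite /kap; ring.
  by rewrite ler_pdivlMr// in hn1; rewrite (_ : 8 ^+ 2 = 64) 1?mulrC//; ring.
have ht : Num.sqrt (fine (mu setT)) *+ N.*2 <= e * l.
  rewrite mulrC -ler_pdivrMr// -ler_sqr ?nnegrE ?divr_ge0 ?mulrn_wge0 ?sqrtr_ge0//; last exact: ltW.
  by rewrite l2 (mulrC _ (ln T)) -ler_pdivrMr.
have ET : expR (- l ^+ 2 / (2 * v)) = T `^ (- ga).
  by rewrite l2 /powR gt_eqF//; congr expR; field; rewrite gt_eqF.
have y1 : 2 * T `^ (- ga) <= 2^-1.
  have hy : (T `^ ga)^-1 <= 4^-1 by rewrite lef_pV2 ?posrE ?powR_gt0.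
  rewrite powRN; lra.
have y0 : 0 <= 2 * T `^ (- ga) by rewrite mulr_ge0 ?powR_ge0.
have e0' : 0 <= 1 - 2 * expR (- l ^+ 2 / (2 * v)).
  by rewrite ET subr_ge0 (le_trans y1)// invf_le1 ?ler1n.
have [K [hK]] := small_ball f_SGF f_mu cm b1 (ltW T1) xT hv v0 l0 e0' hu ht.
rewrite (_ : e * l + (l + e * l) = (1 + 2 * e) * l); last by ring.
apply: le_trans; rewrite ET opprD opprK expRD lnK ?posrE//.
have bT : (2 * b) ^+ (2 ^ n) <= T `^ (- d.+1%:R).
  rewrite /b mulrCA divff ?mulr1 ?pnatr_eq0// -expRM_natl /powR gt_eqF// ler_expR.
  rewrite mulrN mulNr lerN2 -ler_pdivrMr// /B.
  rewrite cancel_ratio ?gt_eqF// ?ltr0n//.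
  by rewrite ler_pdivrMr// [leRHS]mulrC; apply: ltW.
have hKb : K%:R * (2 * b) ^+ (2 ^ n) <= 2^-1.
  apply: (@le_trans _ _ (C * T `^ d%:R * T `^ (- d.+1%:R))).
    by apply: ler_pM => //; rewrite exprn_ge0// mulr_ge0//; case/andP: b1.
  rewrite -mulrA -powRDp// (_ : _ + _ = -1); last by rewrite -natr1; ring.
  by rewrite (powR_inv1 (ltW T0)) ler_pdivrMr// ler_pdivlMl.
rewrite -mulrA; apply: ler_wpM2l; first by rewrite exprn_ge0// pr_ge0.
apply: ler_pM; rewrite ?expR_ge0 ?invr_ge0//; first by lra.
have hp := exp_le_pow K (_ : 0 <= 2 * T `^ (- ga) <= 2^-1).
apply: le_trans (hp _); last by rewrite y0 y1.
rewrite ler_expR lerN2 powRDp// (_ : 2 * _ * K%:R = 4 * T `^ (- ga) * K%:R); last by ring.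
rewrite (_ : 4 * C * _ = 4 * T `^ (- ga) * (C * T `^ d%:R)); last by ring.
by apply: ler_wpM2l => //; rewrite mulr_ge0// powR_ge0.
Unshelve. all: by end_near. Qed.

Lemma lower_bound (eps : R) : 0 < eps <= 1 -> \forall T \near +oo, forall c : R,
  capacity D mu (cball T) = c%:E -> forall (I : finType) (x : I -> site R d D),
  (forall i, cball T (pos (x i))) ->
  expR (- ((1 + eps) * (m * gam * c * ln T))) <= pr P [set w | forall i, 0 <= f (x i) w].
Proof.
move=> /andP[eps0 eps1]; have m0 := ac_gt0.
have g0 : 0 < gam by have /andP[_ h] := alpha_bounds; rewrite subr_gt0.
have al0 : 0 <= alpha by case/andP: alpha_bounds.
(* The squared level, the variance, the exponent and the near-minimiser lose together a factor at
   most 1 + 100 e = 1 + eps / 2, by [slack_bound]. *)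
pose e := eps / 200; have e0 : 0 < e by rewrite divr_gt0.
have e1 : e <= 1 by rewrite /e; lra.
have e01 : 0 < e <= 1 by rewrite e0 e1.
have [A [C sb]] := small_ball_asymp e01.
(* Strictly between alpha - e gam, the exponent of the small-ball cost, and alpha, below which the
   capacity grows: that cost is then at most the capacity. *)
pose beta := alpha - e * gam / 2.
have ba : beta < alpha by rewrite /beta; nra.
have cg := capacity_growth f_mu al0 sing ba.
have gb : d%:R - gam * (1 + e) < beta by rewrite /beta; nra.
have n1 := near_powR_dominates C gb.
pose M := fine (mu setT).
have M0 : 0 < M by exact: total_mass_gt0.
have mg0 : 0 < m * gam by rewrite mulr_gt0.
have n2 : \forall T \near +oo, (1 + (`|A| + ln 2) * M) / (eps / 2 * (m * gam)) <= ln T by exact: near_ln_ge.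
apply: (filter_app _ _ sb); near=> T => sbT c capc I x xT.
have T1 : 1 < T by near: T; apply: nbhs_pinfty_gt; rewrite num_real.
have T0 : 0 < T := lt_trans ltr01 T1.
have {}sbT := sbT I x xT.
have h1 : C * T `^ (d%:R - gam * (1 + e)) <= T `^ beta by near: T.
have h2 : (1 + (`|A| + ln 2) * M) / (eps / 2 * (m * gam)) <= ln T by near: T.
have h3 : ((T `^ beta)%:E <= capacity D mu (cball T))%E by near: T.
rewrite capc lee_fin in h3.
have lnT0 : 0 < ln T by rewrite ln_gt0.
have T0in : cball T (pos (0 : site R d D)) by rewrite /cball /= pos0 enorm0 ltW.
have c0 : 1 <= c * M.
  by have := capacity_ge_mass (ltW T0); rewrite capc lee_fin -div1r ler_pdivrMr.
have cp : 0 < c by rewrite -(pmulr_lgt0 _ M0) (lt_le_trans ltr01 c0).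
have [J [a [y [k [wa yA [k0 E0] pot [hE _]]]]]] := near_minimizer f_mu T0in capc cp e01.
(* The tested sites and the support of the near-minimiser are put into one vector. The direction
   [a'] lives on the second family, the constraint [G] on the first. *)
pose z (o : I + J) := match o with inl i => x i | inr j => y j end.
pose a' (o : I + J) : R := match o with inl i => 0 | inr j => a j / k end.
have gz := field_gauss_vec f_SGF f_mu z.
have pz := psd_kernel mu (fun o => pos (z o)) bounded_weight1.
set S := kernel_mx _ _ _ in gz pz.
have VE : qform S a' = energy mu a y / k ^+ 2.
  rewrite energy_qform /qform big_sumType /= big1 ?add0r; last first.
    by move=> i _; rewrite big1// => j _; rewrite mul0r mul0r.
  rewrite mulr_suml; apply: eq_bigr => i _; rewrite big_sumType /= big1 ?add0r; last first.
    by move=> j _; rewrite mulr0 mul0r.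
  by rewrite mulr_suml; apply: eq_bigr => j _; rewrite /S /kernel_mx /=; field; rewrite gt_eqF.
have V0 : 0 < qform S a' by rewrite VE divr_gt0// exprn_gt0.
set l := _ * Num.sqrt _ in sbT.
have l0 : 0 <= l by rewrite mulr_ge0 ?sqrtr_ge0// addr_ge0// mulr_ge0// ltW.
pose G (o : I + J) := if o is inl _ then true else false.
have Gu o : G o -> 1 <= \sum_j a' j * S j o.
  case: o => // i _; rewrite big_sumType /= big1 ?add0r; last by move=> j _; rewrite mul0r.
  have : 1 <= potential mu a y (x i) / k by rewrite ler_pdivlMr// mul1r; exact: pot.
  move=> /le_trans; apply.
  rewrite /potential mulr_suml le_eqVlt; apply/orP; left; apply/eqP; apply: eq_bigr => j _.
  by rewrite /S /kernel_mx /= -kernelN opprB; ring.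
have := cameron_martin gz pz V0 l0 Gu.
have [mz _ _] := gz.
have -> : [set w | forall i, (G i -> `|f (z i) w| <= l)%R] = [set w | forall i, `|f (x i) w| <= l].
  by apply/seteqP; split => w /= h => [i|[i _|]//]; [exact: (h (inl i))|exact: h].
have -> : [set w | forall i, (G i -> 0 <= f (z i) w)%R] = [set w | forall i, 0 <= f (x i) w].
  by apply/seteqP; split => w /= h => [i|[i _|]//]; [exact: (h (inl i))|exact: h].
have mx i : measurable_fun setT (f (x i)) by exact: measurable_funP.
have ml : measurable [set w | forall i, `|f (x i) w| <= l] by exact: measurable_all_abs.
have mp : measurable [set w | forall i, 0 <= f (x i) w].
  have mB : measurable ([set t : measurableTypeR R | 0 <= t]).
    by rewrite (_ : [set t | _] = `[0, +oo[%classic)//; apply/seteqP; split => t /=; rewrite in_itv /= andbT.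
  exact: (measurable_gv_event mx (fun=> mB)).
rewrite (prE _ ml) (prE _ mp) -EFinM lee_fin => /(le_trans _); apply.
have E2 (t : R) : 2^-1 * expR t = expR (- ln 2 + t) by rewrite expRD expRN lnK ?posrE.
rewrite E2; apply: (le_trans _ (ler_wpM2l (expR_ge0 _) sbT)); rewrite -expRD ler_expR.
rewrite VE.
have l2 : l ^+ 2 = (1 + 2 * e) ^+ 2 * (2 * (m * (1 + e)) * (gam * (1 + e)) * ln T).
  rewrite /l exprMn sqr_sqrtr// ltW// mulr_gt0//.
  have e1' : 0 < 1 + e by rewrite addr_gt0.
  by apply: mulr_gt0; apply: mulr_gt0 => //; apply: mulr_gt0.
set W := m * gam * c * ln T.
have W0 : 0 < W by rewrite !mulr_gt0.
have s1 : l ^+ 2 * (energy mu a y / k ^+ 2) / 2 <= (1 + eps / 2) * W.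
  apply: (@le_trans _ _ (l ^+ 2 * ((1 + e) * c) / 2)).
    by rewrite ler_pM2r// ler_wpM2l// sqr_ge0.
  rewrite l2 (_ : _ / 2 = (1 + 2 * e) ^+ 2 * (1 + e) ^+ 3 * W); last by rewrite /W; field.
  apply: ler_wpM2r; first exact: ltW.
  have -> : 1 + eps / 2 = 1 + 100 * e by rewrite /e; field.
  by apply: slack_bound; rewrite (ltW e0)/= /e -[leRHS]mul1r ler_pM2r.
have s2 := absorb_constants (le_trans h1 h3) cp c0 (divr_gt0 eps0 (ltr0n _ 2)) mg0 h2.
exact: combine_exponents s1 s2.
Unshelve. all: by end_near. Qed.

End LowerBound.

(** * The upper bound on the persistence probability *)

Section CosetGauss.
Context {R : realType}.
Local Notation RM := (measurableTypeR R).

Lemma psd_add (I : finType) (S1 S2 : I -> I -> R) : psd S1 -> psd S2 -> psd (fun i j => S1 i j + S2 i j).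
Proof.
move=> [s1 p1] [s2 p2]; split=> [i j|a]; first by rewrite s1 s2.
rewrite (_ : qform _ a = qform S1 a + qform S2 a) ?addr_ge0//.
rewrite /qform -big_split; apply: eq_bigr => i _; rewrite -big_split; apply: eq_bigr => j _ /=.
by rewrite mulrDr.
Qed.

Lemma measurable_all_ge (I : finType) d (T : measurableType d) (X : I -> T -> R) (c : I -> R) :
  (forall i, measurable_fun setT (X i)) -> measurable [set w | forall i, c i <= X i w].
Proof. move=> mX; exact: (measurable_gv_event mX (fun i => measurable_ray (c i))). Qed.

(* [X] plus an independent vector is i.i.d. with variance [m]; as the levels [g] are at most [l] on
   average, the affine exponents of [ntail_affine] add up to the exponent of the bound. *)
Lemma coset_persistence (K : finType) d (T : measurableType d) (P : probability T R) X (C : K -> K -> R)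
    (m v l delta x0 : R) (g : K -> R) : gauss_vec P X C ->
  psd (fun i j => (i == j)%:R * m - C i j) -> 0 < m -> (forall i, m - C i i <= v) -> 0 < v ->
  0 <= l -> 0 <= delta -> #|K|%:R * expR (- delta ^+ 2 / (2 * v)) <= 2^-1 ->
  \sum_i g i <= #|K|%:R * l ->
  x0 = (l + delta) / Num.sqrt m ->
  pr P [set w | forall i, - g i <= X i w] <=
  2 * expR (- (#|K|%:R * (ntail (x0 + 2) / (2 * (1 + x0))))).
Proof.
move=> gX psdE m0 Cv v0 l0 d0 hd hg x0E.
(* The independent complement that raises the covariance to m times the identity; its variances are
   at most v. *)
have [d' [T' [Q [E gE]]]] := gv_exists psdE.
have gZ : gauss_vec (pprod P Q) (fun i z => X i z.1 + E i z.2) (fun i j => (i == j)%:R * m).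
  by apply: gv_eq (gv_indep gX gE) => // i j; rewrite addrC subrK.
have [mX _ _] := gX; have [mE _ _] := gE; have [mZ _ _] := gZ.
have q0 : 0 < Num.sqrt m by rewrite sqrtr_gt0.
have x00 : 0 <= x0 by rewrite x0E divr_ge0 ?addr_ge0// ltW.
pose F := [set w | forall i, - delta <= E i w].
have mF : measurable F by exact: measurable_all_ge.
(* A union bound. On [F] the complement lowers no coordinate by more than delta, so conditioning
   costs a factor 2 and raises the level to l + delta. *)
have hF : 2^-1 <= pr Q F.
  have gN := gv_neg gE; have [mN _ _] := gN.
  pose B i := [set w | delta <= - E i w].
  have mB i : measurable (B i) by exact: (measurable_fun_le delta (mN i)).1.
  have [mU hU] := pr_seqU Q (enum K) mB.
  have {}hU : pr Q [set w | exists2 i, i \in enum K & B i w] <= 2^-1.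
    apply: (le_trans hU); apply: le_trans hd.
    rewrite cardE mulr_natl -(count_predT (enum K)) -iter_addr_0 -big_const_seq.
    by apply: ler_sum => i _; apply: (gv_tail gN psdE _ v0 d0); rewrite eqxx mul1r; exact: Cv.
  apply: (@le_trans _ _ (pr Q (~` [set w | exists2 i, i \in enum K & B i w]))).
    by rewrite prC//; lra.
  apply: pr_le => //; first exact: measurableC.
  move=> w h i; rewrite leNgt; apply/negP => h'; apply: h; exists i; first by rewrite mem_enum.
  by rewrite /B /=; lra.
have mA : measurable [set w | forall i, - g i <= X i w] by exact: measurable_all_ge.
pose c i := g i + delta.
have key : pr P [set w | forall i, - g i <= X i w] * pr Q F <= \prod_(i <- enum K) ntail (- (c i / Num.sqrt m)).
  rewrite -(gv_iid _ m0 (enum_uniq K) gZ) -pr_pprodX//; apply: pr_le; first exact: measurableX.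
    rewrite (_ : [set w | _] = [set w | forall i, - c i <= X i w.1 + E i w.2]); first exact: measurable_all_ge mZ.
    by apply/seteqP; split => w /= h i; [apply: h; rewrite mem_enum|].
  by move=> [x y] [/= hx hy] i _; rewrite /c opprD; apply: lerD.
pose A := ntail (x0 + 2) / (2 * (1 + x0)).
have A0 : 0 <= A by rewrite divr_ge0 ?ntail_ge0// mulr_ge0// addr_ge0.
have hprod : \prod_(i <- enum K) ntail (- (c i / Num.sqrt m)) <= expR (- (#|K|%:R * A)).
  apply: (@le_trans _ _ (\prod_(i <- enum K) expR (- (A * (1 + x0 - c i / Num.sqrt m))))).
    by apply: ler_prod => i _; rewrite ntail_ge0 ntail_affine.
  rewrite -expR_sum ler_expR sumrN lerN2 -mulr_sumr mulrC ler_wpM2l//.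
  rewrite big_split /= sumrN -mulr_suml big_const_seq count_predT iter_addr_0 -cardE.
  rewrite big_enum /= big_split /= sumr_const cardT -cardE -(mulr_natl (1 + x0)) -(mulr_natl delta).
  have : (\sum_(i in K) g i + #|K|%:R * delta) / Num.sqrt m <= #|K|%:R * x0.
    by rewrite ler_pdivrMr// -mulrA x0E divfK ?gt_eqF// mulrDr lerD2r.
  rewrite cardE; lra.
rewrite -/A; have h1 := le_trans key hprod.
have p0 : 0 <= pr P [set w | forall i, - g i <= X i w] by exact: pr_ge0.
have : pr P [set w | forall i, - g i <= X i w] * 2^-1 <= pr P [set w | forall i, - g i <= X i w] * pr Q F by exact: ler_wpM2l.
lra.
Qed.

(* Conditionally on the smooth part [G], either its weighted mean is large, or its mean over one
   of the cosets is not, and then the rough part [B] has to compensate on that coset. *)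
Lemma split_persistence (J K : finType) d1 (T1 : measurableType d1) (P1 : probability T1 R)
    d2 (T2 : measurableType d2) (P2 : probability T2 R) G B (SG SB : J * K -> J * K -> R)
    (a : J -> R) (V l q : R) :
  gauss_vec P1 G SG -> psd SG -> gauss_vec P2 B SB -> wprob a -> (0 < #|K|)%N ->
  qform SG (fun p => a p.1 * #|K|%:R^-1) <= V -> 0 < V -> 0 <= l -> 0 <= q ->
  (forall (j : J) (g : K -> R), \sum_k g k <= #|K|%:R * l ->
     pr P2 [set w | forall k, - g k <= B (j, k) w] <= q) ->
  pr (pprod P1 P2) [set z | forall p, 0 <= G p z.1 + B p z.2] <= expR (- l ^+ 2 / (2 * V)) + q.
Proof.
move=> gG psdG gB [a0 a1] K0 hV V0 l0 q0 hq.
have n0 : 0 < #|K|%:R :> R by rewrite ltr0n.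
have [mG _ _] := gG; have [mB _ _] := gB.
pose u (_ : 'I_1) (p : J * K) : R := a p.1 * #|K|%:R^-1.
have gM := gv_lin u gG; have pM := psd_lin u psdG; have [mM _ _] := gM.
pose Gb w := \sum_p u ord0 p * G p w.
have hM : pr P1 [set w | l <= Gb w] <= expR (- l ^+ 2 / (2 * V)).
  by apply: (gv_tail gM pM _ V0 l0); apply: le_trans hV; rewrite /qform le_eqVlt eqxx.
have mGb : measurable [set w | l <= Gb w] by exact: (measurable_fun_le l (mM ord0)).1.
pose Z p (z : T1 * T2) := G p z.1 + B p z.2.
have mZ p : measurable_fun setT (Z p).
  have [m _ _] := gv_indep gG gB; exact: m.
have mE : measurable [set z | forall p, 0 <= Z p z] by exact: measurable_all_ge.
pose L := [set w | l <= Gb w] `*` [set: T2].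
have mL : measurable L by exact: measurableX.
rewrite -[X in pr _ X]/([set z | forall p, 0 <= Z p z]) -(setUIDK [set z | forall p, 0 <= Z p z] L).
have m1 := measurableI _ _ mE mL; have m2 := measurableD mE mL.
apply: (le_trans (prU_le _ m1 m2)); apply: lerD.
  apply: le_trans hM; rewrite -[leRHS]mulr1 -(prT P2) -pr_pprodX//.
  by apply: pr_le => // z [].
apply: pr_pprod_le => // x.
have mS : measurable [set y | ([set z | forall p, 0 <= Z p z] `\` L) (x, y)].
  by have := (measurable_sectionP P2 m2).1 x.
have [hx|hx] := leP l (Gb x).
  rewrite (_ : [set y | _] = set0) ?pr0//; apply/seteqP; split => // y [_ /=].
  by case.
have [j hj] : exists j, \sum_k G (j, k) x <= #|K|%:R * l.
  apply: contrapT => hn; suff : l <= Gb x by rewrite leNgt hx.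
  have hn' j : #|K|%:R * l <= \sum_k G (j, k) x.
    by rewrite leNgt; apply/negP => h; apply: hn; exists j; exact: ltW.
  have -> : Gb x = \sum_j \sum_k (a j * #|K|%:R^-1 * G (j, k) x).
    by rewrite pair_big /=; apply: eq_bigr => -[j k] _.
  rewrite (_ : l = \sum_j a j * l); last by rewrite -mulr_suml a1 mul1r.
  apply: ler_sum => j _; rewrite -mulr_sumr -[leRHS]mulrA; apply: ler_wpM2l => //.
  by rewrite ler_pdivlMl//; exact: hn'.
apply: le_trans (hq j _ hj); apply: pr_le => //; first exact: measurable_all_ge.
by move=> y [h _] k; have := h (j, k); rewrite /Z /=; lra.
Qed.

End CosetGauss.

Section UpperField.
Context {R : realType} {d : nat} {D : domain}.
Context {disp : measure_display} {Omega : measurableType disp}.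
Variables (P : probability Omega R) (f : site R d D -> {RV P >-> R}).
Variables mu mu_ac mu_d mu_sc : {finite_measure set (borel R d) -> \bar R}.
Hypotheses (f_SGF : SGF f) (f_mu : spectral_measure f mu).
Hypothesis mu_decomp : lebesgue_decomposition mu mu_ac mu_d mu_sc.
Hypothesis sc_eq0 : mu_sc [set: borel R d] = 0%E.
Local Notation m := (fine (mu_ac [set: borel R d])).

Lemma kernel_decomp w x : bounded_weight w ->
  kernel mu (fun=> 1) x = kernel mu_ac w x + kernel mu_ac (fun l => 1 - w l) x + kernel mu_d (fun=> 1) x.
Proof.
move=> bw; have bw' := bounded_weightC bw.
have i1 := integrable_weighted_cos mu_ac x bw; have i2 := integrable_weighted_cos mu_ac x bw'.
have b1 := @bounded_weight1 R d.
rewrite /kernel -RintegralD//.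
have -> : \int[mu_ac]_l (w l * cos (phase l x) + (1 - w l) * cos (phase l x)) = \int[mu_ac]_l (1 * cos (phase l x)).
  by apply: eq_Rintegral => l _; ring.
rewrite /Rintegral -fineD; last 2 first.
- by apply: integrable_fin_num => //; exact: (integrable_weighted_cos mu_ac x b1).
- by apply: integrable_fin_num => //; exact: (integrable_weighted_cos mu_d x b1).
congr fine; rewrite -integral_measure_add//; last 2 first.
- exact: (integrable_weighted_cos mu_ac x b1).
- exact: (integrable_weighted_cos mu_d x b1).
apply: eq_measure_integral => A mA _; rewrite /measure_add /= /msum /= !big_ord_recl big_ord0 /= adde0.
rewrite (decomp_sum mu_decomp)// (_ : mu_sc A = 0%E) ?adde0//.
exact: subset_measure0 sc_eq0.
Qed.

(** The rough part has spectral measure w mu_ac and the smooth part the rest, atoms included. On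
    each translate of the grid, [per] bounds the rough covariance by m + e times the identity; its
    diagonal falls short by at most 2 e, the variance allowed to the complement in
    [coset_persistence]. *)
Lemma persistence_upper (w : borel R d -> R) (r : nat) (e V l delta x0 : R) (J K : finType)
    (a : J -> R) (y : J -> site R d D) (z : K -> 'rV[int]_d) (s : K -> site R d D) :
  bounded_weight w -> m - e <= \int[mu_ac]_l w l ->
  (forall (I : finType) (a : I -> R) (z : I -> 'rV[int]_d), injective z ->
     \int[mu_ac]_l (w l * trig_sqr a (fun i => r%:R *: map_mx intr (z i)) l) <=
     (m + e) * \sum_i a i ^+ 2) ->
  wprob a -> injective z -> (forall k, pos (s k) = r%:R *: map_mx intr (z k)) ->
  energy mu a y <= V -> 0 < V -> 0 <= l -> 0 <= delta -> 0 < e -> (0 < #|K|)%N ->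
  #|K|%:R * expR (- delta ^+ 2 / (2 * (2 * e))) <= 2^-1 -> x0 = (l + delta) / Num.sqrt (m + e) ->
  pr P [set t | forall p : J * K, 0 <= f (y p.1 + s p.2) t] <=
  expR (- l ^+ 2 / (2 * V)) + 2 * expR (- (#|K|%:R * (ntail (x0 + 2) / (2 * (1 + x0))))).
Proof.
move=> bw hw per wa zi sz EV V0 l0 d0 e0 K0 hd x0E.
have bw' := bounded_weightC bw; have b1 := @bounded_weight1 R d.
have m0 : 0 <= m by exact: fine_ge0.
have n0 : 0 < #|K|%:R :> R by rewrite ltr0n.
pose x (p : J * K) := y p.1 + s p.2; pose px p := pos (x p).
have gf := field_gauss_vec f_SGF f_mu x.
pose SB := kernel_mx mu_ac w px.
pose SG p q := kernel_mx mu_ac (fun l => 1 - w l) px p q + kernel_mx mu_d (fun=> 1) px p q.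
have pB : psd SB by exact: psd_kernel.
have pG : psd SG by apply: psd_add; exact: psd_kernel.
have SE p q : kernel_mx mu (fun=> 1) px p q = SG p q + SB p q.
  by rewrite /kernel_mx (kernel_decomp _ bw) /SG /SB /kernel_mx; ring.
have [d1 [T1 [P1 [G gG]]]] := gv_exists pG.
have [d2 [T2 [P2 [B gB]]]] := gv_exists pB.
have gZ := gv_indep gG gB.
have gf' : gauss_vec P (fun p t => f (x p) t) (fun p q => SG p q + SB p q) := gv_eq (fun _ _ => erefl) SE gf.
have -> : pr P [set t | forall p : J * K, 0 <= f (y p.1 + s p.2) t] =
    pr (pprod P1 P2) [set z | forall p, 0 <= G p z.1 + B p z.2].
  by rewrite /pr (gv_event gf' gZ (fun=> measurable_ray 0)).
pose b (p : J * K) := a p.1 * #|K|%:R^-1.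
have wb : wprob (fun _ : K => #|K|%:R^-1 : R).
  by split => [_|]; [rewrite invr_ge0 ltW|rewrite sumr_const -[LHS]mulr_natl; apply: divff; rewrite gt_eqF].
(* Averaging over the grid as well convolves [a] with a probability, whose transform has modulus at
   most 1, and passing to the smooth part drops a nonnegative form. *)
have hV : qform SG b <= V.
  apply: le_trans EV; apply: (@le_trans _ _ (energy mu b x)).
    rewrite energy_qform -[X in _ <= qform (kernel_mx _ _ X) _]/px.
    suff -> : qform (kernel_mx mu (fun=> 1) px) b = qform SG b + qform SB b by rewrite lerDl; case: pB.
    rewrite /qform -big_split; apply: eq_bigr => p _; rewrite -big_split; apply: eq_bigr => q _ /=.
    by rewrite SE mulrDr.
  apply: le_RintegralT => [||t]; [exact: integrable_trig_sqr|exact: integrable_trig_sqr|].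
  have -> : trig_sqr b (fun i => pos (x i)) t =
      trig_sqr a (fun j => pos (y j)) t * trig_sqr (fun _ : K => #|K|%:R^-1) (fun k => pos (s k)) t.
    by rewrite -trig_sqr_conv; congr trig_sqr; apply/funext => p; rewrite posD.
  rewrite ler_piMr ?trig_sqr_ge0// (le_trans (trig_sqr_bound _ _ _))// expr_le1//.
    by under eq_bigr do rewrite ger0_norm ?invr_ge0 ?ltW//; have [_ ->] := wb.
  by apply: sumr_ge0 => k _.
apply: (split_persistence gG pG gB wa K0 hV V0 l0) => [|j g hg].
  by rewrite mulr_ge0// expR_ge0.
have gX := gv_reindex (fun k => (j, k)) gB.
have XE k k' : SB (j, k) (j, k') = kernel_mx mu_ac w (fun k => r%:R *: map_mx intr (z k)) k k'.
  rewrite /SB /kernel_mx -!sz /px /x /= !posD; congr (kernel _ _ _).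
  by rewrite opprD addrACA subrr add0r.
apply: (coset_persistence gX _ _ _ _ l0 d0 hd hg x0E); [|by lra| |by lra].
  have [sB _] := pB; split => [k k'|c]; first by rewrite eq_sym sB.
  have -> : qform (fun i k => (i == k)%:R * (m + e) - SB (j, i) (j, k)) c =
     (m + e) * (\sum_i c i ^+ 2) - qform (kernel_mx mu_ac w (fun k => r%:R *: map_mx intr (z k))) c.
    rewrite /qform mulr_sumr -sumrB; apply: eq_bigr => k _.
    transitivity (\sum_k' ((k' == k)%:R * (c k * c k' * (m + e)) - c k * c k' * SB (j, k) (j, k'))).
      by apply: eq_bigr => k' _; rewrite eq_sym; ring.
    rewrite sumrB sum_delta; congr (_ - _); first by ring.
    by apply: eq_bigr => k' _; rewrite XE.
  by rewrite qform_kernel// subr_ge0; exact: per.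
move=> k; rewrite XE /kernel_mx subrr kernel0; lra.
Qed.

End UpperField.

Lemma powR_inv {R : realType} (x p : R) : 0 <= x -> x^-1 `^ p = (x `^ p)^-1.
Proof. by move=> x0; rewrite -[x^-1](powR_inv1 x0) -powRrM mulN1r powRN. Qed.

Lemma asymp_ratio {R : realType} (a b : R -> \bar R) (kap : R) : asymp_equiv a b -> 0 < kap ->
  (\forall T \near +oo, (0 < b T)%E) ->
  \forall T \near +oo, exists c : R, [/\ b T = c%:E, 0 < c & (a T <= ((1 + kap) * c)%:E)%E].
Proof.
move=> /fine_cvgP[fin cv] kap0 b0.
(* The bound 1/2 excludes b T = +oo, for which the ratio would be 0. *)
have m0 : 0 < Num.min kap 2^-1 by rewrite lt_min kap0 /=; lra.
move: cv => /cvgrPdist_lt /(_ _ m0) cv.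
near=> T.
have bT : (0 < b T)%E by near: T.
have fT : ((a T / b T)%E \is a fin_num) by near: T.
have : `|1 - fine (a T / b T)| < Num.min kap 2^-1 by near: T.
move: (b T) bT fT => [c| |]//.
  rewrite lte_fin => c0; rewrite inver gt_eqF// => fT.
  rewrite lt_min => /andP[h _]; exists c; split => //.
  move: (a T) fT h => [r| |].
  - rewrite -EFinM /= => _; rewrite ltr_norml => /andP[h _]; rewrite lee_fin -ler_pdivrMr//; lra.
  - by rewrite gt0_mulye// lte_fin invr_gt0.
  - by move=> _ _; rewrite leNye.
rewrite invey mule0 => _ _; rewrite /= subr0 normr1 lt_min => /andP[_]; lra.
Unshelve. all: by end_near. Qed.

(** * Control of the capacity from above and choice of the sparse grid *)

Section CapacityRatio.
Context {R : realType} {d : nat} {D : domain}.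
Context {disp : measure_display} {Omega : measurableType disp}.
Variables (P : probability Omega R) (f : site R d D -> {RV P >-> R}).
Variables mu mu_ac mu_d mu_sc : {finite_measure set (borel R d) -> \bar R}.
Hypotheses (f_SGF : SGF f) (f_mu : spectral_measure f mu).
Hypothesis mu_decomp : lebesgue_decomposition mu mu_ac mu_d mu_sc.
Hypothesis sc_eq0 : mu_sc [set: borel R d] = 0%E.
Hypothesis ac_neq0 : mu_ac [set: borel R d] != 0%E.

Lemma capacity_mono (A B : set 'rV[R]_d) : A `<=` B -> (capacity D mu A <= capacity D mu B)%E.
Proof.
by move=> AB; apply: ereal_inf_le_tmp => s [h [g [rk hB ->]]]; exists h, g; split => // x /AB; exact: hB.
Qed.

Lemma regular_ratio (eps kap : R) : 
  asymp_equiv (fun T => capacity D mu (cball (T + T `^ (1 - eps)))) (fun T => capacity D mu (cball T)) ->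
  0 < kap -> \forall S \near +oo, exists c : R, [/\ capacity D mu (cball S) = c%:E, 0 < c &
    (capacity D mu (cball (S + S `^ (1 - eps))) <= ((1 + kap) * c)%:E)%E].
Proof.
move=> reg kap0; apply: (asymp_ratio reg kap0); near=> T.
have T0 : 0 <= T by near: T; apply: nbhs_pinfty_ge; rewrite num_real.
apply: lt_le_trans (capacity_ge_mass mu_decomp sc_eq0 ac_neq0 T0).
by rewrite lte_fin invr_gt0 (total_mass_gt0 mu_decomp).
Unshelve. all: by end_near. Qed.

(** A near-minimiser with tolerance 1 has energy at most 2 / c, while [energy_ge] bounds every
    energy in the ball below by a quarter of the mass of the ball of radius 1 / (8 T). *)
Lemma capacity_upper (alpha s : R) :
  (lne (mu (cball delta)) / (ln delta)%:E)%E @[delta --> 0^'+] --> alpha%:E -> 0 < s ->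
  \forall T \near +oo, forall c, capacity D mu (cball T) = c%:E -> c <= 8 * (8 * T) `^ (alpha + s).
Proof.
move=> sing s0; have [d0 d00 hd] := ball_mass_bounds sing s0.
near=> T => c capc.
have T1 : 1 < T by near: T; apply: nbhs_pinfty_gt; rewrite num_real.
have Td : d0^-1 < T by near: T; apply: nbhs_pinfty_gt; rewrite num_real.
have T0 : 0 < T by lra.
have T0in : cball T (pos (0 : site R d D)) by rewrite /cball /= pos0 enorm0 ltW.
have c0 : 0 < c.
  have := capacity_ge_mass mu_decomp sc_eq0 ac_neq0 (D := D) (ltW T0); rewrite capc lee_fin.
  by apply: lt_le_trans; rewrite invr_gt0 (total_mass_gt0 mu_decomp).
have k1 : 0 < (1 : R) <= 1.
  by rewrite ltr01 /=.
have [J [a [y [k [wa yA _ _ [_ cE]]]]]] := near_minimizer f_mu T0in capc c0 k1.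
have hE := energy_ge mu T0 wa yA.
have hT : 0 < (8 * T)^-1 < d0.
  rewrite invr_gt0 mulr_gt0//= -[d0]invrK ltf_pV2 ?posrE ?invr_gt0 ?mulr_gt0//; lra.
have /andP[hm _] := hd _ hT.
have p0 : 0 < (8 * T) `^ (alpha + s) by rewrite powR_gt0// mulr_gt0.
have pE : (8 * T)^-1 `^ (alpha + s) = ((8 * T) `^ (alpha + s))^-1.
  by apply: powR_inv; lra.
rewrite pE in hm.
have : c * (((8 * T) `^ (alpha + s))^-1 / 4) <= 2.
  apply: (@le_trans _ _ (c * energy mu a y)); last lra.
  by rewrite ler_pM2l//; apply: le_trans hE; rewrite ler_pM2r.
rewrite mulrA ler_pdivrMr// ler_pdivrMr//; lra.
Unshelve. all: by end_near. Qed.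

Lemma grid_sites (r : nat) (rho : R) : (0 < r)%N -> (0 < d)%N -> 0 < rho ->
  exists (K : finType) (z : K -> 'rV[int]_d) (s : K -> site R d D),
  [/\ injective z, forall k, pos (s k) = r%:R *: map_mx intr (z k),
      forall k, enorm (pos (s k)) <= rho,
      (rho / (r%:R * Num.sqrt d%:R)) ^+ d <= #|K|%:R & #|K|%:R <= (rho + 1) ^+ d].
Proof.
move=> r0 dp rho0.
have sd1 : 1 <= Num.sqrt d%:R :> R by rewrite -[leLHS]sqrtr1; apply: ler_wsqrtr; rewrite ler1n.
have r1 : 1 <= r%:R :> R by rewrite ler1n.
pose q : R := rho / (r%:R * Num.sqrt d%:R).
have rs1 : 1 <= r%:R * Num.sqrt d%:R :> R by rewrite -[leLHS]mulr1 ler_pM.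
have q0 : 0 <= q by rewrite divr_ge0// ltW//; lra.
(* Coordinates run over 0, ..., M; the factor sqrt d in q turns the coordinate bound r q into the
   Euclidean bound rho. *)
pose M := Num.truncn q.
have Mq : M%:R <= q by rewrite truncn_le.
pose z (k : {ffun 'I_d -> 'I_M.+1}) : 'rV[int]_d := \row_i (k i)%:Z.
have hs k : exists x : site R d D, pos x = r%:R *: map_mx intr (z k).
  case: D => /=; first by exists (r%:R *: map_mx intr (z k)).
  by exists (z k *+ r); apply/rowP => i; rewrite !mxE mulmxnE !mxE rmorphMn /= mulr_natl.
have [s sz] := boolp.choice hs.
exists {ffun 'I_d -> 'I_M.+1}, z, s; split => //.
- move=> k k' /rowP e; apply/ffunP => i; have := e i; rewrite !mxE => -[] e'; exact: val_inj.
- move=> k; apply: (@le_trans _ _ (Num.sqrt d%:R * (r%:R * q))).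
    apply: enorm_le_coord => i; rewrite sz !mxE normrM !ger0_norm ?ler0z// ler_pM2l; last lra.
    apply: (le_trans _ Mq); rewrite -[(k i)%:~R]/((k i)%:R) ler_nat -ltnS; exact: ltn_ord.
  rewrite (_ : _ * (_ * q) = q * (r%:R * Num.sqrt d%:R)); last by ring.
  by rewrite /q divfK// gt_eqF//; lra.
- rewrite card_ffun !card_ord natrX; apply: lerXn2r; rewrite ?nnegrE// -/q.
  by apply: ltW; exact: truncnS_gt.
rewrite card_ffun !card_ord natrX; apply: lerXn2r; rewrite ?nnegrE//; first lra.
rewrite -natr1 lerD2r (le_trans Mq)// /q ler_pdivrMr; last lra.
by rewrite ler_peMr// ltW.
Qed.

End CapacityRatio.

Section TailRate.
Context {R : realType}.

(** The margin th / 2 in the squared level is halved in the exponent to pay for the shift of x0 by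
    3, where 2 comes from [ntail_affine] and 1 from [ntail_lower]; the denominator, of order sqrt
    (ln T), costs T^(- sg). *)
Lemma ntail_rate (g th sg : R) : 0 < g -> 0 < th < 1 -> 0 < sg -> exists2 c : R, 0 < c &
  \forall T \near +oo, forall x0, 0 <= x0 -> x0 ^+ 2 <= 2 * g * (1 - th / 2) * ln T ->
  c * T `^ (- (g * (1 - th / 4) + sg)) <= ntail (x0 + 2) / (2 * (1 + x0)).
Proof.
move=> g0 /andP[th0 th1] sg0; have [c1 c10 hc] := @ntail_lower R.
(* From completing the square: (x0 + 3)^2 <= (1 + th / 4) x0^2 + 9 (1 + 4 / th). *)
pose B := 9 * (1 + 4 / th) / 2.
exists (c1 * expR (- B)); first by rewrite mulr_gt0// expR_gt0.
have n1 : \forall T \near +oo, (4 * g / (sg / 2)) * T `^ (sg / 2) <= T `^ sg.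
  by apply: near_powR_dominates; lra.
near=> T => x0 x00 hx.
have h1 : (4 * g / (sg / 2)) * T `^ (sg / 2) <= T `^ sg by near: T.
have T1 : 1 < T by near: T; apply: nbhs_pinfty_gt; rewrite num_real.
have h2 : 8 <= T `^ sg by near: T; exact: near_powR_ge.
have T0 : 0 < T by lra.
have h3 := ln_le_powR T0 (divr_gt0 sg0 (ltr0n _ 2)).
have lnT0 : 0 < ln T by rewrite ln_gt0.
have den : 2 * (1 + x0) <= T `^ sg.
  apply: (@le_trans _ _ (3 + x0 ^+ 2)); first by have := sqr_ge0 (x0 - 1); rewrite sqrrB1; lra.
  have : 2 * g * (1 - th / 2) * ln T <= 2 * g * ln T by rewrite ler_pM2r// ler_piMr//; lra.
  have : 2 * g * ln T <= 2 * g * ((sg / 2)^-1 * T `^ (sg / 2)) by rewrite ler_wpM2l//; lra.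
  have : 2 * (2 * g * ((sg / 2)^-1 * T `^ (sg / 2))) <= T `^ sg.
    by apply: le_trans h1; rewrite le_eqVlt; apply/orP; left; apply/eqP; ring.
  lra.
have ex : (x0 + 2 + 1) ^+ 2 / 2 <= g * (1 - th / 4) * ln T + B.
  have t0 : 0 <= (x0 * th - 12) ^+ 2 / (4 * th) by rewrite divr_ge0 ?sqr_ge0//; lra.
  have e1 : (x0 + 2 + 1) ^+ 2 + (x0 * th - 12) ^+ 2 / (4 * th) = (1 + th / 4) * x0 ^+ 2 + 2 * B.
    by rewrite /B; field; rewrite gt_eqF.
  have e2 : (1 + th / 4) * x0 ^+ 2 <= (1 + th / 4) * (2 * g * (1 - th / 2) * ln T) by rewrite ler_wpM2l//; lra.
  have e3 : (1 + th / 4) * (2 * g * (1 - th / 2) * ln T) <= 2 * (g * (1 - th / 4) * ln T).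
    rewrite (_ : _ * (2 * g * (1 - th / 2) * ln T) = (1 + th / 4) * (1 - th / 2) * (2 * g * ln T)); last by ring.
    rewrite (_ : 2 * (g * _ * ln T) = (1 - th / 4) * (2 * g * ln T)); last by ring.
    apply: ler_wpM2r; first by rewrite mulr_ge0 ?mulr_ge0// ltW.
    have : 0 <= th ^+ 2 by exact: sqr_ge0.
    nra.
  lra.
rewrite ler_pdivlMr; last lra.
have x2 : 0 <= x0 + 2 by lra.
apply: le_trans (hc _ x2).
apply: (@le_trans _ _ (c1 * expR (- B) * T `^ (- (g * (1 - th / 4) + sg)) * T `^ sg)).
  by apply: ler_wpM2l => //; rewrite mulr_ge0 ?powR_ge0// mulr_ge0 ?expR_ge0// ltW.
rewrite -!mulrA ler_pM2l// -powRDp// opprD subrK /powR gt_eqF// -expRD ler_expR mulNr; lra.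
Unshelve. all: by end_near. Qed.

End TailRate.

Section UpperArithmetic.
Context {R : realType}.

Lemma variance_slack (k : R) : 0 <= k <= 20^-1 -> (1 - 10 * k) * (1 + k) ^+ 2 <= 1 - k.
Proof.
move=> /andP[k0 k1]; have kk : k ^+ 2 <= k by rewrite expr2 ler_piMl//; lra.
have q1 : (1 + k) ^+ 2 <= 1 + 3 * k by nra.
apply: (@le_trans _ _ ((1 - 10 * k) * (1 + 3 * k))); first by rewrite ler_wpM2l//; lra.
have : 0 <= k ^+ 2 by exact: sqr_ge0.
nra.
Qed.

Lemma level_slack (th : R) : 0 <= th <= 1 -> (1 + th / 8) ^+ 2 * (1 - th) <= 1 - th / 2.
Proof.
move=> /andP[k0 k1]; have kk : th ^+ 2 <= th by rewrite expr2 ler_piMl//.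
have q1 : (1 + th / 8) ^+ 2 <= 1 + th / 2 by nra.
apply: (@le_trans _ _ ((1 + th / 2) * (1 - th))); first by rewrite ler_wpM2r//; lra.
have : 0 <= th ^+ 2 by exact: sqr_ge0.
nra.
Qed.

(** The two exponentials, with total coefficient 3, are bounded by the larger one; half of the
    margin eps pays for ln 3. *)
Lemma combine_upper (eps b X Y : R) : 0 < eps -> 0 <= b -> (1 - eps / 2) * b <= X -> b <= Y ->
  ln 3 <= eps / 2 * b -> expR (- X) + 2 * expR (- Y) <= expR (- ((1 - eps) * b)).
Proof.
move=> e0 b0 hX hY h3; have E x : 3 * expR x = expR (ln 3 + x) by rewrite expRD lnK ?posrE.
apply: (@le_trans _ _ (3 * expR (- ((1 - eps / 2) * b)))); last by rewrite E ler_expR; lra.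
have : expR (- X) <= expR (- ((1 - eps / 2) * b)) by rewrite ler_expR lerN2.
have : expR (- Y) <= expR (- ((1 - eps / 2) * b)).
  rewrite ler_expR lerN2; apply: le_trans hY; rewrite ler_piMl//; lra.
lra.
Qed.

Lemma add_le_double (x T : R) : x <= T -> 1 <= T -> x + 1 <= 2 * T.
Proof. by lra. Qed.

Lemma count_slack (T : R) n : 0 <= T -> 2 ^+ n.+1 <= T -> (2 * T) ^+ n <= 2^-1 * T ^+ n.+1.
Proof.
move=> T0; rewrite exprS exprMn exprSr => h.
rewrite (_ : 2^-1 * (T ^+ n * T) = 2^-1 * T * T ^+ n); last by ring.
by apply: ler_wpM2r; [exact: exprn_ge0|lra].
Qed.

Lemma tail_exponent (E q D L : R) : E != 0 -> q != 0 -> D != 0 ->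
  - (E * (2 * q * L)) / (2 * (2 * (E * q / (2 * D)))) = - D * L.
Proof. by move=> E0 q0 D0; field; rewrite E0 q0 D0. Qed.

Lemma level_rearrange (E m g h L : R) : E * (2 * (m * g * h) * L) = E * h * (2 * m * g * L).
Proof. ring. Qed.

Lemma mass_rearrange (L E q M : R) : L * (E * (q / M)) = M^-1 * (L * (E * q)).
Proof. ring. Qed.

Lemma ratio_rearrange (m g h V c L : R) : V != 0 -> c != 0 ->
  2 * (m * g * h) * L / (2 * (V ^+ 2 / c)) = h / V ^+ 2 * (m * g * c * L).
Proof. by move=> V0 c0; field; rewrite V0 c0. Qed.

Lemma growth_bound (T sg m g alpha c : R) : 0 < T -> 0 <= ln T -> 0 < sg -> 0 < m -> 0 < g -> c <= 8 * (8 * T) `^ (alpha + sg) ->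
  m * g * c * ln T <= m * g * (8 * 8 `^ (alpha + sg)) / sg * T `^ (alpha + 2 * sg).
Proof.
move=> T0 lnT0 sg0 m0 g0 hc; have mg0 : 0 < m * g by rewrite mulr_gt0.
have p0 : 0 <= 8 * (8 * T) `^ (alpha + sg) by rewrite mulr_ge0 ?powR_ge0.
apply: (@le_trans _ _ (m * g * (8 * (8 * T) `^ (alpha + sg)) * (sg^-1 * T `^ sg))).
  have q0 : 0 <= sg^-1 * T `^ sg by rewrite mulr_ge0 ?powR_ge0// invr_ge0 ltW.
  have hl := ln_le_powR T0 sg0.
  apply: (@le_trans _ _ (m * g * (8 * (8 * T) `^ (alpha + sg)) * ln T)).
    by apply: ler_wpM2r => //; apply: ler_wpM2l => //; exact: ltW.
  by apply: ler_wpM2l => //; rewrite mulr_ge0// ltW.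
rewrite powRM//; last exact: ltW.
rewrite (_ : alpha + 2 * sg = (alpha + sg) + sg); last by ring.
rewrite (powRDp (alpha + sg) sg T0) le_eqVlt; apply/orP; left; apply/eqP; ring.
Qed.

End UpperArithmetic.

Section UpperBound.
Context {R : realType} {d : nat} {D : domain}.
Context {disp : measure_display} {Omega : measurableType disp}.
Variables (P : probability Omega R) (f : site R d D -> {RV P >-> R}).
Variables mu mu_ac mu_d mu_sc : {finite_measure set (borel R d) -> \bar R}.
Hypotheses (f_SGF : SGF f) (f_mu : spectral_measure f mu).
Hypothesis mu_decomp : lebesgue_decomposition mu mu_ac mu_d mu_sc.
Hypothesis sc_eq0 : mu_sc [set: borel R d] = 0%E.
Variable alpha : R.
Hypothesis alpha_bounds : 0 <= alpha < d%:R.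
Hypothesis sing : (lne (mu (cball delta)) / (ln delta)%:E)%E @[delta --> 0^'+] --> alpha%:E.
Hypothesis ac_neq0 : mu_ac [set: borel R d] != 0%E.
Hypothesis regular : forall eps : R, 0 < eps ->
  asymp_equiv (fun T => capacity D mu (cball (T + T `^ (1 - eps)))) (fun T => capacity D mu (cball T)).
Local Notation m := (fine (mu_ac [set: borel R d])).
Local Notation gam := (d%:R - alpha).

(** Room of width T^(1 - e0) is made for the grid. Regular growth is used at the smaller ball with
    exponent 1 - e0 / 2, whose enlargement covers the original ball again. *)
Lemma shrunk_ball (e0 kap : R) : 0 < e0 < 1 -> 0 < kap -> \forall T \near +oo, forall c : R,
  capacity D mu (cball T) = c%:E -> exists S c' : R,
  [/\ 0 <= S, S + T `^ (1 - e0) <= T, capacity D mu (cball S) = c'%:E, 0 < c' & c <= (1 + kap) * c'].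
Proof.
move=> /andP[e00 e01] kap0; have e2 : 0 < e0 / 2 by lra.
have [M0 [_ hM]] := regular_ratio mu_decomp sc_eq0 ac_neq0 (regular e2) kap0.
have n3 : \forall T \near +oo, 2 `^ (1 - e0 / 2) * T `^ (1 - e0) <= T `^ (1 - e0 / 2).
  by apply: near_powR_dominates; lra.
have n4 : \forall T \near +oo, 2 * T `^ (1 - e0) <= T `^ 1 by apply: near_powR_dominates; lra.
near=> T => c capc.
have T1 : 1 < T by near: T; apply: nbhs_pinfty_gt; rewrite num_real.
have TM : 2 * M0 < T by near: T; apply: nbhs_pinfty_gt; rewrite num_real.
have T0 : 0 < T := lt_trans ltr01 T1.
have h3 : 2 `^ (1 - e0 / 2) * T `^ (1 - e0) <= T `^ (1 - e0 / 2) by near: T.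
have h4 : 2 * T `^ (1 - e0) <= T `^ 1 by near: T.
rewrite powRr1 in h4; last lra.
(* Eventually S >= T / 2, so that S^(1 - e0 / 2) dominates T^(1 - e0). *)
pose S := T - T `^ (1 - e0).
have ST : T / 2 <= S by rewrite /S; lra.
have [|c' [capS c0 hc]] := hM S; first lra.
exists S, c'; split => //; [lra|by rewrite /S subrK|].
rewrite -lee_fin -capc; apply: le_trans hc; apply: capacity_mono => x; rewrite /cball /= => xT.
apply: (le_trans xT); rewrite -{1}[T](subrK (T `^ (1 - e0))) lerD2l.
apply: (@le_trans _ _ ((T / 2) `^ (1 - e0 / 2))); last by apply: ge0_ler_powR; rewrite ?nnegrE; lra.
rewrite powRM; [|lra|lra]; rewrite powR_inv// mulrC.
by rewrite ler_pdivlMl// powR_gt0.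
Unshelve. all: by end_near. Qed.

Lemma upper_bound (eps : R) : 0 < eps <= 1 -> \forall T \near +oo, forall c : R,
  capacity D mu (cball T) = c%:E -> exists (I : finType) (x : I -> site R d D),
  (forall i, cball T (pos (x i))) /\
  pr P [set w | forall i, 0 <= f (x i) w] <= expR (- ((1 - eps) * (m * gam * c * ln T))).
Proof.
move=> /andP[eps0 eps1]; have m0 : 0 < m := ac_gt0 ac_neq0.
have al0 : 0 <= alpha by case/andP: alpha_bounds.
have g0 : 0 < gam by have /andP[_ h] := alpha_bounds; rewrite subr_gt0.
have dp : (0 < d)%N by rewrite -(ltr0n R); case/andP: alpha_bounds; exact: le_lt_trans.
have d1 : 1 <= d%:R :> R by rewrite ler1n.
have M0 := total_mass_gt0 mu_decomp sc_eq0 ac_neq0; set M := fine (mu setT) in M0.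
pose th := eps / 20; have th0 : 0 < th by rewrite divr_gt0.
have th1 : th < 1 by rewrite /th; lra.
have e10 : eps / 2 = 10 * th by rewrite /th; field.
have th20 : 0 <= th <= 20^-1 by rewrite (ltW th0)/= /th -[leRHS]mul1r ler_pM2r.
have th2 : 0 <= 1 - th / 2 by lra.
have th01 : 0 < th < 1 by rewrite th0 th1.
have th01' : 0 < th <= 1 by rewrite th0 ltW.
pose eta := th / 8; have eta0 : 0 < eta by rewrite divr_gt0.
(* Chosen so that delta^2 / (4 e) = (d + 1) ln T for delta = eta l: the complement is then below
   delta on the whole grid, which has at most (2 T)^d points. *)
pose e : R := eta ^+ 2 * (m * gam * (1 - th)) / (2 * d.+1%:R).
have e_gt0 : 0 < e.
  by rewrite divr_gt0 ?mulr_gt0 ?exprn_gt0 ?ltr0n// subr_gt0.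
pose sg : R := gam * th / 32; have sg0 : 0 < sg by rewrite divr_gt0// mulr_gt0.
(* The sparse grid loses e0 d = 2 sg in its number of points. The rough cost still has exponent
   alpha + 5 sg, above the exponent alpha + 2 sg that bounds the main term. *)
pose e0 : R := gam * th / (16 * d%:R).
have e0d : e0 * d%:R = 2 * sg by rewrite /e0 /sg; field; rewrite pnatr_eq0 -lt0n.
have expo : (1 - e0) * d%:R + - (gam * (1 - th / 4) + sg) = alpha + 5 * sg.
  by rewrite mulrBl e0d /sg; field.
have e01 : 0 < e0 < 1.
  apply/andP; split; first by rewrite divr_gt0 ?mulr_gt0 ?ltr0n.
  rewrite ltr_pdivrMr ?mulr_gt0 ?ltr0n// mul1r.
  have : gam * th <= gam * 1 by rewrite ler_pM2l// ltW.
  lra.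
have [w [r [bw r0 hw per]]] := periodized_density (decomp_ac mu_decomp) e_gt0.
have [c2 c20 nt] := ntail_rate g0 th01 sg0.
have sb := shrunk_ball e01 th0.
have cu := capacity_upper f_mu mu_decomp sc_eq0 ac_neq0 sing sg0.
pose rd : R := r%:R * Num.sqrt d%:R.
have rd0 : 0 < rd by rewrite mulr_gt0 ?ltr0n// sqrtr_gt0 ltr0n.
pose c3 := c2 / rd ^+ d; have c30 : 0 < c3 by rewrite divr_gt0// exprn_gt0.
pose C6 := m * gam * (8 * 8 `^ (alpha + sg)) / sg.
have n7 : \forall T \near +oo, (C6 / c3) * T `^ (alpha + 2 * sg) <= T `^ (alpha + 5 * sg).
  by apply: near_powR_dominates; lra.
have n8 : \forall T \near +oo, ln 3 / (eps / 2 * (m * gam / M)) <= ln T by exact: near_ln_ge.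
apply: (filter_app _ _ sb); apply: (filter_app _ _ cu); apply: (filter_app _ _ nt).
near=> T => ntT cuT sbT c capc.
have T1 : 1 < T by near: T; apply: nbhs_pinfty_gt; rewrite num_real.
have T0 : 0 < T := lt_trans ltr01 T1.
have T2 : 2 ^+ d.+1 <= T by near: T; apply: nbhs_pinfty_ge; rewrite num_real.
have lnT0 : 0 < ln T by rewrite ln_gt0.
have h7 : (C6 / c3) * T `^ (alpha + 2 * sg) <= T `^ (alpha + 5 * sg) by near: T.
have h8 : ln 3 / (eps / 2 * (m * gam / M)) <= ln T by near: T.
have cM : M^-1 <= c.
  by have := capacity_ge_mass mu_decomp sc_eq0 ac_neq0 (D := D) (ltW T0); rewrite capc lee_fin.
have c0 : 0 < c by apply: lt_le_trans cM; rewrite invr_gt0.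
have hc := cuT c capc.
have [S [c' [S0 ST capS c'0 hc']]] := sbT c capc.
have S0in : cball S (pos (0 : site R d D)) by rewrite /cball /= pos0 enorm0.
have [J [a [y [k [wa yA _ _ [_ cE]]]]]] := near_minimizer f_mu S0in capS c'0 th01'.
have rho0 : 0 < T `^ (1 - e0) by exact: powR_gt0.
have [K [z [s [zi sz sr nlo nhi]]]] := grid_sites (D := D) r0 dp rho0.
pose l := Num.sqrt (2 * (m * gam * (1 - th)) * ln T).
pose delta := eta * l.
pose V := (1 + th) ^+ 2 / c.
pose x0 := (l + delta) / Num.sqrt (m + e).
pose A := ntail (x0 + 2) / (2 * (1 + x0)).
have Q0 : 0 < m * gam * (1 - th) by rewrite mulr_gt0 ?mulr_gt0// subr_gt0.
have l2 : l ^+ 2 = 2 * (m * gam * (1 - th)) * ln T.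
  by rewrite sqr_sqrtr// mulr_ge0 ?(ltW lnT0)// mulr_ge0// ltW.
have l0 : 0 <= l by exact: sqrtr_ge0.
have delta0 : 0 <= delta by rewrite mulr_ge0// ltW.
have V0 : 0 < V by rewrite divr_gt0// exprn_gt0// addr_gt0.
have EV : energy mu a y <= V.
  rewrite /V ler_pdivlMr//; apply: (@le_trans _ _ ((1 + th) * (c' * energy mu a y))).
    by rewrite mulrA mulrC; apply: ler_wpM2r => //; exact: energy_ge0.
  by rewrite expr2 ler_pM2l// addr_gt0.
have K0 : (0 < #|K|)%N.
  by rewrite -(ltr0n R); apply: lt_le_trans nlo; rewrite exprn_gt0// divr_gt0.
have hd : #|K|%:R * expR (- delta ^+ 2 / (2 * (2 * e))) <= 2^-1.
  have -> : - delta ^+ 2 / (2 * (2 * e)) = - d.+1%:R * ln T.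
    by rewrite /delta exprMn l2 /e tail_exponent ?gt_eqF ?exprn_gt0 ?ltr0n.
  have -> : expR (- d.+1%:R * ln T) = (T ^+ d.+1)^-1 by rewrite mulNr expRN expRM_natl lnK ?posrE.
  rewrite ler_pdivrMr ?exprn_gt0//; apply: (le_trans nhi).
  apply: (@le_trans _ _ ((2 * T) ^+ d)).
    apply: lerXn2r; rewrite ?nnegrE; [by rewrite addr_ge0// ltW|by rewrite mulr_ge0// ltW|].
    apply: add_le_double (ltW T1).
    by rewrite -[leRHS](powRr1 (ltW T0)) ler_powR ?(ltW T1)// gerBl ltW//; case/andP: e01.
  by apply: count_slack => //; exact: ltW.
pose I := (J * K)%type; pose x (p : I) := y p.1 + s p.2.
exists I, x; split.
  move=> p; rewrite /cball /= /x posD (le_trans (enormD _ _))// (le_trans _ ST)// lerD//.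
  exact: yA.
apply: (le_trans (persistence_upper f_SGF f_mu mu_decomp sc_eq0 bw hw per wa zi sz EV V0 l0 delta0 e_gt0 K0 hd erefl)).
rewrite -/x0 -/A.
have b0 : 0 <= m * gam * c * ln T by rewrite !mulr_ge0 ?(ltW m0) ?(ltW g0) ?(ltW c0) ?(ltW lnT0).
have x00 : 0 <= x0 by rewrite divr_ge0 ?addr_ge0 ?sqrtr_ge0.
have hx0 : x0 ^+ 2 <= 2 * gam * (1 - th / 2) * ln T.
  rewrite /x0 expr_div_n sqr_sqrtr; last by rewrite addr_ge0// ltW.
  rewrite ler_pdivrMr ?addr_gt0//; apply: (@le_trans _ _ (2 * gam * (1 - th / 2) * ln T * m)); last first.
    rewrite ler_wpM2l ?lerDl ?(ltW e_gt0)// mulr_ge0 ?(ltW lnT0)// mulr_ge0//.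
      by rewrite mulr_ge0// ltW.
  rewrite /delta -{1}[l]mul1r -mulrDl exprMn l2 level_rearrange.
  rewrite (_ : 2 * gam * (1 - th / 2) * ln T * m = (1 - th / 2) * (2 * m * gam * ln T)); last by ring.
  apply: ler_wpM2r; first by rewrite !mulr_ge0 ?(ltW m0) ?(ltW g0) ?(ltW lnT0).
  by apply: level_slack; rewrite !ltW.
have hA := ntT x0 x00 hx0; rewrite -/A in hA.
rewrite mulNr; set b := m * gam * c * ln T in b0 *; set Y := #|K|%:R * A; set X := l ^+ 2 / (2 * V).
apply: (@combine_upper R eps b X Y eps0 b0); rewrite /b /X /Y.
- have -> : l ^+ 2 / (2 * V) = (1 - th) / (1 + th) ^+ 2 * (m * gam * c * ln T).
    by rewrite l2 /V ratio_rearrange// gt_eqF// addr_gt0.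
  apply: ler_wpM2r => //; rewrite ler_pdivlMr ?exprn_gt0 ?addr_gt0//.
  by rewrite e10; exact: variance_slack.
- apply: (@le_trans _ _ (C6 * T `^ (alpha + 2 * sg))).
    exact: (growth_bound T0 (ltW lnT0) sg0 m0 g0 hc).
  apply: (@le_trans _ _ (c3 * T `^ (alpha + 5 * sg))).
    by rewrite -ler_pdivrMl// mulrA (mulrC c3^-1).
  apply: (@le_trans _ _ ((T `^ (1 - e0) / rd) ^+ d * (c2 * T `^ (- (gam * (1 - th / 4) + sg))))).
    rewrite expr_div_n -powR_mulrn ?powR_ge0// -powRrM.
    rewrite (_ : _ / _ * (c2 * _) = c3 * (T `^ ((1 - e0) * d%:R) * T `^ (- (gam * (1 - th / 4) + sg)))); last first.
      by rewrite /c3; ring.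
    rewrite -powRDp// le_eqVlt; apply/orP; left; apply/eqP; congr (_ * _ `^ _).
    exact: (esym expo).
  by apply: ler_pM => //; rewrite ?exprn_ge0 ?divr_ge0 ?(ltW rho0) ?(ltW rd0)// mulr_ge0 ?powR_ge0 ?(ltW c20).
rewrite ler_pdivrMr in h8; last by rewrite mulr_gt0 ?divr_gt0// mulr_gt0.
apply: (le_trans h8).
rewrite (_ : eps / 2 * (m * gam * c * ln T) = c * (ln T * (eps / 2 * (m * gam)))); last by ring.
rewrite mass_rearrange.
by apply: ler_wpM2r => //; rewrite !mulr_ge0 ?(ltW lnT0) ?(ltW m0) ?(ltW g0) ?(ltW eps0).
Unshelve. all: by end_near. Qed.

End UpperBound.

(** * Persistence over the whole ball *)

Section CountableSites.
Context {R : realType} {d : nat}.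
Context {disp : measure_display} {Omega : measurableType disp}.
Variable P : probability Omega R.

Lemma rational_sites_dense (f : site R d Euclidean -> {RV P >-> R}) (T : R) w : SGF f -> 0 < T ->
  (forall q : 'rV[rat]_d, cball T (map_mx ratr q : 'rV[R]_d) -> 0 <= f (map_mx ratr q) w) ->
  forall x : 'rV[R]_d, cball T x -> 0 <= f x w.
Proof.
move=> f_SGF T0 hq x; rewrite /cball /= => xT; rewrite leNgt; apply/negP => fx.
have cf : {for x, continuous (fun x : 'rV[R]_d => f x w)} by exact: (SGF_continuous f_SGF).
have /nbhs_ballP[e /= e0 he] : \forall y \near x, f y w < 0 by exact: (cvgr_lt _ cf).
(* A rational point near a boundary point may leave the closed ball; contracting by 1 - t first
   makes room t T for the approximation. *)
pose t := Num.min 2^-1 (e / (4 * T)).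
have t0 : 0 < t by rewrite lt_min divr_gt0 ?mulr_gt0// invr_gt0 ltr0n.
have t2 : t <= 2^-1 by rewrite ge_min lexx.
have te : t * T <= e / 4.
  have : t <= e / (4 * T) by rewrite ge_min lexx orbT.
  by rewrite ler_pdivlMr ?mulr_gt0//; lra.
pose s := Num.sqrt d%:R + 1 : R; have s0 : 0 < s by rewrite ltr_wpDl// sqrtr_ge0.
have u0 : 0 < Num.min (e / 4) (t * T / s) by rewrite lt_min !divr_gt0// mulr_gt0.
have [q qe] := rational_near ((1 - t) *: x) u0.
have q1 i : `|(1 - t) * x 0 i - ratr (q 0 i)| <= e / 4 /\ `|(1 - t) * x 0 i - ratr (q 0 i)| <= t * T / s.
  by have := qe i; rewrite mxE => /ltW; rewrite le_min => /andP.
have qT : cball T (map_mx ratr q : 'rV[R]_d).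
  rewrite /cball /= -[map_mx ratr q](subKr ((1 - t) *: x)); apply: (le_trans (enormD _ _)).
  have -> : enorm ((1 - t) *: x) = (1 - t) * enorm x by rewrite enormZ ger0_norm//; lra.
  have : enorm (- ((1 - t) *: x - map_mx ratr q)) <= Num.sqrt d%:R * (t * T / s).
    by rewrite enormN; apply: enorm_le_coord => i; rewrite !mxE; case: (q1 i).
  have : Num.sqrt d%:R * (t * T / s) <= t * T.
    rewrite mulrCA ler_piMr ?mulr_ge0// ?ltW// ltr_pdivrMr// mul1r /s; lra.
  have : (1 - t) * enorm x <= (1 - t) * T by rewrite ler_wpM2l//; lra.
  lra.
suff : f (map_mx ratr q) w < 0 by rewrite ltNge hq.
apply: he; split => // i j; rewrite (ord1 i) !mxE /ball/=.
have [h1 _] := q1 j; have h2 := le_trans (coord_le_enorm x j) xT.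
have h3 : `|t * x 0 j| <= t * T by rewrite normrM gtr0_norm// ler_pM2l.
have -> : x 0 j - ratr (q 0 j) = t * x 0 j + ((1 - t) * x 0 j - ratr (q 0 j)) by ring.
apply: (le_lt_trans (ler_normD _ _)); lra.
Qed.

End CountableSites.

Section Final.
Context {R : realType} {d : nat} {D : domain}.
Context {disp : measure_display} {Omega : measurableType disp}.
Variables (P : probability Omega R) (f : site R d D -> {RV P >-> R}).
Hypotheses (f_SGF : SGF f).
Local Notation persistence T := [set w | forall x, cball T (pos x) -> 0 <= f x w].

Lemma countable_sites : exists g : nat -> site R d D, forall T w, 0 < T ->
  (forall n, cball T (pos (g n)) -> 0 <= f (g n) w) -> forall x, cball T (pos x) -> 0 <= f x w.
Proof.
case: D f f_SGF => f' s'.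
  exists (fun n => map_mx ratr (odflt 0 (unpickle n : option 'rV[rat]_d))) => T w T0 h.
  apply: (rational_sites_dense s' T0) => q qT.
  by have := h (pickle q); rewrite pickleK; apply.
exists (fun n => odflt 0 (unpickle n : option 'rV[int]_d)) => T w T0 h x xT.
by have := h (pickle x); rewrite pickleK; apply.
Qed.

(** Persistence over the ball is a decreasing limit of persistence at finitely many sites, which
    yields its measurability together with the bound. *)
Lemma persistence_approx (T L : R) : 0 < T ->
  (forall (I : finType) (x : I -> site R d D), (forall i, cball T (pos (x i))) ->
     L <= pr P [set w | forall i, 0 <= f (x i) w]) ->
  measurable (persistence T) /\ L <= pr P (persistence T).
Proof.
move=> T0 hL; have [g hg] := countable_sites.
(* Sites outside the ball are replaced by the origin, where the field has to be nonnegative in any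
   case. *)
pose x n := if enorm (pos (g n)) <= T then g n else 0.
have xT n : cball T (pos (x n)) by rewrite /x /cball /=; case: ifP => // _; rewrite pos0 enorm0 ltW.
pose F n := [set w | forall i : 'I_n, 0 <= f (x i) w].
have FE : persistence T = \bigcap_n F n.
  apply/seteqP; split => w /= h; first by move=> n _ i; apply: h; exact: xT.
  apply: (hg T w T0) => n gT; have := h n.+1 I ord_max; rewrite /= /x.
  by move: gT; rewrite /cball /= => ->.
have mF n : measurable (F n).
  by apply: (measurable_all_ge (fun=> 0)) => i; exact: measurable_funP.
have mI : measurable (\bigcap_n F n) by exact: bigcapT_measurable.
have niF : nonincreasing_seq F.
  by move=> n k nk; apply/subsetPset => w h i; exact: (h (widen_ord nk i)).
have fF0 : (P (F 0%N) < +oo)%E by rewrite ltey_eq fin_num_measure.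
rewrite FE; split => //; rewrite -lee_fin -prE//.
have cv := nonincreasing_cvg_mu fF0 mF mI niF.
apply: (cvge_ge _ cv); near=> n; rewrite /= prE//.
by rewrite lee_fin; exact: hL.
Unshelve. all: by end_near. Qed.

End Final.

Theorem theorem1 (R : realType) (d : nat) (D : domain) (alpha : R)
  (disp : measure_display) (Omega : measurableType disp)
  (P : probability Omega R) (f : site R d D -> {RV P >-> R})
  (mu mu_ac mu_d mu_sc : {finite_measure set (borel R d) -> \bar R})
  (alpha_bounds : 0 <= alpha < d%:R)
  (f_SGF : SGF f)
  (f_mu : spectral_measure f mu)
  (mu_decomp : lebesgue_decomposition mu mu_ac mu_d mu_sc)
  (spectral_singularity :
    (lne (mu (cball delta)) / (ln delta)%:E)%E @[delta --> 0^'+] --> alpha%:E)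
  (ac_neq0 : mu_ac [set: borel R d] != 0%E)
  (sc_eq0 : mu_sc [set: borel R d] = 0%E)
  (regular_capacity_growth : forall eps : R, 0 < eps ->
    asymp_equiv (fun T => capacity D mu (cball (T + T `^ (1 - eps))))
                (fun T => capacity D mu (cball T))) :
  asymp_equiv (persistence_exponent f)
    (fun T => mu_ac [set: borel R d] * (d%:R - alpha)%:E
              * capacity D mu (cball T) * (ln T)%:E)%E.
Proof.
set m := fine (mu_ac setT); set b := fun T => (_ * _ * _ * _)%E.
have m0 : 0 < m := ac_gt0 ac_neq0.
have g0 : 0 < d%:R - alpha by have /andP[_ h] := alpha_bounds; rewrite subr_gt0.
have key eps : 0 < eps <= 1 -> \forall T \near +oo%R, exists q : R,
    (persistence_exponent f T / b T)%E = q%:E /\ `|1 - q| <= eps.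
  move=> eps01.
  have lo := lower_bound f_SGF f_mu mu_decomp sc_eq0 alpha_bounds spectral_singularity ac_neq0 eps01.
  have up := upper_bound f_SGF f_mu mu_decomp sc_eq0 alpha_bounds spectral_singularity ac_neq0
    regular_capacity_growth eps01.
  (* Used here only for the capacity to be eventually finite and positive, so that both bounds refer
     to the same real c. *)
  have fin := regular_ratio mu_decomp sc_eq0 ac_neq0 (regular_capacity_growth 1 ltr01) ltr01.
  apply: (filter_app _ _ lo); apply: (filter_app _ _ up); apply: (filter_app _ _ fin).
  near=> T => -[c [capc c0 _]] upT loT.
  have T1 : 1 < T by near: T; apply: nbhs_pinfty_gt; rewrite num_real.
  have [I [x [xT hU]]] := upT c capc.
  have [mE hL] := persistence_approx f_SGF (lt_trans ltr01 T1) (loT c capc).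
  pose B := m * (d%:R - alpha) * c * ln T.
  have B0 : 0 < B by rewrite !mulr_gt0// ln_gt0.
  have bE : b T = B%:E by rewrite /b capc -(fineK (fin_num_measure mu_ac setT measurableT)) -!EFinM.
  set p := pr P _ in hL; have p0 : 0 < p := lt_le_trans (expR_gt0 _) hL.
  have pU : p <= expR (- ((1 - eps) * B)).
    apply: le_trans hU; apply: pr_le => //; first by apply: (measurable_all_ge (fun=> 0)) => i; exact: measurable_funP.
    by move=> w h i; apply: h; exact: xT.
  exists (- ln p / B); split.
    rewrite /persistence_exponent prE// -/p lne_EFin// bE inver gt_eqF//.
  have l1 : - ((1 + eps) * B) <= ln p by rewrite -[leLHS]expRK ler_ln ?posrE ?expR_gt0.
  have l2 : ln p <= - ((1 - eps) * B) by rewrite -[leRHS]expRK ler_ln ?posrE ?expR_gt0.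
  have -> : 1 - - ln p / B = (B + ln p) / B by rewrite mulrDl divff ?gt_eqF// mulNr opprK.
  rewrite normrM normfV (gtr0_norm B0) ler_pdivrMr// ler_norml; apply/andP; split; lra.
apply/fine_cvgP; split.
  have h01 : 0 < (1 : R) <= 1 by rewrite ltr01 /=.
  by apply: filterS (key 1 h01) => T [q [-> _]].
apply/cvgrPdist_le => eps eps0.
have h01 : 0 < Num.min eps 1 <= 1 by rewrite lt_min eps0 ltr01 ge_min lexx orbT.
apply: filterS (key _ h01) => T [q [e h]]; rewrite /= e /=.
by apply: (le_trans h); rewrite ge_min lexx.
Unshelve. all: by end_near. Qed.
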